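(* Let $d\ge1$, $\mu\in\{\mathcal L^d,\gamma_d\}$, and $1\le p<\infty$. Then boundary restriction $f\mapsto f(\cdot,0,\cdot)$, defined on $C_c^\infty(\overline{\mathbb H^d}\times\mathbb R^d)$, extends uniquely to a bounded linear operator $$\operatorname{Tr}^{(p)}_{\mu,\mathbb H}\colon\mathcal X_\mu(\mathbb H^d)\longrightarrow L^2\!\left(\mathbb R^{d-1}\times\mathbb R^d,\ \omega_p(|w|)\,d\mu(v)\,dz\right).$$
   Context: All functions are real-valued. $\mathbb H^d=\mathbb R^{d-1}\times(0,\infty)$; write $x=(z,y)\in\mathbb R^{d-1}\times(0,\infty)$ and $v=(u,w)\in\mathbb R^{d-1}\times\mathbb R$. $\omega_p(s)=\min\{s,s^p\}$ for $s\ge0$. $\mathcal L^d$ is Lebesgue measure, $d\gamma_d(v)=(2\pi)^{-d/2}e^{-|v|^2/2}dv$. $H^1_\mu$ has norm $\|g\|_{H^1_\mu}^2=\int_{\mathbb R^d}(|g|^2+|\nabla_vg|^2)\,d\mu$; $H^{-1}_\mu$ is its dual, an $L^2(\mu)$ function $q$ acting by $\langle q,\phi\rangle=\int q\phi\,d\mu$. $\mathcal X_\mu(\Omega)=\{f\in L^2(\Omega;H^1_\mu):v\cdot\nabla_xf\in L^2(\Omega;H^{-1}_\mu)\}$, with the transport derivative taken in the sense of distributions, is equipped with the graph norm $\|f\|_{\mathcal X_\mu(\Omega)}^2=\|f\|_{L^2(\Omega;H^1_\mu)}^2+\|v\cdot\nabla_xf\|_{L^2(\Omega;H^{-1}_\mu)}^2$.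 *)

(* Defs.v *)
From HB Require Import structures.
From mathcomp Require Import all_boot all_order all_algebra.
From mathcomp Require Import all_classical all_reals all_analysis.
From mathcomp Require Import measurable_realfun.

Set Implicit Arguments.
Unset Strict Implicit.
Unset Printing Implicit Defensive.

Import Order.TTheory GRing.Theory Num.Theory.
Import numFieldNormedType.Exports.

Local Open Scope classical_set_scope.
Local Open Scope ring_scope.

(* R^n is 'rV[R]_n, with the product sigma-algebra (the one the library puts on
   n.-tuple R). The library's norm on 'rV[R]_n is the sup norm: it is used here
   for its topology and differential calculus only. *)
Definition rV_display : measure_display.
Proof. exact: default_measure_display. Qed.

Section measurable_rV.
Context {R : realType}.
Variable n : nat.

Let coors : 'I_n -> 'rV[R]_n -> R := fun i x => x ord0 i.

Let rV_set0 : g_sigma_preimage coors set0.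
Proof. exact: sigma_algebra0. Qed.

Let rV_setC A : g_sigma_preimage coors A -> g_sigma_preimage coors (~` A).
Proof. exact: sigma_algebraC. Qed.

Let rV_bigcup (F : _^nat) : (forall i, g_sigma_preimage coors (F i)) ->
  g_sigma_preimage coors (\bigcup_i (F i)).
Proof. exact: sigma_algebra_bigcup. Qed.

HB.instance Definition _ := @isMeasurable.Build rV_display
  'rV[R]_n (g_sigma_preimage coors) rV_set0 rV_setC rV_bigcup.

End measurable_rV.

Lemma measurable_coord (R : realType) n (i : 'I_n) :
  measurable_fun [set: 'rV[R]_n] (fun x => x ord0 i).
Proof.
move=> _ Y mY; rewrite setTI; apply: sub_sigma_algebra => /=.
rewrite -bigcup_seq/=; exists i => /=; first by rewrite mem_index_enum.
by exists Y => //; rewrite setTI.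
Qed.

Lemma measurable_fun_rV (R : realType) d (T : measurableType d) n
    (f : T -> 'rV[R]_n) :
  (forall i, measurable_fun [set: T] (fun t => f t ord0 i)) ->
  measurable_fun [set: T] f.
Proof.
move=> mf _ A mA; rewrite setTI.
have : g_sigma_preimage (fun (i : 'I_n) t => f t ord0 i) `<=` measurable.
  apply: smallest_sub; first exact: sigma_algebra_measurable.
  move=> B; rewrite -bigcup_seq => -[i _ [C mC <-]].
  exact: mf.
apply.
have -> : (fun (i : 'I_n) t => f t ord0 i) =
  (fun i => (fun x : 'rV[R]_n => x ord0 i) \o f) by [].
by rewrite g_sigma_preimage_comp; exists A => //; rewrite setTI.
Qed.

(* The measure w dm. *)
Definition density d (T : measurableType d) (R : realType)
    (m : set T -> \bar R) (w : T -> R)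
    of measurable_fun [set: T] w & (forall t, 0 <= w t) : set T -> \bar R :=
  fun A => (\int[m]_(t in A) (w t)%:E)%E.

Section density.
Context d (T : measurableType d) (R : realType).
Variables (m : {measure set T -> \bar R}) (w : T -> R).
Variables (mw : measurable_fun [set: T] w) (w0 : forall t, 0 <= w t).

Local Notation dens := (density m mw w0).

Let mEw : measurable_fun [set: T] (EFin \o w).
Proof. exact/measurable_EFinP. Qed.

Let density0 : dens set0 = 0%E.
Proof. by rewrite /density integral_set0. Qed.

Let density_ge0 A : (0 <= dens A)%E.
Proof. by apply: integral_ge0 => t _; rewrite lee_fin. Qed.

Let density_sigma_additive : semi_sigma_additive dens.
Proof.
move=> /= F mF tF mUF; rewrite /density ge0_integral_bigcup//=; last first.
- by move=> t _; rewrite lee_fin.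
- exact: measurable_funTS.
by apply: is_cvg_ereal_nneg_natsum_cond => n _ _; exact: density_ge0.
Qed.

HB.instance Definition _ := isMeasure.Build _ _ _ dens
  density0 density_ge0 density_sigma_additive.

End density.

Section density_sigma_finite.
Context d (T : measurableType d) (R : realType).
Variables (m : {sigma_finite_measure set T -> \bar R}) (w : T -> R).
Variables (mw : measurable_fun [set: T] w) (w0 : forall t, 0 <= w t).

Local Notation dens := (density m mw w0).

Let density_sigma_finite : sigma_finite setT dens.
Proof.
have /sigma_finiteP[F [TF ndF Foo]] := sigma_finiteT m.
pose G (n : nat) := w @^-1` `]-oo, n%:R].
have mG n : measurable (G n).
  by rewrite -[G n]setTI; apply: mw => //.
exists (fun n => F n `&` G n).
  apply/esym; rewrite -subTset => t _.
  have : (\bigcup_i F i) t by rewrite -TF.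
  move=> [i _ Fit]; exists (maxn i (Num.truncn (w t)).+1) => //; split.
    by move: Fit; apply/subsetPset/ndF/leq_maxl.
  rewrite /G/= in_itv/= (le_trans (ltW (truncnS_gt _)))//.
  by rewrite ler_nat leq_maxr.
move=> n; have [mFn Fn] := Foo n; split; first exact: measurableI.
apply: (@le_lt_trans _ _ (\int[m]_(t in F n `&` G n) (n%:R)%:E)%E).
  apply: ge0_le_integral => //.
  - exact: measurableI.
  - by move=> t _; rewrite lee_fin.
  - exact/measurable_funTS/measurable_EFinP.
  - by move=> t [_]; rewrite /G/= in_itv/= lee_fin.
rewrite integral_cst//; last exact: measurableI.
rewrite lte_mul_pinfty//.
rewrite (le_lt_trans _ Fn)// le_measure// ?inE//.
exact: measurableI.
Qed.

HB.instance Definition _ := Measure_isSigmaFinite.Build _ _ _ dens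
  density_sigma_finite.

End density_sigma_finite.

Lemma product_sigma_finite d1 d2 (T1 : measurableType d1)
    (T2 : measurableType d2) (R : realType)
    (m1 : {sigma_finite_measure set T1 -> \bar R})
    (m2 : {sigma_finite_measure set T2 -> \bar R}) :
  sigma_finite setT (m1 \x m2)%E.
Proof.
have /sigma_finiteP[F [TF ndF Foo]] := sigma_finiteT m1.
have /sigma_finiteP[G [TG ndG Goo]] := sigma_finiteT m2.
exists (fun n => F n `*` G n).
 rewrite -setXTT TF TG predeqE => -[x y]; split.
    move=> [/= [n _ Fnx] [k _ Gky]]; exists (maxn n k) => //; split.
    - by move: x Fnx; exact/subsetPset/ndF/leq_maxl.
    - by move: y Gky; exact/subsetPset/ndG/leq_maxr.
  by move=> [n _ []/= ? ?]; split; exists n.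
move=> k; have [? ?] := Foo k; have [? ?] := Goo k.
split; first exact: measurableX.
by rewrite product_measure1E// lte_mul_pinfty// ge0_fin_numE.
Qed.

Section lebesgue_rV.
Context {R : realType}.

Definition rV_cons n (p : measurableTypeR R * 'rV[R]_n) : 'rV[R]_n.+1 :=
  row_mx (p.1%:M : 'rV[R]_1) p.2.

Definition rV_uncons n (x : 'rV[R]_n.+1) : measurableTypeR R * 'rV[R]_n :=
  (x ord0 ord0, \row_i x ord0 (lift ord0 i)).

Lemma rV_cons0 n (p : measurableTypeR R * 'rV[R]_n) : rV_cons p ord0 ord0 = p.1.
Proof.
rewrite /rV_cons (_ : ord0 = lshift n ord0 :> 'I_(1 + n)); last exact/val_inj.
by rewrite [LHS]row_mxEl mxE eqxx mulr1n.
Qed.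

Lemma rV_consS n (p : measurableTypeR R * 'rV[R]_n) i :
  rV_cons p ord0 (lift ord0 i) = p.2 ord0 i.
Proof.
rewrite /rV_cons (_ : lift ord0 i = rshift 1 i :> 'I_(1 + n)).
  by rewrite [LHS]row_mxEr.
exact/val_inj.
Qed.

Lemma rV_consK n : cancel (@rV_cons n) (@rV_uncons n).
Proof.
move=> [a x]; rewrite /rV_uncons rV_cons0; congr pair.
by apply/rowP => i; rewrite mxE rV_consS.
Qed.

Lemma measurable_rV_cons n : measurable_fun setT (@rV_cons n).
Proof.
apply: measurable_fun_rV => i; case: (unliftP ord0 i) => [j ->|->].
  rewrite (_ : (fun _ => _) = (fun x : 'rV[R]_n => x ord0 j) \o snd).
    by apply: measurableT_comp => //; exact: measurable_coord.
  by apply/funext => p; rewrite rV_consS.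
rewrite (_ : (fun _ => _) = fst)//.
by apply/funext => p; rewrite rV_cons0.
Qed.

Lemma measurable_rV_uncons n : measurable_fun setT (@rV_uncons n).
Proof.
apply: measurable_fun_pair; first exact: measurable_coord.
apply: measurable_fun_rV => i.
rewrite (_ : (fun _ => _) = fun x : 'rV[R]_n.+1 => x ord0 (lift ord0 i)).
  exact: measurable_coord.
by apply/funext => x; rewrite mxE.
Qed.

Section step.
Context n (m : {sigma_finite_measure set 'rV[R]_n -> \bar R}).

Definition lebesgue_rV_step : set 'rV[R]_n.+1 -> \bar R :=
  pushforward (@lebesgue_measure R \x m)%E (@rV_cons n).

Let step0 : lebesgue_rV_step set0 = 0%E.
Proof. by rewrite /lebesgue_rV_step /pushforward preimage_set0 measure0. Qed.

Let step_ge0 A : (0 <= lebesgue_rV_step A)%E.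
Proof. by rewrite /lebesgue_rV_step /pushforward; apply: measure_ge0. Qed.

Let step_sigma_additive : semi_sigma_additive lebesgue_rV_step.
Proof.
move=> F mF tF mUF; rewrite /lebesgue_rV_step /pushforward preimage_bigcup.
apply: measure_semi_sigma_additive.
- by move=> k; rewrite -[X in measurable X]setTI; exact: measurable_rV_cons.
- apply/trivIsetP => /= i j _ _ ij; rewrite -preimage_setI.
  by move/trivIsetP : tF => /(_ _ _ _ _ ij) ->//; rewrite preimage_set0.
- rewrite -preimage_bigcup -[X in measurable X]setTI.
  exact: measurable_rV_cons.
Qed.

HB.instance Definition _ := isMeasure.Build _ _ _ lebesgue_rV_step
  step0 step_ge0 step_sigma_additive.

Let step_sigma_finite : sigma_finite setT lebesgue_rV_step.
Proof.
have [F TF Foo] := product_sigma_finite (@lebesgue_measure R) m.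
exists (fun k => @rV_uncons n @^-1` F k).
  by rewrite -preimage_bigcup -TF preimage_setT.
move=> k; have [mFk Fk] := Foo k; split.
  by rewrite -[X in measurable X]setTI; exact: measurable_rV_uncons.
rewrite /lebesgue_rV_step /pushforward -comp_preimage.
rewrite (_ : @rV_uncons n \o @rV_cons n = id); last exact/funext/rV_consK.
by rewrite preimage_id.
Qed.

HB.instance Definition _ := Measure_isSigmaFinite.Build _ _ _ lebesgue_rV_step
  step_sigma_finite.

End step.

(* Lebesgue measure on R^n: the point mass for n = 0, and the product of the
   one-dimensional measure with that on R^n for n + 1. *)
Fixpoint lebesgue_rV n : {sigma_finite_measure set 'rV[R]_n -> \bar R} :=
  match n with
  | 0 => dirac (0 : 'rV[R]_0)
  | n'.+1 => lebesgue_rV_step (lebesgue_rV n')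
  end.

End lebesgue_rV.
Arguments lebesgue_rV : clear implicits.

Section gaussian.
Context {R : realType}.
Variable d : nat.

Definition sqnorm (v : 'rV[R]_d) : R := \sum_(i < d) v ord0 i ^+ 2.

Definition gauss_pdf (v : 'rV[R]_d) : R :=
  (2 * pi) `^ (- (d%:R / 2)) * expR (- (sqnorm v / 2)).

Lemma measurable_gauss_pdf : measurable_fun [set: 'rV[R]_d] gauss_pdf.
Proof.
apply: measurable_funM => //; apply: measurableT_comp => //.
apply: measurableT_comp => //; apply: measurable_funM => //.
apply: measurable_sum => i; apply: measurable_funX.
exact: measurable_coord.
Qed.

Lemma gauss_pdf_ge0 v : 0 <= gauss_pdf v.
Proof. by rewrite mulr_ge0 ?powR_ge0 ?expR_ge0. Qed.

Definition gaussian_rV : {sigma_finite_measure set 'rV[R]_d -> \bar R} :=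
  density (lebesgue_rV R d) measurable_gauss_pdf gauss_pdf_ge0.

End gaussian.
Arguments gaussian_rV : clear implicits.

Section test_functions.
Context {R : realType} {V : normedModType R}.

Fixpoint Ck (k : nat) (f : V -> R) : Prop :=
  match k with
  | 0 => continuous f
  | k'.+1 => (forall x, differentiable f x) /\ forall v, Ck k' ('D_v f)
  end.

Definition smooth (f : V -> R) := forall k, Ck k f.

Definition supp (f : V -> R) : set V := closure [set x | f x != 0].

(* C_c^infty(U) for U open, its elements being extended by 0 outside U. *)
Definition test_fun (U : set V) : set (V -> R) :=
  [set phi | [/\ smooth phi, compact (supp phi) & supp phi `<=` U]].

End test_functions.

(* L^2(D; V), at the level of representatives, where V is the quotient of the
   subspace M of E by the kernel of the seminorm N. Measurability is that of
   Bochner: on D, F is a pointwise limit of simple functions. *)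
Section bochner.
Context d (X : measurableType d) (R : realType) (E : zmodType).
Variables (m : {measure set X -> \bar R}) (D : set X).
Variables (M : set E) (N : E -> R).

Definition simple_on (s : X -> E) :=
  [/\ finite_set (s @` D), s @` D `<=` M &
      forall e, measurable (D `&` s @^-1` [set e])].

Definition strongly_measurable (F : X -> E) :=
  exists s : nat -> X -> E, (forall k, simple_on (s k)) /\
    forall x, D x -> N (s k x - F x) @[k --> \oo] --> (0 : R).

Definition L2_bochner : set (X -> E) := [set F |
  [/\ forall x, D x -> M (F x), strongly_measurable F &
      (\int[m]_(x in D) (N (F x) ^+ 2)%:E < +oo)%E]].

Definition L2_bochner_norm (F : X -> E) : R :=
  Num.sqrt (\int[m]_(x in D) N (F x) ^+ 2).

End bochner.

Section sobolev.
Context {R : realType} {d : nat}.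
Variable mu : {measure set 'rV[R]_d -> \bar R}.
Implicit Types (g : 'rV[R]_d -> R) (l : ('rV[R]_d -> R) -> R).

Definition weak_gradient g (h : 'rV[R]_d -> 'rV[R]_d) :=
  forall phi, test_fun setT phi -> forall i,
    \int[lebesgue_rV R d]_v (g v * 'D_(delta_mx ord0 i) phi v) =
    - \int[lebesgue_rV R d]_v (h v ord0 i * phi v).

Definition L2_gradient g : set ('rV[R]_d -> 'rV[R]_d) := [set h |
  weak_gradient g h /\ forall i, (fun v => h v ord0 i) \in Lfun mu 2%:E].

Definition H1 : set ('rV[R]_d -> R) :=
  [set g | g \in Lfun mu 2%:E /\ L2_gradient g !=set0].

(* The weak gradient, which is unique up to a null set, chosen by [xget]. *)
Definition nabla g : 'rV[R]_d -> 'rV[R]_d := xget (fun=> 0) (L2_gradient g).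

Definition H1_norm g : R :=
  Num.sqrt (\int[mu]_v (g v ^+ 2 + sqnorm (nabla g v))).

(* H^{-1}: functionals are total on 'rV[R]_d -> R, but only their values on H1
   matter. *)
Definition Hm1 : set (('rV[R]_d -> R) -> R) := [set l |
  (forall (a : R) g1 g2, H1 g1 -> H1 g2 -> l (a *: g1 + g2) = a * l g1 + l g2) /\
  exists C, forall g, H1 g -> `|l g| <= C * H1_norm g].

Definition Hm1_norm l : R :=
  sup [set `|l g| | g in [set g | H1 g /\ H1_norm g <= 1]].

End sobolev.

Section kinetic.
Context {R : realType} {d : nat}.
Variable mu : {measure set 'rV[R]_d -> \bar R}.
Variable Omega : set 'rV[R]_d.
Implicit Types (f : 'rV[R]_d -> 'rV[R]_d -> R).
Implicit Types (G : 'rV[R]_d -> ('rV[R]_d -> R) -> R).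

(* G = v . nabla_x f in the sense of distributions on Omega x R^d. *)
Definition distr_transport f G :=
  forall phi : 'rV[R]_d * 'rV[R]_d -> R, test_fun (Omega `*` setT) phi ->
    \int[lebesgue_rV R d]_(x in Omega) G x (fun v => phi (x, v)) =
    - \int[lebesgue_rV R d]_(x in Omega)
        \int[mu]_v (f x v * 'D_(v, 0) phi (x, v)).

Definition L2H1 : set ('rV[R]_d -> 'rV[R]_d -> R) :=
  L2_bochner (lebesgue_rV R d) Omega (H1 mu) (H1_norm mu).

Definition L2H1_norm f : R :=
  L2_bochner_norm (lebesgue_rV R d) Omega (H1_norm mu) f.

Definition L2Hm1 : set ('rV[R]_d -> ('rV[R]_d -> R) -> R) :=
  L2_bochner (lebesgue_rV R d) Omega (Hm1 mu) (Hm1_norm mu).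

Definition L2Hm1_norm G : R :=
  L2_bochner_norm (lebesgue_rV R d) Omega (Hm1_norm mu) G.

Definition L2Hm1_transport f : set ('rV[R]_d -> ('rV[R]_d -> R) -> R) :=
  L2Hm1 `&` distr_transport f.

Definition kinetic : set ('rV[R]_d -> 'rV[R]_d -> R) :=
  [set f | L2H1 f /\ L2Hm1_transport f !=set0].

Definition transport f : 'rV[R]_d -> ('rV[R]_d -> R) -> R :=
  xget (fun=> cst 0) (L2Hm1_transport f).

Definition kinetic_norm f : R :=
  Num.sqrt (L2H1_norm f ^+ 2 + L2Hm1_norm (transport f) ^+ 2).

End kinetic.

(* The dimension d >= 1 is n + 1; x = (z, y) is row_mx z y%:M. *)
Section trace.
Context {R : realType} {n : nat}.
Variable mu : {sigma_finite_measure set 'rV[R]_(n + 1) -> \bar R}.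

Definition lastc (x : 'rV[R]_(n + 1)) : R := x ord0 (rshift n ord0).

Definition half_space : set 'rV[R]_(n + 1) := [set x | 0 < lastc x].

(* C_c^infty of the closed half space times R^d: restrictions to it of functions
   in C_c^infty(R^d x R^d). *)
Definition test_closed_half_space :
    set ('rV[R]_(n + 1) -> 'rV[R]_(n + 1) -> R) := [set f |
  exists2 F : 'rV[R]_(n + 1) * 'rV[R]_(n + 1) -> R, test_fun setT F &
    forall x v, closure half_space x -> f x v = F (x, v)].

Definition boundary_restriction (f : 'rV[R]_(n + 1) -> 'rV[R]_(n + 1) -> R)
  (zv : 'rV[R]_n * 'rV[R]_(n + 1)) : R := f (row_mx zv.1 0) zv.2.

Variable p : R.

Definition omega (s : R) : R := Num.min s (s `^ p).

Definition trace_weight (zv : 'rV[R]_n * 'rV[R]_(n + 1)) : R :=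
  omega `|lastc zv.2|.

Lemma measurable_trace_weight : measurable_fun setT trace_weight.
Proof.
have mw : measurable_fun [set: 'rV[R]_n * 'rV[R]_(n + 1)]
    (fun zv => `|lastc zv.2|).
  apply: measurableT_comp => //.
  by apply: (measurableT_comp (measurable_coord _)).
apply: measurable_minr => //.
exact: (measurableT_comp (measurable_powR _)).
Qed.

Lemma trace_weight_ge0 zv : 0 <= trace_weight zv.
Proof. by rewrite /trace_weight /omega le_min normr_ge0 powR_ge0. Qed.

Definition trace_measure :
    {measure set ('rV[R]_n * 'rV[R]_(n + 1)) -> \bar R} :=
  density (lebesgue_rV R n \x mu)%E measurable_trace_weight trace_weight_ge0.

Local Notation X := (kinetic mu half_space).

(* Bounded linear operators from the kinetic space to L^2(trace_measure), at the
   level of representatives. *)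
Definition bounded_linear_trace
    (T : ('rV[R]_(n + 1) -> 'rV[R]_(n + 1) -> R) ->
         ('rV[R]_n * 'rV[R]_(n + 1) -> R)) :=
  [/\ forall f, X f -> T f \in Lfun trace_measure 2%:E,
      forall (a : R) f g, X f -> X g ->
        T (a *: f + g) = a *: T f + T g %[ae trace_measure] &
      exists C : R, forall f, X f ->
        ('N[trace_measure]_2%:E[EFin \o T f] <=
         (C * kinetic_norm mu half_space f)%:E)%E].

Definition extends_boundary_restriction
    (T : ('rV[R]_(n + 1) -> 'rV[R]_(n + 1) -> R) ->
         ('rV[R]_n * 'rV[R]_(n + 1) -> R)) :=
  forall f, test_closed_half_space f ->
    X f /\ T f = boundary_restriction f %[ae trace_measure].

End trace.

(* Main.v *)
From HB Require Import structures.
Require Import Defs.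
From mathcomp Require Import all_boot all_order all_algebra.
From mathcomp Require Import all_classical all_reals all_analysis.
From mathcomp Require Import measurable_realfun ring lra.
Import Order.TTheory GRing.Theory Num.Theory.
Import numFieldNormedType.Exports.
Set Implicit Arguments.
Unset Strict Implicit.
Unset Printing Implicit Defensive.
Set SsrHave NoTCResolution.
Local Open Scope classical_set_scope.
Local Open Scope ring_scope.
Arguments lebesgue_rV : simpl never.

(* For a test function [F], multiply the transport identity for [F^2] by [profile r w], with
   [profile r w = w (w^2 + 3 r^2) / (w^2 + r^2)^(3/2)] and [r = (y + r0^3)^(1/3)], the depth
   at which kinetic scaling puts velocities of size [r], and integrate over the half-space.
   The boundary term tends to the integral of [|w| F^2] as [r0] tends to [0].  The transport term is
   bounded by duality by the H^{-1} norm of [v . grad_x F] times the H^1 norm of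
   [profile r w * F].  That norm contains the singular term [(d_w profile)^2 F^2], of size
   [r^-2] where [|w| < r]; it is absorbed by the drift [w d_y (profile r w) F^2], up to the Hardy
   inequality obtained from [barrier = w / (w^2 + 4 r^2)] by expanding
   [(d_w F + barrier F)^2 >= 0].  This bounds the trace for the weight [|w|], and
   [min(s, s^p) <= s].

   Test functions are dense in the kinetic space: cut off in [x] and [v], then mollify in [x] with
   a kernel supported in an orthant pointing into the half-space, so that no value outside
   enters.  Mollifying a simple approximant instead of the function itself gives a finite sum of
   products [a(x) e(v)], in which each [e] can be replaced by a test function. *)

(** * Integration on row vectors *)

(** The natural multiplier is sign(w), which would put exactly |w| F^2 on the boundary; but sign(w)
    F is not in H^1 in the velocity and cannot be paired with the H^{-1} derivative, so the sign is
    smoothed at width r. With a fixed width nothing compensates the singular term. Letting r^3 grow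
    linearly in y respects the balance of w d_y against d_w^2, under which y scales like w^3, and
    makes the drift of the same order r^-2. The term 3 r^2 in [profile] makes the drift nonnegative
    for |w| >= r; near w = 0 the drift vanishes and the Hardy inequality takes over. In the density
    argument no vector-valued integral is formed: mollification errors are measured through all
    functionals dominated by the norm. The mollification scale is fixed before the simple
    approximant is chosen, so the error of the latter may be multiplied by the mass of the
    derivative of the kernel. Convergence of the velocity cutoff in the dual norm does not follow
    from its strong convergence on H^1; it rests on an almost norming element with compact
    support. *)

Section lebesgue_rV_theory.
Context {R : realType}.
Local Notation leb := (@lebesgue_measure R).

Lemma ge0_integral_rV_cons n (f : 'rV[R]_n.+1 -> \bar R) :
  measurable_fun setT f -> (forall x, 0 <= f x)%E ->
  (\int[lebesgue_rV R n.+1]_x f x =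
   \int[leb]_a \int[lebesgue_rV R n]_x f (rV_cons (a, x)))%E.
Proof.
move=> mf f0.
have := @ge0_integral_pushforward _ _ _ _ R (@rV_cons R n) (@measurable_rV_cons R n)
  (leb \x lebesgue_rV R n)%E setT f measurableT mf (fun x _ => f0 x).
rewrite preimage_setT => h.
transitivity (\int[(leb \x lebesgue_rV R n)%E]_x (f \o @rV_cons R n) x)%E.
  exact: h.
rewrite (@fubini_tonelli1 _ _ _ _ R leb (lebesgue_rV R n) (f \o @rV_cons R n))//=.
by apply: measurableT_comp => //; exact: measurable_rV_cons.
Qed.

Lemma measurable_addr (h : R) : measurable_fun setT (fun x : measurableTypeR R => (x + h : measurableTypeR R)).
Proof. by apply: measurable_funD. Qed.

(** The image of Lebesgue measure under a translation gives half-open intervals their length, so it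
    is Lebesgue measure by uniqueness. *)
Lemma ge0_integral_translate1 (h : R) (f : R -> \bar R) :
  measurable_fun setT f -> (forall x, 0 <= f x)%E ->
  (\int[leb]_x f (x + h)%R = \int[leb]_x f x)%E.
Proof.
move=> mf f0.
pose phi := (fun x : measurableTypeR R => (x + h : measurableTypeR R)).
have := @ge0_integral_pushforward _ _ _ _ R phi (measurable_addr h)
  leb setT f measurableT mf (fun x _ => f0 x).
rewrite preimage_setT => <-.
pose m1 := isMeasurableFun.Build _ _ _ _ phi (measurable_addr h).
pose phi' : {mfun _ >-> _} := HB.pack phi m1.
rewrite -[LHS]/(\int[pushforward leb phi']_x f x)%E.
apply: eq_measure_integral => /= A mA _; apply/esym/lebesgue_measure_unique => //=.
  exact: measurable_addr.
move=> mphi _ [[a b]] _ <-.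
rewrite /pushforward.
rewrite (_ : phi @^-1` _ = `]a - h, b - h]%classic); last first.
  by apply/seteqP; split=> x; rewrite /phi/= !in_itv/= ltrBlDr lerBrDr.
by rewrite !lebesgue_measure_itv/= !lte_fin ltrD2r -!EFinB opprB addrA subrK.
Qed.

Lemma rV_consD n (a b : R) (x y : 'rV[R]_n) :
  rV_cons (a, x) + rV_cons (b, y) = rV_cons (a + b, x + y).
Proof.
apply/rowP => i; rewrite mxE; case: (unliftP ord0 i) => [j ->|->].
  by rewrite !rV_consS/= mxE.
by rewrite !rV_cons0.
Qed.

Lemma rV_unconsK n : cancel (@rV_uncons R n) (@rV_cons R n).
Proof.
move=> x; apply/rowP => i; case: (unliftP ord0 i) => [j ->|->].
  by rewrite !rV_consS/= mxE.
by rewrite !rV_cons0.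
Qed.

Lemma measurable_rVD n (h : 'rV[R]_n) : measurable_fun [set: 'rV[R]_n] (fun x : 'rV[R]_n => x + h).
Proof.
apply: measurable_fun_rV => i.
under eq_fun do rewrite mxE.
by apply: measurable_funD => //; exact: measurable_coord.
Qed.

Lemma ge0_integral_translate n (h : 'rV[R]_n) (f : 'rV[R]_n -> \bar R) :
  measurable_fun setT f -> (forall x, 0 <= f x)%E ->
  (\int[lebesgue_rV R n]_x f (x + h)%R = \int[lebesgue_rV R n]_x f x)%E.
Proof.
elim: n h f => [|n IH] h f mf f0.
  by apply: eq_integral => x _; congr f; apply/rowP; case.
have mfh : measurable_fun [set: 'rV[R]_n.+1] (fun x : 'rV[R]_n.+1 => f (x + h)).
  by apply: measurableT_comp => //; exact: measurable_rVD.
rewrite (ge0_integral_rV_cons mf f0) (ge0_integral_rV_cons mfh (fun x => f0 _)).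
rewrite -(rV_unconsK h); case: (rV_uncons h) => b y.
have mcons (a : R) : measurable_fun [set: 'rV[R]_n] (fun x => f (rV_cons (a, x))).
  apply: measurableT_comp => //.
  have := @measurable_rV_cons R n; move/(@measurableT_comp _ _ _ _ _ _ _ _ (fun x : 'rV[R]_n => (a, x))).
  by apply; exact: pair1_measurable.
transitivity (\int[leb]_a (\int[lebesgue_rV R n]_x f (rV_cons ((a + b)%R, x))))%E.
  apply: eq_integral => a _; move: (a : R) => {}a.
  rewrite -(IH y (fun x : 'rV[R]_n => f (rV_cons (a + b, x))))//.
  by apply: eq_integral => x _; rewrite rV_consD.
rewrite (@ge0_integral_translate1 b (fun a : R => \int[lebesgue_rV R n]_x f (rV_cons (a, x)))%E)//.
  have := @measurable_fun_fubini_tonelli_F _ _ _ _ R (lebesgue_rV R n) (f \o @rV_cons R n).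
  apply => //=.
  by apply: measurableT_comp => //; exact: measurable_rV_cons.
by move=> a; apply: integral_ge0.
Qed.

Lemma lebesgue_rV_cube n (C : set R) : measurable C ->
  (lebesgue_rV R n [set x : 'rV[R]_n | forall i, C (x ord0 i)] = leb C ^+ n)%E.
Proof.
move=> mC.
have mD m : measurable [set x : 'rV[R]_m | forall i, C (x ord0 i)].
  rewrite (_ : mkset _ = \bigcap_i ((fun x : 'rV[R]_m => x ord0 i) @^-1` C)).
    apply: fin_bigcap_measurable => // i _.
    rewrite -[X in measurable X]setTI; exact: measurable_coord.
  by apply/seteqP; split=> [x Cx i _|x Cx i]; [exact: Cx|exact: (Cx i)].
elim: n => [|n IH].
  by rewrite expe0 /= diracE mem_set//=; case.
pose D m := [set x : 'rV[R]_m | forall i, C (x ord0 i)].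
transitivity (\int[lebesgue_rV R n.+1]_x (\1_(D n.+1) x)%:E)%E.
  rewrite integral_indic// ?setIT//; exact: mD.
rewrite (@ge0_integral_rV_cons n (fun x => (\1_(D n.+1) x)%:E));
  [|by apply/measurable_EFinP; apply: measurable_indic; exact: mD|by move=> x; rewrite lee_fin].
have E (a : R) : (\int[lebesgue_rV R n]_x (\1_(D n.+1) (rV_cons (a, x)))%:E =
    leb C ^+ n * (\1_C a)%:E)%E.
  have := integral_indic (lebesgue_rV R n) measurableT (mD n); rewrite setIT [X in _ = X]IH => <-.
  rewrite -ge0_integralZr//=; last by apply/measurable_EFinP; apply: measurable_indic; exact: (mD n).
  apply: eq_integral => x _; rewrite -EFinM; congr EFin; rewrite !indicE -natrM mulnb.
  congr (nat_of_bool _)%:R; apply/idP/andP => [/set_mem h|[/set_mem h /set_mem Ca]].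
    split; apply/mem_set; last by have := h ord0; rewrite rV_cons0.
    by move=> i; have := h (lift ord0 i); rewrite rV_consS.
  apply/mem_set => i; case: (unliftP ord0 i) => [j ->|->].
    by rewrite rV_consS; exact: h.
  by rewrite rV_cons0.
under eq_integral do rewrite E.
rewrite ge0_integralZl//; [|by apply/measurable_EFinP; exact: measurable_indic|exact: expe_ge0].
by rewrite integral_indic// setIT expeS muleC.
Qed.

Lemma rV_cons_row_mx n (a : R) (z : 'rV[R]_n) (y : R) :
  (rV_cons (a, (row_mx z (y%:M : 'rV_1)%R)) : 'rV[R]_(n + 1).+1) =
  (row_mx (rV_cons (a, z) : 'rV[R]_n.+1) (y%:M : 'rV_1) : 'rV[R]_(n.+1 + 1)).
Proof.
apply/rowP => i; case: (unliftP ord0 i) => [j ->|->]; last first.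
  rewrite rV_cons0; rewrite (_ : ord0 = lshift 1 (ord0 : 'I_n.+1) :> 'I_(n.+1 + 1)); last exact/val_inj.
  by rewrite [RHS]row_mxEl rV_cons0.
rewrite rV_consS/=; case: (split_ordP j) => k ->.
  rewrite row_mxEl (_ : lift ord0 (lshift 1 k) = lshift 1 (lift ord0 k) :> 'I_(n.+1 + 1)); last exact/val_inj.
  by rewrite [RHS]row_mxEl rV_consS.
rewrite row_mxEr (_ : lift ord0 (rshift n k) = rshift n.+1 k :> 'I_(n.+1 + 1)); last exact/val_inj.
by rewrite [RHS]row_mxEr.
Qed.

Lemma measurable_row_mx n :
  measurable_fun [set: 'rV[R]_n * measurableTypeR R]
    (fun p => row_mx p.1 (p.2%:M : 'rV_1) : 'rV[R]_(n + 1)).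
Proof.
apply: measurable_fun_rV => i; case: (split_ordP i) => k ->.
  under eq_fun do rewrite row_mxEl.
  exact: (measurableT_comp (measurable_coord k)).
rewrite (_ : (fun _ => _) = snd); first exact: measurable_snd.
by apply/funext => p; rewrite row_mxEr (ord1 k) mxE eqxx mulr1n.
Qed.

(** [lebesgue_rV] splits off the first coordinate, whereas the half-space singles out the last one.
    Induction on the dimension moves the split from one end to the other. *)
Lemma ge0_integral_row_mx n (f : 'rV[R]_(n + 1) -> \bar R) :
  measurable_fun setT f -> (forall x, 0 <= f x)%E ->
  (\int[lebesgue_rV R (n + 1)]_x f x =
   \int[lebesgue_rV R n]_z \int[leb]_y f (row_mx z (y%:M : 'rV_1)))%E.
Proof.
elim: n f => [|n IH] f mf f0.
  have mfr : measurable_fun [set: 'rV[R]_0 * measurableTypeR R]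
      (fun p => f (row_mx p.1 (p.2%:M : 'rV_1))).
    by apply: measurableT_comp => //; exact: measurable_row_mx.
  rewrite (@ge0_integral_rV_cons 0)// [RHS]integral_dirac//; last first.
    exact: (@measurable_fun_fubini_tonelli_F _ _ _ _ R leb _ mfr).
  rewrite diracT mul1e; apply: eq_integral => a _.
  rewrite integral_dirac//; last first.
    apply: measurableT_comp => //; apply: (measurableT_comp (@measurable_rV_cons R 0)).
    exact: pair1_measurable.
  rewrite diracT mul1e; congr f; apply/rowP => i.
  transitivity (rV_cons (a, (0 : 'rV[R]_0)) ord0 ord0).
    by congr (rV_cons _ _ _); rewrite (ord1 i); exact/val_inj.
  rewrite rV_cons0 (_ : i = rshift 0 ord0); last by rewrite (ord1 i); exact/val_inj.
  by rewrite row_mxEr mxE eqxx mulr1n.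
have mfc : measurable_fun [set: measurableTypeR R * 'rV[R]_n] (fun p =>
    \int[leb]_y f (row_mx (rV_cons p : 'rV[R]_n.+1) (y%:M : 'rV_1)))%E.
  apply: (@measurable_fun_fubini_tonelli_F _ _ _ _ R leb
    (fun q : (measurableTypeR R * 'rV[R]_n) * measurableTypeR R =>
    f (row_mx (rV_cons q.1 : 'rV[R]_n.+1) (q.2%:M : 'rV_1)))) => //=.
  apply: measurableT_comp => //.
  have h1 : measurable_fun [set: (measurableTypeR R * 'rV[R]_n) * measurableTypeR R]
      (fun q => (rV_cons q.1 : 'rV[R]_n.+1, q.2)).
    apply: measurable_fun_pair => //=.
    exact: (measurableT_comp (@measurable_rV_cons R n) measurable_fst).
  exact: (measurableT_comp (@measurable_row_mx n.+1) h1).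
rewrite (@ge0_integral_rV_cons (n + 1))// (@ge0_integral_rV_cons n
  (fun z => \int[leb]_y f (row_mx z (y%:M : 'rV_1)))%E); last 2 first.
- apply: (@measurable_fun_fubini_tonelli_F _ _ _ _ R leb
    (fun q : 'rV[R]_n.+1 * measurableTypeR R => f (row_mx q.1 (q.2%:M : 'rV_1)))) => //=.
  by apply: measurableT_comp => //; exact: measurable_row_mx.
- by move=> z; apply: integral_ge0.
apply: eq_integral => a _.
have mfa : measurable_fun [set: 'rV[R]_(n + 1)] (fun x => f (rV_cons (a, x))).
  apply: measurableT_comp => //; apply: (measurableT_comp (@measurable_rV_cons R (n + 1))).
  exact: pair1_measurable.
rewrite (IH _ mfa (fun x => f0 _)).
apply: eq_integral => z _; apply: eq_integral => y _.
by rewrite rV_cons_row_mx.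
Qed.

Lemma rV_norm_coord n (x : 'rV[R]_n) i : `|x ord0 i| <= `|x|.
Proof.
rewrite [leRHS]mx_normrE; apply: (le_bigmax _ (fun ij => `|x ij.1 ij.2|) (ord0, i)).
Qed.

Lemma rV_norm_le n (x : 'rV[R]_n) M : 0 <= M -> (forall i, `|x ord0 i| <= M) -> `|x| <= M.
Proof.
move=> M0 xM; rewrite [leLHS]mx_normrE; apply: bigmax_le => // -[i j] _ /=.
by rewrite (ord1 i).
Qed.

Definition cube n (M : R) := [set x : 'rV[R]_n | forall i, `|x ord0 i| <= M].
Arguments cube : clear implicits.

Lemma cubeE n M : cube n M = [set x : 'rV[R]_n | forall i, [set y : R | `|y| <= M] (x ord0 i)].
Proof. by []. Qed.

Lemma measurable_normr_le (M : R) : measurable [set y : measurableTypeR R | `|y| <= M].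
Proof.
rewrite (_ : mkset _ = `[- M, M]%classic) //.
by apply/seteqP; split=> y; rewrite /= in_itv/= ler_norml.
Qed.

Lemma measurable_cube n M : measurable (cube n M).
Proof.
rewrite (_ : cube n M = \bigcap_i ((fun x : 'rV[R]_n => x ord0 i) @^-1` [set y : R | `|y| <= M])).
  apply: fin_bigcap_measurable => // i _.
  rewrite -[X in measurable X]setTI; apply: measurable_coord => //.
  exact: measurable_normr_le.
by apply/seteqP; split=> [x Cx i _|x Cx i]; [exact: Cx|exact: (Cx i)].
Qed.

Lemma lebesgue_cube_lty n M : (lebesgue_rV R n (cube n M) < +oo)%E.
Proof.
rewrite cubeE lebesgue_rV_cube; last exact: measurable_normr_le.
rewrite (_ : mkset _ = `[- M, M]%classic); last first.
  by apply/seteqP; split=> y; rewrite /= in_itv/= ler_norml.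
rewrite lebesgue_measure_itv/=; case: ifP => _.
  by rewrite -EFinD -EFin_expe ltry.
by rewrite -EFin_expe ltry.
Qed.

Lemma countable_valued_measurable d (T : measurableType d) (I : countType)
    (q : T -> I) (Y : set I) :
  (forall i, measurable (q @^-1` [set i])) -> measurable (q @^-1` Y).
Proof.
move=> mq; rewrite (_ : q @^-1` Y = \bigcup_i ((q @^-1` [set i]) `&` [set _ | Y i])).
  apply: countable_bigcupT_measurable => [|i]; first exact: countableP.
  apply: measurableI => //; have [Yi|nYi] := pselect (Y i).
    by rewrite (_ : mkset _ = setT)//; apply/seteqP; split.
  by rewrite (_ : mkset _ = set0)//; apply/seteqP; split.
by apply/seteqP; split=> [x Yx|x [i _ [/= -> //]]]; exists (q x).
Qed.

(** Rounding down to the mesh 1/(k+1), recorded by integers: the target is countable, so every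
    function of [grid k x] is measurable as soon as the fibres are. *)
Definition grid n k (x : 'rV[R]_n) : 'rV[int]_n := \row_i Num.floor (x ord0 i * k.+1%:R).

Definition of_grid n k (z : 'rV[int]_n) : 'rV[R]_n := \row_i ((z ord0 i)%:~R / k.+1%:R).

Lemma measurable_grid n k (z : 'rV[int]_n) : measurable (grid k @^-1` [set z]).
Proof.
rewrite (_ : _ @^-1` _ = \bigcap_i ((fun x : 'rV[R]_n => x ord0 i * k.+1%:R) @^-1`
   `[(z ord0 i)%:~R, (z ord0 i + 1)%:~R[)).
  apply: fin_bigcap_measurable => // i _.
  rewrite -[X in measurable X]setTI.
  have : measurable_fun [set: 'rV[R]_n] (fun x : 'rV[R]_n => x ord0 i * k.+1%:R).
    by apply: measurable_funM => //; exact: measurable_coord.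
  by apply.
apply/seteqP; split=> [x /= <- i _|x zx] /=.
  by rewrite mxE in_itv/= floor_le floorD1_gt.
apply/rowP => i; rewrite mxE.
by apply: floor_def; have := zx i I; rewrite /= in_itv.
Qed.

Lemma of_gridK n k (x : 'rV[R]_n) : `|of_grid k (grid k x) - x| <= k.+1%:R^-1.
Proof.
apply: rV_norm_le => [|i]; first by rewrite invr_ge0.
rewrite !mxE -[X in _ - X](mulfK (x := k.+1%:R)) // -mulrBl normrM (ger0_norm (x := _^-1)) ?invr_ge0//.
rewrite ler_piMl ?invr_ge0// ler0_norm ?subr_le0 ?floor_le// opprB lerBlDl.
by apply: ltW; have := floorD1_gt (x ord0 i * k.+1%:R); rewrite intrD.
Qed.

Lemma cvg_of_grid n (x : 'rV[R]_n) : of_grid k (grid k x) @[k --> \oo] --> x.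
Proof.
apply/cvgrPdist_le => e e0; near=> k.
rewrite distrC; apply: le_trans (of_gridK _ _) _.
rewrite invf_ple ?posrE//; apply: ltW; apply: le_lt_trans (_ : k%:R < _); last by rewrite ltr_nat.
near: k; exact: nbhs_infty_ger.
Unshelve. all: by end_near. Qed.

Lemma cvg_of_grid2 n m (x : 'rV[R]_n) (y : 'rV[R]_m) :
  (of_grid k (grid k x), of_grid k (grid k y)) @[k --> \oo] --> (x, y).
Proof. by exact: (cvg_pair (@cvg_of_grid _ x) (@cvg_of_grid _ y)). Qed.

(** The sigma-algebra is generated by the coordinates, not by the open sets. A continuous function
    is the pointwise limit of its values at the rounded points, and each of these approximations
    factors through the countable type of [grid]. *)
Lemma continuous_measurable_rV n (f : 'rV[R]_n -> R) : continuous f -> measurable_fun setT f.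
Proof.
move=> cf; apply: (measurable_fun_cvg (h := fun k x => f (of_grid k (grid k x)))) => [k|x _].
  move=> _ Y mY; rewrite setTI.
  exact: (@countable_valued_measurable _ _ _ (grid k) [set z | Y (f (of_grid k z))] (@measurable_grid n k)).
by apply: continuous_cvg; [exact: cf|exact: cvg_of_grid].
Qed.

Lemma continuous_measurable_rV2 n m (f : 'rV[R]_n * 'rV[R]_m -> R) :
  continuous f -> measurable_fun setT f.
Proof.
move=> cf; apply: (measurable_fun_cvg (h := fun k x =>
  f (of_grid k (grid k x.1), of_grid k (grid k x.2)))) => [k|x _].
  move=> _ Y mY; rewrite setTI.
  apply: (@countable_valued_measurable _ ('rV[R]_n * 'rV[R]_m)%type _ (fun x => (grid k x.1, grid k x.2))
     [set z | Y (f (of_grid k z.1, of_grid k z.2))]) => -[z1 z2].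
  rewrite (_ : _ @^-1` _ = (grid k @^-1` [set z1]) `*` (grid k @^-1` [set z2])).
    by apply: measurableX; exact: measurable_grid.
  by apply/seteqP; split=> [[x y] /= [-> ->]|[x y] /= [-> ->]].
by apply: continuous_cvg; [exact: cf|case: x => x y; exact: cvg_of_grid2].
Qed.

End lebesgue_rV_theory.
Arguments cube {R} n M _.

(** * Smooth functions *)

Section smooth.
Context {R : realType}.

Lemma linear_is_diff (V W : normedModType R) (f : V -> W) :
  linear f -> continuous f -> forall x, is_diff x f f.
Proof.
move=> lf cf x.
pose m := GRing.isLinear.Build R V W _ f lf.
pose g : {linear V -> W} := HB.pack f m.
have cg : continuous g by [].
apply: DiffDef; first exact: (linear_differentiable x cg).
exact: (diff_lin x cg).
Qed.

Lemma CkSP (V : normedModType R) k (f : V -> R) :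
  Ck k.+1 f <-> (forall x, differentiable f x) /\ forall v, Ck k ('D_v f).
Proof. by []. Qed.

Lemma is_diffP (V W : normedModType R) (f df : V -> W) x :
  is_diff x f df -> differentiable f x /\ 'd f x = df :> (V -> W).
Proof. by case. Qed.

Lemma CkS (V : normedModType R) k (f : V -> R) : Ck k.+1 f -> Ck k f.
Proof.
elim: k f => [|k IH] f [df Df].
  by move=> x; exact: differentiable_continuous.
by split=> // v; apply: IH; exact: Df.
Qed.

Lemma smooth_D (V : normedModType R) (f : V -> R) v : smooth f -> smooth ('D_v f).
Proof. by move=> sf k; have [_] := sf k.+1; exact. Qed.

Lemma smooth_differentiable (V : normedModType R) (f : V -> R) x : smooth f -> differentiable f x.
Proof. by move=> /(_ 1%N) [df _]. Qed.

Lemma smooth_derivable (V : normedModType R) (f : V -> R) x v : smooth f -> derivable f x v.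
Proof. by move=> sf; apply: diff_derivable; exact: smooth_differentiable. Qed.

Lemma smooth_continuous (V : normedModType R) (f : V -> R) : smooth f -> continuous f.
Proof. by move=> /(_ 0%N). Qed.

Lemma Ck_cst (V : normedModType R) k (c : R) : Ck k (fun _ : V => c).
Proof.
elim: k c => [|k IH] c; first exact: cst_continuous.
split=> [x|v]; first exact: differentiable_cst.
by rewrite (_ : 'D_v _ = fun=> 0)//; apply/funext => x; exact: derive_cst.
Qed.

Lemma CkD (V : normedModType R) k (f g : V -> R) :
  Ck k f -> Ck k g -> Ck k (fun x => f x + g x).
Proof.
elim: k f g => [|k IH] f g.
  by move=> cf cg x; apply: cvgD; [exact: cf|exact: cg].
move=> /CkSP[df Df] /CkSP[dg Dg]; apply/CkSP; split=> [x|v]; first exact: differentiableD.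
rewrite (_ : 'D_v _ = fun x => 'D_v f x + 'D_v g x); first exact: IH.
by apply/funext => x; rewrite -deriveD//; exact: diff_derivable.
Qed.

Lemma CkM (V : normedModType R) k (f g : V -> R) :
  Ck k f -> Ck k g -> Ck k (fun x => f x * g x).
Proof.
elim: k f g => [|k IH] f g.
  by move=> cf cg x; apply: cvgM; [exact: cf|exact: cg].
move=> cf cg; have /CkSP[df Df] := cf; have /CkSP[dg Dg] := cg.
apply/CkSP; split=> [x|v]; first exact: differentiableM.
rewrite (_ : 'D_v _ = fun x => f x * 'D_v g x + g x * 'D_v f x).
  by apply: CkD; apply: IH => //; apply: CkS.
by apply/funext => x; rewrite -[LHS]/('D_v (f * g) x) deriveM//; exact: diff_derivable.
Qed.

Lemma CkV (V : normedModType R) k (f : V -> R) : (forall x, f x != 0) ->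
  Ck k f -> Ck k (fun x => (f x)^-1).
Proof.
move=> f0; elim: k => [|k IH] cf.
  by move=> x; apply: cvgV => //; exact: cf.
have /CkSP[df Df] := cf; apply/CkSP; split=> [x|v]; first exact: differentiableV.
rewrite (_ : 'D_v _ = fun x => (-1) * ((f x)^-1 * (f x)^-1 * 'D_v f x)).
  apply: CkM; first exact: Ck_cst.
  by apply: CkM; [apply: CkM; apply: IH; exact: CkS|exact: Df].
apply/funext => x; rewrite deriveV//; last exact: diff_derivable.
by rewrite /GRing.scale/= mulN1r mulNr -invfM -expr2.
Qed.

Lemma derive_comp_affine (V W : normedModType R) (f : W -> R) (A L : V -> W) x v :
  is_diff x A L -> differentiable f (A x) -> 'D_v (fun x => f (A x)) x = 'D_(L v) f (A x).
Proof.
move=> /is_diffP[dA eA] df.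
rewrite deriveE; last by apply: differentiable_comp.
by rewrite -[X in 'd X x]/(f \o A) diff_comp// deriveE//= eA.
Qed.

(** The differential [L] is the same at every point, so [A] is affine: a derivative of the composite
    is again a derivative of [f], in the direction [L v], composed with [A], and the induction
    closes without products. *)
Lemma Ck_comp (V W : normedModType R) k (f : W -> R) (A L : V -> W) :
  (forall x, is_diff x A L) -> Ck k f -> Ck k (fun x => f (A x)).
Proof.
move=> dA; elim: k f => [|k IH] f.
  move=> cf x; apply: continuous_comp; last exact: cf.
  by apply: differentiable_continuous; have /is_diffP[] := dA x.
move=> /CkSP[df Df]; apply/CkSP; split=> [x|v].
  apply: differentiable_comp; last exact: df.
  by have /is_diffP[] := dA x.
rewrite (_ : 'D_v _ = fun x => ('D_(L v) f) (A x)); first by apply: (IH ('D_(L v) f)); exact: Df.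
by apply/funext => x; exact: derive_comp_affine.
Qed.

Lemma smoothM (V : normedModType R) (f g : V -> R) :
  smooth f -> smooth g -> smooth (fun x => f x * g x).
Proof. by move=> sf sg k; exact: CkM. Qed.

Lemma smoothD (V : normedModType R) (f g : V -> R) :
  smooth f -> smooth g -> smooth (fun x => f x + g x).
Proof. by move=> sf sg k; exact: CkD. Qed.

Lemma smooth_cst (V : normedModType R) (c : R) : smooth (fun _ : V => c).
Proof. by move=> k; exact: Ck_cst. Qed.

Lemma smooth_comp (V W : normedModType R) (f : W -> R) (A L : V -> W) :
  (forall x, is_diff x A L) -> smooth f -> smooth (fun x => f (A x)).
Proof. by move=> dA sf k; exact: (Ck_comp dA). Qed.

Lemma smooth_sum (V : normedModType R) I (s : seq I) (P : pred I) (f : I -> V -> R) :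
  (forall i, smooth (f i)) -> smooth (fun x => \sum_(i <- s | P i) f i x).
Proof.
move=> sf; elim: s => [|i s IH].
  by under eq_fun do rewrite big_nil; exact: smooth_cst.
under eq_fun do rewrite big_cons; case: (P i) => //.
exact: smoothD.
Qed.

Lemma smooth_prod (V : normedModType R) I (s : seq I) (f : I -> V -> R) :
  (forall i, smooth (f i)) -> smooth (fun x => \prod_(i <- s) f i x).
Proof.
move=> sf; elim: s => [|i s IH].
  by under eq_fun do rewrite big_nil; exact: smooth_cst.
by under eq_fun do rewrite big_cons; exact: smoothM.
Qed.

Lemma Ck_derive1 k (f f' : R -> R) :
  (forall x, is_derive x (1 : R) f (f' x)) -> Ck k f' -> Ck k.+1 f.
Proof.
move=> df cf'.
have dif x : differentiable f x by apply/derivable1_diffP; have [] := df x.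
split=> // v.
rewrite (_ : 'D_v f = fun x => v * f' x); first by apply: CkM => //; exact: Ck_cst.
apply/funext => x; rewrite deriveE// -[X in 'd f x X]mulr1 -[X in 'd f x X]/(v *: (1:R)) linearZ/=.
by rewrite -deriveE//; have [_ ->] := df x.
Qed.

Lemma is_diff_coord n (i : 'I_n) (x : 'rV[R]_n) :
  is_diff x (fun x : 'rV[R]_n => x ord0 i) (fun x => x ord0 i).
Proof.
apply: linear_is_diff => [a u v|u]; first by rewrite !mxE.
by apply: differentiable_continuous; exact: differentiable_coord.
Qed.

Lemma is_diff_fst (V W : normedModType R) (x : V * W) : is_diff x fst fst.
Proof. by apply: linear_is_diff => [a [u1 u2] [v1 v2]//|u]; exact: cvg_fst. Qed.

Lemma is_diff_snd (V W : normedModType R) (x : V * W) : is_diff x snd snd.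
Proof. by apply: linear_is_diff => [a [u1 u2] [v1 v2]//|u]; exact: cvg_snd. Qed.

Lemma is_diff_translate (V : normedModType R) (c x : V) : is_diff x (fun x => x + c) id.
Proof.
have := is_diffD (is_diff_id x) (is_diff_cst c x).
by move/is_diff_eq; apply; rewrite addr0.
Qed.

Lemma is_diff_pairl (V W : normedModType R) (w : W) (x : V) :
  is_diff x (fun x => (x, w)) (fun h => (h, 0)).
Proof. exact: (is_diff_pair (is_diff_id x) (is_diff_cst w x)). Qed.

Lemma is_diff_pairr (V W : normedModType R) (v : V) (x : W) :
  is_diff x (fun x => (v, x)) (fun h => (0, h)).
Proof. exact: (is_diff_pair (is_diff_cst v x) (is_diff_id x)). Qed.

Lemma smooth_coord n (i : 'I_n) : smooth (fun x : 'rV[R]_n => x ord0 i).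
Proof.
apply: (smooth_comp (is_diff_coord i) (f := id)) => k.
case: k => [|k]; first by move=> x.
by apply: (@Ck_derive1 _ _ (fun=> 1)); exact: Ck_cst.
Qed.

(* The functions x^-k e^{-1/x} on the positive half-line are closed under derivation up to linear combinations. *)
Definition flat (k : nat) (x : R) : R := if 0 < x then x^-1 ^+ k * expR (- x^-1) else 0.

Lemma flat_ge0 k x : 0 <= flat k x.
Proof. by rewrite /flat; case: ifP => // x0; rewrite mulr_ge0 ?expR_ge0// exprn_ge0// invr_ge0 ltW. Qed.

(** From e^t >= t^(k+2)/(k+2)! at t = 1/x. The two spare powers of x make the difference quotient at
    0 tend to 0, which is what glues the two branches of [flat]. *)
Lemma flat_le k x : 0 < x -> flat k x <= k.+2`!%:R * x ^+ 2.
Proof.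
move=> x0; rewrite /flat x0.
have h : (x^-1) ^+ k.+2 / k.+2`!%:R <= expR x^-1.
  by apply: le_trans (expR_ge1Dxn k.+1 _); rewrite ?lerDr// invr_ge0 ltW.
rewrite expRN ler_pdivrMr ?expR_gt0//.
have k0 : (0 : R) < k.+2`!%:R by rewrite ltr0n fact_gt0.
apply: (@le_trans _ _ (k.+2`!%:R * x ^+ 2 * ((x^-1) ^+ k.+2 / k.+2`!%:R))); last first.
  by rewrite ler_wpM2l// mulr_ge0 ?exprn_ge0 ?ltW.
rewrite le_eqVlt; apply/orP; left; apply/eqP.
have -> : x^-1 ^+ k.+2 = x^-1 ^+ k * x^-1 * x^-1 by rewrite !exprSr.
move: (x^-1 ^+ k) => a.
move: k0; move: (k.+2`!%:R) => N N0; field.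
by rewrite !lt0r_neq0.
Qed.

Lemma is_derive_inv (x : R) : x != 0 -> is_derive x (1 : R) (fun y : R => y^-1) (- x^-1 ^+ 2).
Proof.
move=> x0; have h := @is_deriveV R (@id R) x 1 1 x0 (is_derive_id x 1).
have e : - (@id R x) ^- 2 *: (1 : R) = - x^-1 ^+ 2 by rewrite /GRing.scale/= mulr1 exprVn.
by rewrite e in h.
Qed.

Lemma is_derive_flat k x : is_derive x (1 : R) (flat k) (flat k.+2 x - k%:R * flat k.+1 x).
Proof.
have [x0|x0|x0] := ltrgtP 0 x.
- have -> : flat k.+2 x - k%:R * flat k.+1 x =
      x^-1 ^+ k * (expR (- x^-1) * x^-1 ^+ 2) + expR (- x^-1) * (k%:R * x^-1 ^+ k.-1 * (- x^-1 ^+ 2)).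
    rewrite /flat x0; case: k => [|k]; first by rewrite /=; ring.
    by rewrite /= !exprS; ring.
  have : is_derive x (1 : R) ((fun y => (y^-1) ^+ k) * (fun y => expR (- y^-1)))
    (x^-1 ^+ k * (expR (- x^-1) * x^-1 ^+ 2) + expR (- x^-1) * (k%:R * x^-1 ^+ k.-1 * (- x^-1 ^+ 2))).
    have dV : is_derive x (1 : R) (fun y : R => y^-1) (- x^-1 ^+ 2).
      exact: is_derive_inv (lt0r_neq0 x0).
    have dX : is_derive x (1 : R) (fun y : R => (y^-1) ^+ k) (k%:R * x^-1 ^+ k.-1 * (- x^-1 ^+ 2)).
      rewrite (_ : (fun _ => _) = (fun y : R => y^-1) ^+ k); last by apply/funext => y; rewrite exprfctE.
      exact: (is_derive_eq (is_deriveX k dV)).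
    have dE : is_derive x (1 : R) (fun y : R => expR (- y^-1)) (expR (- x^-1) * x^-1 ^+ 2).
      have dN : is_derive x (1 : R) (fun y : R => - y^-1) (x^-1 ^+ 2).
        by have h := is_deriveN dV; rewrite opprK in h.
      have h := @is_derive1_comp R (@expR R) (fun y : R => - y^-1) x _ _ (is_derive_expR _) dN.
      exact: h.
    exact: (is_deriveM dX dE).
  apply: near_eq_is_derive.
  near=> y; rewrite /flat ifT//.
  near: y; exact: lt_nbhsr.
- have -> : flat k.+2 x - k%:R * flat k.+1 x = 0 by rewrite /flat !ltNge (ltW x0)/= mulr0 subrr.
  have h : \near x, (cst 0 : R -> R) x = flat k x.
    near=> y; have y0 : y < 0 by near: y; exact: lt_nbhsl.
    by rewrite /flat ltNge (ltW y0).
  exact: (near_eq_is_derive h (is_derive_cst (0 : R) x (1 : R))).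
rewrite -x0 /flat ltxx mulr0 subrr -/(flat k).
have h : h^-1 *: (flat k (h *: (1 : R) + 0) - flat k 0) @[h --> 0^'] --> (0 : R).
  apply/cvgr0Pnorm_le => e e0.
  near=> h; rewrite addr0 /GRing.scale/= mulr1 {2}/flat ltxx subr0 normrM.
  have [h0|h0] := leP h 0; first by rewrite /flat ltNge h0/= normr0 mulr0 ltW.
  rewrite (ger0_norm (flat_ge0 _ _)) ger0_norm ?invr_ge0 ?(ltW h0)// mulrC ler_pdivrMr//.
  apply: le_trans (flat_le _ h0) _; rewrite expr2 mulrA ler_wpM2r ?(ltW h0)//.
  rewrite -ler_pdivlMl ?ltr0n ?fact_gt0// mulrC.
  apply: (le_trans (ler_norm h)).
  near: h; apply: dnbhs0_le; rewrite divr_gt0// ltr0n fact_gt0//.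
split; first by apply/cvg_ex; exists 0.
by apply/cvg_lim.
Unshelve. all: by end_near. Qed.

Lemma smooth_flat k : smooth (flat k).
Proof.
move=> m; elim: m k => [|m IH] k.
  move=> x; apply: differentiable_continuous; apply/derivable1_diffP.
  by have [] := is_derive_flat k x.
apply: (@Ck_derive1 _ _ (fun x => flat k.+2 x + (- k%:R) * flat k.+1 x)).
  by move=> x; rewrite mulNr; exact: is_derive_flat.
by apply: CkD => //; apply: CkM => //; exact: Ck_cst.
Qed.

Lemma is_diff_affine1 (a b x : R) : is_diff x (fun y : R => a * y + b) (fun y => a * y).
Proof.
have := is_diffD (is_diffZ a (is_diff_id x)) (is_diff_cst b x).
by move/is_diff_eq; apply; rewrite addr0.
Qed.

Definition bump (t : R) : R := flat 0 t * flat 0 (1 - t).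

Lemma smooth_bump : smooth bump.
Proof.
apply: smoothM; first exact: smooth_flat.
rewrite (_ : (fun _ => _) = fun x => flat 0 (-1 * x + 1)).
  by apply: (smooth_comp (is_diff_affine1 (-1) 1)); exact: smooth_flat.
by apply/funext => x; rewrite mulN1r addrC.
Qed.

Lemma bump_ge0 t : 0 <= bump t.
Proof. by rewrite mulr_ge0// flat_ge0. Qed.

Lemma bump_gt0 t : 0 < t < 1 -> 0 < bump t.
Proof.
by move=> /andP[t0 t1]; rewrite /bump /flat t0 subr_gt0 t1 !expr0 !mul1r mulr_gt0// expR_gt0.
Qed.

Lemma bump_eq0 t : ~~ (0 < t < 1) -> bump t = 0.
Proof.
rewrite negb_and => /orP[t0|t1]; rewrite /bump /flat.
  by rewrite (negbTE t0) mul0r.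
by rewrite subr_gt0 (negbTE t1) mulr0.
Qed.

Definition step (t : R) : R := flat 0 t / (flat 0 t + flat 0 (1 - t)).

Lemma flat_gt0 t : 0 < t -> 0 < flat 0 t.
Proof. by move=> t0; rewrite /flat t0 expr0 mul1r expR_gt0. Qed.

Lemma step_den_gt0 t : 0 < flat 0 t + flat 0 (1 - t).
Proof.
have [t0|t0] := leP t 0.
  by rewrite ltr_wpDl ?flat_ge0// flat_gt0// subr_gt0 (le_lt_trans t0).
by rewrite ltr_wpDr ?flat_ge0// flat_gt0.
Qed.

Lemma smooth_step : smooth step.
Proof.
have sf : smooth (fun t : R => flat 0 (1 - t)).
  rewrite (_ : (fun _ => _) = fun x => flat 0 (-1 * x + 1)).
    by apply: (smooth_comp (is_diff_affine1 (-1) 1)); exact: smooth_flat.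
  by apply/funext => x; rewrite mulN1r addrC.
apply: smoothM; first exact: smooth_flat.
move=> k; apply: CkV => [x|]; first by rewrite gt_eqF// step_den_gt0.
by apply: CkD; [exact: smooth_flat|exact: sf].
Qed.

Lemma step_ge0 t : 0 <= step t.
Proof. by rewrite divr_ge0// ?flat_ge0// ltW// step_den_gt0. Qed.

Lemma step_le1 t : step t <= 1.
Proof. by rewrite ler_pdivrMr ?step_den_gt0// mul1r lerDl flat_ge0. Qed.

Lemma step1 t : 1 <= t -> step t = 1.
Proof.
move=> t1; have := step_den_gt0 t; rewrite /step.
have -> : flat 0 (1 - t) = 0 by rewrite /flat subr_gt0 ltNge t1.
by rewrite addr0 => h; rewrite divff// gt_eqF.
Qed.

Lemma step0 t : t <= 0 -> step t = 0.
Proof. by move=> t0; rewrite /step {1}/flat ltNge t0/= mul0r. Qed.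

Definition plateau (t : R) : R := step (2 - t) * step (2 + t).

Lemma smooth_plateau : smooth plateau.
Proof.
apply: smoothM.
  rewrite (_ : (fun _ => _) = fun x => step (-1 * x + 2)).
    by apply: (smooth_comp (is_diff_affine1 (-1) 2)); exact: smooth_step.
  by apply/funext => x; rewrite mulN1r addrC.
rewrite (_ : (fun _ => _) = fun x => step (1 * x + 2)).
  by apply: (smooth_comp (is_diff_affine1 1 2)); exact: smooth_step.
by apply/funext => x; rewrite mul1r addrC.
Qed.

Lemma plateau_ge0 t : 0 <= plateau t.
Proof. by rewrite mulr_ge0// step_ge0. Qed.

Lemma plateau_le1 t : plateau t <= 1.
Proof. by rewrite mulr_ile1// ?step_ge0 ?step_le1. Qed.

Lemma plateau1 t : `|t| <= 1 -> plateau t = 1.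
Proof. by rewrite ler_norml => /andP[t1 t2]; rewrite /plateau !step1 ?mulr1//; lra. Qed.

Lemma plateau0 t : 2 <= `|t| -> plateau t = 0.
Proof.
rewrite ler_normr /plateau => /orP[t2|t2]; first by rewrite step0 ?mul0r//; lra.
by rewrite [X in _ * X]step0 ?mulr0//; lra.
Qed.

End smooth.

(** * Test functions *)

Section test_functions_theory.
Context {R : realType}.

Lemma supp_eq0 (V : normedModType R) (f : V -> R) x : ~ supp f x -> f x = 0.
Proof.
by move=> h; apply/eqP/negPn/negP => fx; apply: h; exact: subset_closure.
Qed.

Lemma derive_eq0_supp (V : normedModType R) (f : V -> R) v x : ~ supp f x -> 'D_v f x = 0.
Proof.
move=> h; rewrite -(derive_cst (0 : R) x v); apply: near_eq_derive.
have oS : open (~` supp f) by apply: closed_openC; exact: closed_closure.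
have : nbhs x (~` supp f) by exact: open_nbhs_nbhs.
by apply: filterS => y /supp_eq0.
Qed.

Lemma supp_subset_closed (V : normedModType R) (f : V -> R) (A : set V) : closed A ->
  (forall x, f x != 0 -> A x) -> supp f `<=` A.
Proof.
by move=> cA fA; rewrite [X in _ `<=` X]((closure_id _).1 cA); exact: closureS.
Qed.

Lemma closed_norm_le (V : normedModType R) (M : R) : closed [set x : V | `|x| <= M].
Proof.
have : closed ((fun x : V => `|x|) @^-1` [set y : R | y <= M]).
  by apply: preimage_closed; [move=> x _; exact: norm_continuous|exact: closed_le].
by [].
Qed.

Lemma test_fun_supp (V : normedModType R) U (f g : V -> R) :
  test_fun U f -> smooth g -> (forall x, ~ supp f x -> g x = 0) -> test_fun U g.
Proof.
move=> [sf cf fU] sg fg.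
have gf : supp g `<=` supp f.
  apply: supp_subset_closed => [|x gx]; first exact: closed_closure.
  apply: contrapT => /fg gx0.
  by rewrite gx0 eqxx in gx.
split => //; last exact: subset_trans fU.
by apply: subclosed_compact cf gf; exact: closed_closure.
Qed.

Lemma test_funD (V : normedModType R) U (f : V -> R) v : test_fun U f -> test_fun U ('D_v f).
Proof.
move=> tf; apply: (test_fun_supp tf) => [|x]; last exact: derive_eq0_supp.
by apply: smooth_D; case: tf.
Qed.

Lemma test_funM (V : normedModType R) U (f g : V -> R) :
  test_fun U f -> smooth g -> test_fun U (fun x => f x * g x).
Proof.
move=> tf sg; apply: (test_fun_supp tf) => [|x /supp_eq0 ->]; last by rewrite mul0r.
by apply: smoothM => //; case: tf.
Qed.

Lemma test_fun_smooth (V : normedModType R) U (f : V -> R) : test_fun U f -> smooth f.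
Proof. by case. Qed.

Lemma test_bounded (V : normedModType R) U (f : V -> R) : test_fun U f ->
  exists2 C, 0 <= C & forall x, `|f x| <= C.
Proof.
move=> [sf cf _].
have : compact (f @` supp f).
  by apply: continuous_compact => //; apply: continuous_subspaceT; exact: smooth_continuous.
move/compact_bounded => [M [Mr h]].
exists (`|M| + 1) => [|x]; first by rewrite addr_ge0.
have [fx|/supp_eq0 ->] := pselect (supp f x); last by rewrite normr0 addr_ge0.
by apply: h; [rewrite (le_lt_trans (ler_norm M))// ltrDl|exists x].
Qed.

Lemma test_bounded_supp (V : normedModType R) U (f : V -> R) : test_fun U f ->
  exists2 M, 0 <= M & forall x, f x != 0 -> `|x| <= M.
Proof.
move=> [sf /compact_bounded [M [Mr h]] _].
exists (`|M| + 1) => [|x fx]; first by rewrite addr_ge0.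
apply: h; first by rewrite (le_lt_trans (ler_norm M))// ltrDl.
by apply: subset_closure.
Qed.

Lemma test_fun_rV n (f : 'rV[R]_n -> R) M : smooth f ->
  (forall x, f x != 0 -> `|x| <= M) -> test_fun setT f.
Proof.
move=> sf fM; split => //.
have fM' : supp f `<=` [set x | `|x| <= M].
  by apply: supp_subset_closed => //; exact: closed_norm_le.
apply: bounded_closed_compact; last exact: closed_closure.
exists M; split; first exact: num_real.
by move=> N MN x /fM' /= h; rewrite (le_trans h)// ltW.
Qed.

Lemma compact_rV_ball n (M : R) : compact [set x : 'rV[R]_n | `|x| <= M].
Proof.
apply: bounded_closed_compact.
  by exists M; split; [exact: num_real|move=> N MN x /= h; rewrite (le_trans h)// ltW].
exact: closed_norm_le.
Qed.

Lemma test_fun_rV2 n m (f : 'rV[R]_n * 'rV[R]_m -> R) M U : smooth f ->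
  (forall x, f x != 0 -> `|x| <= M) -> supp f `<=` U -> test_fun U f.
Proof.
move=> sf fM fU; split => //.
have cA : closed [set x : 'rV[R]_n * 'rV[R]_m | `|x| <= M].
  exact: closed_norm_le.
have cM : compact ([set x : 'rV[R]_n | `|x| <= M] `*` [set x : 'rV[R]_m | `|x| <= M]).
  by apply: compact_setX; exact: compact_rV_ball.
apply: (subclosed_compact _ cM); first exact: closed_closure.
apply: subset_trans (supp_subset_closed cA fM) _ => -[x y].
by rewrite /= prod_normE ge_max => /andP.
Qed.

Lemma is_diff_scale (V : normedModType R) (c : R) (x : V) : is_diff x (fun x => c *: x) (fun x => c *: x).
Proof. exact: is_diff_scaler. Qed.

Lemma smooth_coord_affine n (i : 'I_n) (f : R -> R) a b : smooth f ->
  smooth (fun x : 'rV[R]_n => f (a * x ord0 i + b)).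
Proof.
move=> sf; apply: (smooth_comp (f := fun t => f (a * t + b)) (is_diff_coord i)).
exact: (smooth_comp (is_diff_affine1 a b)).
Qed.

(** A product over the coordinates and not a function of the norm, because the norm at hand is the
    sup norm, which is not differentiable. *)
Definition cutoff n (j : nat) (v : 'rV[R]_n) : R :=
  \prod_(i < n) plateau (j.+1%:R^-1 * v ord0 i + 0).

Lemma smooth_cutoff n j : smooth (@cutoff n j).
Proof. by apply: smooth_prod => i; exact: smooth_coord_affine smooth_plateau. Qed.

Lemma cutoff_ge0 n j v : 0 <= @cutoff n j v.
Proof. by apply: prodr_ge0 => i _; exact: plateau_ge0. Qed.

Lemma cutoff_le1 n j v : @cutoff n j v <= 1.
Proof.
suff /andP[] : 0 <= @cutoff n j v <= 1 by [].
rewrite /cutoff; elim/big_ind: _ => [|x y /andP[x0 x1] /andP[y0 y1]|i _].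
- by rewrite ler01 lexx.
- by rewrite mulr_ge0// mulr_ile1.
- by rewrite plateau_ge0 plateau_le1.
Qed.

Lemma cutoff1 n j v : `|v| <= j.+1%:R -> @cutoff n j v = 1.
Proof.
move=> vj; apply: big1 => i _; apply: plateau1.
rewrite addr0 normrM ger0_norm ?invr_ge0// ler_pdivrMl// mulr1.
exact: le_trans (rV_norm_coord _ _) vj.
Qed.

Lemma cutoff_supp n j v : @cutoff n j v != 0 -> `|v| <= 2 * j.+1%:R.
Proof.
move=> vj; apply: rV_norm_le => [|i]; first by rewrite mulr_ge0.
rewrite leNgt; apply/negP => h; move/eqP: vj; apply.
rewrite /cutoff (bigD1 i)//= plateau0 ?mul0r//.
by rewrite addr0 normrM ger0_norm ?invr_ge0// ler_pdivlMl// mulrC ltW.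
Qed.

Lemma test_cutoff n j : test_fun setT (@cutoff n j).
Proof.
by apply: (test_fun_rV (M := 2 * j.+1%:R)); [exact: smooth_cutoff|exact: cutoff_supp].
Qed.

Lemma cutoff_scale n j v : @cutoff n j v = @cutoff n 0 (j.+1%:R^-1 *: v).
Proof. by rewrite /cutoff; apply: eq_bigr => i _; rewrite mxE invr1 mul1r. Qed.

(** All cutoffs are rescalings of the one of index 0 by a factor at most 1, so one bound serves
    every [j]. *)
Lemma cutoff_derive_bounded n : exists2 C, 0 <= C &
  forall j v i, `|'D_(delta_mx ord0 i) (@cutoff n j) v| <= C.
Proof.
have /choice[C hC] : forall i : 'I_n, exists C, 0 <= C /\
    forall v, `|'D_(delta_mx ord0 i) (@cutoff n 0) v| <= C.
  move=> i; have [C C0 hC] := test_bounded (test_funD (delta_mx ord0 i) (@test_cutoff n 0)).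
  by exists C.
exists (\sum_i C i) => [|j v i]; first by apply: sumr_ge0 => i _; case: (hC i).
rewrite (_ : @cutoff n j = fun v => @cutoff n 0 (j.+1%:R^-1 *: v)); last by apply/funext => w; exact: cutoff_scale.
rewrite (derive_comp_affine _ (is_diff_scale _ _)); last exact: (smooth_differentiable _ (@smooth_cutoff n 0)).
rewrite deriveE; last exact: (smooth_differentiable _ (@smooth_cutoff n 0)).
rewrite linearZ/= normrM -deriveE; last exact: (smooth_differentiable _ (@smooth_cutoff n 0)).
apply: (@le_trans _ _ (1 * C i)).
  rewrite ler_pM//; last by have [_] := hC i; exact.
  by rewrite ger0_norm ?invr_ge0// invf_le1// ler1n.
rewrite mul1r (bigD1 i)//= lerDl; apply: sumr_ge0 => k _; by case: (hC k).
Qed.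

(** The support is the cube with edges from 0 to 1/(k+1), on one side of the origin: averaging
    against it reads a function only on the translate of the positive orthant to the given point. *)
Definition bumps n (k : nat) (y : 'rV[R]_n) : R :=
  \prod_(i < n) bump (k.+1%:R * y ord0 i + 0).

Lemma smooth_bumps n k : smooth (@bumps n k).
Proof. by apply: smooth_prod => i; exact: smooth_coord_affine smooth_bump. Qed.

Lemma bumps_ge0 n k y : 0 <= @bumps n k y.
Proof. by apply: prodr_ge0 => i _; exact: bump_ge0. Qed.

Lemma bumps_supp n k y : @bumps n k y != 0 <-> forall i, 0 < y ord0 i < k.+1%:R^-1.
Proof.
split => [h i|h].
  have : bump (k.+1%:R * y ord0 i + 0) != 0.
    apply: contra h => /eqP h; rewrite /bumps (bigD1 i)//= h mul0r//.
  rewrite addr0; apply: contraNT => h'; apply/eqP/bump_eq0; apply: contra h'.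
  by rewrite pmulr_rgt0// -ltr_pdivlMl// mulr1.
rewrite gt_eqF//; apply: prodr_gt0 => i _; apply: bump_gt0.
by rewrite addr0 pmulr_rgt0// -ltr_pdivlMl// mulr1.
Qed.

Lemma bumps_norm n k y : @bumps n k y != 0 -> `|y| <= k.+1%:R^-1.
Proof.
move=> /bumps_supp h; apply: rV_norm_le => [|i]; first by rewrite invr_ge0.
by have /andP[h0 h1] := h i; rewrite ger0_norm ltW.
Qed.

Lemma test_bumps n k : test_fun setT (@bumps n k).
Proof.
by apply: (test_fun_rV (M := k.+1%:R^-1)); [exact: smooth_bumps|exact: bumps_norm].
Qed.

Lemma measurable_test n U (f : 'rV[R]_n -> R) : test_fun U f -> measurable_fun setT f.
Proof. by case=> sf _ _; apply: continuous_measurable_rV; exact: smooth_continuous. Qed.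

Lemma test_cube n U (f : 'rV[R]_n -> R) : test_fun U f ->
  exists2 M, 0 <= M & forall x, ~ cube n M x -> f x = 0.
Proof.
move=> tf; have [M M0 hM] := test_bounded_supp tf; exists M => // x h.
apply/eqP/negPn/negP => /hM xM; apply: h => i.
exact: le_trans (rV_norm_coord x i) xM.
Qed.

Lemma integrable_bounded_cube n (f : 'rV[R]_n -> R) C M :
  measurable_fun setT f -> (forall x, `|f x| <= C) -> (forall x, ~ cube n M x -> f x = 0) ->
  (lebesgue_rV R n).-integrable setT (EFin \o f).
Proof.
move=> mf fC fM.
have : (lebesgue_rV R n).-integrable (cube n M) (EFin \o f).
  apply: measurable_bounded_integrable => //.
  - exact: measurable_cube.
  - exact: lebesgue_cube_lty.
  - exact: measurable_funTS.
  - exists C; split; first exact: num_real.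
    by move=> N CN x _ /=; rewrite (le_trans (fC x))// ltW.
move/(integrable_mkcond _ (@measurable_cube R n M)); apply: eq_integrable => // x _.
rewrite patchE; case: ifPn => // /negP h.
by rewrite /= fM// => /mem_set.
Qed.

Lemma integrable_test n U (f : 'rV[R]_n -> R) : test_fun U f ->
  (lebesgue_rV R n).-integrable setT (EFin \o f).
Proof.
move=> tf; have [C _ fC] := test_bounded tf; have [M _ fM] := test_cube tf.
exact: (integrable_bounded_cube (measurable_test tf) fC fM).
Qed.

Lemma measurable_rV_cube n (C : set R) : measurable C ->
  measurable [set y : 'rV[R]_n | forall i, C (y ord0 i)].
Proof.
move=> mC; rewrite (_ : mkset _ = \bigcap_i ((fun x : 'rV[R]_n => x ord0 i) @^-1` C)).
  apply: fin_bigcap_measurable => // i _.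
  rewrite -[X in measurable X]setTI; exact: measurable_coord.
by apply/seteqP; split=> [x Cx i _|x Cx i]; [exact: Cx|exact: (Cx i)].
Qed.

(** A nonnegative function with zero integral vanishes almost everywhere, but this one is positive
    on an open cube of edge 1/(k+1), whose measure is not zero. *)
Lemma bumps_int_gt0 n k : 0 < \int[lebesgue_rV R n]_y (@bumps n k y).
Proof.
have h0 : 0 <= \int[lebesgue_rV R n]_y (@bumps n k y) by apply: Rintegral_ge0 => y _; exact: bumps_ge0.
rewrite lt_neqAle h0 andbT eq_sym; apply/eqP => h.
have ib := integrable_test (@test_bumps n k).
have h1 : (\int[lebesgue_rV R n]_y `|(@bumps n k y)%:E| = 0)%E.
  under eq_integral do rewrite gee0_abs ?lee_fin ?bumps_ge0//.
  by rewrite -[LHS]fineK ?integrable_fin_num// [X in X%:E]h.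
pose C : set R := `]0, k.+1%:R^-1[%classic.
have mC : measurable C by exact: measurable_itv.
have : (lebesgue_rV R n).-negligible [set y : 'rV[R]_n | forall i, C (y ord0 i)].
  have /ae_eq_integral_abs : measurable_fun setT (EFin \o @bumps n k).
    by apply/measurable_EFinP; exact: measurable_test (@test_bumps n k).
  move=> /(_ (lebesgue_rV R n) measurableT) [/(_ h1) + _].
  apply: negligibleS => y /= hy /(_ I) [] /eqP; apply/negP.
  by apply/bumps_supp => i; have := hy i; rewrite /C/= in_itv.
have mD : measurable [set y : 'rV[R]_n | forall i, C (y ord0 i)] by exact: measurable_rV_cube.
move/(negligibleP (lebesgue_rV R n) mD) => e.
have /esym/eqP := lebesgue_rV_cube n mC; rewrite [X in _ == X]e lebesgue_measure_itv/= lte_fin invr_gt0 ltr0Sn.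
by rewrite oppr0 adde0 -EFin_expe eqe expf_eq0 invr_eq0 pnatr_eq0 andbF.
Qed.

Definition mollifier n k (y : 'rV[R]_n) : R :=
  (\int[lebesgue_rV R n]_y (@bumps n k y))^-1 * @bumps n k y.

Lemma smooth_mollifier n k : smooth (@mollifier n k).
Proof. by apply: smoothM; [exact: smooth_cst|exact: smooth_bumps]. Qed.

Lemma mollifier_ge0 n k y : 0 <= @mollifier n k y.
Proof. by rewrite mulr_ge0 ?bumps_ge0// invr_ge0 ltW// bumps_int_gt0. Qed.

Lemma mollifier_supp n k y : @mollifier n k y != 0 -> forall i, 0 < y ord0 i < k.+1%:R^-1.
Proof. by rewrite mulf_eq0 negb_or => /andP[_ /bumps_supp]. Qed.

Lemma test_mollifier n k : test_fun setT (@mollifier n k).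
Proof.
apply: (test_fun_supp (@test_bumps n k)); first exact: smooth_mollifier.
by move=> x /supp_eq0 e; rewrite /mollifier e mulr0.
Qed.

Lemma integral_mollifier n k : (\int[lebesgue_rV R n]_y (@mollifier n k y)%:E = 1)%E.
Proof.
have ib := integrable_test (@test_bumps n k).
under eq_integral do rewrite EFinM.
rewrite integralZl//= -[X in (_ * X)%E]fineK ?integrable_fin_num// -EFinM.
by rewrite mulVf// gt_eqF// bumps_int_gt0.
Qed.

(** A quadratic remainder identifies the differential. The remainder bound of [test_taylor] has this
    form and survives integration, so it yields differentiation under the integral sign. *)
Lemma is_diff_candidate (V : normedModType R) (f : V -> R) (L : V -> R) x K :
  linear L -> continuous L ->
  (forall h, `|f (h + x) - f x - L h| <= K * `|h| ^+ 2) ->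
  is_diff x f L.
Proof.
move=> lL cL hL.
pose m := GRing.isLinear.Build R V R _ L lL.
pose g : {linear V -> R} := HB.pack L m.
have cg : continuous g by [].
have e : f \o shift x = cst (f x) + g +o_ (0 : V) id.
  apply/eqaddoP => _/posnumP[eps].
  have K0 : 0 < `|K| + 1 by rewrite ltr_wpDl.
  near=> h; rewrite -[X in `|X|]/(f (h + x) - (f x + L h)) opprD addrA.
  apply: le_trans (hL h) _; rewrite expr2 mulrA ler_wpM2r//.
  apply: (@le_trans _ _ ((`|K| + 1) * `|h|)).
    by rewrite ler_wpM2r// (le_trans (ler_norm K))// lerDl.
  rewrite -ler_pdivlMl// mulrC; near: h; apply: nbhs0_le; exact: divr_gt0.
have dg := diff_unique cg e.
by apply: DiffDef; [apply/diff_locallyP; rewrite dg|exact: dg].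
Unshelve. all: by end_near. Qed.

Lemma is_derive_line (V : normedModType R) (f : V -> R) (x v : V) (s d : R) :
  is_derive (x + s *: v) v f d -> is_derive s (1 : R) (fun s => f (x + s *: v)) d.
Proof.
have e : (fun h : R => h^-1 *: (((fun s => f (x + s *: v)) \o shift s) (h *: (1 : R)) - f (x + s *: v)))
    = (fun h : R => h^-1 *: ((f \o shift (x + s *: v)) (h *: v) - f (x + s *: v))).
  apply/funext => h /=; congr (_ *: (f _ - _)).
  have -> : h *: (1 : R) = h by rewrite -[LHS]/(h * 1) mulr1.
  by rewrite scalerDl addrCA.
case=> dfl <-; split; first by rewrite /derivable e.
by rewrite /derive e.
Qed.

Lemma derive_line_MVT_scale (V : normedModType R) (f g : V -> R) (v x : V) t : 0 <= t ->
  (forall x, is_derive x v f (g x)) ->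
  exists2 c, 0 <= c <= t & f (x + t *: v) - f x = g (x + c *: v) * t.
Proof.
move=> t0 dg.
have d s : is_derive s (1 : R) (fun s => f (x + s *: v)) (g (x + s *: v)).
  by apply: is_derive_line; exact: dg.
have cs : {within `[0, t], continuous (fun s => f (x + s *: v))}.
  apply: continuous_subspaceT => s; apply: differentiable_continuous; apply/derivable1_diffP.
  by have [] := d s.
have [c c01] := @MVT_segment R (fun s => f (x + s *: v)) (fun s => g (x + s *: v)) 0 t t0
  (fun s _ => d s) cs.
by rewrite scale0r addr0 subr0 => ->; exists c => //; rewrite in_itv/= in c01.
Qed.

Lemma derive_line_MVT (V : normedModType R) (f g : V -> R) (v x : V) :
  (forall x, is_derive x v f (g x)) ->
  exists2 c, 0 <= c <= 1 & f (x + v) - f x = g (x + c *: v).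
Proof.
move=> dg; have [c c01] := derive_line_MVT_scale x ler01 dg.
by rewrite scale1r mulr1 => e; exists c.
Qed.

Lemma derive_lipschitz (V : normedModType R) (f g : V -> R) (v x : V) C :
  (forall x, is_derive x v f (g x)) -> (forall x, `|g x| <= C) ->
  `|f (x + v) - f x| <= C.
Proof. by move=> dg gC; have [c _ ->] := derive_line_MVT x dg. Qed.

Lemma deriveE_coord n (f : 'rV[R]_n -> R) x v : differentiable f x ->
  'D_v f x = \sum_i v ord0 i * 'D_(delta_mx ord0 i) f x.
Proof.
move=> df; rewrite deriveE// {1}(row_sum_delta v) linear_sum/=.
by apply: eq_bigr => i _; rewrite linearZ/= -deriveE.
Qed.

Lemma deriveE_coordl n (W : normedModType R) (f : 'rV[R]_n * W -> R) x v : differentiable f x ->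
  'D_(v, 0) f x = \sum_i v ord0 i * 'D_(delta_mx ord0 i, 0) f x.
Proof.
move=> df; rewrite deriveE//.
have -> : (v, (0 : W)) = \sum_i v ord0 i *: (delta_mx ord0 i : 'rV[R]_n, (0 : W)).
  rewrite {1}(row_sum_delta v); elim/big_rec2: _ => // i y1 y2 _ <-.
  by congr pair; rewrite /= scaler0 addr0.
rewrite linear_sum/=.
by apply: eq_bigr => i _; rewrite linearZ/= -deriveE.
Qed.

Lemma test_lipschitz n U (f : 'rV[R]_n -> R) : test_fun U f ->
  exists2 C, 0 <= C & forall x h, `|f (x + h) - f x| <= C * `|h|.
Proof.
move=> tf; have sf := test_fun_smooth tf.
have /choice[C hC] : forall i : 'I_n, exists C, 0 <= C /\
    forall v, `|'D_(delta_mx ord0 i) f v| <= C.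
  by move=> i; have [C C0 hC] := test_bounded (test_funD (delta_mx ord0 i) tf); exists C.
exists (\sum_i C i) => [|x h]; first by apply: sumr_ge0 => i _; case: (hC i).
have dh x' : is_derive x' h f ('D_h f x') by apply: derivableP; exact: smooth_derivable.
apply: (derive_lipschitz x dh) => y.
rewrite deriveE_coord; last exact: smooth_differentiable.
rewrite mulr_suml; apply: le_trans (ler_norm_sum _ _ _) _; apply: ler_sum => i _.
by rewrite normrM mulrC ler_pM//; [have [_] := hC i; exact|exact: rV_norm_coord].
Qed.

Lemma test_lipschitzl n (W : normedModType R) U (f : 'rV[R]_n * W -> R) : test_fun U f ->
  exists2 C, 0 <= C & forall x v h, `|f (x + h, v) - f (x, v)| <= C * `|h|.
Proof.
move=> tf; have sf := test_fun_smooth tf.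
have /choice[C hC] : forall i : 'I_n, exists C, 0 <= C /\
    forall v, `|'D_(delta_mx ord0 i, 0) f v| <= C.
  by move=> i; have [C C0 hC] := test_bounded (test_funD (delta_mx ord0 i, 0) tf); exists C.
exists (\sum_i C i) => [|x v h]; first by apply: sumr_ge0 => i _; case: (hC i).
have dh x' : is_derive x' (h, 0) f ('D_(h, 0) f x') by apply: derivableP; exact: smooth_derivable.
have -> : (x + h, v) = (x, v) + (h, 0) by congr pair; rewrite /= addr0.
apply: (derive_lipschitz (x, v) dh) => y.
rewrite deriveE_coordl; last exact: smooth_differentiable.
rewrite mulr_suml; apply: le_trans (ler_norm_sum _ _ _) _; apply: ler_sum => i _.
by rewrite normrM mulrC ler_pM//; [have [_] := hC i; exact|exact: rV_norm_coord].
Qed.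

(** The mean value theorem moves the derivative to an intermediate point, and the partial
    derivatives, being test functions, are Lipschitz. *)
Lemma test_taylor n U (f : 'rV[R]_n -> R) : test_fun U f ->
  exists2 C, 0 <= C & forall x h, `|f (x + h) - f x - 'D_h f x| <= C * `|h| ^+ 2.
Proof.
move=> tf; have sf := test_fun_smooth tf.
have /choice[C hC] : forall i : 'I_n, exists C, 0 <= C /\
    forall x h, `|'D_(delta_mx ord0 i) f (x + h) - 'D_(delta_mx ord0 i) f x| <= C * `|h|.
  by move=> i; have [C C0 hC] := test_lipschitz (test_funD (delta_mx ord0 i) tf); exists C.
exists (\sum_i C i) => [|x h]; first by apply: sumr_ge0 => i _; case: (hC i).
have dh x' : is_derive x' h f ('D_h f x') by apply: derivableP; exact: smooth_derivable.
have [c /andP[c0 c1] ->] := derive_line_MVT x dh.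
rewrite !deriveE_coord; try exact: smooth_differentiable.
rewrite -sumrB mulr_suml; apply: le_trans (ler_norm_sum _ _ _) _; apply: ler_sum => i _.
rewrite -mulrBr normrM expr2 mulrCA ler_pM//; first exact: rV_norm_coord.
have [C0 h2] := hC i; apply: le_trans (h2 _ _) _.
by rewrite ler_wpM2l// normrZ ger0_norm// ler_piMl.
Qed.

Lemma integral_translate n (h : 'rV[R]_n) (f : 'rV[R]_n -> \bar R) :
  measurable_fun setT f ->
  (\int[lebesgue_rV R n]_x f (x + h)%R = \int[lebesgue_rV R n]_x f x)%E.
Proof.
move=> mf; rewrite integralE [RHS]integralE; congr (_ - _)%E.
  transitivity (\int[lebesgue_rV R n]_x f^\+%E (x + h)%R)%E.
    by apply: eq_integral => x _; rewrite !funeposE.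
  by rewrite ge0_integral_translate//; exact: measurable_funepos.
transitivity (\int[lebesgue_rV R n]_x f^\-%E (x + h)%R)%E.
  by apply: eq_integral => x _; rewrite !funenegE.
by rewrite ge0_integral_translate//; exact: measurable_funeneg.
Qed.

Lemma Rintegral_translate n (h : 'rV[R]_n) (f : 'rV[R]_n -> R) :
  measurable_fun setT f ->
  \int[lebesgue_rV R n]_x f (x + h) = \int[lebesgue_rV R n]_x f x.
Proof.
move=> mf; rewrite /Rintegral; congr fine.
by rewrite (integral_translate h (f := EFin \o f))//; exact/measurable_EFinP.
Qed.

(* Translation invariance of the integral, differentiated. *)
Lemma integral_derive_eq0 n (f g : 'rV[R]_n -> R) (v : 'rV[R]_n) C B M :
  measurable_fun setT f -> (forall x, `|f x| <= B) ->
  (forall x, is_derive x v f (g x)) -> (forall x, `|g x| <= C) ->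
  (forall x, ~ cube n M x -> f x = 0) ->
  [/\ (lebesgue_rV R n).-integrable setT (EFin \o g) &
  \int[lebesgue_rV R n]_x g x = 0].
Proof.
move=> mf fB dg gC fM.
have C0 : 0 <= C by exact: le_trans (gC 0).
pose t k : R := k.+1%:R^-1.
have t0 k : 0 < t k by rewrite invr_gt0.
have t1 k : t k <= 1 by rewrite invf_le1// ler1n.
(* Difference quotients along [v]: bounded by [C] through the mean value theorem, supported in the
   cube enlarged by |v| since the steps are at most 1, and of zero integral by translation
   invariance. Dominated convergence passes to [g]. *)
pose q k x := (t k)^-1 * (f (x + t k *: v) - f x).
have mfh k : measurable_fun setT (fun x : 'rV[R]_n => f (x + t k *: v)).
  by apply: measurableT_comp => //; exact: measurable_rVD.
have mq k : measurable_fun setT (q k).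
  by apply: measurable_funM => //; exact: measurable_funB.
have qg x : q k x @[k --> \oo] --> g x.
  have [dfx <-] := dg x.
  have tc : t k @[k --> \oo] --> 0^'.
    move=> A hA; have : \forall k \near \oo, t k != 0 -> A (t k) by exact: (@cvg_harmonic R _ hA).
    by apply: filterS => k; apply; rewrite gt_eqF.
  have := cvg_comp _ _ tc dfx; apply: cvg_trans; apply: near_eq_cvg.
  near=> k; rewrite /q /=; congr (_ * (f _ - _)); first by rewrite addrC.
have qC k x : `|q k x| <= C.
  have [c _ e] := derive_line_MVT_scale x (ltW (t0 k)) dg.
  by rewrite /q e mulrCA mulVf ?mulr1// gt_eqF.
pose M' := M + `|v|.
have qM k x : ~ cube n M' x -> q k x = 0.
  move=> h; rewrite /q !fM ?subr0 ?mulr0// => h'; apply: h => i.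
    by rewrite (le_trans (h' i))// lerDl.
  have := h' i; rewrite !mxE => h2.
  rewrite -(addrK (t k * v ord0 i) (x ord0 i)); apply: le_trans (ler_normB _ _) _.
  rewrite lerD// normrM ger0_norm ?(ltW (t0 k))// -[leRHS]mul1r ler_pM//; first exact: ltW.
  exact: rV_norm_coord.
have gM x : ~ cube n M' x -> g x = 0.
  move=> h; have h2 : (fun k => q k x) = cst 0 by apply/funext => k; exact: qM.
  have := qg x; rewrite h2 => /cvg_lim <-//.
  exact: lim_cst.
have mg : measurable_fun setT g by apply: (measurable_fun_cvg mq) => x _; exact: qg.
have ig := integrable_bounded_cube mg gC gM.
split=> //.
have iC : (lebesgue_rV R n).-integrable setT (fun x => (C * \1_(cube n M') x)%:E).
  apply: (@integrable_bounded_cube _ _ C M'); last first.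
  - by move=> x h; rewrite indicE memNset// mulr0.
  - move=> x; rewrite indicE normrM ger0_norm// normr_nat.
    by case: (x \in _); rewrite ?mulr1 ?mulr0.
  - by apply: measurable_funM => //; apply: measurable_indic; exact: measurable_cube.
have [|||||_ _ cv] := @dominated_convergence _ _ R (lebesgue_rV R n) setT measurableT
   (fun k x => (q k x)%:E) (EFin \o g) (fun x => (C * \1_(cube n M') x)%:E).
- by move=> k; apply/measurable_EFinP.
- exact/measurable_EFinP.
- by apply: aeW => x _; apply: cvg_EFin; [exact: nearW|exact: qg].
- exact: iC.
- apply: aeW => x k _; rewrite abse_EFin lee_fin indicE.
  have [h|h] := pselect (cube n M' x); first by rewrite mem_set// mulr1.
  by rewrite qM// normr0 memNset// mulr0.
have e k : (\int[lebesgue_rV R n]_x (q k x)%:E = 0)%E.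
  have i1 := integrable_bounded_cube mf fB fM.
  have fM2 x : ~ cube n M' x -> f (x + t k *: v) = 0.
    move=> h; apply: fM => h'; apply: h => i.
    have := h' i; rewrite !mxE => h2.
    rewrite -(addrK (t k * v ord0 i) (x ord0 i)); apply: le_trans (ler_normB _ _) _.
    rewrite lerD// normrM ger0_norm ?(ltW (t0 k))// -[leRHS]mul1r ler_pM//; first exact: ltW.
    exact: rV_norm_coord.
  have i2 := integrable_bounded_cube (mfh k) (fun x => fB _) fM2.
  under eq_integral do rewrite /q EFinM EFinB.
  rewrite integralZl//; last exact: integrableB.
  rewrite integralB// (integral_translate _ (f := EFin \o f)); last exact/measurable_EFinP.
  by rewrite subee ?mule0// integrable_fin_num.
have /cvg_unique h : (\int[lebesgue_rV R n]_x (q k x)%:E)%E @[k --> \oo] --> (0 : \bar R)%E.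
  by under eq_fun do rewrite e; exact: cvg_cst.
rewrite /Rintegral (_ : (\int[_]_x _)%E = 0%E)//.
apply/esym; apply: h => //.
Unshelve. all: by end_near. Qed.

End test_functions_theory.

(** * Mollification by a one-sided kernel *)

Section integrable_bounded.
Context d (T : measurableType d) (R : realType) (m : {measure set T -> \bar R}).

Lemma integrableM_bounded D (h g : T -> R) C : measurable D -> measurable_fun D h ->
  (forall x, D x -> `|h x| <= C) -> m.-integrable D (EFin \o g) ->
  m.-integrable D (EFin \o (fun x => h x * g x)).
Proof.
move=> mD mh hC ig; have := integrableMr mD mh _ ig; apply.
exists C; split; first exact: num_real.
by move=> N CN x Dx /=; rewrite (le_trans (hC x Dx))// ltW.
Qed.

Lemma integrable_cst_on D (c : R) : measurable D -> (m D < +oo)%E ->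
  m.-integrable D (EFin \o cst c).
Proof.
move=> mD Doo; apply: measurable_bounded_integrable => //.
by exists `|c|; split; [exact: num_real|move=> N cN x _ /=; exact: ltW].
Qed.

Lemma intD D (f g : T -> R) : measurable D -> m.-integrable D (EFin \o f) -> m.-integrable D (EFin \o g) ->
  m.-integrable D (EFin \o (fun x => f x + g x)).
Proof. by move=> mD h1 h2; exact: (integrableD mD h1 h2). Qed.

Lemma intB D (f g : T -> R) : measurable D -> m.-integrable D (EFin \o f) -> m.-integrable D (EFin \o g) ->
  m.-integrable D (EFin \o (fun x => f x - g x)).
Proof. by move=> mD h1 h2; exact: (integrableB mD h1 h2). Qed.

Lemma intZ D (f : T -> R) c : measurable D -> m.-integrable D (EFin \o f) ->
  m.-integrable D (EFin \o (fun x => c * f x)).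
Proof. by move=> mD h1; exact: (integrableZl mD c h1). Qed.

Lemma Rintegral_lincomb D I (s : seq I) (c : I -> R) (f : I -> T -> R) : measurable D ->
  (forall i, m.-integrable D (EFin \o f i)) ->
  m.-integrable D (EFin \o (fun x => \sum_(i <- s) c i * f i x)) /\
  \int[m]_(x in D) (\sum_(i <- s) c i * f i x) = \sum_(i <- s) c i * \int[m]_(x in D) f i x.
Proof.
move=> mD fi; elim: s => [|i s [IH1 IH2]].
  under eq_fun do rewrite big_nil; split; first exact: integrable0.
  by rewrite big_nil Rintegral_cst// mul0r.
under eq_fun do rewrite big_cons; split; first by apply: intD => //; exact: intZ.
by rewrite RintegralD//; [rewrite RintegralZl// IH2 big_cons|exact: intZ].
Qed.

End integrable_bounded.

Section convolution.
Context {R : realType} {n : nat}.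
Local Notation leb := (lebesgue_rV R n).
Implicit Types (f g : 'rV[R]_n -> R).

(** A correlation: the kernel is evaluated at y - x, so derivatives in x fall on [f] with a minus
    sign, and a kernel supported in the positive orthant only sees [g] on x plus that orthant. *)
Definition mconv f g (x : 'rV[R]_n) : R := \int[leb]_y (f (y - x) * g y).

Definition moll k g (x : 'rV[R]_n) : R := \int[leb]_y (@mollifier R n k y * g (x + y)).

Lemma mollE k g : measurable_fun setT g -> moll k g = mconv (@mollifier R n k) g.
Proof.
move=> mg; apply/funext => x; rewrite /mconv /moll.
rewrite -(Rintegral_translate x (f := fun y => mollifier k (y - x) * g y)).
  by apply: eq_Rintegral => y _; rewrite addrK addrC.
apply: measurable_funM => //.
by apply: measurableT_comp; [exact: measurable_test (test_mollifier n k)|exact: measurable_rVD].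
Qed.

Section fixed.
Variable (g : 'rV[R]_n -> R).
Hypothesis ig : leb.-integrable setT (EFin \o g).

Lemma integrable_conv U f x : test_fun U f ->
  leb.-integrable setT (EFin \o (fun y => f (y - x) * g y)).
Proof.
move=> tf; have [C _ fC] := test_bounded tf.
apply: (integrableM_bounded (C := C)) => //.
by apply: measurableT_comp; [exact: measurable_test tf|exact: measurable_rVD].
Qed.

(** The Taylor remainder of the kernel is C |h|^2 uniformly in the integration variable; integrating
    it against |g| keeps it quadratic, so integrability of [g] suffices. *)
Lemma is_diff_conv U f x : test_fun U f ->
  is_diff x (mconv f g) (fun h => \sum_i h ord0 i * - mconv ('D_(delta_mx ord0 i) f) g x).
Proof.
move=> tf; have [C C0 hC] := test_taylor tf.
apply: (@is_diff_candidate _ _ _ _ _ (C * \int[leb]_y `|g y|)).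
- move=> a u v; rewrite scaler_sumr -big_split/=; apply: eq_bigr => i _.
  by rewrite !mxE /GRing.scale/= mulrDl mulrA.
- apply: smooth_continuous; apply: smooth_sum => i.
  by apply: smoothM; [exact: smooth_coord|exact: smooth_cst].
pose G := \int[leb]_y `|g y|.
have G0 : 0 <= G by apply: Rintegral_ge0.
move=> h; rewrite -/G.
  have iD i : leb.-integrable setT (EFin \o (fun y => 'D_(delta_mx ord0 i) f (y - x) * g y)).
    exact: integrable_conv (test_funD _ tf).
  have -> : \sum_i h ord0 i * - mconv ('D_(delta_mx ord0 i) f) g x =
      - \int[leb]_y ('D_h f (y - x) * g y).
    under [in RHS]eq_Rintegral => y _.
      rewrite deriveE_coord; last exact: smooth_differentiable (test_fun_smooth tf).
      rewrite mulr_suml.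
      under eq_bigr do rewrite -mulrA.
      over.
    have [_ ->] := @Rintegral_lincomb _ _ _ leb setT _ (index_enum 'I_n) (fun i => h ord0 i) _ measurableT iD.
    by rewrite -sumrN; apply: eq_bigr => i _; rewrite mulrN.
  have i1 := integrable_conv (h + x) tf.
  have i2 := integrable_conv x tf.
  have i3 := integrable_conv x (test_funD h tf).
  rewrite opprK /mconv -RintegralB// -RintegralD//; last exact: intB.
  apply: le_trans (le_normr_Rintegral _ _) _ => //.
    by apply: intD => //; exact: intB.
  rewrite /G mulrAC -RintegralZl//; last exact: integrable_norm.
  apply: le_Rintegral => //.
  - apply: integrable_norm.
    by apply: intD => //; exact: intB.
  - by apply: intZ => //; exact: integrable_norm.
  move=> y _; rewrite -!mulrBl -mulrDl normrM ler_wpM2r//.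
  have := hC (y - x) (- h).
  rewrite normrN deriveE; last exact: smooth_differentiable (test_fun_smooth tf).
  rewrite linearN/= opprK -deriveE; last exact: smooth_differentiable (test_fun_smooth tf).
  by rewrite opprD addrA addrAC.
Qed.

Lemma derive_conv U f x v : test_fun U f -> 'D_v (mconv f g) x = - mconv ('D_v f) g x.
Proof.
move=> tf; have [d1 e1] := is_diffP (is_diff_conv x tf).
have e i : mconv ('D_(delta_mx ord0 i) f) g x = \int[leb]_y ('D_(delta_mx ord0 i) f (y - x) * g y) by [].
rewrite deriveE// e1.
under eq_bigr do rewrite mulrN; rewrite sumrN; congr (- _).
rewrite [RHS]/mconv; under [in RHS]eq_Rintegral => y _.
  rewrite deriveE_coord; last exact: smooth_differentiable (test_fun_smooth tf).
  rewrite mulr_suml.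
  under eq_bigr do rewrite -mulrA.
  over.
have iD i : leb.-integrable setT (EFin \o (fun y => 'D_(delta_mx ord0 i) f (y - x) * g y)).
  exact: integrable_conv (test_funD _ tf).
have [_ ->//] := @Rintegral_lincomb _ _ _ leb setT _ (index_enum 'I_n) (fun i => v ord0 i) _ measurableT iD.
Qed.

Lemma smooth_conv U f : test_fun U f -> smooth (mconv f g).
Proof.
move=> tf k; elim: k f tf => [|k IH] f tf.
  by move=> x; apply: differentiable_continuous; have [] := is_diffP (is_diff_conv x tf).
apply/CkSP; split=> [x|v]; first by have [] := is_diffP (is_diff_conv x tf).
rewrite (_ : 'D_v _ = fun x => (-1) * mconv ('D_v f) g x).
  by apply: CkM; [exact: Ck_cst|apply: IH; exact: test_funD].
by apply/funext => x; rewrite (derive_conv _ _ tf) mulN1r.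
Qed.

End fixed.

Lemma test_moll k g M : leb.-integrable setT (EFin \o g) -> 0 <= M ->
  (forall x, ~ cube n M x -> g x = 0) -> test_fun setT (moll k g).
Proof.
move=> ig M0 gM.
have mg : measurable_fun setT g by apply/measurable_EFinP; exact: measurable_int ig.
apply: (test_fun_rV (M := M + 1)).
  by rewrite mollE//; exact: smooth_conv (test_mollifier n k).
move=> x; apply: contraNT; rewrite -ltNge => xM; apply/eqP.
rewrite /moll (_ : (fun y => _) = cst 0) ?Rintegral_cst ?mul0r//.
apply/funext => y /=; have [->|ry] := eqVneq (@mollifier R n k y) 0; first by rewrite mul0r.
rewrite gM ?mulr0// => h.
move: xM; apply/negP; rewrite -leNgt; apply: rV_norm_le => [|i]; first by rewrite addr_ge0.
have := h i; rewrite mxE => h1; have /andP[y0 y1] := mollifier_supp ry i.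
rewrite -(addrK (y ord0 i) (x ord0 i)) (le_trans (ler_normB _ _))// lerD//.
by rewrite ger0_norm ?(ltW y0)// (le_trans (ltW y1))// invf_le1// ler1n.
Qed.

End convolution.

(** * Mollified indicators converge in L^1 on cubes *)

Section indicator.
Context {R : realType} {n : nat}.
Local Notation leb := (lebesgue_rV R n).

(** Lower orthants form a pi-system generating the sigma-algebra, and convergence can be checked on
    them by hand; a Dynkin class argument then reaches all measurable sets. *)
Definition orthant (c : 'I_n -> R) := [set x : 'rV[R]_n | forall i, x ord0 i < c i].

Lemma orthantI : setI_closed (range orthant).
Proof.
move=> _ _ [c _ <-] [c' _ <-]; exists (fun i => Num.min (c i) (c' i)) => //.
apply/seteqP; split=> [x h|x [h h'] i]; last by rewrite lt_min h h'.
by split=> i; have := h i; rewrite lt_min => /andP[].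
Qed.

Lemma measurable_orthant c : measurable (orthant c).
Proof.
rewrite (_ : orthant c = \bigcap_i ((fun x : 'rV[R]_n => x ord0 i) @^-1` `]-oo, c i[)).
  apply: fin_bigcap_measurable => // i _.
  by rewrite -[X in measurable X]setTI; apply: measurable_coord => //; exact: measurable_itv.
apply/seteqP; split=> [x Cx i _|x Cx i]; first by rewrite /= in_itv/=; exact: Cx.
by have := Cx i I; rewrite /= in_itv.
Qed.

Lemma measurable_rV_orthant (A : set 'rV[R]_n) : measurable A -> <<s range orthant >> A.
Proof.
pose T' := g_sigma_algebraType (range orthant).
move=> mA; have : @measurable rV_display 'rV[R]_n A by [].
rewrite /measurable/=; apply: smallest_sub => //.
rewrite -bigcup_seq => B [i _ [Y mY <-]].
have mi : @measurable_fun _ _ T' (measurableTypeR R) setT (fun x : 'rV[R]_n => x ord0 i).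
  apply: (measurability _ (RGenInftyO.measurableE R)) => //.
  move=> _ [_ [a ->] <-]; rewrite setTI.
  rewrite (_ : _ @^-1` _ = \bigcup_m orthant (fun j => if j == i then a else m%:R)).
    apply: bigcupT_measurable => m; apply: sub_sigma_algebra.
    by eexists.
  apply/seteqP; split=> [x|x [m _ h]] /=; rewrite in_itv/=; last by have := h i; rewrite eqxx.
  move=> xa; exists (Num.truncn `|x|).+1 => // j; case: eqP => [->//|_].
  apply: le_lt_trans (ler_norm _) _; apply: le_lt_trans (rV_norm_coord _ _) _.
  exact: truncnS_gt.
exact: (mi measurableT Y mY).
Qed.

Definition mollA k (A : set 'rV[R]_n) (x : 'rV[R]_n) : \bar R :=
  (\int[leb]_y (@mollifier R n k y * \1_A (x + y))%:E)%E.

Lemma measurable_addV : measurable_fun [set: 'rV[R]_n * 'rV[R]_n] (fun p : 'rV[R]_n * 'rV[R]_n => p.1 + p.2).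
Proof.
apply: measurable_fun_rV => i.
under eq_fun do rewrite mxE.
apply: measurable_funD; first exact: (measurableT_comp (measurable_coord i)).
exact: (measurableT_comp (measurable_coord i)).
Qed.

Lemma measurable_moll_kernel k (f : 'rV[R]_n -> R) : measurable_fun setT f ->
  measurable_fun setT (fun p : 'rV[R]_n * 'rV[R]_n => @mollifier R n k p.2 * f (p.1 + p.2)).
Proof.
move=> mf; apply: measurable_funM.
  exact: (measurableT_comp (measurable_test (test_mollifier n k)) measurable_snd).
exact: (measurableT_comp mf measurable_addV).
Qed.

Lemma measurable_mollA k A : measurable A -> measurable_fun setT (mollA k A).
Proof.
move=> mA; apply: (@measurable_fun_fubini_tonelli_F _ _ _ _ R leb
  (fun p : 'rV[R]_n * 'rV[R]_n => (@mollifier R n k p.2 * \1_A (p.1 + p.2))%:E)).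
- by apply/measurable_EFinP; apply: measurable_moll_kernel; exact: measurable_indic.
- by move=> p; rewrite lee_fin mulr_ge0// mollifier_ge0.
Qed.

Lemma mollA_ge0 k A x : (0 <= mollA k A x)%E.
Proof. by apply: integral_ge0 => y _; rewrite lee_fin mulr_ge0// mollifier_ge0. Qed.

Lemma measurable_indic_shift (A : set 'rV[R]_n) (x : 'rV[R]_n) : measurable A ->
  measurable_fun [set: 'rV[R]_n] (fun y : 'rV[R]_n => \1_A (x + y) : R).
Proof.
move=> mA; under eq_fun do rewrite addrC.
have mi : measurable_fun [set: 'rV[R]_n] (\1_A : 'rV[R]_n -> R) by exact: measurable_indic.
exact: (measurableT_comp mi (measurable_rVD x)).
Qed.

Lemma mollA_le k A B x : measurable A -> measurable B -> A `<=` B -> (mollA k A x <= mollA k B x)%E.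
Proof.
move=> mA mB AB; apply: ge0_le_integral => //.
- by move=> y _; rewrite lee_fin mulr_ge0// mollifier_ge0.
- apply/measurable_EFinP; apply: measurable_funM; last exact: measurable_indic_shift.
  exact: measurable_test (test_mollifier n k).
- apply/measurable_EFinP; apply: measurable_funM; last exact: measurable_indic_shift.
  exact: measurable_test (test_mollifier n k).
move=> y _; rewrite lee_fin ler_wpM2l ?mollifier_ge0// !indicE ler_nat.
have [h|h] := pselect (A (x + y)); last by rewrite memNset.
by rewrite (mem_set (AB _ h)); case: (_ \in _).
Qed.

Lemma mollAT k x : mollA k setT x = 1%E.
Proof.
rewrite -(integral_mollifier n k); apply: eq_integral => y _.
by rewrite indicE mem_set// mulr1.
Qed.

Lemma mollA_le1 k A x : measurable A -> (mollA k A x <= 1)%E.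
Proof. by move=> mA; rewrite -(mollAT k x); exact: mollA_le. Qed.

Lemma mollA_fin k A x : measurable A -> mollA k A x \is a fin_num.
Proof.
move=> mA; rewrite ge0_fin_numE; last exact: mollA_ge0.
exact: le_lt_trans (mollA_le1 k x mA) (ltry _).
Qed.

Lemma mollAU k A B x : measurable A -> measurable B -> A `&` B = set0 ->
  mollA k (A `|` B) x = (mollA k A x + mollA k B x)%E.
Proof.
move=> mA mB AB; rewrite /mollA -ge0_integralD//.
- apply: eq_integral => y _; rewrite -EFinD -mulrDr; congr (_ * _)%:E.
  rewrite !indicE -natrD; congr (_%:R).
  have [hA|hA] := pselect (A (x + y)); have [hB|hB] := pselect (B (x + y)).
  - by have : (A `&` B) (x + y) by []; rewrite AB.
  - by rewrite (mem_set hA) (memNset hB) mem_set//; left.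
  - by rewrite (mem_set hB) (memNset hA) mem_set//; right.
  - by rewrite (memNset hB) (memNset hA) memNset// => -[].
- by move=> y _; rewrite lee_fin mulr_ge0// mollifier_ge0.
- apply/measurable_EFinP; apply: measurable_funM; last exact: measurable_indic_shift.
  exact: measurable_test (test_mollifier n k).
- by move=> y _; rewrite lee_fin mulr_ge0// mollifier_ge0.
- apply/measurable_EFinP; apply: measurable_funM; last exact: measurable_indic_shift.
  exact: measurable_test (test_mollifier n k).
Qed.

Definition molld k A M : \bar R := (\int[leb]_(x in cube n M) `|mollA k A x - (\1_A x)%:E|)%E.

Lemma measurable_molld k A D : measurable A -> measurable_fun D (fun x => `|mollA k A x - (\1_A x)%:E|%E).
Proof.
move=> mA; apply: measurable_funTS; apply: measurableT_comp => //.
apply: emeasurable_funB; first exact: measurable_mollA.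
exact/measurable_EFinP/measurable_indic.
Qed.

(** The class is shown to be closed under proper differences and increasing unions; both use only
    that mollification is additive, monotone and does not increase mass. *)
Definition mollgood : set (set 'rV[R]_n) :=
  [set A | measurable A /\ forall M, molld k A M @[k --> \oo] --> 0%E].

Lemma mollA_eq1 k (A : set 'rV[R]_n) x : (forall y, @mollifier R n k y != 0 -> A (x + y)) -> mollA k A x = 1%E.
Proof.
move=> h; rewrite -(integral_mollifier n k); apply: eq_integral => y _.
have [->|r0] := eqVneq (@mollifier R n k y) 0; first by rewrite mul0r.
by rewrite indicE mem_set ?mulr1//; exact: h.
Qed.

Lemma mollA_eq0 k (A : set 'rV[R]_n) x : (forall y, @mollifier R n k y != 0 -> ~ A (x + y)) -> mollA k A x = 0%E.
Proof.
move=> h; apply: integral0_eq => y _.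
have [->|r0] := eqVneq (@mollifier R n k y) 0; first by rewrite mul0r.
by rewrite indicE memNset ?mulr0//; exact: h.
Qed.

(** The kernel looks upwards in each coordinate: from a point outside the orthant it never enters
    it, and from a point inside it stays there once 1/(k+1) is below every gap. So the error is
    eventually zero at each point, and dominated convergence applies. *)
Lemma mollgood_orthant : range orthant `<=` mollgood.
Proof.
move=> _ [c _ <-]; split=> [|M]; first exact: measurable_orthant.
have mA := measurable_orthant c.
have [|||||_ _] := @dominated_convergence _ _ R leb (cube n M) (measurable_cube M)
  (fun k x => `|mollA k (orthant c) x - (\1_(orthant c) x)%:E|)%E (cst 0%E) (cst 2%:E).
- by move=> k; exact: measurable_molld.
- exact: measurable_cst.
- apply: aeW => x _.
  apply: cvg_near_cst; have [h|h] := pselect (orthant c x); last first.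
    apply: nearW => k; rewrite indicE memNset// mollA_eq0 ?sube0 ?abse0// => y /mollifier_supp ry h'.
    apply: h => i; apply: le_lt_trans (h' i); rewrite mxE lerDl ltW//.
    by have /andP[] := ry i.
  have : \forall k \near \oo, forall i, x ord0 i + k.+1%:R^-1 <= c i.
    have := @cvg_harmonic R.
    move=> /cvgrPdist_le hh.
    have : forall i : 'I_n, \forall k \near \oo, x ord0 i + k.+1%:R^-1 <= c i.
      move=> i; have ci : 0 < c i - x ord0 i by rewrite subr_gt0; exact: h.
      have := hh _ ci; apply: filterS => k.
      by rewrite /harmonic/= sub0r normrN ger0_norm ?invr_ge0// lerBrDl.
    by move/filter_forall.
  apply: filterS => k hk; rewrite indicE mem_set// mollA_eq1 ?subee ?abse0// => y /mollifier_supp ry i.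
  rewrite mxE; apply: lt_le_trans (hk i); rewrite ltrD2l.
  by have /andP[] := ry i.
- by apply: (integrable_cst_on 2); [exact: measurable_cube|exact: lebesgue_cube_lty].
- apply: aeW => x k _; rewrite abse_id.
  apply: le_trans (lee_abs_sub _ _) _.
  rewrite gee0_abs ?mollA_ge0// gee0_abs ?lee_fin//.
  rewrite (_ : 2%:E = 1 + 1)%E//; apply: leeD; first exact: mollA_le1.
  by rewrite lee_fin indicE; case: (_ \in _).
by rewrite integral0.
Qed.

Lemma ge0_integral_addr (x : 'rV[R]_n) (f : 'rV[R]_n -> \bar R) : measurable_fun setT f -> (forall y, 0 <= f y)%E ->
  (\int[leb]_y f (x + y)%R = \int[leb]_y f y)%E.
Proof.
by move=> mf f0; rewrite -(ge0_integral_translate x mf f0); apply: eq_integral => y _; rewrite addrC.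
Qed.

(** Tonelli and translation invariance, the kernel having mass 1. The cube grows by 1 because the
    kernel reaches at most 1/(k+1) <= 1. *)
Lemma mollA_mass k A M : measurable A ->
  (\int[leb]_(x in cube n M) mollA k A x <= leb (A `&` cube n (M + 1)))%E.
Proof.
move=> mA.
pose h (p : 'rV[R]_n * 'rV[R]_n) : \bar R := (@mollifier R n k p.2 * \1_A (p.1 + p.2) * \1_(cube n M) p.1)%:E.
have mI : measurable_fun [set: 'rV[R]_n] (\1_A : 'rV[R]_n -> R) by exact: measurable_indic.
have mC : measurable_fun [set: 'rV[R]_n] (\1_(cube n M) : 'rV[R]_n -> R).
  by apply: measurable_indic; exact: measurable_cube.
have mh : measurable_fun setT h.
  apply/measurable_EFinP; apply: measurable_funM; first exact: measurable_moll_kernel.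
  exact: (measurableT_comp mC measurable_fst).
have h0 p : (0 <= h p)%E.
  by rewrite lee_fin; apply: mulr_ge0 => //; apply: mulr_ge0 => //; exact: mollifier_ge0.
have e2 y : (\int[leb]_x h (x, y) <= leb (A `&` cube n (M + 1)) * (@mollifier R n k y)%:E)%E.
  have [ry|ry] := eqVneq (@mollifier R n k y) 0.
    rewrite ry mule0 integral0_eq// => x _; by rewrite /h/= ry !mul0r.
  have mAM : measurable (A `&` cube n (M + 1)) by apply: measurableI => //; exact: measurable_cube.
  rewrite -[X in leb X]setIT -integral_indic// -ge0_integralZr//; last 2 first.
  - exact/measurable_EFinP/measurable_indic.
  - by rewrite lee_fin mollifier_ge0.
  rewrite -[leRHS](ge0_integral_translate y); last 2 first.
  - apply: emeasurable_funM => //; exact/measurable_EFinP/measurable_indic.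
  - by move=> x; rewrite mule_ge0// lee_fin// mollifier_ge0.
  apply: ge0_le_integral => //.
  - by apply: (measurableT_comp mh); exact: pair2_measurable.
  - apply: emeasurable_funM => //; apply/measurable_EFinP.
    have mi : measurable_fun [set: 'rV[R]_n] (\1_(A `&` cube n (M + 1)) : 'rV[R]_n -> R) by exact: measurable_indic.
    exact: (measurableT_comp mi (measurable_rVD y)).
  move=> x _; rewrite /h/= -EFinM lee_fin -mulrA [leRHS]mulrC; apply: ler_wpM2l; first exact: mollifier_ge0.
  rewrite !indicE -natrM ler_nat mulnb.
  case: andP => [[/set_mem hA /set_mem hx]|]//=; rewrite mem_set//; split=> // i.
  rewrite mxE (le_trans (ler_normD _ _))// lerD//.
  have /andP[y0 y1] := mollifier_supp ry i.
  by rewrite ger0_norm ?(ltW y0)// (le_trans (ltW y1))// invf_le1// ler1n.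
have e1 : (\int[leb]_(x in cube n M) mollA k A x = \int[leb]_x \int[leb]_y h (x, y))%E.
  rewrite integral_mkcond; apply: eq_integral => x _; rewrite patchE.
  case: ifPn => [/set_mem hx|/negP hx].
    have hx1 : \1_(cube n M) x = 1 :> R by rewrite indicE mem_set.
    by apply: eq_integral => y _; rewrite /h/= hx1 mulr1.
  have hx0 : \1_(cube n M) x = 0 :> R by rewrite indicE memNset// => /mem_set.
  by apply/esym; apply: integral0_eq => y _; rewrite /h/= hx0 mulr0.
rewrite e1 (fubini_tonelli h mh h0) {e1}.
apply: le_trans (_ : (\int[leb]_y (leb (A `&` cube n (M + 1)) * (@mollifier R n k y)%:E)) <= _)%E.
  apply: ge0_le_integral => //.
  - by move=> y _; apply: integral_ge0.
  - exact: measurable_fun_fubini_tonelli_G.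
  - by apply: emeasurable_funM => //; apply/measurable_EFinP; exact: measurable_test (test_mollifier n k).
rewrite ge0_integralZl//; last 2 first.
- by apply/measurable_EFinP; exact: measurable_test (test_mollifier n k).
- by move=> y _; rewrite lee_fin mollifier_ge0.
by rewrite integral_mollifier mule1.
Qed.

Lemma mollA_split k A B x : measurable A -> measurable B -> B `<=` A ->
  mollA k A x = (mollA k (A `\` B) x + mollA k B x)%E.
Proof.
move=> mA mB BA; rewrite -mollAU//; last 2 first.
- exact: measurableD.
- by apply/seteqP; split=> // y [[_ +]].
congr (mollA k _ x); apply/seteqP; split=> [y Ay|y [[]//|/BA//]].
by have [By|By] := pselect (B y); [right|left].
Qed.

Lemma indic_split (A B : set 'rV[R]_n) x : B `<=` A -> \1_A x = \1_(A `\` B) x + \1_B x :> R.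
Proof.
move=> BA; rewrite !indicE -natrD; congr (_%:R).
have [hB|hB] := pselect (B x).
  by rewrite (mem_set hB) (mem_set (BA _ hB)) memNset// => -[].
rewrite (memNset hB) addn0; congr nat_of_bool; apply/idP/idP => /set_mem h; apply/mem_set => //.
by case: h.
Qed.

Lemma molld_setD k A B M : measurable A -> measurable B -> B `<=` A ->
  (molld k (A `\` B) M <= molld k A M + molld k B M)%E.
Proof.
move=> mA mB BA; rewrite /molld -ge0_integralD//; first last.
- exact: measurable_molld.
- exact: measurable_molld.
- exact: measurable_cube.
apply: ge0_le_integral => //.
- exact: measurable_cube.
- by apply: measurable_molld; exact: measurableD.
- by apply: emeasurable_funD; exact: measurable_molld.
move=> x _.
have mAB : measurable (A `\` B) by exact: measurableD.
have e1 := mollA_split k x mA mB BA; have e2 := indic_split x BA.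
have := mollA_fin k x mAB; have := mollA_fin k x mB.
rewrite e1 e2; case: (mollA k (A `\` B) x) => // a; case: (mollA k B x) => // b _ _.
set u := \1_(_ `\` _) x; set w := \1_B x.
have : `|a - u| <= `|a + b - (u + w)| + `|b - w|.
  rewrite (_ : a - u = (a + b - (u + w)) - (b - w)); last by ring.
  exact: ler_normB.
by rewrite -lee_fin.
Qed.

Lemma molld_ge0 k A M : (0 <= molld k A M)%E. Proof. exact: integral_ge0. Qed.

(** Removing a set of small measure changes both the indicator and its mollification little in L^1,
    whence the factor 2. This makes the convergence stable under increasing unions, uniformly in
    [k]. *)
Lemma molld_near k A B M : measurable A -> measurable B -> B `<=` A ->
  (molld k A M <= molld k B M + leb ((A `\` B) `&` cube n (M + 1)) *+ 2)%E.
Proof.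
move=> mA mB BA.
have mAB : measurable (A `\` B) by exact: measurableD.
apply: (@le_trans _ _ (molld k B M + (\int[leb]_(x in cube n M) mollA k (A `\` B) x +
  \int[leb]_(x in cube n M) (\1_(A `\` B) x)%:E))%E).
  have m1 : measurable_fun (cube n M) (fun x => mollA k (A `\` B) x).
    by apply: measurable_funTS; exact: measurable_mollA.
  have m2 : measurable_fun (cube n M) (fun x => (\1_(A `\` B) x)%:E : \bar R).
    by apply: measurable_funTS; apply/measurable_EFinP; exact: measurable_indic.
  rewrite /molld -ge0_integralD//; first last.
  - by move=> x _; exact: mollA_ge0.
  - exact: measurable_cube.
  rewrite -ge0_integralD//; first last.
  - by apply: emeasurable_funD.
  - by move=> x _; rewrite adde_ge0 ?mollA_ge0.
  - exact: measurable_molld.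
  - exact: measurable_cube.
  apply: ge0_le_integral => //.
  - exact: measurable_cube.
  - exact: measurable_molld.
  - by apply: emeasurable_funD; [exact: measurable_molld|exact: emeasurable_funD].
  move=> x _.
  have e1 := mollA_split k x mA mB BA; have e2 := indic_split x BA.
  have := mollA_ge0 k (A `\` B) x.
  have := mollA_fin k x mAB; have := mollA_fin k x mB.
  rewrite e1 e2; case: (mollA k (A `\` B) x) => // a; case: (mollA k B x) => // b _ _.
  rewrite lee_fin => a0.
  have : 0 <= \1_(A `\` B) x :> R by [].
  set u := \1_(_ `\` _) x; set w := \1_B x => u0.
  have : `|a + b - (u + w)| <= `|b - w| + (a + u).
    rewrite (_ : a + b - (u + w) = (b - w) + (a - u)); last by ring.
    rewrite (le_trans (ler_normD _ _))// lerD2l (le_trans (ler_normB _ _))//.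
    by rewrite !ger0_norm.
  by rewrite -lee_fin.
rewrite leeD2l// mule2n leeD//; first exact: mollA_mass.
rewrite integral_indic//; last exact: measurable_cube.
apply: le_measure; rewrite ?inE.
- by apply: measurableI => //; exact: measurable_cube.
- by apply: measurableI => //; exact: measurable_cube.
apply: setIS => x h i; by rewrite (le_trans (h i))// lerDl.
Qed.

Lemma mollgood_lambda : lambda_system setT mollgood.
Proof.
split=> //.
- split=> // M; rewrite (_ : (fun k => _) = cst 0%E); first exact: cvg_cst.
  apply/funext => k; apply: integral0_eq => x _.
  by rewrite mollAT indicE mem_set// subee// abse0.
- move=> A B BA [mA gA] [mB gB]; split=> [|M]; first exact: measurableD.
  apply: (@squeeze_cvge _ _ _ _ (cst 0%E) _ (fun k => molld k A M + molld k B M)%E).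
  - by apply: nearW => k; rewrite molld_ge0 molld_setD.
  - exact: cvg_cst.
  - by rewrite -[X in _ --> X]adde0; apply: cvgeD.
move=> F ndF FG.
have mF i : measurable (F i) by have [] := FG i.
have mUF : measurable (\bigcup_i F i) by exact: bigcupT_measurable.
split=> // M.
(* The part of the union missing from [F j] decreases to the empty set inside a set of finite
   measure. Below, it is counted twice at e/4, and [F j] itself contributes e/2. *)
have c0 : leb (((\bigcup_i F i) `\` F j) `&` cube n (M + 1)) @[j --> \oo] --> 0%E.
  have hI : \bigcap_j (((\bigcup_i F i) `\` F j) `&` cube n (M + 1)) = set0.
    apply/seteqP; split=> // x h; have [[[i _ Fi] _] _] := h 0%N I.
    by have [[_ +] _] := h i I; apply.
  rewrite -(measure0 leb) -hI.
  apply: nonincreasing_cvg_mu => //.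
  - apply: le_lt_trans (lebesgue_cube_lty n (M + 1)); apply: le_measure; rewrite ?inE//.
    + by apply: measurableI; [exact: measurableD|exact: measurable_cube].
    + exact: measurable_cube.
  - by move=> j; apply: measurableI; [exact: measurableD|exact: measurable_cube].
  - by apply: bigcapT_measurable => j; apply: measurableI; [exact: measurableD|exact: measurable_cube].
  - move=> i j ij; apply/subsetPset; apply: setSI; apply: setDS; exact/subsetPset/ndF.
apply/fine_cvgP; split.
  apply: nearW => k; rewrite ge0_fin_numE; last exact: molld_ge0.
  apply: le_lt_trans (_ : \int[leb]_(x in cube n M) 2%:E < _)%E; last first.
    rewrite integral_cst; last exact: measurable_cube.
    by rewrite lte_mul_pinfty// lebesgue_cube_lty.
  apply: ge0_le_integral => //.
  - exact: measurable_cube.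
  - exact: measurable_molld.
  move=> x _; apply: le_trans (lee_abs_sub _ _) _.
  rewrite gee0_abs ?mollA_ge0// gee0_abs ?lee_fin//.
  rewrite (_ : 2%:E = 1 + 1)%E//; apply: leeD; first exact: mollA_le1.
  by rewrite lee_fin indicE; case: (_ \in _).
apply/cvgr0Pnorm_le => e e0.
have e4 : (0 < (e / 4)%:E :> \bar R)%E by rewrite lte_fin divr_gt0.
have [j hj] : exists j, (leb (((\bigcup_i F i) `\` F j) `&` cube n (M + 1)) <= (e / 4)%:E)%E.
  have : \forall j \near \oo, (leb (((\bigcup_i F i) `\` F j) `&` cube n (M + 1)) <= (e / 4)%:E)%E.
    have /fine_cvgP[h1 /cvgr0Pnorm_le/(_ (e / 4) (divr_gt0 e0 _))] := c0.
    move=> /(_ ltac:(by [])) h2; near=> j.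
    have f : leb (((\bigcup_i F i) `\` F j) `&` cube n (M + 1)) \is a fin_num by near: j.
    rewrite -(fineK f) lee_fin; apply: le_trans (ler_norm _) _.
    by near: j.
  by move=> [N _ /(_ N (leqnn N))]; exists N.
have [_ /(_ M)/fine_cvgP[h1 /cvgr0Pnorm_le/(_ (e / 2) (divr_gt0 e0 _))]] := FG j.
move=> /(_ ltac:(by [])) h2; near=> k.
have f : molld k (F j) M \is a fin_num by near: k.
have h3 : `|fine (molld k (F j) M)| <= e / 2 by near: k.
have UF : F j `<=` \bigcup_i F i by exact: bigcup_sup.
have := molld_near k M mUF (mF j) UF.
rewrite ger0_norm ?fine_ge0 ?molld_ge0// => h4.
have h5 : (molld k (\bigcup_i F i) M <= e%:E)%E.
  apply: le_trans h4 _; rewrite (_ : e%:E = (e / 2)%:E + (e / 4)%:E *+ 2)%E; last first.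
    by rewrite mule2n -!EFinD; congr EFin; field.
  rewrite !mule2n; apply: leeD; last exact: leeD.
  by rewrite -(fineK f) lee_fin (le_trans (ler_norm _)).
move=> /=; have := molld_ge0 k (\bigcup_i F i) M.
by case: (molld _ _ _) h5 => //= r; rewrite lee_fin.
Unshelve. all: by end_near. Qed.

Lemma moll_indic_cvg (A : set 'rV[R]_n) M : measurable A ->
  molld k A M @[k --> \oo] --> 0%E.
Proof.
move=> mA; have : mollgood A; last by case.
have := measurable_rV_orthant mA.
apply: (lambda_system_subset orthantI mollgood_lambda mollgood_orthant).
by [].
Qed.

End indicator.

(** * Bochner integrability for a seminorm *)

Lemma EFin_Rintegral d (T : measurableType d) (R : realType) (m : {measure set T -> \bar R})
    (D : set T) (f : T -> R) : measurable D -> m.-integrable D (EFin \o f) ->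
  (\int[m]_(x in D) (f x)%:E = (\int[m]_(x in D) f x)%:E)%E.
Proof. by move=> mD fi; rewrite /Rintegral fineK//; exact: (integrable_fin_num mD fi). Qed.

Section bochner_general.
Context d (T : measurableType d) (R : realType).

Lemma simple_on_comp2 (E1 E2 E3 : zmodType) D (M1 : set E1) (M2 : set E2) (M3 : set E3)
    (op : E1 -> E2 -> E3) (s : T -> E1) (t : T -> E2) :
  (forall e e', M1 e -> M2 e' -> M3 (op e e')) ->
  simple_on D M1 s -> simple_on D M2 t -> simple_on D M3 (fun x => op (s x) (t x)).
Proof.
move=> hop [fs sM ms] [ft tM mt].
have fst' : finite_set ((s @` D) `*` (t @` D)) by exact: finite_setX.
split.
- apply: (sub_finite_set _ (finite_image (fun p => op p.1 p.2) fst')) => _ [x Dx <-].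
  by exists (s x, t x) => //; split; exists x.
- by move=> _ [x Dx <-]; apply: hop; [apply: sM|apply: tM]; exists x.
move=> e.
rewrite (_ : _ `&` _ = \bigcup_(p in ((s @` D) `*` (t @` D)) `&` [set p | op p.1 p.2 = e])
    ((D `&` s @^-1` [set p.1]) `&` (D `&` t @^-1` [set p.2]))).
  apply: fin_bigcup_measurable => [|p _]; first exact: finite_setIl.
  by apply: measurableI; [exact: ms|exact: mt].
apply/seteqP; split=> [x [Dx /= <-]|x [p [_ /= pe] [[Dx /= sx] [_ tx]]]].
  by exists (s x, t x) => //; split=> //; split; exists x.
by split=> //=; rewrite sx tx.
Qed.

Lemma simple_on_piecewise (E : zmodType) D (M : set E) (s : T -> E) (L : T -> E -> R) : measurable D ->
  simple_on D M s -> (forall e, M e -> measurable_fun D (L^~ e)) ->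
  measurable_fun D (fun x => L x (s x)).
Proof.
move=> mD [fs sM ms] mL _ Y mY.
rewrite (_ : _ `&` _ = \bigcup_(e in s @` D) ((D `&` s @^-1` [set e]) `&` (D `&` (L^~ e) @^-1` Y))).
  apply: fin_bigcup_measurable => // e [x Dx <-].
  by apply: measurableI; [exact: ms|apply: mL => //; apply: sM; exists x].
apply/seteqP; split=> [x [Dx /= h]|x [e [y Dy <-]] [[Dx /= sx] [_ /= h]]].
  by exists (s x); [exists x|].
by split=> //=; rewrite sx.
Qed.

(** The spaces are encoded as subspaces of a larger module with a seminorm controlled on the
    subspace only. Nonnegativity is asked everywhere, which holds for [H1_norm] as a square root and
    for [Hm1_norm] by the convention on suprema. *)
Record seminorm_on (E : lmodType R) (M : set E) (N : E -> R) : Prop := SeminormOn {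
  sm0 : M 0 ;
  smD : forall e e', M e -> M e' -> M (e + e') ;
  smZ : forall a e, M e -> M (a *: e) ;
  sn_ge0 : forall e, 0 <= N e ;
  snD : forall e e', M e -> M e' -> N (e + e') <= N e + N e' ;
  snZ : forall a e, M e -> N (a *: e) = `|a| * N e }.

Section one_space.
Context (E : lmodType R) (M : set E) (N : E -> R) (hN : seminorm_on M N).
Variable (D : set T).
Hypothesis mD : measurable D.

Lemma smB e e' : M e -> M e' -> M (e - e').
Proof. by move=> h h'; apply: smD hN _ _ h _; rewrite -scaleN1r; exact: smZ hN _ _ h'. Qed.

Lemma sn0 : N 0 = 0.
Proof. by rewrite -(scale0r (0 : E)) (snZ hN) ?normr0 ?mul0r//; exact: sm0 hN. Qed.

Lemma snN e : M e -> N (- e) = N e.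
Proof. by move=> Me; rewrite -scaleN1r (snZ hN)// normrN1 mul1r. Qed.

Lemma snB e e' : M e -> M e' -> N (e - e') <= N e + N e'.
Proof.
move=> h h'; rewrite -(snN h'); apply: (snD hN) => //.
by rewrite -scaleN1r; exact: (smZ hN).
Qed.

Lemma snC e e' : M e -> M e' -> N (e - e') = N (e' - e).
Proof. by move=> h h'; rewrite -snN ?opprB//; exact: smB. Qed.

Lemma sn_dist e e' : M e -> M e' -> `|N e - N e'| <= N (e - e').
Proof.
move=> h h'; rewrite ler_norml; apply/andP; split.
  rewrite lerNl opprB lerBlDr snC// -{1}(subrK e e'); apply: (snD hN) => //; exact: smB.
by rewrite lerBlDr -{1}(subrK e' e); apply: (snD hN) => //; exact: smB.
Qed.

(** On simple functions the pairing is piecewise measurable, and the Lipschitz bound in the second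
    argument passes to the pointwise limit. The Lipschitz constant may depend on the point. *)
Lemma measurable_pairing (F : T -> E) (L : T -> E -> R) (c : T -> R) :
  (forall x, D x -> M (F x)) -> strongly_measurable D M N F ->
  (forall e, M e -> measurable_fun D (L^~ e)) ->
  (forall x e e', D x -> M e -> M e' -> `|L x e - L x e'| <= c x * N (e - e')) ->
  measurable_fun D (fun x => L x (F x)).
Proof.
move=> FM [s [ss sF]] mL hL.
apply: (measurable_fun_cvg (h := fun k x => L x (s k x))) => [k|x Dx].
  exact: (simple_on_piecewise mD (ss k)).
apply/cvgrPdist_le => e e0.
have c0 : 0 < `|c x| + 1 by rewrite ltr_wpDl.
have /cvgr0Pnorm_le/(_ _ (divr_gt0 e0 c0)) := sF x Dx.
apply: filterS => k; rewrite ger0_norm ?(sn_ge0 hN)// => h.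
have Ms : M (s k x) by have [_ + _] := ss k; apply; exists x.
rewrite distrC; apply: le_trans (hL x _ _ Dx Ms (FM x Dx)) _.
apply: (@le_trans _ _ ((`|c x| + 1) * N (s k x - F x))).
  by rewrite ler_wpM2r ?(sn_ge0 hN)// (le_trans (ler_norm _))// lerDl.
by rewrite mulrC -ler_pdivlMr.
Qed.

Lemma measurable_sn (F : T -> E) :
  (forall x, D x -> M (F x)) -> strongly_measurable D M N F -> measurable_fun D (N \o F).
Proof.
move=> FM sF; apply: (measurable_pairing (L := fun _ e => N e) (c := cst 1) FM sF) => //.
by move=> x e e' _ h h'; rewrite mul1r; exact: sn_dist.
Qed.

Lemma simple_on_strongly (s : T -> E) : simple_on D M s -> strongly_measurable D M N s.
Proof.
move=> ss; exists (fun=> s); split=> // x Dx.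
by under eq_fun do rewrite subrr sn0; exact: cvg_cst.
Qed.

End one_space.

(** A Lipschitz operation maps simple approximants to simple approximants, so it preserves
    measurability in the sense of Bochner. *)
Lemma strongly_comp2 (E1 E2 E3 : lmodType R) (M1 : set E1) (M2 : set E2) (M3 : set E3) N1 N2 N3
    (op : E1 -> E2 -> E3) C D (F : T -> E1) (G : T -> E2) :
  seminorm_on M1 N1 -> seminorm_on M2 N2 -> seminorm_on M3 N3 -> 0 <= C ->
  (forall e e', M1 e -> M2 e' -> M3 (op e e')) ->
  (forall e f e' f', M1 e -> M1 f -> M2 e' -> M2 f' -> N3 (op e e' - op f f') <= C * (N1 (e - f) + N2 (e' - f'))) ->
  (forall x, D x -> M1 (F x)) -> (forall x, D x -> M2 (G x)) ->
  strongly_measurable D M1 N1 F -> strongly_measurable D M2 N2 G ->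
  strongly_measurable D M3 N3 (fun x => op (F x) (G x)).
Proof.
move=> h1 h2 h3 C0 hop hN MF MG [s [ss sF]] [t [tt tG]].
exists (fun k x => op (s k x) (t k x)); split=> [k|x Dx].
  exact: simple_on_comp2 (ss k) (tt k).
apply: (@squeeze_cvgr _ _ _ _ (cst 0) (fun k => C * (N1 (s k x - F x) + N2 (t k x - G x)))).
- apply: nearW => k; rewrite (sn_ge0 h3)/=; apply: hN.
  + by have [_ + _] := ss k; apply; exists x.
  + exact: MF.
  + by have [_ + _] := tt k; apply; exists x.
  + exact: MG.
- exact: cvg_cst.
rewrite -[X in _ --> X](mulr0 C) -[X in _ --> C * X](addr0 0).
by apply: cvgMr; apply: cvgD; [exact: sF|exact: tG].
Qed.

Lemma strongly_comp (E1 E2 : lmodType R) (M1 : set E1) (M2 : set E2) N1 N2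
    (op : E1 -> E2) C D (F : T -> E1) :
  seminorm_on M1 N1 -> seminorm_on M2 N2 -> 0 <= C ->
  (forall e, M1 e -> M2 (op e)) ->
  (forall e f, M1 e -> M1 f -> N2 (op e - op f) <= C * N1 (e - f)) ->
  (forall x, D x -> M1 (F x)) ->
  strongly_measurable D M1 N1 F -> strongly_measurable D M2 N2 (fun x => op (F x)).
Proof.
move=> h1 h2 C0 hop hN MF sF.
apply: (strongly_comp2 (M2 := M1) (N2 := N1) (op := fun e _ => op e) h1 h1 h2 C0 _ _ MF MF sF sF) => //.
- by move=> e e' he _; exact: hop.
move=> e f e' f' he hf he' hf'; apply: le_trans (hN _ _ he hf) _.
by rewrite ler_wpM2l// lerDl (sn_ge0 h1).
Qed.

Section L2.
Context (E : lmodType R) (M : set E) (N : E -> R) (hN : seminorm_on M N).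
Variables (m : {measure set T -> \bar R}) (D : set T).
Hypothesis mD : measurable D.

Lemma measurable_sn2 F : (forall x, D x -> M (F x)) -> strongly_measurable D M N F ->
  measurable_fun D (fun x => (N (F x) ^+ 2)%:E).
Proof.
by move=> h h'; apply/measurable_EFinP; apply: measurable_funX; exact: (measurable_sn hN mD h h').
Qed.

Lemma L2_bochner_comb a F G : L2_bochner m D M N F -> L2_bochner m D M N G ->
  L2_bochner m D M N (fun x => a *: F x + G x).
Proof.
move=> [MF sF iF] [MG sG iG].
have MFG x : D x -> M (a *: F x + G x).
  by move=> Dx; apply: (smD hN); [apply: (smZ hN); exact: MF|exact: MG].
have sFG : strongly_measurable D M N (fun x => a *: F x + G x).
  apply: (strongly_comp2 (op := fun e e' => a *: e + e') (C := `|a| + 1) hN hN hN _ _ _ MF MG sF sG).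
  - by rewrite addr_ge0.
  - by move=> e e' he he'; apply: (smD hN) => //; exact: (smZ hN).
  move=> e f e' f' he hf he' hf'.
  have -> : a *: e + e' - (a *: f + f') = a *: (e - f) + (e' - f').
    by rewrite scalerBr opprD addrACA.
  have Mef := smB hN he hf; have Mef' := smB hN he' hf'.
  rewrite (le_trans (snD hN _ _))//; first exact: (smZ hN).
  rewrite (snZ hN)// mulrDr; have := sn_ge0 hN (e - f); have := sn_ge0 hN (e' - f').
  move: (N _) (N _) (normr_ge0 a) => p q ? ? ?; nra.
split=> //.
apply: (@le_lt_trans _ _ (\int[m]_(x in D) ((2 * `|a| ^+ 2)%:E * (N (F x) ^+ 2)%:E + 2%:E * (N (G x) ^+ 2)%:E))%E).
  apply: ge0_le_integral => //.
  - by move=> x _; rewrite lee_fin sqr_ge0.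
  - exact: measurable_sn2.
  - by apply: emeasurable_funD; apply: emeasurable_funM => //; exact: measurable_sn2.
  move=> x Dx; rewrite -!EFinM -EFinD lee_fin.
  have := snD hN (smZ hN a (MF x Dx)) (MG x Dx); rewrite (snZ hN); last exact: MF.
  have := sn_ge0 hN (a *: F x + G x); have := sn_ge0 hN (F x); have := sn_ge0 hN (G x).
  move: (N (a *: _ + _)) (N (F x)) (N (G x)) (`|a|) => u v w b w0 v0 u0 h.
  apply: (@le_trans _ _ ((b * v + w) ^+ 2)); first by rewrite ler_sqr// nnegrE// (le_trans u0).
  by have := sqr_ge0 (b * v - w); nra.
rewrite ge0_integralD//.
- rewrite ge0_integralZl//; last 2 first.
  + exact: measurable_sn2.
  + by move=> x _; rewrite lee_fin sqr_ge0.
  rewrite ge0_integralZl//; last 2 first.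
  + exact: measurable_sn2.
  + by move=> x _; rewrite lee_fin sqr_ge0.
  by rewrite lte_add_pinfty// lte_mul_pinfty// ?lee_fin// mulr_ge0// sqr_ge0.
- by move=> x _; rewrite -EFinM lee_fin mulr_ge0 ?sqr_ge0// mulr_ge0// sqr_ge0.
- by apply: emeasurable_funM => //; exact: measurable_sn2.
- by move=> x _; rewrite -EFinM lee_fin mulr_ge0// sqr_ge0.
- by apply: emeasurable_funM => //; exact: measurable_sn2.
Qed.

End L2.

Lemma L2_bochner_comp (m : {measure set T -> \bar R}) (E1 E2 : lmodType R) (M1 : set E1) (M2 : set E2) N1 N2
    (op : E1 -> E2) C D (F : T -> E1) : measurable D ->
  seminorm_on M1 N1 -> seminorm_on M2 N2 -> 0 <= C ->
  (forall e, M1 e -> M2 (op e)) ->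
  (forall e f, M1 e -> M1 f -> N2 (op e - op f) <= C * N1 (e - f)) ->
  (forall e, M1 e -> N2 (op e) <= C * N1 e) ->
  L2_bochner m D M1 N1 F -> L2_bochner m D M2 N2 (fun x => op (F x)).
Proof.
move=> mD h1 h2 C0 hop hN hN1 [MF sF iF].
have sO := strongly_comp h1 h2 C0 hop hN MF sF.
have MO x : D x -> M2 (op (F x)) by move=> Dx; apply: hop; exact: MF.
split=> //.
apply: (@le_lt_trans _ _ (\int[m]_(x in D) ((C ^+ 2)%:E * (N1 (F x) ^+ 2)%:E))%E).
  apply: ge0_le_integral => //.
  - by move=> x _; rewrite lee_fin sqr_ge0.
  - exact: (measurable_sn2 h2 mD).
  - by apply: emeasurable_funM => //; exact: (measurable_sn2 h1 mD).
  move=> x Dx; rewrite -EFinM lee_fin -exprMn ler_sqr ?nnegrE ?(sn_ge0 h2)//.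
    by apply: hN1; exact: MF.
  by rewrite mulr_ge0// (sn_ge0 h1).
rewrite ge0_integralZl//.
- by rewrite lte_mul_pinfty// lee_fin sqr_ge0.
- exact: (measurable_sn2 h1 mD).
- by move=> x _; rewrite lee_fin sqr_ge0.
- by rewrite lee_fin sqr_ge0.
Qed.

End bochner_general.

Section young.
Context {R : realType} {n : nat}.
Local Notation leb := (lebesgue_rV R n).

(** The choice t = u/c is optimal; if c = 0, the choice t = (V + 1)/u gives a contradiction. It
    replaces a Cauchy-Schwarz inequality wherever a direct division would need a nonzero
    denominator. *)
Lemma sq_le_of_young (u c V : R) : 0 <= u -> 0 <= c -> 0 <= V ->
  (forall t, 0 < t -> 2 * t * u <= t ^+ 2 * c + V) -> u ^+ 2 <= c * V.
Proof.
move=> u0 c0 V0 h; have [->|un0] := eqVneq u 0; first by rewrite expr0n/= mulr_ge0.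
have up : 0 < u by rewrite lt_neqAle eq_sym un0.
have [c00|cn0] := eqVneq c 0.
  have t0 : 0 < (V + 1) / u by rewrite divr_gt0// ltr_wpDl.
  have := h _ t0; rewrite c00 mulr0 add0r -mulrA divfK// => h2.
  by exfalso; move: h2; lra.
have cp : 0 < c by rewrite lt_neqAle eq_sym cn0.
have t0 : 0 < u / c by rewrite divr_gt0.
have := h _ t0; have -> : 2 * (u / c) * u = 2 * (u ^+ 2 / c) by field.
have -> : (u / c) ^+ 2 * c = u ^+ 2 / c by field.
move=> h2; have : u ^+ 2 / c <= V by lra.
by rewrite ler_pdivrMr// mulrC.
Qed.

(** Young's inequality for a kernel of mass at most [c]: from 2 t h <= t^2 + h^2 against the kernel,
    then optimisation in t, u^2 is at most c times the average of h^2, and Tonelli integrates the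
    latter. The function is extended by zero outside [D]. *)
Lemma young (D : set 'rV[R]_n) (kap h : 'rV[R]_n -> R) c K : measurable D ->
  measurable_fun setT kap -> (forall y, 0 <= kap y <= K) -> (\int[leb]_y (kap y)%:E <= c%:E)%E ->
  measurable_fun D h -> (forall x, 0 <= h x) -> (\int[leb]_(x in D) (h x ^+ 2)%:E < +oo)%E ->
  let u x := \int[leb]_y (kap y * (h \_ D) (x + y)) in
  [/\ forall x, leb.-integrable setT (EFin \o (fun y => kap y * (h \_ D) (x + y))),
      measurable_fun setT u, forall x, 0 <= u x &
      (\int[leb]_x (u x ^+ 2)%:E <= (c ^+ 2)%:E * \int[leb]_(x in D) (h x ^+ 2)%:E)%E].
Proof.
move=> mD mk kK kc mh h0 hoo u.
pose hD : 'rV[R]_n -> R := h \_ D.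
have hD0 x : 0 <= hD x by rewrite /hD patchE; case: ifP.
have mhD : measurable_fun [set: 'rV[R]_n] hD by apply/(measurable_restrictT _ mD).
have k0 y : 0 <= kap y by have /andP[] := kK y.
have c0 : 0 <= c by rewrite -lee_fin; apply: le_trans kc; apply: integral_ge0 => y _; rewrite lee_fin.
pose H2 : \bar R := (\int[leb]_x (hD x ^+ 2)%:E)%E.
have eH2 : H2 = (\int[leb]_(x in D) (h x ^+ 2)%:E)%E.
  rewrite /H2 [RHS]integral_mkcond; apply: eq_integral => x _.
  by rewrite /hD !patchE; case: ifP => // _; rewrite expr0n.
have mhx x : measurable_fun [set: 'rV[R]_n] (fun y : 'rV[R]_n => hD (x + y)).
  under eq_fun do rewrite addrC.
  exact: (measurableT_comp mhD (measurable_rVD x)).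
have mkh x : measurable_fun [set: 'rV[R]_n] (fun y : 'rV[R]_n => kap y * hD (x + y)) by exact: measurable_funM.
have mkh2 x : measurable_fun [set: 'rV[R]_n] (fun y : 'rV[R]_n => kap y * hD (x + y) ^+ 2).
  by apply: measurable_funM => //; exact: measurable_funX.
pose V x : \bar R := (\int[leb]_y (kap y * hD (x + y) ^+ 2)%:E)%E.
have V0 x : (0 <= V x)%E by apply: integral_ge0 => y _; rewrite lee_fin mulr_ge0// sqr_ge0.
have mhD2 : measurable_fun [set: 'rV[R]_n] (fun y : 'rV[R]_n => (hD y ^+ 2)%:E : \bar R).
  by apply/measurable_EFinP; exact: measurable_funX.
(* The bound [K] on the kernel makes the average of h^2 finite at every point, not only almost
   everywhere, so [u] is an honest integral everywhere. *)
have Voo x : (V x < +oo)%E.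
  have K0 : 0 <= K by have /andP[a b] := kK 0; exact: le_trans b.
  apply: (@le_lt_trans _ _ (K%:E * H2)%E); last by rewrite lte_mul_pinfty// eH2.
  rewrite /H2 -(@ge0_integral_addr R n x (fun y => (hD y ^+ 2)%:E))//; last by move=> y; rewrite lee_fin sqr_ge0.
  have mhx2 : measurable_fun [set: 'rV[R]_n] (fun y : 'rV[R]_n => (hD (x + y) ^+ 2)%:E : \bar R).
    by apply/measurable_EFinP; exact: measurable_funX.
  rewrite -ge0_integralZl//; last by move=> y _; rewrite lee_fin sqr_ge0.
  apply: ge0_le_integral => //.
  - by move=> y _; rewrite lee_fin mulr_ge0// sqr_ge0.
  - exact/measurable_EFinP.
  - by apply: emeasurable_funM.
  by move=> y _; rewrite -EFinM lee_fin ler_wpM2r ?sqr_ge0//; have /andP[] := kK y.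
have key t x : 0 < t -> (\int[leb]_y ((2 * t)%:E * (kap y * hD (x + y))%:E) <= (t ^+ 2 * c)%:E + V x)%E.
  move=> t0; apply: (@le_trans _ _ (\int[leb]_y ((t ^+ 2)%:E * (kap y)%:E + (kap y * hD (x + y) ^+ 2)%:E))%E).
    apply: ge0_le_integral => //.
    - by move=> y _; rewrite -EFinM lee_fin !mulr_ge0// ltW.
    - by apply: emeasurable_funM => //; exact/measurable_EFinP.
    - apply: emeasurable_funD; last exact/measurable_EFinP.
      by apply: emeasurable_funM => //; exact/measurable_EFinP.
    move=> y _; rewrite -!EFinM -EFinD lee_fin.
    have := mulr_ge0 (k0 y) (sqr_ge0 (t - hD (x + y))); nra.
  rewrite ge0_integralD//.
  - rewrite leeD2r// ge0_integralZl//; last 3 first.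
    + exact/measurable_EFinP.
    + by move=> y _; rewrite lee_fin.
    + by rewrite lee_fin sqr_ge0.
    by rewrite (EFinM (t ^+ 2) c) lee_wpmul2l// lee_fin sqr_ge0.
  - by move=> y _; rewrite -EFinM lee_fin mulr_ge0// sqr_ge0.
  - by apply: emeasurable_funM => //; exact/measurable_EFinP.
  - by move=> y _; rewrite lee_fin mulr_ge0// sqr_ge0.
  - exact/measurable_EFinP.
have ifin x : leb.-integrable setT (EFin \o (fun y => kap y * hD (x + y))).
  apply/integrableP; split; first exact/measurable_EFinP.
  under eq_integral do rewrite /= ger0_norm ?mulr_ge0//.
  have := key 1 x ltr01.
  rewrite ge0_integralZl//; last 2 first.
  - exact/measurable_EFinP.
  - by move=> y _; rewrite lee_fin mulr_ge0.
  move=> h2; apply: (@le_lt_trans _ _ ((2 * 1)%:E * \int[leb]_y (kap y * hD (x + y))%:E)%E).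
    rewrite -[leLHS]mul1e lee_wpmul2r//; first by apply: integral_ge0 => y _; rewrite lee_fin mulr_ge0.
    by rewrite lee_fin mulr1 ler1n.
  apply: (le_lt_trans h2); exact: lte_add_pinfty (ltry _) (Voo x).
have eu x : (\int[leb]_y (kap y * hD (x + y))%:E = (u x)%:E)%E.
  by rewrite (EFin_Rintegral measurableT (ifin x)).
have u0 x : 0 <= u x by apply: Rintegral_ge0 => y _; rewrite mulr_ge0.
have mprod : measurable_fun [set: 'rV[R]_n * 'rV[R]_n] (fun p : 'rV[R]_n * 'rV[R]_n => kap p.2 * hD (p.1 + p.2)).
  apply: measurable_funM; first exact: (measurableT_comp mk measurable_snd).
  exact: (measurableT_comp mhD measurable_addV).
have mu : measurable_fun setT u.
  apply/measurable_EFinP; rewrite (_ : EFin \o u = fun x => (\int[leb]_y (kap y * hD (x + y))%:E)%E); last first.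
    by apply/funext => x; rewrite eu.
  apply: (@measurable_fun_fubini_tonelli_F _ _ _ _ R leb (fun p : 'rV[R]_n * 'rV[R]_n => (kap p.2 * hD (p.1 + p.2))%:E)) => //=.
  - exact/measurable_EFinP.
  - by move=> p; rewrite lee_fin mulr_ge0.
split=> //.
have uV x : ((u x ^+ 2)%:E <= c%:E * V x)%E.
  have := V0 x; have := Voo x; have := fun t => @key t x; case: (V x) => // v kx _ v0.
  rewrite -EFinM lee_fin; apply: sq_le_of_young => // t t0.
  rewrite -lee_fin EFinD; apply: le_trans (kx t t0).
  rewrite ge0_integralZl//; last 3 first.
  - exact/measurable_EFinP.
  - by move=> y _; rewrite lee_fin mulr_ge0.
  - by rewrite lee_fin mulr_ge0// ltW.
  by rewrite eu -EFinM.
have mprod2 : measurable_fun [set: 'rV[R]_n * 'rV[R]_n] (fun p : 'rV[R]_n * 'rV[R]_n => (kap p.2 * hD (p.1 + p.2) ^+ 2)%:E : \bar R).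
  apply/measurable_EFinP; apply: measurable_funM; first exact: (measurableT_comp mk measurable_snd).
  apply: measurable_funX; exact: (measurableT_comp mhD measurable_addV).
have p0 (p : 'rV[R]_n * 'rV[R]_n) : (0 <= (kap p.2 * hD (p.1 + p.2) ^+ 2)%:E)%E.
  by rewrite lee_fin mulr_ge0// sqr_ge0.
have mV : measurable_fun setT V.
  exact: (@measurable_fun_fubini_tonelli_F _ _ _ _ R leb _ mprod2).
apply: (@le_trans _ _ (\int[leb]_x (c%:E * V x))%E).
  apply: ge0_le_integral => //.
  - by move=> x _; rewrite lee_fin sqr_ge0.
  - by apply/measurable_EFinP; exact: measurable_funX.
  - by apply: emeasurable_funM.
rewrite ge0_integralZl// -eH2 expr2 (EFinM c c) -muleA lee_wpmul2l//.
rewrite (fubini_tonelli _ mprod2 p0).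
apply: (@le_trans _ _ (\int[leb]_y ((kap y)%:E * H2))%E).
  apply: ge0_le_integral => //.
  - by move=> y _; apply: integral_ge0.
  - exact: (measurable_fun_fubini_tonelli_G _ mprod2 p0).
  - by apply: emeasurable_funM => //; exact/measurable_EFinP.
  move=> y _; rewrite /fubini_G /H2 -(ge0_integral_translate y mhD2); last by move=> x; rewrite lee_fin sqr_ge0.
  have mhy2 : measurable_fun [set: 'rV[R]_n] (fun x : 'rV[R]_n => (hD (x + y) ^+ 2)%:E : \bar R).
    exact: (measurableT_comp mhD2 (measurable_rVD y)).
  rewrite -ge0_integralZl//; last 2 first.
  - by move=> x _; rewrite lee_fin sqr_ge0.
  - by rewrite lee_fin.
rewrite ge0_integralZr//.
- by rewrite lee_wpmul2r// integral_ge0// => x _; rewrite lee_fin sqr_ge0.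
- exact/measurable_EFinP.
- by move=> y _; rewrite lee_fin.
- by apply: integral_ge0 => x _; rewrite lee_fin sqr_ge0.
Qed.

End young.

Lemma near_all_seq (I : eqType) (r : seq I) (P : I -> nat -> Prop) :
  (forall i, i \in r -> \forall k \near \oo, P i k) ->
  \forall k \near \oo, forall i, i \in r -> P i k.
Proof.
elim: r => [|i r IH] h; first exact: nearW.
have h1 := h i (mem_head _ _).
have h2 : \forall k \near \oo, forall i, i \in r -> P i k.
  by apply: IH => j jr; apply: h; rewrite inE jr orbT.
near=> k => j; rewrite inE => /orP[/eqP ->|jr]; first by near: k.
by move: j jr; near: k.
Unshelve. all: by end_near. Qed.

(** * Approximation and mollification of vector-valued functions *)

Section bochner_rV.
Context {R : realType} {n : nat}.
Local Notation leb := (lebesgue_rV R n).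

Lemma simple_on_indic d (T : measurableType d) (D A : set T) : measurable D -> measurable A ->
  simple_on D setT (\1_A : T -> R).
Proof.
move=> mD mA; split=> //.
  apply: (sub_finite_set (B := [set 0; 1])); last exact: finite_set2.
  by move=> _ [x _ <-]; rewrite indicE; case: (x \in A); [right|left].
move=> e; have := @measurable_indic _ _ R D A mA mD [set e] (measurable_set1 e).
by [].
Qed.

Context (E : lmodType R) (M : set E) (N : E -> R) (hN : seminorm_on M N).
Variable (D : set 'rV[R]_n).
Hypothesis mD : measurable D.

Lemma measurable_sn_simple (s F : 'rV[R]_n -> E) : simple_on D M s -> (forall x, D x -> M (F x)) ->
  strongly_measurable D M N F -> measurable_fun D (fun x => N (s x - F x)).
Proof.
move=> ss MF sF.
have Ms x : D x -> M (s x) by have [_ + _] := ss; move=> h Dx; apply: h; exists x.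
apply: (measurable_pairing hN mD (L := fun x e => N (s x - e)) (c := cst 1) MF sF) => [e Me|x e e' Dx Me Me'].
  by apply: (simple_on_piecewise (L := fun _ f => N (f - e)) mD ss) => f Mf; exact: measurable_cst.
rewrite mul1r.
apply: le_trans (sn_dist hN _ _) _; try by apply: (smB hN) => //; exact: Ms.
by rewrite opprB addrC subrKA (snC hN).
Qed.

(** The given simple approximants are kept only where their error is at most [N (F x)] and x lies in
    a large cube, and are zero elsewhere. The error is then dominated by [N (F x)] everywhere, and
    dominated convergence applies. *)
Lemma L2_bochner_approx F (del : R) : 0 < del -> L2_bochner leb D M N F ->
  exists s, [/\ simple_on D M s, exists2 B, 0 <= B & forall x, D x -> ~ cube n B x -> s x = 0 &
    (\int[leb]_(x in D) (N (s x - F x) ^+ 2)%:E <= del%:E)%E].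
Proof.
move=> d0 [MF sF iF]; have [s [ss sFc]] := sF.
have Ms k x : D x -> M (s k x) by have [_ + _] := ss k; move=> h Dx; apply: h; exists x.
have mg k : measurable_fun D (fun x => N (s k x - F x)) by exact: measurable_sn_simple.
have mNF := measurable_sn hN mD MF sF.
pose B k := D `&` [set x | N (s k x - F x) <= N (F x)] `&` cube n k%:R.
have mB k : measurable (B k).
  apply: measurableI; last exact: measurable_cube.
  have h : measurable (D `&` (fun x => N (s k x - F x) <= N (F x)) @^-1` [set true]).
    exact: (measurable_fun_ler (mg k) mNF mD).
  by [].
pose s' k x : E := (\1_(B k) x : R) *: s k x.
have ss' k : simple_on D M (s' k).
  apply: (simple_on_comp2 (M2 := setT) (op := fun e (r : R) => r *: e) _ (ss k)).
    by move=> e r Me _; exact: (smZ hN).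
  exact: simple_on_indic.
have Ms' k x : D x -> M (s' k x) by have [_ + _] := ss' k; move=> h Dx; apply: h; exists x.
have le k x : D x -> N (s' k x - F x) <= N (F x).
  move=> Dx; rewrite /s' indicE; have [h|h] := pselect (B k x).
    by rewrite mem_set// scale1r; case: h => -[].
  by rewrite memNset// scale0r sub0r (snN hN)//; exact: MF.
have cv x : D x -> N (s' k x - F x) @[k --> \oo] --> (0 : R).
  (* Where [N (F x)] vanishes, the truncation may never let the approximant through, but the
     domination already forces the error to be zero. *)
  move=> Dx; have [F0|F0] := eqVneq (N (F x)) 0.
    rewrite (_ : (fun _ => _) = cst 0); first exact: cvg_cst.
    apply/funext => k; apply/eqP; rewrite eq_le (sn_ge0 hN) andbT -[leRHS]F0; exact: le.
  have Fp : 0 < N (F x) by rewrite lt_neqAle eq_sym F0 (sn_ge0 hN).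
  have := sFc x Dx; apply: cvg_trans; apply: near_eq_cvg; near=> k.
  rewrite /s' indicE mem_set ?scale1r//; split.
    split=> //=; near: k.
    have /cvgr0Pnorm_le/(_ _ Fp) := sFc x Dx.
    by apply: filterS => k; rewrite ger0_norm// (sn_ge0 hN).
  move=> i; apply: le_trans (rV_norm_coord x i) _; near: k; exact: nbhs_infty_ger.
have [|||||_ _] := @dominated_convergence _ _ R leb D mD (fun k x => (N (s' k x - F x) ^+ 2)%:E) (cst 0%E)
   (fun x => (N (F x) ^+ 2)%:E).
- move=> k; apply/measurable_EFinP; apply: measurable_funX; exact: measurable_sn_simple.
- exact: measurable_cst.
- apply: aeW => x Dx; apply: cvg_EFin; first exact: nearW.
  rewrite -[X in _ --> X](expr0n _ 2) /=; under eq_fun do rewrite /= expr2.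
  by rewrite expr2; apply: cvgM; exact: cv.
- apply/integrableP; split; first exact: (measurable_sn2 hN mD MF sF).
  by under eq_integral do rewrite gee0_abs ?lee_fin ?sqr_ge0//.
- apply: aeW => x k Dx; rewrite gee0_abs ?lee_fin ?sqr_ge0// ler_sqr ?nnegrE ?(sn_ge0 hN)//.
  exact: le.
rewrite integral0 => /fine_cvgP[h1 /cvgr0Pnorm_le/(_ _ d0) h2].
have [k] : exists k, (\int[leb]_(x in D) (N (s' k x - F x) ^+ 2)%:E <= del%:E)%E.
  have : \forall k \near \oo, (\int[leb]_(x in D) (N (s' k x - F x) ^+ 2)%:E <= del%:E)%E.
    near=> k; have f : (\int[leb]_(x in D) (N (s' k x - F x) ^+ 2)%:E)%E \is a fin_num by near: k.
    rewrite -(fineK f) lee_fin; apply: le_trans (ler_norm _) _.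
    by near: k.
  by move=> [K _ /(_ K (leqnn K))]; exists K.
exists (s' k); split=> //.
exists k%:R => // x Dx nc; rewrite /s' indicE memNset ?scale0r// => -[_]; exact: nc.
Unshelve. all: by end_near. Qed.

Lemma simple_on_seq (s : 'rV[R]_n -> E) : simple_on D M s ->
  exists r : seq E, [/\ uniq r, forall e, e \in r -> M e & forall x, D x -> s x \in r].
Proof.
move=> [fs sM _]; exists (finmap.enum_fset (fset_set (s @` D))); split => [|e|x Dx]; first exact: finmap.fset_uniq.
- by rewrite in_fset_set// inE; exact: sM.
- by rewrite in_fset_set// inE; exists x.
Qed.

Lemma sum_indic_seq (s : 'rV[R]_n -> E) (r : seq E) (lam : E -> R) x : uniq r -> D x -> s x \in r ->
  lam (s x) = \sum_(e <- r) (\1_(D `&` s @^-1` [set e]) x * lam e).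
Proof.
move=> ur Dx sr; rewrite (bigD1_seq (s x))//= indicE mem_set// mul1r big1 ?addr0// => e ne.
by rewrite indicE memNset ?mul0r// => -[_] /= e1; rewrite e1 eqxx in ne.
Qed.

(** Such functionals stand in for the vector-valued integral: an average of [F] is only ever seen
    through its images, and a bound valid for all of them at once is a bound on the norm. *)
Definition functional_le (lam : E -> R) :=
  (forall e e', M e -> M e' -> lam (e - e') = lam e - lam e') /\ (forall e, M e -> `|lam e| <= N e).

Lemma measurable_functional lam F : functional_le lam -> (forall x, D x -> M (F x)) ->
  strongly_measurable D M N F -> measurable_fun D (lam \o F).
Proof.
move=> [l1 l2] MF sF.
apply: (measurable_pairing hN mD (L := fun _ e => lam e) (c := cst 1) MF sF) => // x e e' _ Me Me'.
by rewrite mul1r -l1//; apply: l2; exact: (smB hN).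
Qed.

Lemma mollA_EFin k (A : set 'rV[R]_n) x : measurable A ->
  \int[leb]_y (@mollifier R n k y * \1_A (x + y)) = fine (mollA k A x).
Proof. by []. Qed.

Lemma integrable_moll_indic k (A : set 'rV[R]_n) x : measurable A ->
  leb.-integrable setT (EFin \o (fun y => @mollifier R n k y * \1_A (x + y))).
Proof.
move=> mA; under eq_fun do rewrite mulrC.
apply: (@integrableM_bounded _ _ R leb setT _ _ 1) => //.
- exact: measurable_indic_shift.
- by move=> y _; rewrite indicE; case: (_ \in _); rewrite ?normr1 ?normr0.
- exact: integrable_test (test_mollifier n k).
Qed.

Hypothesis Dshift : forall x y : 'rV[R]_n, D x -> (forall i, 0 < y ord0 i) -> D (x + y).

Lemma moll_shift k x y : D x -> @mollifier R n k y != 0 -> D (x + y).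
Proof. by move=> Dx /mollifier_supp h; apply: Dshift => // i; have /andP[] := h i. Qed.

(** The majorant [r] does not depend on the functional. With a simple approximant s of [F], the
    error is bounded by the average of N(s - F), plus the mollification error of finitely many
    indicators weighted by the norms of the values, plus N(s - F) itself. *)
Lemma mollify_approx F (del : R) : 0 < del -> L2_bochner leb D M N F ->
  \forall k \near \oo, exists r : 'rV[R]_n -> R,
    [/\ measurable_fun D r, forall x, 0 <= r x,
        (\int[leb]_(x in D) (r x ^+ 2)%:E <= del%:E)%E &
        forall lam, functional_le lam -> forall x, D x ->
          leb.-integrable setT (EFin \o (fun y => @mollifier R n k y * lam (F (x + y)))) /\
          `|\int[leb]_y (@mollifier R n k y * lam (F (x + y))) - lam (F x)| <= r x].
Proof.
move=> d0 LF; have [MF sF iF] := LF.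
(* Three contributions, and the square of a sum of three terms costs a factor 3: each contribution
   may use a ninth of [del]. *)
have d9 : 0 < del / 9 by rewrite divr_gt0.
have [s [ss [B B0 sB] sFd]] := L2_bochner_approx d9 LF.
have Ms x : D x -> M (s x) by have [_ + _] := ss; move=> h Dx; apply: h; exists x.
have [r [ur rM sr]] := simple_on_seq ss.
pose A e := D `&` s @^-1` [set e].
have mA e : measurable (A e) by have [_ _] := ss; exact.
pose C := \sum_(e <- r) N e.
have C0 : 0 <= C by apply: sumr_ge0 => e _; exact: (sn_ge0 hN).
(* The sum [S] below is at most [C] pointwise, so its squared norm is at most [C] times its
   integral, that is C^2 times [eta]. *)
pose eta := del / (9 * (C ^+ 2 + 1)).
have eta0 : 0 < eta by rewrite divr_gt0// mulr_gt0// ltr_wpDl// sqr_ge0.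
have near_e : \forall k \near \oo, forall e, e \in r -> (molld k (A e) (B + 1) <= eta%:E)%E.
  apply: near_all_seq => e _.
  have /fine_cvgP[h1 /cvgr0Pnorm_le/(_ _ eta0) h2] := moll_indic_cvg (B + 1) (mA e).
  near=> k; have f : molld k (A e) (B + 1) \is a fin_num by near: k.
  by rewrite -(fineK f) lee_fin; apply: le_trans (ler_norm _) _; near: k.
near=> k.
have hk : forall e, e \in r -> (molld k (A e) (B + 1) <= eta%:E)%E by near: k.
pose hh x := N (s x - F x).
have mhh : measurable_fun D hh by exact: measurable_sn_simple.
have [K _ hK] := test_bounded (test_mollifier n k : test_fun setT (@mollifier R n k)).
have kK y : 0 <= @mollifier R n k y <= K by rewrite mollifier_ge0 (le_trans (ler_norm _)).
have [|iu mu u0 uI] := @young R n D (@mollifier R n k) hh 1 K mD (measurable_test (test_mollifier n k))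
  kK _ mhh (fun x => sn_ge0 hN _) (le_lt_trans sFd (ltry _)).
  by rewrite integral_mollifier.
pose u x := \int[leb]_y (@mollifier R n k y * (hh \_ D) (x + y)).
pose c e x := \1_(A e) x - fine (mollA k (A e) x).
have c1 e x : `|c e x| <= 1.
  have := mollA_ge0 k (A e) x; have := mollA_le1 k x (mA e); have := mollA_fin k x (mA e).
  rewrite /c indicE; case: (mollA _ _ _) => // a _; rewrite !lee_fin /= => a1 a0.
  by rewrite ler_norml; case: (x \in _) => /=; lra.
have mc e : measurable_fun [set: 'rV[R]_n] (c e).
  apply: measurable_funB; first exact: measurable_indic.
  exact: (measurableT_comp (fine_measurable measurableT) (measurable_mollA k (mA e))).
pose S x := \sum_(e <- r) N e * `|c e x|.
have S0 x : 0 <= S x by apply: sumr_ge0 => e _; rewrite mulr_ge0// (sn_ge0 hN).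
have SC x : S x <= C.
  by apply: ler_sum => e _; rewrite -[leRHS]mulr1 ler_wpM2l// (sn_ge0 hN).
have mS : measurable_fun [set: 'rV[R]_n] S.
  by apply: measurable_sum => e; apply: measurable_funM => //; exact: (measurableT_comp _ (mc e)).
have intS : (\int[leb]_(x in D) (S x ^+ 2)%:E <= (del / 9)%:E)%E.
  apply: (@le_trans _ _ (\int[leb]_(x in D) (C%:E * (\sum_(e <- r) (N e)%:E * (`|c e x|)%:E)))%E).
    apply: ge0_le_integral => //.
    - by move=> x _; rewrite lee_fin sqr_ge0.
    - by apply/measurable_EFinP; apply: measurable_funX; exact: measurable_funTS.
    - apply: emeasurable_funM => //; apply: emeasurable_sum => e; apply: emeasurable_funM => //.
      by apply/measurable_EFinP; apply: measurable_funTS; exact: (measurableT_comp _ (mc e)).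
    move=> x _; under eq_bigr do rewrite -EFinM; rewrite sumEFin -EFinM lee_fin expr2.
    by rewrite ler_wpM2r.
  have mce e : measurable_fun D (fun x => (`|c e x|)%:E : \bar R).
    by apply/measurable_EFinP; apply: measurable_funTS; exact: (measurableT_comp _ (mc e)).
  rewrite ge0_integralZl//; last 2 first.
  - by apply: emeasurable_sum => e; apply: emeasurable_funM.
  - by move=> x _; apply: sume_ge0 => e _; rewrite -EFinM lee_fin mulr_ge0// (sn_ge0 hN).
  rewrite ge0_integral_sum//; last 2 first.
  - by move=> e; apply: emeasurable_funM.
  - by move=> e x _; rewrite -EFinM lee_fin mulr_ge0// (sn_ge0 hN).
  have he e : e \in r -> (\int[leb]_(x in D) ((N e)%:E * (`|c e x|)%:E) <= (N e * eta)%:E)%E.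
    move=> er; rewrite ge0_integralZl//; last by rewrite lee_fin (sn_ge0 hN).
    (* Level sets of nonzero values are bounded, so the estimate on a cube is enough. The level set
       of 0 may be unbounded, but its weight [N 0] is zero. *)
    have [->|e0] := eqVneq e 0; first by rewrite (sn0 hN) mul0e mul0r.
    rewrite EFinM lee_wpmul2l ?lee_fin ?(sn_ge0 hN)//; apply: le_trans (hk e er).
    have Ae x : A e x -> cube n B x.
      move=> [Dx /= se]; apply: contrapT => nb.
      by have := sB x Dx nb; rewrite se => e00; rewrite e00 eqxx in e0.
    have ce0 x : ~ cube n (B + 1) x -> c e x = 0.
      move=> nb; rewrite /c indicE memNset ?sub0r; last first.
        by move=> /Ae h; apply: nb => i; rewrite (le_trans (h i))// lerDl.
      rewrite mollA_eq0 ?oppr0// => y ry /Ae h; apply: nb => i.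
      have := h i; rewrite mxE => h1; have /andP[y0 y1] := mollifier_supp ry i.
      rewrite -(addrK (y ord0 i) (x ord0 i)) (le_trans (ler_normB _ _))// lerD//.
      by rewrite ger0_norm ?(ltW y0)// (le_trans (ltW y1))// invf_le1// ler1n.
    rewrite /molld [leRHS](_ : _ = \int[leb]_(x in cube n (B + 1)) (`|c e x|)%:E)%E; last first.
      apply: eq_integral => x _; rewrite /c -(fineK (mollA_fin k x (mA e))) -EFinB abse_EFin.
      by rewrite distrC fineK// mollA_fin.
    rewrite integral_mkcond [leRHS]integral_mkcond; apply: ge0_le_integral => //.
    - by move=> x _; rewrite patchE; case: ifP => // _; rewrite lee_fin.
    - by apply/(measurable_restrictT _ mD).
    - apply/(measurable_restrictT _ (measurable_cube (B + 1))); apply/measurable_EFinP; apply: measurable_funTS.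
      exact: (measurableT_comp _ (mc e)).
    move=> x _; rewrite !patchE; case: ifP => _; case: ifPn => [|/negP h] //.
    - by rewrite ce0 ?normr0// => /mem_set.
    - by move=> _; rewrite lee_fin.
  apply: (@le_trans _ _ (C%:E * (\sum_(e <- r) (N e * eta)%:E))%E).
    rewrite lee_wpmul2l ?lee_fin// big_seq [leRHS]big_seq; apply: lee_sum => e er; exact: he.
  rewrite sumEFin -mulr_suml -EFinM lee_fin -/C mulrA -expr2.
  have hp : 0 < C ^+ 2 + 1 by rewrite ltr_wpDl// sqr_ge0.
  have -> : eta = del / 9 / (C ^+ 2 + 1) by rewrite /eta invfM mulrA.
  by rewrite mulrA ler_pdivrMr// mulrC ler_wpM2l ?lerDl// ltW.
exists (fun x => u x + S x + hh x); split.
- by apply: measurable_funD => //; apply: measurable_funD; exact: measurable_funTS.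
- by move=> x; apply: addr_ge0; [apply: addr_ge0; [exact: u0|exact: S0]|exact: (sn_ge0 hN)].
- apply: (@le_trans _ _ (\int[leb]_(x in D) (3%:E * ((u x ^+ 2)%:E + (S x ^+ 2)%:E + (hh x ^+ 2)%:E)))%E).
    apply: ge0_le_integral => //.
    - by move=> x _; rewrite lee_fin sqr_ge0.
    - apply/measurable_EFinP; apply: measurable_funX; apply: measurable_funD => //.
      by apply: measurable_funD; exact: measurable_funTS.
    - apply: emeasurable_funM => //; apply: emeasurable_funD; last by apply/measurable_EFinP; exact: measurable_funX.
      by apply: emeasurable_funD; apply/measurable_EFinP; apply: measurable_funTS; exact: measurable_funX.
    move=> x _; rewrite -!EFinD -EFinM lee_fin.
    have := sqr_ge0 (u x - S x); have := sqr_ge0 (u x - hh x); have := sqr_ge0 (S x - hh x).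
    nra.
  have mu2 : measurable_fun D (fun x => (u x ^+ 2)%:E : \bar R).
    by apply/measurable_EFinP; apply: measurable_funTS; exact: measurable_funX.
  have mS2 : measurable_fun D (fun x => (S x ^+ 2)%:E : \bar R).
    by apply/measurable_EFinP; apply: measurable_funTS; exact: measurable_funX.
  have mh2 : measurable_fun D (fun x => (hh x ^+ 2)%:E : \bar R).
    by apply/measurable_EFinP; exact: measurable_funX.
  have p0 (f : 'rV[R]_n -> R) : forall x, D x -> (0 <= (f x ^+ 2)%:E)%E by move=> x _; rewrite lee_fin sqr_ge0.
  rewrite ge0_integralZl//; last 2 first.
  - by apply: emeasurable_funD => //; exact: emeasurable_funD.
  - by move=> x _; rewrite -!EFinD lee_fin !addr_ge0// sqr_ge0.
  rewrite ge0_integralD//; [|by move=> x _; rewrite -!EFinD lee_fin !addr_ge0// sqr_ge0|exact: emeasurable_funD|exact: p0].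
  rewrite ge0_integralD//; try exact: p0.
  have uD : (\int[leb]_(x in D) (u x ^+ 2)%:E <= (del / 9)%:E)%E.
    apply: le_trans sFd; rewrite -[leRHS]mul1e -[X in (X%:E * _)%E](expr1n R 2); apply: le_trans uI.
    apply: (@ge0_subset_integral _ _ R leb D setT mD measurableT (fun x => (u x ^+ 2)%:E)) => //.
      by apply/measurable_EFinP; exact: measurable_funX.
    by move=> x _; rewrite lee_fin sqr_ge0.
  apply: (@le_trans _ _ (3%:E * ((del / 9)%:E + (del / 9)%:E + (del / 9)%:E))%E).
    by rewrite lee_wpmul2l//; apply: leeD => //; apply: leeD.
  by rewrite -!EFinD -EFinM lee_fin; lra.
move=> lam hlam x Dx; have [l1 l2] := hlam.
have eF y : @mollifier R n k y * lam (F (x + y)) =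
    @mollifier R n k y * (- ((lam \o (fun x => s x - F x)) \_ D) (x + y)) +
    \sum_(e <- r) lam e * (@mollifier R n k y * \1_(A e) (x + y)).
  have [->|ry] := eqVneq (@mollifier R n k y) 0.
    by rewrite !mul0r big1 ?addr0// => e _; rewrite mul0r mulr0.
  have Dxy := moll_shift Dx ry.
  under eq_bigr do rewrite mulrCA; rewrite -mulr_sumr -mulrDr; congr (_ * _).
  rewrite patchE mem_set//= l1 ?opprB; [|exact: Ms|exact: MF].
  under eq_bigr do rewrite mulrC; rewrite -(sum_indic_seq lam ur Dxy (sr _ Dxy)).
  by rewrite subrK.
have mlF : measurable_fun D (lam \o (fun x => s x - F x)).
  have m1 : measurable_fun D (lam \o s).
    by apply: (measurable_functional hlam) => //; exact: (simple_on_strongly hN).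
  have m2 := measurable_functional hlam MF sF.
  apply: eq_measurable_fun (measurable_funB m1 m2) => y /set_mem Dy.
  by rewrite /= l1; [|exact: Ms|exact: MF].
have i1 : leb.-integrable setT (EFin \o (fun y => @mollifier R n k y * - ((lam \o (fun x => s x - F x)) \_ D) (x + y))).
  apply: le_integrable (iu x) => //.
    apply/measurable_EFinP; apply: measurable_funM; first exact: measurable_test (test_mollifier n k).
    apply: measurableT_comp => //; under eq_fun do rewrite addrC.
    have m3 : measurable_fun [set: 'rV[R]_n] ((lam \o (fun x => s x - F x)) \_ D) by apply/(measurable_restrictT _ mD).
    exact: (measurableT_comp m3 (measurable_rVD x)).
  move=> y _ /=; rewrite lee_fin !normrM ler_wpM2l// normrN !patchE; case: ifPn => // /set_mem Dxy.
  rewrite [leRHS]ger0_norm ?(sn_ge0 hN)//; apply: l2; apply: (smB hN); [exact: Ms|exact: MF].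
have [i2 e2] := @Rintegral_lincomb _ _ R leb setT _ r lam
  (fun e y => @mollifier R n k y * \1_(A e) (x + y)) measurableT (fun e => integrable_moll_indic k x (mA e)).
under eq_fun do rewrite eF; split; first exact: intD.
rewrite RintegralD// e2.
have -> : lam (F x) = \sum_(e <- r) lam e * \1_(A e) x - lam (s x - F x).
  under eq_bigr do rewrite mulrC; rewrite -(sum_indic_seq lam ur Dx (sr _ Dx)) l1 ?subKr//; [exact: Ms|exact: MF].
set a := \int[_]_y _; set b := \sum_(e <- r) _ * _; set b' := \sum_(e <- r) _ * _.
rewrite (_ : a + b - (b' - lam (s x - F x)) = a + (b - b') + lam (s x - F x)); last by ring.
apply: le_trans (ler_normD _ _) _; apply: lerD; last by apply: l2; apply: (smB hN); [exact: Ms|exact: MF].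
apply: le_trans (ler_normD _ _) _; apply: lerD.
  apply: le_trans (le_normr_Rintegral _ i1) _ => //.
  apply: le_Rintegral => //; first exact: integrable_norm.
  move=> y _ /=; rewrite normrM ger0_norm ?mollifier_ge0// ler_wpM2l ?mollifier_ge0// normrN !patchE; case: ifPn => [/set_mem Dxy|_]; last by rewrite normr0.
  by apply: l2; apply: (smB hN); [exact: Ms|exact: MF].
rewrite /b /b' -sumrB; apply: le_trans (ler_norm_sum _ _ _) _; rewrite /S big_seq [leRHS]big_seq.
apply: ler_sum => e er; rewrite -mulrBr normrM distrC mollA_EFin//.
by rewrite ler_wpM2r//; apply: l2; exact: rM.
Unshelve. all: by end_near. Qed.

Lemma finite_bounded_int (m : nat) : finite_set [set z : 'rV[int]_n | forall i, `|z ord0 i| <= m%:Z].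
Proof.
pose f (g : {ffun 'I_n -> 'I_(m + m).+1}) : 'rV[int]_n := \row_i ((g i)%:Z - m%:Z).
apply: (sub_finite_set (B := f @` setT)); last by apply: finite_image; exact: finite_finset.
move=> z hz.
have hb i : (absz (z ord0 i + m%:Z)%R < (m + m).+1)%N.
  have := hz i; rewrite ler_norml => /andP[h1 h2]; rewrite ltnS -lez_nat gez0_abs; last by rewrite -lerBlDr sub0r.
  by rewrite PoszD lerD2r.
exists [ffun i => Ordinal (hb i)] => //; apply/rowP => i; rewrite mxE ffunE /= gez0_abs ?addrK//.
by have := hz i; rewrite ler_norml => /andP[h1 h2]; rewrite -lerBlDr sub0r.
Qed.

(** Sampling at the rounded points inside a growing cube gives finitely many values, since only
    finitely many grid points occur there. *)
Lemma lipschitz_strongly (F : 'rV[R]_n -> E) C : (forall x, M (F x)) ->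
  (forall x h, N (F (x + h) - F x) <= C * `|h|) -> strongly_measurable D M N F.
Proof.
move=> MF hF.
pose s k (x : 'rV[R]_n) : E := (\1_(cube n k%:R) x : R) *: F (of_grid k (grid k x)).
have sE k x : s k x = if x \in cube n k%:R then F (of_grid k (grid k x)) else 0.
  by rewrite /s indicE; case: (_ \in _); rewrite ?scale1r ?scale0r.
exists s; split=> [k|x Dx].
  split.
  - pose B := [set z : 'rV[int]_n | forall i, `|z ord0 i| <= (k * k.+1 + 1)%N%:Z].
    apply: (sub_finite_set (B := (F \o of_grid k) @` B `|` [set 0])); last first.
      by rewrite finite_setU; split; [apply: finite_image; exact: finite_bounded_int|exact: finite_set1].
    move=> _ [x Dx <-]; rewrite sE; case: ifPn => [/set_mem cx|_]; last by right.
    left; exists (grid k x) => // i; rewrite mxE.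
    have := cx i; rewrite ler_norml => /andP[h1 h2].
    have kp : 0 < k.+1%:R :> R by rewrite ltr0n.
    have a1 : x ord0 i * k.+1%:R <= ((k * k.+1)%:Z)%:~R by rewrite -pmulrn natrM ler_wpM2r.
    have a2 : (- (k * k.+1)%:Z)%:~R <= x ord0 i * k.+1%:R by rewrite mulrNz -pmulrn natrM -mulNr ler_wpM2r.
    rewrite ler_norml; apply/andP; split.
      apply: (@le_trans _ _ (- (k * k.+1)%:Z)); first by rewrite lerN2 PoszD lerDl.
      by rewrite floor_ge_int.
    rewrite -(ler_int R); apply: le_trans (floor_le _) _; apply: le_trans a1 _.
    by rewrite ler_int PoszD lerDl.
  - move=> _ [x Dx <-]; rewrite sE; case: ifP => _; [exact: MF|exact: sm0 hN].
  - move=> e; rewrite (_ : _ `&` _ = D `&` ((cube n k%:R `&` grid k @^-1` [set z | F (of_grid k z) = e])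
       `|` (~` cube n k%:R `&` [set _ | 0 = e]))).
      apply: measurableI => //; apply: measurableU; apply: measurableI.
      + exact: measurable_cube.
      + exact: (@countable_valued_measurable _ _ _ (grid k) [set z | F (of_grid k z) = e] (@measurable_grid R n k)).
      + by apply: measurableC; exact: measurable_cube.
      + have [h|h] := pselect (0 = e :> E).
          by rewrite (_ : [set _ | _] = setT)//; apply/seteqP; split.
        by rewrite (_ : [set _ | _] = set0)//; apply/seteqP; split.
    congr (_ `&` _); apply/seteqP; split => x /=; rewrite sE.
      by case: ifPn => [/set_mem h <-|/negP h <-]; [left|right; split=> // h2; apply: h; exact/mem_set].
    by move=> [[h <-]|[h <-]]; [rewrite mem_set|rewrite memNset].
have cv : C * `|of_grid k (grid k x) - x| @[k --> \oo] --> (0 : R).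
  rewrite -[X in _ --> X](mulr0 C); apply: cvgMr.
  have /cvgrPdist_le h := @cvg_of_grid R n x.
  apply/cvgrPdist_le => e e0; apply: filterS (h e e0) => k.
  by rewrite sub0r normrN normr_id distrC.
apply: (@squeeze_cvgr _ _ _ _ (cst 0) (fun k => C * `|of_grid k (grid k x) - x|)) => //; last exact: cvg_cst.
near=> k; rewrite (sn_ge0 hN)/= sE mem_set; last first.
  move=> i; apply: le_trans (rV_norm_coord x i) _; near: k; exact: nbhs_infty_ger.
have := hF x (of_grid k (grid k x) - x); by rewrite (addrC x) subrK.
Unshelve. all: by end_near. Qed.

End bochner_rV.

Section scalar.
Context {R : realType} {n : nat}.
Local Notation leb := (lebesgue_rV R n).

Lemma seminorm_on_real : @seminorm_on R R^o setT (fun x => `|x|).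
Proof. by split=> //= *; [exact: ler_normD|exact: normrM]. Qed.

Import HBSimple.

Lemma strongly_measurable_real d (T : measurableType d) (w : T -> R) : measurable_fun setT w ->
  @strongly_measurable _ T R R^o setT setT (fun x => `|x|) w.
Proof.
move=> mw; have mw' : measurable_fun setT (EFin \o w) by exact/measurable_EFinP.
have [g hg] := approximation_sfun measurableT mw'.
exists (fun k x => g k x); split=> [k|x _].
  split=> // e; rewrite setTI; exact: measurable_funPTI.
have /fine_cvgP[_ h] := hg x I.
apply/cvgrPdist_le => e e0; have /cvgrPdist_le/(_ e e0) := h.
by apply: filterS => k /=; rewrite sub0r normrN normr_id distrC.
Qed.

Lemma square_integrable_cube M (w : 'rV[R]_n -> R) : measurable_fun setT w ->
  (\int[leb]_x (w x ^+ 2)%:E < +oo)%E -> (forall x, ~ cube n M x -> w x = 0) ->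
  leb.-integrable setT (EFin \o w).
Proof.
move=> mw w2 w0; apply/integrableP; split; first exact/measurable_EFinP.
apply: (@le_lt_trans _ _ (\int[leb]_x ((\1_(cube n M) x)%:E + (w x ^+ 2)%:E))%E).
  apply: ge0_le_integral => //.
  - by apply: measurableT_comp => //; exact/measurable_EFinP.
  - apply: emeasurable_funD; apply/measurable_EFinP; first by apply: measurable_indic; exact: measurable_cube.
    exact: measurable_funX.
  move=> x _; rewrite /= -EFinD lee_fin indicE.
  have [h|h] := pselect (cube n M x).
    by rewrite mem_set//= -[w x ^+ 2]real_normK ?num_real//; have := sqr_ge0 (`|w x| - 1); have := normr_ge0 (w x); nra.
  by rewrite w0// normr0 addr_ge0// sqr_ge0.
rewrite ge0_integralD//.
- rewrite integral_indic// ?setIT; last exact: measurable_cube.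
  by rewrite lte_add_pinfty// lebesgue_cube_lty.
- by apply/measurable_EFinP; apply: measurable_indic; exact: measurable_cube.
- by move=> x _; rewrite lee_fin sqr_ge0.
- by apply/measurable_EFinP; exact: measurable_funX.
Qed.

(** The scalar case of [mollify_approx], on the whole space and with the identity as the
    functional. *)
Lemma moll_L2 M (w : 'rV[R]_n -> R) (del : R) : 0 <= M -> measurable_fun setT w ->
  (\int[leb]_x (w x ^+ 2)%:E < +oo)%E -> (forall x, ~ cube n M x -> w x = 0) -> 0 < del ->
  \forall k \near \oo, (\int[leb]_x ((moll k w x - w x) ^+ 2)%:E <= del%:E)%E.
Proof.
move=> M0 mw w2 w0 d0.
have wi := square_integrable_cube mw w2 w0.
have LF : L2_bochner leb setT [set: R^o] (fun x : R^o => `|x|) w.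
  by split=> //; [exact: strongly_measurable_real|under eq_integral do rewrite real_normK ?num_real//].
have := @mollify_approx R n _ _ _ seminorm_on_real setT measurableT (fun _ _ _ _ => I) w del d0 LF.
apply: filterS => k [r [mr r0 rd hr]].
have fl : functional_le [set: R^o] (fun x : R^o => `|x|) id by split.
apply: le_trans rd; apply: ge0_le_integral => //.
- by move=> x _; rewrite lee_fin sqr_ge0.
- apply/measurable_EFinP; apply: measurable_funX; apply: measurable_funB => //.
  exact: measurable_test (test_moll k wi M0 w0).
- by apply/measurable_EFinP; exact: measurable_funX.
move=> x _; rewrite lee_fin -real_normK ?num_real// ler_sqr ?nnegrE//.
by have [_] := hr id fl x I.
Qed.

End scalar.

(** * Square integrable functions *)

Section square_integrable.
Context d (T : measurableType d) (R : realType) (m : {measure set T -> \bar R}).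
Implicit Types (f g : T -> R).

Definition sq_integrable f := measurable_fun setT f /\ (\int[m]_x (f x ^+ 2)%:E < +oo)%E.

Lemma Lnorm2E f : ('N[m]_2%:E[EFin \o f] = (\int[m]_x (f x ^+ 2)%:E) `^ (2^-1))%E.
Proof.
rewrite unlock; congr (_ `^ _)%E; apply: eq_integral => x _ /=.
by rewrite powR_mulrn// real_normK// num_real.
Qed.

Lemma Lfun2P f : f \in Lfun m 2%:E <-> sq_integrable f.
Proof.
split=> [h|[mf f2]].
  have [_] := integrableP _ _ _ (Lfun2_integrable_sqr h).
  under eq_integral do rewrite /= ger0_norm ?sqr_ge0//.
  split=> //; by move: h; rewrite inE => /andP[]; rewrite inE.
rewrite inE; apply/andP; split; rewrite inE//=.
by rewrite /finite_norm Lnorm2E poweR_lty.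
Qed.

Lemma sq_integrableP f : sq_integrable f -> m.-integrable setT (EFin \o (fun x => f x ^+ 2)).
Proof.
move=> [mf f2]; apply/integrableP; split; first by apply/measurable_EFinP; exact: measurable_funX.
by under eq_integral do rewrite /= ger0_norm ?sqr_ge0//.
Qed.

Lemma sq_integrable_le f (C : R) g : measurable_fun setT f -> (forall x, `|f x| <= C * `|g x|) ->
  sq_integrable g -> sq_integrable f.
Proof.
move=> mf fg [mg g2]; split=> //.
apply: (@le_lt_trans _ _ (\int[m]_x ((C ^+ 2)%:E * (g x ^+ 2)%:E))%E).
  apply: ge0_le_integral => //.
  - by move=> x _; rewrite lee_fin sqr_ge0.
  - by apply/measurable_EFinP; exact: measurable_funX.
  - by apply: emeasurable_funM => //; apply/measurable_EFinP; exact: measurable_funX.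
  move=> x _; rewrite -EFinM lee_fin -[leLHS]real_normK ?num_real// -[X in _ * X]real_normK ?num_real//.
  rewrite -exprMn ler_sqr ?nnegrE//; exact: le_trans (fg x).
rewrite ge0_integralZl//; [|by apply/measurable_EFinP; exact: measurable_funX
  |by move=> x _; rewrite lee_fin sqr_ge0|by rewrite lee_fin sqr_ge0].
by rewrite lte_mul_pinfty// lee_fin sqr_ge0.
Qed.

Lemma sq_integrableD f g : sq_integrable f -> sq_integrable g -> sq_integrable (fun x => f x + g x).
Proof.
move=> [mf f2] [mg g2]; split; first exact: measurable_funD.
have m2 (h : T -> R) : measurable_fun setT h -> measurable_fun setT (fun x => (h x ^+ 2)%:E : \bar R).
  by move=> mh; apply/measurable_EFinP; exact: measurable_funX.
apply: (@le_lt_trans _ _ (\int[m]_x (2%:E * ((f x ^+ 2)%:E + (g x ^+ 2)%:E)))%E).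
  apply: ge0_le_integral => //.
  - by move=> x _; rewrite lee_fin sqr_ge0.
  - by apply: m2; exact: measurable_funD.
  - by apply: emeasurable_funM => //; apply: emeasurable_funD; exact: m2.
  by move=> x _; rewrite -EFinD -EFinM lee_fin; have := sqr_ge0 (f x - g x); nra.
rewrite ge0_integralZl//; last 2 first.
- by apply: emeasurable_funD; exact: m2.
- by move=> x _; rewrite -EFinD lee_fin addr_ge0 ?sqr_ge0.
rewrite ge0_integralD//; [|by move=> x _; rewrite lee_fin sqr_ge0|exact: m2|by move=> x _; rewrite lee_fin sqr_ge0|exact: m2].
by rewrite lte_mul_pinfty// lte_add_pinfty.
Qed.

Lemma sq_integrableZ (a : R) f : sq_integrable f -> sq_integrable (fun x => a * f x).
Proof.
move=> sf; apply: (sq_integrable_le (C := `|a|) _ _ sf) => [|x]; last by rewrite normrM.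
by apply: measurable_funM => //; case: sf.
Qed.

Lemma sq_integrableB f g : sq_integrable f -> sq_integrable g -> sq_integrable (fun x => f x - g x).
Proof.
move=> sf sg; have := sq_integrableD sf (sq_integrableZ (-1) sg).
by under [X in sq_integrable X -> _]eq_fun do rewrite mulN1r.
Qed.

Lemma sq_integrableM f g : sq_integrable f -> sq_integrable g ->
  m.-integrable setT (EFin \o (fun x => f x * g x)).
Proof.
move=> sf sg; have i := intD measurableT (sq_integrableP sf) (sq_integrableP sg).
apply: le_integrable i => //.
  by apply/measurable_EFinP; apply: measurable_funM; [case: sf|case: sg].
move=> x _ /=; rewrite lee_fin normrM [leRHS]ger0_norm ?addr_ge0 ?sqr_ge0//.
rewrite -[f x ^+ 2]real_normK ?num_real// -[g x ^+ 2]real_normK ?num_real//.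
have := sqr_ge0 (`|f x| - `|g x|); have := normr_ge0 (f x); have := normr_ge0 (g x); nra.
Qed.

Lemma Rintegral_sq_ge0 f : 0 <= \int[m]_x (f x ^+ 2).
Proof. by apply: Rintegral_ge0 => x _; exact: sqr_ge0. Qed.

Lemma ae_eq0_sq f : measurable_fun setT f -> (\int[m]_x (f x ^+ 2)%:E = 0)%E ->
  {ae m, forall x, f x = 0}.
Proof.
move=> mf i0.
have [h _] := @ae_eq_integral_abs _ _ R m setT measurableT (fun x => (f x ^+ 2)%:E)
  (measurable_funTS (proj2 (measurable_EFinP _ _) (measurable_funX 2 mf))).
have : ae_eq m setT (fun x => (f x ^+ 2)%:E : \bar R) (cst 0%E).
  apply: h; rewrite -[RHS]i0; apply: eq_integral => x _.
  by rewrite gee0_abs// lee_fin sqr_ge0.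
apply: filterS => x /(_ I) /= [] /eqP; by rewrite sqrf_eq0 => /eqP.
Qed.

Lemma ae_Rintegral f g : measurable_fun setT f -> measurable_fun setT g -> {ae m, forall x, f x = g x} ->
  \int[m]_x f x = \int[m]_x g x.
Proof.
move=> mf mg fg; rewrite /Rintegral; congr fine; apply: ae_eq_integral => //.
- exact/measurable_EFinP.
- exact/measurable_EFinP.
by apply: filterS fg => x e _; rewrite e.
Qed.

End square_integrable.

Section semi_inner.
Context {R : realType} (E : lmodType R) (M : set E) (B : E -> E -> R).
Hypothesis M0 : M 0.
Hypothesis MD : forall a e f, M e -> M f -> M (a *: e + f).
Hypothesis BC : forall e f, M e -> M f -> B e f = B f e.
Hypothesis BD : forall a e f g, M e -> M f -> M g -> B (a *: e + f) g = a * B e g + B f g.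
Hypothesis B0 : forall e, 0 <= B e e.

Let N e := Num.sqrt (B e e).

Lemma semi_inner_sq a e f : M e -> M f -> B (a *: e + f) (a *: e + f) = a ^+ 2 * B e e + 2 * a * B e f + B f f.
Proof.
move=> Me Mf; rewrite BD//; last exact: MD.
rewrite (BC Me) ?(BC Mf); [|exact: MD|exact: MD].
by rewrite !BD// (BC Mf Me); ring.
Qed.

(** The form may be degenerate. Positivity at t e + f and at - t e + f bounds 2 t |B e f|, and
    optimising over t avoids dividing by a norm. *)
Lemma semi_inner_CS e f : M e -> M f -> `|B e f| <= N e * N f.
Proof.
move=> Me Mf; rewrite -ler_sqr ?nnegrE ?mulr_ge0 ?sqrtr_ge0// exprMn !sqr_sqrtr//.
apply: sq_le_of_young => // t t0.
have h1 := semi_inner_sq t Me Mf; have h2 := semi_inner_sq (- t) Me Mf.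
have p1 := B0 (t *: e + f); have p2 := B0 (- t *: e + f).
move: p1 p2; rewrite h1 h2 sqrrN mulrN; move: (t ^+ 2 * _ : R) (B f f) (B e f) => a b c p1 p2.
by case: (lerP 0 c) => h; [rewrite ger0_norm//|rewrite ltr0_norm// mulrN]; lra.
Qed.

Lemma semi_inner_seminorm : seminorm_on M N.
Proof.
have MZ a e : M e -> M (a *: e) by move=> Me; rewrite -[a *: e]addr0; exact: MD.
split=> //.
- by move=> e f Me Mf; rewrite -[e]scale1r; exact: MD.
- by move=> e; exact: sqrtr_ge0.
- move=> e f Me Mf; rewrite -ler_sqr ?nnegrE ?addr_ge0 ?sqrtr_ge0//.
  have := semi_inner_sq 1 Me Mf; rewrite scale1r /N sqr_sqrtr// sqrrD !sqr_sqrtr// => ->.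
  have := le_trans (ler_norm _) (semi_inner_CS Me Mf); rewrite /N; lra.
move=> a e Me; rewrite /N -{1 2}[a *: e]addr0 semi_inner_sq//.
have B00 f : M f -> B 0 f = 0.
  by move=> Mf; have := BD (-1) M0 M0 Mf; rewrite scaler0 addr0; lra.
rewrite (BC Me M0) !B00// mulr0 !addr0 sqrtrM ?sqr_ge0//; by rewrite sqrtr_sqr.
Qed.

End semi_inner.

(** * The weighted Sobolev space and its dual *)

(** What the two measures share: a smooth positive bounded density whose logarithmic gradient is -
    kap v, with kap = 0 for Lebesgue measure and kap = 1 for the Gaussian. *)
Record weight_of {R : realType} {n : nat} (mu : {measure set 'rV[R]_n -> \bar R})
    (m : 'rV[R]_n -> R) (kap : R) : Prop := WeightOf {
  wt_gt0 : forall v, 0 < m v ;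
  wt_smooth : smooth m ;
  wt_le : exists C, forall v, m v <= C ;
  wt_derive : forall v i, 'D_(delta_mx ord0 i) m v = - kap * v ord0 i * m v ;
  wt_int : forall f : 'rV[R]_n -> \bar R, measurable_fun setT f -> (forall v, 0 <= f v)%E ->
    (\int[mu]_v f v = \int[lebesgue_rV R n]_v (f v * (m v)%:E))%E }.

Section weighted.
Context {R : realType} {n : nat} (mu : {measure set 'rV[R]_n -> \bar R}) (m : 'rV[R]_n -> R) (kap : R).
Hypothesis wt : weight_of mu m kap.
Local Notation leb := (lebesgue_rV R n).
Implicit Types (f g chi phi : 'rV[R]_n -> R) (h : 'rV[R]_n -> 'rV[R]_n).

Lemma measurable_wt : measurable_fun setT m.
Proof. by apply: continuous_measurable_rV; apply: smooth_continuous; exact: wt_smooth wt. Qed.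

Lemma wt_ge0 v : 0 <= m v.
Proof. by apply: ltW; exact: wt_gt0 wt v. Qed.

Lemma wt_integral (f : 'rV[R]_n -> R) : measurable_fun setT f ->
  (\int[mu]_v (f v)%:E = \int[leb]_v (f v * m v)%:E)%E.
Proof.
move=> mf; have mEf : measurable_fun setT (EFin \o f) by exact/measurable_EFinP.
rewrite integralE [RHS]integralE !(wt_int wt)//.
- congr (_ - _)%E; apply: eq_integral => v _.
    by rewrite !funeposE -EFin_max -EFinM -EFin_max maxr_pMl ?mul0r// wt_ge0.
  by rewrite !funenegE -!EFinN -!EFin_max -EFinM maxr_pMl ?mul0r ?mulNr// wt_ge0.
- exact: measurable_funeneg.
- exact: measurable_funepos.
Qed.

Lemma wt_Rintegral f : measurable_fun setT f -> \int[mu]_v f v = \int[leb]_v (f v * m v).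
Proof. by move=> mf; rewrite /Rintegral wt_integral. Qed.

(** The reciprocal of the density is smooth, so its product with a cutoff is a test function and
    hence bounded. Weighted and unweighted square integrability therefore agree locally. *)
Lemma wt_low M : exists2 c, 0 < c & forall v, cube n M v -> c <= m v.
Proof.
have sV : smooth (fun v => (m v)^-1).
  by move=> k; apply: CkV => [v|]; [rewrite gt_eqF// (wt_gt0 wt)|exact: (wt_smooth wt)].
have [j Mj] : exists j : nat, `|M| <= j.+1%:R.
  exists (Num.truncn `|M|); exact: ltW (truncnS_gt _).
have [C C0 hC] := test_bounded (test_funM (@test_cutoff R n j) sV).
exists (C + 1)^-1 => [|v cv]; first by rewrite invr_gt0 ltr_wpDl.
have vM : `|v| <= j.+1%:R.
  by apply: rV_norm_le => // i; apply: le_trans (cv i) _; apply: le_trans (ler_norm _) Mj.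
have := hC v; rewrite cutoff1// mul1r ger0_norm ?invr_ge0 ?wt_ge0// => h.
rewrite -[leRHS]invrK lef_pV2 ?posrE ?invr_gt0 ?(wt_gt0 wt)//; last by rewrite ltr_wpDl.
by rewrite (le_trans h)// lerDl.
Qed.

Lemma sq_integrable_loc g chi C M : sq_integrable mu g -> measurable_fun setT chi ->
  (forall v, `|chi v| <= C) -> (forall v, ~ cube n M v -> chi v = 0) ->
  sq_integrable leb (fun v => chi v * g v).
Proof.
move=> [mg g2] mchi chiC chi0; split; first exact: measurable_funM.
have [c c0 hc] := wt_low M.
have mg2 : measurable_fun setT (fun v => (g v ^+ 2)%:E : \bar R).
  by apply/measurable_EFinP; exact: measurable_funX.
apply: (@le_lt_trans _ _ (\int[leb]_v ((C ^+ 2 / c)%:E * ((g v ^+ 2)%:E * (m v)%:E)))%E).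
  apply: ge0_le_integral => //.
  - by move=> x _; rewrite lee_fin sqr_ge0.
  - by apply/measurable_EFinP; apply: measurable_funX; exact: measurable_funM.
  - apply: emeasurable_funM => //; apply: emeasurable_funM => //.
    apply/measurable_EFinP; exact: measurable_wt.
  move=> v _; rewrite -!EFinM lee_fin.
  have [cv|ncv] := pselect (cube n M v); last first.
    by rewrite chi0// mul0r expr0n/= mulr_ge0 ?divr_ge0 ?sqr_ge0 ?(ltW c0)// mulr_ge0 ?sqr_ge0 ?wt_ge0.
  rewrite exprMn (_ : C ^+ 2 / c * _ = (C ^+ 2 * (m v / c)) * g v ^+ 2); last by ring.
  rewrite ler_wpM2r ?sqr_ge0//; apply: (@le_trans _ _ (C ^+ 2)).
    by rewrite -[leLHS]real_normK ?num_real// ler_sqr ?nnegrE// (le_trans _ (chiC v)).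
  by rewrite ler_peMr ?sqr_ge0// ler_pdivlMr// mul1r hc.
rewrite ge0_integralZl//.
- rewrite -(wt_int wt)//; last by move=> v; rewrite lee_fin sqr_ge0.
  by rewrite lte_mul_pinfty// lee_fin divr_ge0 ?sqr_ge0// ltW.
- apply: emeasurable_funM => //; apply/measurable_EFinP; exact: measurable_wt.
- by move=> v _; rewrite -EFinM lee_fin mulr_ge0 ?sqr_ge0 ?wt_ge0.
- by rewrite lee_fin divr_ge0 ?sqr_ge0// ltW.
Qed.

Lemma integrable_loc g chi C M : sq_integrable mu g -> measurable_fun setT chi ->
  (forall v, `|chi v| <= C) -> (forall v, ~ cube n M v -> chi v = 0) ->
  leb.-integrable setT (EFin \o (fun v => chi v * g v)).
Proof.
move=> sg mchi chiC chi0; have [mw w2] := sq_integrable_loc sg mchi chiC chi0.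
by apply: (square_integrable_cube (M := M)) => // v /chi0 ->; rewrite mul0r.
Qed.

Lemma integrable_mul_test U g phi : sq_integrable mu g -> test_fun U phi ->
  leb.-integrable setT (EFin \o (fun v => g v * phi v)).
Proof.
move=> sg tphi; have [C _ hC] := test_bounded tphi; have [M _ hM] := test_cube tphi.
under eq_fun do rewrite mulrC.
exact: (integrable_loc sg (measurable_test tphi) hC hM).
Qed.

Lemma wt_sq_le : exists2 C, 0 <= C & forall f, measurable_fun setT f ->
  (\int[mu]_v (f v ^+ 2)%:E <= C%:E * \int[leb]_v (f v ^+ 2)%:E)%E.
Proof.
have [C hC] := wt_le wt; have C0 : 0 <= C by apply: le_trans (wt_ge0 0) (hC 0).
exists C => // f mf.
have mf2 : measurable_fun setT (fun v => (f v ^+ 2)%:E : \bar R).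
  by apply/measurable_EFinP; exact: measurable_funX.
rewrite (wt_int wt)//; last by move=> v; rewrite lee_fin sqr_ge0.
rewrite -ge0_integralZl//; last by move=> v _; rewrite lee_fin sqr_ge0.
apply: ge0_le_integral => //.
- by move=> v _; rewrite -EFinM lee_fin mulr_ge0 ?sqr_ge0 ?wt_ge0.
- by apply: emeasurable_funM => //; apply/measurable_EFinP; exact: measurable_wt.
- exact: emeasurable_funM.
by move=> v _; rewrite -!EFinM lee_fin mulrC ler_wpM2r ?sqr_ge0.
Qed.

(** The mollification of a truncation of [g] is at each point an integral of [g] against a test
    function, hence zero; but it converges to the truncation in L^2. *)
Lemma ae_eq0_test g : sq_integrable mu g ->
  (forall phi, test_fun setT phi -> \int[leb]_v (g v * phi v) = 0) -> {ae mu, forall v, g v = 0}.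
Proof.
move=> sg g0; have mg := sg.1.
suff : {ae mu, forall v, forall j : nat, cutoff j v * g v = 0}.
  apply: filterS => v h; have := h (Num.truncn `|v|).
  by rewrite cutoff1 ?mul1r//; exact: ltW (truncnS_gt _).
apply: ae_foralln => j.
have tj := @test_cutoff R n j; have mj := measurable_test tj.
have [M M0 hM] := test_cube tj.
have cj v : `|@cutoff R n j v| <= 1 by rewrite ger0_norm ?cutoff_ge0 ?cutoff_le1.
have [mw w2] := sq_integrable_loc sg mj cj hM.
have w0 v : ~ cube n M v -> cutoff j v * g v = 0 by move=> /hM ->; rewrite mul0r.
have z : (\int[leb]_v ((cutoff j v * g v) ^+ 2)%:E = 0)%E.
  apply/eqP; rewrite eq_le; apply/andP; split; last by apply: integral_ge0 => v _; rewrite lee_fin sqr_ge0.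
  apply/lee_addgt0Pr => e e0; rewrite add0e.
  have [K _ /(_ K (leqnn K))] := moll_L2 M0 mw w2 w0 e0.
  under eq_integral => x _.
    rewrite mollE// /mconv.
    under eq_Rintegral do rewrite mulrA mulrC.
    rewrite g0 ?sub0r ?sqrrN; last first.
      apply: (test_fun_supp tj) => [|y /supp_eq0 ->]; last by rewrite mulr0.
      apply: smoothM; last exact: test_fun_smooth tj.
      exact: (smooth_comp (@is_diff_translate R _ (- x)) (@smooth_mollifier R n K)).
    over.
  by [].
apply: ae_eq0_sq => //; have [C C0 hC] := wt_sq_le.
apply/eqP; rewrite eq_le integral_ge0 ?andbT; last by move=> v _; rewrite lee_fin sqr_ge0.
by apply: le_trans (hC _ mw) _; rewrite z mule0.
Qed.

Lemma L2_gradientP g h : L2_gradient mu g h <->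
  weak_gradient g h /\ forall i, sq_integrable mu (fun v => h v ord0 i).
Proof. by split=> -[wg h2]; split=> // i; apply/Lfun2P; exact: h2. Qed.

Lemma H1P g : H1 mu g <-> sq_integrable mu g /\ exists h, L2_gradient mu g h.
Proof. by split=> -[/Lfun2P g2 hg]; split=> //; exact/Lfun2P. Qed.

Lemma nablaP g : H1 mu g -> L2_gradient mu g (nabla mu g).
Proof. by move=> /H1P[_ [h hg]]; exact: (@xgetI _ (fun=> 0) (L2_gradient mu g) h hg). Qed.

Lemma L2_gradient_comb a g g' h h' : sq_integrable mu g -> sq_integrable mu g' ->
  L2_gradient mu g h -> L2_gradient mu g' h' ->
  L2_gradient mu (a *: g + g') (fun v => a *: h v + h' v).
Proof.
move=> sg sg' /L2_gradientP[wg h2] /L2_gradientP[wg' h2']; apply/L2_gradientP; split=> [phi tphi i|i]; last first.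
  under eq_fun do rewrite !mxE; exact: sq_integrableD (sq_integrableZ a (h2 i)) (h2' i).
have tD := test_funD (delta_mx ord0 i) tphi.
transitivity (a * \int[leb]_v (g v * 'D_(delta_mx ord0 i) phi v) + \int[leb]_v (g' v * 'D_(delta_mx ord0 i) phi v)).
  rewrite -RintegralZl//; last exact: integrable_mul_test tD.
  rewrite -RintegralD//; last exact: integrable_mul_test tD.
    by apply: eq_Rintegral => v _; rewrite mulrA -mulrDl.
  by apply: intZ => //; exact: integrable_mul_test tD.
rewrite wg// wg'// mulrN -opprD; congr (- _).
rewrite -RintegralZl//; last exact: (integrable_mul_test (h2 i) tphi).
rewrite -RintegralD//; last exact: (integrable_mul_test (h2' i) tphi).
  by apply: eq_Rintegral => v _; rewrite !mxE mulrA -mulrDl.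
by apply: intZ => //; exact: (integrable_mul_test (h2 i) tphi).
Qed.

Lemma L2_gradient_unique g h h' : L2_gradient mu g h -> L2_gradient mu g h' ->
  forall i, {ae mu, forall v, h v ord0 i = h' v ord0 i}.
Proof.
move=> /L2_gradientP[wg h2] /L2_gradientP[wg' h2'] i.
have := @ae_eq0_test (fun v => h v ord0 i - h' v ord0 i) (sq_integrableB (h2 i) (h2' i)).
move=> H; have : {ae mu, forall v, h v ord0 i - h' v ord0 i = 0}.
  apply: H => phi tphi; under eq_Rintegral do rewrite mulrBl.
  rewrite RintegralB//; [|exact: (integrable_mul_test (h2 i) tphi)|exact: (integrable_mul_test (h2' i) tphi)].
  by apply/eqP; rewrite subr_eq0 -eqr_opp -wg// -wg'.
by apply: filterS => v /eqP; rewrite subr_eq0 => /eqP.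
Qed.

Definition dot_grad g (h : 'rV[R]_n -> 'rV[R]_n) g' (h' : 'rV[R]_n -> 'rV[R]_n) : R :=
  \int[mu]_v (g v * g' v + \sum_i h v ord0 i * h' v ord0 i).

Definition H1dot g g' := dot_grad g (nabla mu g) g' (nabla mu g').

Lemma integrable_dot_grad g h g' h' : sq_integrable mu g -> sq_integrable mu g' ->
  (forall i, sq_integrable mu (fun v => h v ord0 i)) -> (forall i, sq_integrable mu (fun v => h' v ord0 i)) ->
  mu.-integrable setT (EFin \o (fun v => g v * g' v + \sum_i h v ord0 i * h' v ord0 i)).
Proof.
move=> sg sg' h2 h2'; apply: intD => //; first exact: sq_integrableM.
have [hh _] := @Rintegral_lincomb _ _ R mu setT 'I_n (index_enum 'I_n) (fun=> 1)
  (fun i v => h v ord0 i * h' v ord0 i) measurableT (fun i => sq_integrableM (h2 i) (h2' i)).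
by apply: eq_integrable hh => // v _ /=; congr EFin; apply: eq_bigr => i _; rewrite mul1r.
Qed.

(** [nabla] is a choice among weak gradients. Since these agree almost everywhere, the inner product
    may be computed with any of them, and every later norm computation uses this freedom. *)
Lemma H1dotE g h g' h' : H1 mu g -> H1 mu g' -> L2_gradient mu g h -> L2_gradient mu g' h' ->
  H1dot g g' = dot_grad g h g' h'.
Proof.
move=> Hg Hg' hg hg'; have := nablaP Hg; have := nablaP Hg'.
rewrite /H1dot; move: (nabla mu g) (nabla mu g') => k k' kg' kg.
have [[sg _] [sg' _]] := (proj1 (H1P g) Hg, proj1 (H1P g') Hg').
have [[_ h2] [_ h2']] := (proj1 (L2_gradientP _ _) hg, proj1 (L2_gradientP _ _) hg').
have [[_ k2] [_ k2']] := (proj1 (L2_gradientP _ _) kg, proj1 (L2_gradientP _ _) kg').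
have mdot (l l' : 'rV[R]_n -> 'rV[R]_n) : (forall i, sq_integrable mu (fun v => l v ord0 i)) ->
    (forall i, sq_integrable mu (fun v => l' v ord0 i)) ->
    measurable_fun setT (fun v => g v * g' v + \sum_i l v ord0 i * l' v ord0 i).
  move=> l2 l2'; apply: measurable_funD; first by apply: measurable_funM; [case: sg|case: sg'].
  by apply: measurable_sum => i; apply: measurable_funM; [case: (l2 i)|case: (l2' i)].
apply: ae_Rintegral; [exact: mdot|exact: mdot|].
have e1 : {ae mu, forall v, forall i, k v ord0 i = h v ord0 i}.
  by apply: filter_forall => i; exact: L2_gradient_unique kg hg i.
have e2 : {ae mu, forall v, forall i, k' v ord0 i = h' v ord0 i}.
  by apply: filter_forall => i; exact: L2_gradient_unique kg' hg' i.
apply: filterS2 e1 e2 => v e1 e2; congr (_ + _); apply: eq_bigr => i _.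
by rewrite e1 e2.
Qed.

Lemma H1_normE g : H1_norm mu g = Num.sqrt (H1dot g g).
Proof. by []. Qed.

Lemma H1_0 : H1 mu 0.
Proof.
have s0 : sq_integrable mu (0 : 'rV[R]_n -> R).
  split; first exact: measurable_cst.
  by under eq_integral do rewrite /= expr0n/=; rewrite integral0.
apply/H1P; split=> //; exists (fun=> 0); apply/L2_gradientP; split=> [phi tphi i|i].
  under eq_Rintegral do rewrite mul0r; under [in RHS]eq_Rintegral do rewrite mxE mul0r.
  by rewrite Rintegral_cst// mul0r oppr0.
by under eq_fun do rewrite mxE; exact: s0.
Qed.

Lemma H1_comb a g g' : H1 mu g -> H1 mu g' -> H1 mu (a *: g + g').
Proof.
move=> /H1P[sg [h hg]] /H1P[sg' [h' hg']]; apply/H1P; split.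
  exact: sq_integrableD (sq_integrableZ a sg) sg'.
by eexists; exact: L2_gradient_comb hg hg'.
Qed.

Lemma H1dotC g g' : H1dot g g' = H1dot g' g.
Proof. by apply: eq_Rintegral => v _; rewrite mulrC; congr (_ + _); apply: eq_bigr => i _; rewrite mulrC. Qed.

Lemma H1dotD a g g' f : H1 mu g -> H1 mu g' -> H1 mu f ->
  H1dot (a *: g + g') f = a * H1dot g f + H1dot g' f.
Proof.
move=> Hg Hg' Hf.
have [[sg _] [sg' _]] := (proj1 (H1P g) Hg, proj1 (H1P g') Hg'); have [sf _] := proj1 (H1P f) Hf.
have nc := L2_gradient_comb a sg sg' (nablaP Hg) (nablaP Hg').
rewrite (H1dotE (H1_comb a Hg Hg') Hf nc (nablaP Hf)) /H1dot /dot_grad.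
have [_ h2] := proj1 (L2_gradientP _ _) (nablaP Hg).
have [_ h2'] := proj1 (L2_gradientP _ _) (nablaP Hg').
have [_ k2] := proj1 (L2_gradientP _ _) (nablaP Hf).
rewrite -RintegralZl//; last exact: integrable_dot_grad.
rewrite -RintegralD//; [|by apply: intZ => //; exact: integrable_dot_grad|exact: integrable_dot_grad].
apply: eq_Rintegral => v _; rewrite mulrDr addrACA; congr (_ + _).
  by rewrite mulrA -mulrDl.
by rewrite mulr_sumr -big_split/=; apply: eq_bigr => i _; rewrite !mxE mulrA -mulrDl.
Qed.

Lemma H1dot_ge0 g : 0 <= H1dot g g.
Proof.
by apply: Rintegral_ge0 => v _; rewrite addr_ge0 ?sqr_ge0//; apply: sumr_ge0 => i _; exact: sqr_ge0.
Qed.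

Lemma H1_seminorm : seminorm_on (H1 mu) (H1_norm mu).
Proof.
apply: semi_inner_seminorm H1dot_ge0; [exact: H1_0|exact: H1_comb| |exact: H1dotD].
by move=> e f _ _; exact: H1dotC.
Qed.

Lemma H1_norm_ge0 g : 0 <= H1_norm mu g.
Proof. exact: sn_ge0 H1_seminorm g. Qed.

Lemma H1_norm_sqE g h : H1 mu g -> L2_gradient mu g h ->
  H1_norm mu g ^+ 2 = \int[mu]_v (g v ^+ 2 + \sum_i h v ord0 i ^+ 2).
Proof. by move=> Hg hg; rewrite H1_normE sqr_sqrtr ?H1dot_ge0// (H1dotE Hg Hg hg hg). Qed.

Lemma H1_norm_sqEFin g h : H1 mu g -> L2_gradient mu g h ->
  (H1_norm mu g ^+ 2)%:E = (\int[mu]_v (g v ^+ 2 + \sum_i h v ord0 i ^+ 2)%:E)%E.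
Proof.
move=> Hg hg; rewrite (H1_norm_sqE Hg hg); have [sg _] := proj1 (H1P g) Hg.
by have [_ h2] := proj1 (L2_gradientP _ _) hg; rewrite -EFin_Rintegral//; exact: integrable_dot_grad.
Qed.

Lemma L2_le_H1_norm g : H1 mu g -> \int[mu]_v (g v ^+ 2) <= H1_norm mu g ^+ 2.
Proof.
move=> Hg; rewrite (H1_norm_sqE Hg (nablaP Hg)); have [sg _] := proj1 (H1P g) Hg.
have [_ h2] := proj1 (L2_gradientP _ _) (nablaP Hg).
apply: le_Rintegral => //; [exact: sq_integrableP|exact: integrable_dot_grad|].
by move=> v _; rewrite lerDl; apply: sumr_ge0 => i _; exact: sqr_ge0.
Qed.

Lemma H1_norm_le g h g' h' C : 0 <= C -> H1 mu g -> L2_gradient mu g h -> H1 mu g' -> L2_gradient mu g' h' ->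
  (forall v, g v ^+ 2 + \sum_i h v ord0 i ^+ 2 <= C ^+ 2 * (g' v ^+ 2 + \sum_i h' v ord0 i ^+ 2)) ->
  H1_norm mu g <= C * H1_norm mu g'.
Proof.
move=> C0 Hg hg Hg' hg' le; rewrite -ler_sqr ?nnegrE ?mulr_ge0 ?H1_norm_ge0// exprMn.
rewrite [leLHS](H1_norm_sqE Hg hg) [X in _ <= _ * X](H1_norm_sqE Hg' hg').
have [[sg _] [sg' _]] := (proj1 (H1P g) Hg, proj1 (H1P g') Hg').
have [[_ h2] [_ h2']] := (proj1 (L2_gradientP _ _) hg, proj1 (L2_gradientP _ _) hg').
rewrite -RintegralZl//; last exact: integrable_dot_grad.
apply: le_Rintegral => //; first exact: integrable_dot_grad.
by apply: intZ => //; exact: integrable_dot_grad.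
Qed.

Lemma L2_gradient_mul chi g h A B : test_fun setT chi -> (forall v, `|chi v| <= A) ->
  (forall v i, `|'D_(delta_mx ord0 i) chi v| <= B) -> sq_integrable mu g -> L2_gradient mu g h ->
  L2_gradient mu (fun v => chi v * g v) (fun v => chi v *: h v + \row_i (g v * 'D_(delta_mx ord0 i) chi v)).
Proof.
move=> tchi cA cB sg /L2_gradientP[wg h2]; have mchi := measurable_test tchi; have [mg _] := sg.
apply/L2_gradientP; split=> [phi tphi i|i]; last first.
  under eq_fun do rewrite !mxE; apply: sq_integrableD.
    apply: (sq_integrable_le (C := A) _ _ (h2 i)); first by apply: measurable_funM => //; case: (h2 i).
    by move=> v; rewrite normrM ler_wpM2r.
  apply: (sq_integrable_le (C := B) _ _ sg) => [|v]; last by rewrite normrM mulrC ler_wpM2r.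
  by apply: measurable_funM => //; exact: measurable_test (test_funD _ tchi).
have sphi := test_fun_smooth tphi; have schi := test_fun_smooth tchi.
have tp : test_fun setT (fun v => chi v * phi v) by exact: test_funM.
have tDp : test_fun setT (fun v => 'D_(delta_mx ord0 i) chi v * phi v).
  by apply: test_funM sphi; exact: test_funD.
have e v : chi v * g v * 'D_(delta_mx ord0 i) phi v =
    g v * 'D_(delta_mx ord0 i) (fun v => chi v * phi v) v - g v * ('D_(delta_mx ord0 i) chi v * phi v).
  have dc : derivable chi v (delta_mx ord0 i) by exact: smooth_derivable.
  have dp : derivable phi v (delta_mx ord0 i) by exact: smooth_derivable.
  rewrite (deriveM dc dp) /GRing.scale/=; ring.
under eq_Rintegral do rewrite e.
rewrite RintegralB//; last 2 first.
- exact: (integrable_mul_test sg (test_funD _ tp)).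
- exact: (integrable_mul_test sg tDp).
rewrite wg// -opprD; congr (- _).
rewrite -RintegralD//; [|exact: (integrable_mul_test (h2 i) tp)|exact: (integrable_mul_test sg tDp)].
by apply: eq_Rintegral => v _; rewrite !mxE; ring.
Qed.

Lemma H1_mul chi A B : test_fun setT chi -> (forall v, `|chi v| <= A) ->
  (forall v i, `|'D_(delta_mx ord0 i) chi v| <= B) ->
  forall g, H1 mu g -> H1 mu (fun v => chi v * g v) /\
    H1_norm mu (fun v => chi v * g v) <= Num.sqrt (2 * A ^+ 2 + 2 * n%:R * B ^+ 2) * H1_norm mu g.
Proof.
move=> tchi cA cB g Hg; have [sg _] := proj1 (H1P g) Hg.
have hm := L2_gradient_mul tchi cA cB sg (nablaP Hg).
have Hm : H1 mu (fun v => chi v * g v).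
  apply/H1P; split; last by eexists; exact: hm.
  apply: (sq_integrable_le (C := A) _ _ sg) => [|v]; last by rewrite normrM ler_wpM2r.
  by apply: measurable_funM; [exact: measurable_test tchi|case: sg].
split=> //; apply: (H1_norm_le _ Hm hm Hg (nablaP Hg)); first exact: sqrtr_ge0.
move=> v; rewrite sqr_sqrtr; last by apply: addr_ge0; apply: mulr_ge0; rewrite ?sqr_ge0// mulr_ge0.
have sqb (x y : R) : `|x| <= y -> x ^+ 2 <= y ^+ 2.
  by move=> xy; rewrite -[leLHS]real_normK ?num_real// ler_sqr ?nnegrE// (le_trans _ xy).
have cA2 : chi v ^+ 2 <= A ^+ 2 by exact: sqb.
apply: (@le_trans _ _ (A ^+ 2 * g v ^+ 2 +
    \sum_i (2 * A ^+ 2 * nabla mu g v ord0 i ^+ 2 + 2 * B ^+ 2 * g v ^+ 2))).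
  rewrite exprMn; apply: lerD; first by rewrite ler_wpM2r ?sqr_ge0.
  apply: ler_sum => i _; rewrite !mxE.
  have cB2 : 'D_(delta_mx ord0 i) chi v ^+ 2 <= B ^+ 2 by exact: sqb.
  apply: (@le_trans _ _ (2 * (chi v ^+ 2 * nabla mu g v ord0 i ^+ 2) + 2 * ('D_(delta_mx ord0 i) chi v ^+ 2 * g v ^+ 2))).
    have := sqr_ge0 (chi v * nabla mu g v ord0 i - g v * 'D_(delta_mx ord0 i) chi v); nra.
  have k1 := ler_wpM2r (sqr_ge0 (nabla mu g v ord0 i)) cA2; have k2 := ler_wpM2r (sqr_ge0 (g v)) cB2; lra.
rewrite big_split/= -mulr_sumr sumr_const card_ord -mulr_natl.
set S := \sum_i _; have S0 : 0 <= S by apply: sumr_ge0 => i _; exact: sqr_ge0.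
have a0 := sqr_ge0 A; have b0 := sqr_ge0 B; have g0 := sqr_ge0 (g v); have n0 : 0 <= n%:R :> R by [].
have := mulr_ge0 a0 g0; have := mulr_ge0 n0 (mulr_ge0 b0 S0); nra.
Qed.

Lemma H1_cutoff : exists2 C, 0 <= C & forall j g, H1 mu g ->
  H1 mu (fun v => cutoff j v * g v) /\ H1_norm mu (fun v => cutoff j v * g v) <= C * H1_norm mu g.
Proof.
have [B _ hB] := cutoff_derive_bounded (R := R) n.
exists (Num.sqrt (2 * 1 ^+ 2 + 2 * n%:R * B ^+ 2)) => [|j g]; first exact: sqrtr_ge0.
apply: H1_mul; first exact: test_cutoff.
- by move=> v; rewrite ger0_norm ?cutoff_ge0 ?cutoff_le1.
- exact: hB.
Qed.

Lemma H1_cutoff_mem j g : H1 mu g -> H1 mu (fun v => cutoff j v * g v).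
Proof. by move=> Hg; have [C _ hC] := H1_cutoff; have [] := hC j g Hg. Qed.

Lemma cutoff_derive0 j v (e : 'rV[R]_n) : `|v| < j.+1%:R -> 'D_e (@cutoff R n j) v = 0.
Proof.
move=> vj; rewrite -(derive_cst (1 : R) v e); apply: near_eq_derive.
have : nbhs v [set x : 'rV[R]_n | `|x| < j.+1%:R].
  apply: open_nbhs_nbhs; split=> //.
  have : open ((fun x : 'rV[R]_n => `|x|) @^-1` [set y : R | y < j.+1%:R]).
    by apply: open_comp; [move=> x _; exact: norm_continuous|exact: open_lt].
  by [].
by apply: filterS => x xj; rewrite cutoff1// ltW.
Qed.

Lemma L2_gradientB g g' h h' : sq_integrable mu g -> sq_integrable mu g' ->
  L2_gradient mu g h -> L2_gradient mu g' h' -> L2_gradient mu (g - g') (fun v => h v - h' v).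
Proof.
move=> sg sg' hg hg'; have := L2_gradient_comb (-1) sg' sg hg' hg.
by rewrite scaleN1r addrC; under [X in L2_gradient _ _ X -> _]eq_fun do rewrite scaleN1r addrC.
Qed.

Lemma H1B g g' : H1 mu g -> H1 mu g' -> H1 mu (g - g').
Proof. by move=> h1 h2; exact: (smB H1_seminorm h1 h2). Qed.

(** At a fixed velocity the cutoff is eventually 1 near that point and its gradient eventually 0, so
    the integrand is eventually zero; the uniform bound on the derivatives of the cutoffs provides
    the majorant. *)
Lemma H1_cutoff_cvg g (del : R) : H1 mu g -> 0 < del ->
  \forall j \near \oo, H1_norm mu ((fun v => cutoff j v * g v) - g) <= del.
Proof.
move=> Hg d0; have [C C0 hC] := H1_cutoff; have [B B0 hB] := cutoff_derive_bounded (R := R) n.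
have [sg _] := proj1 (H1P g) Hg; have hg := nablaP Hg; have [_ h2] := proj1 (L2_gradientP _ _) hg.
move: (nabla mu g) hg h2 => h hg h2.
have c1 j v : `|@cutoff R n j v| <= 1 by rewrite ger0_norm ?cutoff_ge0 ?cutoff_le1.
have Hj j : H1 mu ((fun v => cutoff j v * g v) - g) by apply: H1B => //; have [] := hC j g Hg.
have hj j := L2_gradientB (proj1 (proj1 (H1P _) (hC j g Hg).1)) sg
  (L2_gradient_mul (@test_cutoff R n j) (c1 j) (hB j) sg hg) hg.
have e j := H1_norm_sqEFin (Hj j) (hj j).
pose I j v : R := ((fun v => cutoff j v * g v) - g) v ^+ 2 +
  \sum_i (cutoff j v *: h v + \row_i0 (g v * 'D_(delta_mx ord0 i0) (cutoff j) v) - h v) ord0 i ^+ 2.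
pose G v : R := g v ^+ 2 + \sum_i (2 * h v ord0 i ^+ 2 + 2 * B ^+ 2 * g v ^+ 2).
have iG : mu.-integrable setT (EFin \o G).
  apply: intD => //; first exact: sq_integrableP.
  have [hh _] := @Rintegral_lincomb _ _ R mu setT 'I_n (index_enum 'I_n) (fun=> 1)
    (fun i v => 2 * h v ord0 i ^+ 2 + 2 * B ^+ 2 * g v ^+ 2) measurableT
    (fun i => intD measurableT (intZ 2 measurableT (sq_integrableP (h2 i))) (intZ (2 * B ^+ 2) measurableT (sq_integrableP sg))).
  by apply: eq_integrable hh => // v _ /=; congr EFin; apply: eq_bigr => i _; rewrite mul1r.
have [|||||_ _ cv] := @dominated_convergence _ _ R mu setT measurableT (fun j v => (I j v)%:E) (cst 0%E) (EFin \o G).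
- move=> j; have [sj _] := proj1 (H1P _) (Hj j); have [_ h2j] := proj1 (L2_gradientP _ _) (hj j).
  by have := @integrable_dot_grad _ _ _ _ sj sj h2j h2j => /measurable_int.
- exact: measurable_cst.
- apply: aeW => v _; apply: cvg_near_cst; near=> j.
  have vj : `|v| < j.+1%:R.
    apply: lt_le_trans (truncnS_gt _) _; rewrite ler_nat ltnS; near: j; exact: nbhs_infty_ge.
  rewrite /I big1 => [|i _]; first by rewrite !fctE cutoff1 ?ltW// mul1r subrr expr0n addr0.
  by rewrite cutoff1 ?ltW// !mxE cutoff_derive0// mulr0 addr0 mul1r subrr expr0n.
- exact: iG.
- apply: aeW => v j _; rewrite gee0_abs; last by rewrite lee_fin addr_ge0 ?sqr_ge0// sumr_ge0// => i _; rewrite sqr_ge0.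
  rewrite lee_fin; apply: lerD.
    rewrite !fctE; have := cutoff_ge0 j v; have := cutoff_le1 j v; move: (cutoff j v) => c c11 c00.
    rewrite (_ : c * g v - g v = (c - 1) * g v); last by ring.
    by rewrite exprMn ler_piMl ?sqr_ge0//; nra.
  apply: ler_sum => i _; rewrite !mxE.
  have := cutoff_ge0 j v; have := cutoff_le1 j v; move: (cutoff j v) => c c11 c00.
  have k1 : 'D_(delta_mx ord0 i) (cutoff j) v ^+ 2 <= B ^+ 2.
    by rewrite -[leLHS]real_normK ?num_real// ler_sqr ?nnegrE.
  move: ('D_ _ _ _) k1 => D k1.
  have := ler_wpM2r (sqr_ge0 (g v)) k1.
  have k2 : (c - 1) ^+ 2 <= 1 by nra.
  have := ler_wpM2r (sqr_ge0 (h v ord0 i)) k2.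
  have := sqr_ge0 ((c - 1) * h v ord0 i - g v * D).
  nra.
move: cv; rewrite integral0 => /fine_cvgP[_ /cvgr0Pnorm_le/(_ _ (exprn_gt0 2 d0))].
apply: filterS => j /=; rewrite /I -(e j) /= ger0_norm ?sqr_ge0//.
by rewrite ler_sqr ?nnegrE ?H1_norm_ge0// ltW.
Unshelve. all: by end_near. Qed.

(** Meant for the product of a test function with the boundary multiplier, for which only first
    partial derivatives are computed. Integration by parts is the vanishing of the integral of the
    derivative of [g * phi]. *)
Lemma H1_C1 g h M C B : measurable_fun setT g -> (forall v, `|g v| <= B) ->
  (forall v i, is_derive v (delta_mx ord0 i) g (h v ord0 i)) -> (forall v i, `|h v ord0 i| <= C) ->
  (forall v, ~ cube n M v -> g v = 0) -> sq_integrable mu g /\ L2_gradient mu g h.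
Proof.
move=> mg gB dg hC g0; have [Cm Cm0 hCm] := wt_sq_le.
have bsq f K : (forall v, `|f v| <= K) -> leb.-integrable setT (EFin \o f) -> sq_integrable mu f.
  move=> fK fi; have mf : measurable_fun setT f by apply/measurable_EFinP; exact: measurable_int fi.
  split=> //; apply: le_lt_trans (hCm _ mf) _; rewrite lte_mul_pinfty//.
  have := integrableM_bounded measurableT mf (fun v _ => fK v) fi.
  by case/integrableP => _; under eq_integral do rewrite /= -expr2 ger0_norm ?sqr_ge0//.
split; first by apply: (bsq _ B) => //; exact: integrable_bounded_cube g0.
have ih i : leb.-integrable setT (EFin \o (fun v => h v ord0 i)).
  by have [] := integral_derive_eq0 mg gB (dg^~ i) (hC^~ i) g0.
apply/L2_gradientP; split=> [phi tphi i|i]; last by apply: (bsq _ C) => //; exact: ih.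
have sphi := test_fun_smooth tphi; have mphi := measurable_test tphi.
have [P P0 hP] := test_bounded tphi; have tD := test_funD (delta_mx ord0 i) tphi.
have [Q Q0 hQ] := test_bounded tD.
have B0 : 0 <= B by apply: le_trans (gB 0).
have C0 : 0 <= C by apply: le_trans (hC 0 i).
have [|||||i0 e0] := @integral_derive_eq0 R n (fun v => g v * phi v)
  (fun v => g v * 'D_(delta_mx ord0 i) phi v + phi v * h v ord0 i) (delta_mx ord0 i) (B * Q + P * C) (B * P) M.
- exact: measurable_funM.
- by move=> v; rewrite normrM ler_pM.
- move=> v; have dphi : is_derive v (delta_mx ord0 i) phi ('D_(delta_mx ord0 i) phi v).
    by apply: DeriveDef => //; exact: smooth_derivable.
  exact: (is_deriveM (dg v i) dphi).
- by move=> v; apply: le_trans (ler_normD _ _) _; rewrite !normrM; apply: lerD; apply: ler_pM.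
- by move=> v /g0 ->; rewrite mul0r.
have i1 : leb.-integrable setT (EFin \o (fun v => g v * 'D_(delta_mx ord0 i) phi v)).
  by apply: (integrableM_bounded (C := B)) => //; exact: integrable_test tD.
have i2 : leb.-integrable setT (EFin \o (fun v => phi v * h v ord0 i)).
  by apply: (integrableM_bounded (C := P)).
move: e0; rewrite RintegralD// => /eqP; rewrite addr_eq0 => /eqP ->.
by congr (- _); apply: eq_Rintegral => v _; rewrite mulrC.
Qed.

Lemma test_H1 U phi : test_fun U phi ->
  H1 mu phi /\ L2_gradient mu phi (fun v => \row_i 'D_(delta_mx ord0 i) phi v).
Proof.
move=> tphi; have [B _ hB] := test_bounded tphi; have [M _ hM] := test_cube tphi.
have /choice[C hC] : forall i : 'I_n, exists C, 0 <= C /\ forall v, `|'D_(delta_mx ord0 i) phi v| <= C.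
  by move=> i; have [C C0 h] := test_bounded (test_funD (delta_mx ord0 i) tphi); exists C.
have [|v i|v i|sg hg] := @H1_C1 phi (fun v => \row_i 'D_(delta_mx ord0 i) phi v) M (\sum_i C i) B _ hB _ _ hM.
- exact: measurable_test tphi.
- by rewrite mxE; apply: DeriveDef => //; apply: smooth_derivable; exact: test_fun_smooth tphi.
- rewrite mxE; apply: le_trans (proj2 (hC i) v) _; rewrite (bigD1 i)//= lerDl.
  by apply: sumr_ge0 => k _; have [] := hC k.
by split=> //; apply/H1P; split=> //; eexists; exact: hg.
Qed.

(** The derivative falls on the kernel; the translated kernel is a test function, and the definition
    of the weak gradient carries the derivative over to [w]. *)
Lemma derive_moll l (w : 'rV[R]_n -> R) (k : 'rV[R]_n -> 'rV[R]_n) i v : leb.-integrable setT (EFin \o w) ->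
  measurable_fun setT (fun v : 'rV[R]_n => k v ord0 i) -> weak_gradient w k ->
  'D_(delta_mx ord0 i) (moll l w) v = moll l (fun v => k v ord0 i) v.
Proof.
move=> wi mk wg; have mw : measurable_fun setT w by apply/measurable_EFinP; exact: measurable_int wi.
rewrite (mollE l mw) (derive_conv wi v (delta_mx ord0 i) (test_mollifier n l)) (mollE l mk).
have tr : test_fun setT (fun y => @mollifier R n l (y - v)).
  apply: (test_fun_rV (M := l.+1%:R^-1 + `|v|)).
    exact: (smooth_comp (@is_diff_translate R _ (- v)) (@smooth_mollifier R n l)).
  move=> y ry; rewrite -{1}(subrK v y); apply: le_trans (ler_normD _ _) _; rewrite lerD2r.
  apply: rV_norm_le => [|i0]; first by rewrite invr_ge0.
  by have /andP[a b] := mollifier_supp ry i0; rewrite ger0_norm ltW.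
have e1 y : 'D_(delta_mx ord0 i) (fun y => @mollifier R n l (y - v)) y = 'D_(delta_mx ord0 i) (@mollifier R n l) (y - v).
  have := @derive_comp_affine R _ _ (@mollifier R n l) (fun x => x - v) id y (delta_mx ord0 i) (is_diff_translate (- v) y).
  by move=> ->//; apply: smooth_differentiable; exact: smooth_mollifier.
rewrite /mconv; transitivity (- \int[leb]_y (w y * 'D_(delta_mx ord0 i) (fun y => @mollifier R n l (y - v)) y)).
  by congr (- _); apply: eq_Rintegral => y _; exact: (etrans (mulrC _ _) (congr1 (fun z => w y * z) (esym (e1 y)))).
by rewrite wg// opprK; apply: eq_Rintegral => y _; rewrite mulrC.
Qed.

(** Cutoff, then mollification. The latter is estimated for Lebesgue measure, where translation
    invariance holds: the truncated function and its gradient have bounded support, so they are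
    square integrable there too, and the bound on the density returns to [mu]. *)
Lemma H1_dense g (del : R) : H1 mu g -> 0 < del ->
  exists phi, test_fun setT phi /\ H1_norm mu (phi - g) <= del.
Proof.
move=> Hg d0; have d20 : 0 < del / 2 by rewrite divr_gt0.
have [j _ /(_ j (leqnn j)) hj] := H1_cutoff_cvg Hg d20.
have [sg _] := proj1 (H1P g) Hg; have [B B0 hB] := cutoff_derive_bounded (R := R) n.
have tj := @test_cutoff R n j; have mj := measurable_test tj.
have [_ [_ /(_ j g Hg)[Hw _]]] : exists2 C, 0 <= C & forall j g, H1 mu g ->
  H1 mu (fun v => cutoff j v * g v) /\ H1_norm mu (fun v => cutoff j v * g v) <= C * H1_norm mu g.
  exact: H1_cutoff.
have cj v : `|@cutoff R n j v| <= 1 by rewrite ger0_norm ?cutoff_ge0 ?cutoff_le1.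
have hg := nablaP Hg; have [_ h2] := proj1 (L2_gradientP _ _) hg.
move: (nabla mu g) hg h2 => h hg h2.
have hw := L2_gradient_mul tj cj (hB j) sg hg.
pose w := fun v => cutoff j v * g v.
pose k := fun v => cutoff j v *: h v + \row_i (g v * 'D_(delta_mx ord0 i) (cutoff j) v).
have kE v i : k v ord0 i = cutoff j v * h v ord0 i + g v * 'D_(delta_mx ord0 i) (cutoff j) v by rewrite /k !mxE.
have [M M0 hM] := test_cube tj.
have hMD i v : ~ cube n M v -> 'D_(delta_mx ord0 i) (@cutoff R n j) v = 0.
  move=> nc; apply: derive_eq0_supp => sv; apply: nc.
  have : supp (@cutoff R n j) `<=` [set x | cube n M x].
    apply: supp_subset_closed => [|x cx]; last by apply: contrapT => /hM e; rewrite e eqxx in cx.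
    rewrite (_ : [set x | _] = \bigcap_i ((fun x : 'rV[R]_n => `|x ord0 i|) @^-1` [set y | y <= M])).
      apply: closed_bigI => i0 _; apply: preimage_closed; last exact: closed_le.
      by move=> x _; apply: (@continuous_comp _ _ _ (fun x : 'rV[R]_n => x ord0 i0)); [exact: coord_continuous|exact: norm_continuous].
    by apply/seteqP; split=> [x cx i0 _|x cx i0]; [exact: cx|exact: cx i0 I].
  by apply.
have lw : sq_integrable leb w := sq_integrable_loc sg mj cj hM.
have lk i : sq_integrable leb (fun v => k v ord0 i).
  rewrite /k; under eq_fun do rewrite !mxE; apply: sq_integrableD.
    exact: sq_integrable_loc (h2 i) mj cj hM.
  under eq_fun do rewrite mulrC.
  exact: sq_integrable_loc sg (measurable_test (test_funD _ tj)) (hB j ^~ i) (hMD i).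
have w0 v : ~ cube n M v -> w v = 0 by move=> /hM e; rewrite /w e mul0r.
have k0 i v : ~ cube n M v -> k v ord0 i = 0.
  by move=> nc; rewrite /k !mxE hM// hMD// mul0r mulr0 addr0.
have [Cm Cm0 hCm] := wt_sq_le.
(* The function and its [n] partial derivatives each cost at most [Cm * eps] in [mu], and the total
   must stay below the square of del/2. *)
pose eps := (del / 2) ^+ 2 / ((Cm + 1) * (n%:R + 1)).
have e0 : 0 < eps by rewrite divr_gt0 ?exprn_gt0// mulr_gt0 ?ltr_wpDl.
have nk : \forall l \near \oo, (\int[leb]_x ((moll l w x - w x) ^+ 2)%:E <= eps%:E)%E /\
    forall i, (\int[leb]_x ((moll l (fun v => k v ord0 i) x - k x ord0 i) ^+ 2)%:E <= eps%:E)%E.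
  have n1 := moll_L2 M0 lw.1 lw.2 w0 e0.
  have n2 : \forall l \near \oo, forall i, (\int[leb]_x ((moll l (fun v => k v ord0 i) x - k x ord0 i) ^+ 2)%:E <= eps%:E)%E.
    by apply: filter_forall => i; exact: moll_L2 M0 (lk i).1 (lk i).2 (k0 i) e0.
  by apply: filterS2 n1 n2.
have [l _ /(_ l (leqnn l)) [hl1 hl2]] := nk.
have wi := square_integrable_cube lw.1 lw.2 w0.
have tm := test_moll l wi M0 w0.
exists (moll l w); split=> //.
have [Hm hm] := test_H1 tm.
have De v i : 'D_(delta_mx ord0 i) (moll l w) v = moll l (fun v => k v ord0 i) v.
  by apply: derive_moll => //; [exact: (lk i).1|exact: (proj1 (proj1 (L2_gradientP _ _) hw))].
rewrite (_ : moll l w - g = (moll l w - w) + (w - g)); last by rewrite addrA subrK.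
rewrite [leRHS](splitr del); apply: le_trans (snD H1_seminorm _ _) _; [exact: H1B|exact: H1B|apply: lerD; last exact: hj].
have sm := proj1 (proj1 (H1P _) Hm); have sw := proj1 (proj1 (H1P _) Hw).
have hd := L2_gradientB sm sw hm hw.
rewrite -ler_sqr ?nnegrE ?H1_norm_ge0 ?(ltW d20)// -lee_fin (H1_norm_sqEFin (H1B Hm Hw) hd).
have mml i : measurable_fun setT (moll l (fun v => k v ord0 i)).
  by have wk := square_integrable_cube (lk i).1 (lk i).2 (k0 i); exact: measurable_test (test_moll l wk M0 (k0 i)).
have msq f : measurable_fun setT f -> measurable_fun setT (fun v => (f v ^+ 2)%:E : \bar R).
  by move=> mf; apply/measurable_EFinP; exact: measurable_funX.
have m1 : measurable_fun setT (fun v => moll l w v - w v).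
  by apply: measurable_funB; [exact: measurable_test tm|exact: lw.1].
have m2 i : measurable_fun setT (fun v => moll l (fun v => k v ord0 i) v - k v ord0 i).
  by apply: measurable_funB => //; exact: (lk i).1.
under eq_integral => v _.
  under eq_bigr do rewrite !mxE De -kE.
  over.
rewrite (_ : (fun v => _) = (fun v => ((moll l w v - w v) ^+ 2)%:E +
    \sum_i ((moll l (fun v => k v ord0 i) v - k v ord0 i) ^+ 2)%:E)%E); last first.
  by apply/funext => v; rewrite sumEFin -EFinD.
rewrite ge0_integralD//; last 4 first.
- by move=> v _; rewrite lee_fin sqr_ge0.
- exact: msq.
- by move=> v _; apply: sume_ge0 => i _; rewrite lee_fin sqr_ge0.
- by apply: emeasurable_sum => i; exact: msq.
rewrite ge0_integral_sum//; [|by move=> i; exact: msq|by move=> i v _; rewrite lee_fin sqr_ge0].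
apply: (@le_trans _ _ ((Cm * eps)%:E + \sum_(i < n) (Cm * eps)%:E)%E).
  apply: leeD.
    by apply: le_trans (hCm _ m1) _; rewrite EFinM lee_wpmul2l.
  apply: lee_sum => i _.
  by apply: le_trans (hCm _ (m2 i)) _; rewrite EFinM lee_wpmul2l.
rewrite sumEFin -EFinD lee_fin sumr_const card_ord -[X in _ + X <= _]mulr_natl.
rewrite (_ : Cm * eps + n%:R * (Cm * eps) = eps * (Cm * (n%:R + 1))); last by ring.
rewrite /eps mulrAC ler_pdivrMr ?mulr_gt0 ?ltr_wpDl// ler_pM2l ?exprn_gt0// ler_pM2r ?ltr_wpDl//.
by rewrite lerDl.
Qed.

Implicit Types (l : ('rV[R]_n -> R) -> R).

Lemma Hm1_0 l : Hm1 mu l -> l 0 = 0.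
Proof.
move=> [hl [C hC]]; apply/eqP; rewrite -normr_le0; apply: le_trans (hC _ H1_0) _.
by rewrite (sn0 H1_seminorm) mulr0.
Qed.

Lemma Hm1Z l a g : Hm1 mu l -> H1 mu g -> l (a *: g) = a * l g.
Proof. by move=> ml Hg; rewrite -[a *: g]addr0 ml.1//; [rewrite (Hm1_0 ml) addr0|exact: H1_0]. Qed.

Lemma Hm1N l g : Hm1 mu l -> H1 mu g -> l (- g) = - l g.
Proof. by move=> ml Hg; rewrite -scaleN1r Hm1Z// mulN1r. Qed.

Lemma Hm1D l g g' : Hm1 mu l -> H1 mu g -> H1 mu g' -> l (g + g') = l g + l g'.
Proof. by move=> ml Hg Hg'; rewrite -[g]scale1r ml.1// mul1r scale1r. Qed.

Lemma Hm1B l g g' : Hm1 mu l -> H1 mu g -> H1 mu g' -> l (g - g') = l g - l g'.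
Proof. by move=> ml Hg Hg'; rewrite addrC -scaleN1r ml.1// mulN1r addrC. Qed.

Let unit_values l := [set `|l g| | g in [set g | H1 mu g /\ H1_norm mu g <= 1]].

Let unit_values0 l : unit_values l `|l 0|.
Proof. by exists 0 => //; split; [exact: H1_0|rewrite (sn0 H1_seminorm)]. Qed.

Lemma Hm1_norm_le l C : (forall g, H1 mu g -> H1_norm mu g <= 1 -> `|l g| <= C) -> Hm1_norm mu l <= C.
Proof.
move=> h; apply: ge_sup; first by exists `|l 0|; exact: unit_values0.
by move=> _ [g [Hg g1] <-]; exact: h.
Qed.

(** Holds for an arbitrary functional: when the values on the unit ball are unbounded, the supremum
    is 0 by convention. *)
Lemma Hm1_norm_ge0 l : 0 <= Hm1_norm mu l.
Proof.
have [hs|/sup_out e] := pselect (has_sup (unit_values l)); last by rewrite /Hm1_norm e.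
apply: le_trans (normr_ge0 (l 0)) _; apply: sup_upper_bound => //; exact: unit_values0.
Qed.

Lemma Hm1_has_sup l : Hm1 mu l -> has_sup (unit_values l).
Proof.
move=> [_ [C hC]]; split; first by exists `|l 0|; exact: unit_values0.
exists `|C| => _ [g [Hg g1] <-]; apply: le_trans (hC g Hg) _; apply: le_trans (ler_norm _) _.
by rewrite normrM ler_piMr// ger0_norm ?H1_norm_ge0.
Qed.

(** Normalisation, except when the seminorm of [g] is zero: then the a priori bound in the
    definition of [Hm1] already makes [l g] vanish. *)
Lemma Hm1_le l g : Hm1 mu l -> H1 mu g -> `|l g| <= Hm1_norm mu l * H1_norm mu g.
Proof.
move=> ml Hg; have [g0|g0] := eqVneq (H1_norm mu g) 0.
  by have [_ [C hC]] := ml; have := hC g Hg; rewrite g0 !mulr0.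
have gp : 0 < H1_norm mu g by rewrite lt_neqAle eq_sym g0 H1_norm_ge0.
rewrite -ler_pdivrMr// -[(H1_norm mu g)^-1]gtr0_norm ?invr_gt0// mulrC -normrM -Hm1Z//.
apply: sup_upper_bound; first exact: Hm1_has_sup.
exists ((H1_norm mu g)^-1 *: g) => //; split; first exact: smZ H1_seminorm _ _ Hg.
by rewrite (snZ H1_seminorm _ Hg) gtr0_norm ?invr_gt0// mulVf.
Qed.

Lemma Hm1_seminorm : seminorm_on (Hm1 mu) (Hm1_norm mu).
Proof.
split=> [|l l' ml ml'|a l ml|l|l l' ml ml'|a l ml].
- split=> [a g g' _ _|]; first by rewrite mulr0 addr0.
  by exists 0 => g _; rewrite normr0 mul0r.
- split=> [a g g' Hg Hg'|]; first by rewrite !fctE ml.1// ml'.1// mulrDr addrACA.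
  exists (Hm1_norm mu l + Hm1_norm mu l') => g Hg; rewrite mulrDl.
  by apply: le_trans (ler_normD _ _) _; apply: lerD; exact: Hm1_le.
- split=> [b g g' Hg Hg'|]; first by rewrite !fctE ml.1// /GRing.scale/=; ring.
  exists (`|a| * Hm1_norm mu l) => g Hg.
  by rewrite /= normrM -mulrA ler_wpM2l//; exact: Hm1_le.
- exact: Hm1_norm_ge0.
- apply: Hm1_norm_le => g Hg g1; apply: le_trans (ler_normD _ _) _.
  apply: lerD; (apply: le_trans (Hm1_le _ Hg) _; first by []); by rewrite ler_piMr// Hm1_norm_ge0.
have Zle b k : Hm1 mu k -> Hm1_norm mu (b *: k) <= `|b| * Hm1_norm mu k.
  move=> mk; apply: Hm1_norm_le => g Hg g1; rewrite /= normrM ler_wpM2l//.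
  by apply: le_trans (Hm1_le mk Hg) _; rewrite ler_piMr// Hm1_norm_ge0.
apply/eqP; rewrite eq_le Zle//=; have [->|a0] := eqVneq a 0.
  by rewrite normr0 mul0r Hm1_norm_ge0.
rewrite -ler_pdivlMl ?normr_gt0// -normfV -{1}[l]scale1r -(mulVf a0) -scalerA; apply: Zle.
split=> [b g g' Hg Hg'|]; first by rewrite !fctE ml.1// /GRing.scale/=; ring.
exists (`|a| * Hm1_norm mu l) => g Hg.
by rewrite /= normrM -mulrA ler_wpM2l//; exact: Hm1_le.
Qed.

Lemma Hm1_comp_cutoff j l : Hm1 mu l -> Hm1 mu (fun g => l (fun v => cutoff j v * g v)).
Proof.
move=> ml; have [C C0 hC] := H1_cutoff; split=> [a g g' Hg Hg'|].
  rewrite -ml.1; [|by have [] := hC j g Hg|by have [] := hC j g' Hg'].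
  by congr l; apply/funext => v; rewrite !fctE /GRing.scale/=; ring.
exists (Hm1_norm mu l * C) => g Hg; have [Hc hc] := hC j g Hg.
by apply: le_trans (Hm1_le ml Hc) _; rewrite -mulrA ler_wpM2l// Hm1_norm_ge0.
Qed.

(** For orthogonal vectors the squared norms add, so perturbing a vector of norm at most 1 + eta by
    one of squared norm at most u raises the norm bound by only u/2. This second-order cost drives
    the convergence of cutoffs in the dual. *)
Lemma sq_perturb_le (eta u a b : R) : 0 <= eta -> 0 <= u -> b <= (1 + eta) ^+ 2 -> a <= u ->
  a + b <= (1 + eta + u / 2) ^+ 2.
Proof.
move=> e0 u0 hb ha; apply: (@le_trans _ _ (u + (1 + eta) ^+ 2)); first exact: lerD.
rewrite -subr_ge0 (_ : _ - _ = eta * u + u ^+ 2 / 4); last by field.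
by apply: addr_ge0; [exact: mulr_ge0|apply: divr_ge0 => //; exact: sqr_ge0].
Qed.

Lemma near_max_slope (N K t eta x p : R) : 2 * N * eta <= t ^+ 2 -> N - t ^+ 2 - N * eta <= p ->
  x + p <= N * (1 + eta + t ^+ 2 * K ^+ 2 / 2) -> x <= 2 * t ^+ 2 + N * t ^+ 2 * K ^+ 2 / 2.
Proof.
rewrite (_ : N * (_ + _ / 2) = N + N * eta + N * t ^+ 2 * K ^+ 2 / 2); last by ring.
by move: (N * t ^+ 2 * K ^+ 2 / 2) => z; lra.
Qed.

Lemma near_max_step (N K t : R) : 0 <= N ->
  2 * t ^+ 2 + N * t ^+ 2 * K ^+ 2 / 2 <= t * (t * (2 + N * K ^+ 2)).
Proof.
move=> N0; have h : 0 <= N * t ^+ 2 * K ^+ 2 by apply: mulr_ge0; [apply: mulr_ge0 => //|]; exact: sqr_ge0.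
rewrite [leRHS](_ : _ = 2 * t ^+ 2 + N * t ^+ 2 * K ^+ 2); last by ring.
by move: (N * t ^+ 2 * K ^+ 2) h => z; lra.
Qed.

(* A functional nearly attains its norm at a compactly supported [phi]; moving away from [phi] in a
   direction [h] of disjoint support only costs O(|h|^2), so the functional is small at [h]. *)
Lemma Hm1_cutoff_cvg l (del : R) : Hm1 mu l -> 0 < del ->
  \forall j \near \oo, Hm1_norm mu ((fun g => l (fun v => cutoff j v * g v)) - l) <= del.
Proof.
move=> ml d0; have [C C0 hC] := H1_cutoff.
set N := Hm1_norm mu l; have N0 : 0 <= N by exact: Hm1_norm_ge0.
pose K := C + 1; have K0 : 0 <= K by rewrite addr_ge0.
(* [t] is the size of the step in the direction of [k]. It solves t (2 + N K^2) = del, so that the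
   final bound on t |l k| reads t del. *)
pose t := del / (2 + N * K ^+ 2).
have p0 : 0 < 2 + N * K ^+ 2 by rewrite ltr_pwDl// mulr_ge0// sqr_ge0.
have t0 : 0 < t by rewrite divr_gt0.
have [_ [g0 [Hg0 g01] <-]] := sup_adherent (exprn_gt0 2 t0) (Hm1_has_sup ml).
rewrite -/(Hm1_norm mu l) -/N => near0.
have [g1 [Hg1 g11 near1]] : exists g, [/\ H1 mu g, H1_norm mu g <= 1 & N - t ^+ 2 < l g].
  have [l0|l0] := lerP 0 (l g0); first by exists g0; split=> //; rewrite ger0_norm in near0.
  exists (- g0); split; [by rewrite -scaleN1r; exact: smZ H1_seminorm _ _ Hg0|by rewrite (snN H1_seminorm)|].
  by rewrite ltr0_norm// in near0; rewrite Hm1N.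
(* Replacing the almost norming element by a test function loses N eta in the value and N eta in the
   norm; together they stay below t^2. *)
pose eta := t ^+ 2 / (2 * N + 1).
have q0 : 0 < 2 * N + 1 by rewrite ltr_wpDl// mulr_ge0.
have eta0 : 0 < eta by rewrite divr_gt0// exprn_gt0.
have [phi [tphi phig]] := H1_dense Hg1 eta0.
have [Hphi hphi] := test_H1 tphi.
have [M M0 hM] := test_bounded_supp tphi.
near=> j.
have Mj : M < j.+1%:R.
  apply: lt_le_trans (_ : (Num.truncn M).+1%:R <= _); first exact: truncnS_gt.
  by rewrite ler_nat ltnS; near: j; exact: nbhs_infty_ge.
apply: Hm1_norm_le => h Hh h1.
have [Hc hc] := hC j h Hh.
pose k : 'rV[R]_n -> R := (fun v => cutoff j v * h v) - h.
have Hk : H1 mu k by exact: H1B.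
have kK : H1_norm mu k <= K.
  apply: le_trans (snB H1_seminorm Hc Hh) _; apply: lerD => //.
  by apply: le_trans hc _; rewrite ler_piMr.
have -> : ((fun g => l (fun v => cutoff j v * g v)) - l) h = l k by rewrite Hm1B.
(* The cutoff is 1 around the support of [phi], so [k] and its gradient vanish there; outside it,
   [phi] and its gradient vanish. *)
have dot0 : H1dot k phi = 0.
  have [B B0 hB] := cutoff_derive_bounded (R := R) n.
  have c1 v : `|@cutoff R n j v| <= 1 by rewrite ger0_norm ?cutoff_ge0 ?cutoff_le1.
  have sh := proj1 (proj1 (H1P _) Hh); have sc := proj1 (proj1 (H1P _) Hc).
  have hk := L2_gradientB sc sh (L2_gradient_mul (@test_cutoff R n j) c1 (hB j) sh (nablaP Hh)) (nablaP Hh).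
  rewrite (H1dotE Hk Hphi hk hphi) /dot_grad.
  under eq_Rintegral => v _.
    rewrite (_ : _ + _ = 0); first over.
    have [sv|sv] := pselect (supp phi v); last first.
      by rewrite (supp_eq0 sv) mulr0 add0r big1// => i _; rewrite [in X in _ * X]mxE derive_eq0_supp// mulr0.
    have vM : `|v| < j.+1%:R.
      apply: le_lt_trans Mj; move: sv; apply: (supp_subset_closed (A := [set x | `|x| <= M])) => //.
      exact: closed_norm_le.
    rewrite /k !fctE cutoff1 ?ltW// mul1r subrr mul0r add0r big1// => i _.
    by rewrite !mxE cutoff_derive0// mulr0 addr0 mul1r subrr mul0r.
  by rewrite Rintegral_cst// mul0r.
have near2 : N - t ^+ 2 - N * eta <= l phi.
  rewrite (_ : phi = g1 + (phi - g1)); last by rewrite addrC subrK.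
  rewrite Hm1D//; last exact: H1B.
  have := ler_norm (- l (phi - g1)); rewrite normrN => n1.
  have := Hm1_le ml (H1B Hphi Hg1); rewrite -/N => n2.
  have n3 : N * H1_norm mu (phi - g1) <= N * eta by rewrite ler_wpM2l.
  apply: lerD; first exact: ltW.
  by rewrite lerNl; apply: le_trans n1 (le_trans n2 n3).
have phi1 : H1_norm mu phi <= 1 + eta.
  rewrite -[phi](subrK g1) addrC; apply: le_trans (snD H1_seminorm _ _) _ => //; first exact: H1B.
  exact: (lerD g11 phig).
(* Used with s = t and with s = - t, which bounds [l k] from both sides. *)
have key s : s ^+ 2 = t ^+ 2 -> s * l k <= 2 * t ^+ 2 + N * t ^+ 2 * K ^+ 2 / 2.
  move=> st; have Hs : H1 mu (s *: k + phi) by exact: H1_comb.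
  have n1 := le_trans (ler_norm _) (Hm1_le ml Hs).
  rewrite ml.1// -/N in n1.
  have n2 : H1_norm mu (s *: k + phi) <= 1 + eta + t ^+ 2 * K ^+ 2 / 2.
    have u0 : 0 <= t ^+ 2 * K ^+ 2 by rewrite mulr_ge0 ?sqr_ge0.
    rewrite -ler_sqr ?nnegrE ?H1_norm_ge0//; last by rewrite !addr_ge0// ?(ltW eta0)// divr_ge0.
    rewrite H1_normE sqr_sqrtr ?H1dot_ge0//.
    rewrite (semi_inner_sq H1_comb (fun e f _ _ => H1dotC e f) H1dotD _ Hk Hphi) dot0 mulr0 addr0 st.
    have e1 : H1dot k k <= K ^+ 2.
      by rewrite -[leLHS]sqr_sqrtr ?H1dot_ge0// -H1_normE ler_sqr ?nnegrE ?H1_norm_ge0.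
    have e2 : H1dot phi phi <= (1 + eta) ^+ 2.
      rewrite -[leLHS]sqr_sqrtr ?H1dot_ge0// -H1_normE ler_sqr ?nnegrE ?H1_norm_ge0//.
      by rewrite addr_ge0// ltW.
    exact: (sq_perturb_le (ltW eta0) u0 e2 (ler_wpM2l (sqr_ge0 t) e1)).
  have n3 := ler_wpM2l N0 n2.
  have n4 : 2 * N * eta <= t ^+ 2.
    by rewrite /eta mulrA ler_pdivrMr// mulrC ler_wpM2l ?sqr_ge0// lerDl.
  exact: near_max_slope n4 near2 (le_trans n1 n3).
have t2 : (- t) ^+ 2 = t ^+ 2 by rewrite sqrrN.
have fin : 2 * t ^+ 2 + N * t ^+ 2 * K ^+ 2 / 2 <= t * del.
  have -> : del = t * (2 + N * K ^+ 2) by rewrite /t divfK// gt_eqF.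
  exact: near_max_step.
have b1 := le_trans (key t erefl) fin; have b2 := le_trans (key (- t) t2) fin.
rewrite ler_norml; apply/andP; split.
  by rewrite lerNl -(ler_pM2l t0) mulrN -mulNr.
by rewrite -(ler_pM2l t0).
Unshelve. all: by end_near. Qed.

End weighted.

(** * Velocity slices of test functions of position and velocity *)

Section slices.
Context {R : realType} {n : nat}.
Local Notation V := 'rV[R]_n.
Implicit Types (phi : V * V -> R) (g : V -> R).

Lemma closed_cube M : closed [set x : V | cube n M x].
Proof.
rewrite (_ : [set x | _] = \bigcap_i ((fun x : V => `|x ord0 i|) @^-1` [set y | y <= M])).
  apply: closed_bigI => i0 _; apply: preimage_closed; last exact: closed_le.
  by move=> x _; apply: (@continuous_comp _ _ _ (fun x : V => x ord0 i0)); [exact: coord_continuous|exact: norm_continuous].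
by apply/seteqP; split=> [x cx i0 _|x cx i0]; [exact: cx|exact: cx i0 I].
Qed.

Lemma derive_off_cube g M (v e : V) : (forall v, ~ cube n M v -> g v = 0) -> ~ cube n M v -> 'D_e g v = 0.
Proof.
move=> g0 nc; apply: derive_eq0_supp => sv; apply: nc; move: v sv.
apply: (supp_subset_closed (closed_cube (M := M))) => x gx.
by apply: contrapT => /g0 e0; rewrite e0 eqxx in gx.
Qed.

Lemma norm_pair_snd (x v : V) : `|v| <= `|(x, v)|.
Proof. by rewrite prod_normE/= le_max lexx orbT. Qed.

Lemma norm_pair_fst (x v : V) : `|x| <= `|(x, v)|.
Proof. by rewrite prod_normE/= le_max lexx. Qed.

Lemma test_supp2 U phi : test_fun U phi -> exists2 M, 0 <= M & forall x v, phi (x, v) != 0 -> `|x| <= M /\ `|v| <= M.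
Proof.
move=> tphi; have [M M0 hM] := test_bounded_supp tphi; exists M => // x v /hM h.
by split; apply: le_trans h; [exact: norm_pair_fst|exact: norm_pair_snd].
Qed.

Lemma test_slice U phi x : test_fun U phi -> test_fun setT (fun v => phi (x, v)).
Proof.
move=> tphi; have [M M0 hM] := test_supp2 tphi; apply: (test_fun_rV (M := M)).
  exact: (smooth_comp (is_diff_pairr x) (test_fun_smooth tphi)).
by move=> v /hM[].
Qed.

Lemma derive_slice U phi x v e : test_fun U phi ->
  'D_e (fun v => phi (x, v)) v = 'D_(0, e) phi (x, v).
Proof.
move=> tphi; have := @derive_comp_affine R _ _ phi (fun v : V => (x, v)) (fun e => (0, e)) v e (is_diff_pairr x v).
by apply; apply: smooth_differentiable; exact: test_fun_smooth tphi.
Qed.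

Lemma test_transport U phi : test_fun U phi -> test_fun U (fun p : V * V => 'D_(p.2, 0) phi p).
Proof.
move=> tphi; have sphi := test_fun_smooth tphi; apply: (test_fun_supp tphi).
  rewrite (_ : (fun _ => _) = fun p : V * V => \sum_i p.2 ord0 i * 'D_(delta_mx ord0 i, 0) phi p).
    apply: smooth_sum => i; apply: smoothM; last exact: smooth_D.
    by apply: (smooth_comp (f := fun v : V => v ord0 i) (@is_diff_snd R V V)); exact: smooth_coord.
  by apply/funext => -[x v]; rewrite deriveE_coordl//; exact: smooth_differentiable.
by move=> p np; exact: derive_eq0_supp.
Qed.

End slices.

Section slices_H1.
Context {R : realType} {n : nat} (mu : {measure set 'rV[R]_n -> \bar R}) (m : 'rV[R]_n -> R) (kap : R).
Hypothesis wt : weight_of mu m kap.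
Local Notation V := 'rV[R]_n.
Local Notation leb := (lebesgue_rV R n).
Implicit Types (phi : V * V -> R) (g : V -> R).

Lemma wt_cube_lty M : (mu (cube n M) < +oo)%E.
Proof.
have [C C0 hC] := wt_sq_le wt; have mc := @measurable_cube R n M.
have mi : measurable_fun [set: V] (\1_(cube n M) : V -> R) by apply: measurable_indic.
have := hC _ mi.
rewrite (eq_integral (fun v => (\1_(cube n M) v)%:E)) => [|v _]; last by rewrite indicE; case: (_ \in _); rewrite /= ?expr1n ?expr0n.
rewrite [X in (_ <= _ * X)%E](eq_integral (fun v => (\1_(cube n M) v)%:E)) => [|v _]; last by rewrite indicE; case: (_ \in _); rewrite /= ?expr1n ?expr0n.
rewrite !integral_indic// !setIT => h; apply: le_lt_trans h _.
by rewrite lte_mul_pinfty// lebesgue_cube_lty.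
Qed.

(** On a fixed cube the weighted measure is finite, so there the H^1 norm is controlled by uniform
    bounds on the function and its partial derivatives. *)
Lemma H1_norm_test_le M : exists2 K, 0 <= K & forall g A, 0 <= A -> test_fun setT g ->
  (forall v, `|g v| <= A) -> (forall v i, `|'D_(delta_mx ord0 i) g v| <= A) ->
  (forall v, ~ cube n M v -> g v = 0) -> H1_norm mu g <= K * A.
Proof.
have fc : mu (cube n M) \is a fin_num by rewrite ge0_fin_numE// wt_cube_lty.
exists (Num.sqrt ((1 + n%:R) * fine (mu (cube n M)))) => [|g A A0 tg gA DA g0]; first exact: sqrtr_ge0.
have [Hg hg] := test_H1 wt tg.
rewrite -ler_sqr ?nnegrE ?mulr_ge0 ?sqrtr_ge0 ?(H1_norm_ge0 wt)// exprMn [X in _ <= X * _]sqr_sqrtr; last first.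
  by rewrite mulr_ge0 ?addr_ge0// fine_ge0.
rewrite -lee_fin (H1_norm_sqEFin wt Hg hg).
apply: (@le_trans _ _ (\int[mu]_v (((1 + n%:R) * A ^+ 2)%:E * (\1_(cube n M) v)%:E))%E).
  have mg := measurable_test tg.
  apply: ge0_le_integral => //.
  - by move=> v _; rewrite lee_fin addr_ge0 ?sqr_ge0// sumr_ge0// => i _; exact: sqr_ge0.
  - apply/measurable_EFinP; apply: measurable_funD; first exact: measurable_funX.
    apply: measurable_sum => i; apply: measurable_funX; under eq_fun do rewrite mxE.
    exact: measurable_test (test_funD _ tg).
  - apply: emeasurable_funM => //; apply/measurable_EFinP; apply: measurable_indic; exact: measurable_cube.
  have sqb (x : R) : `|x| <= A -> x ^+ 2 <= A ^+ 2.
    by move=> xy; rewrite -[leLHS]real_normK ?num_real// ler_sqr ?nnegrE// (le_trans _ xy).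
  move=> v _; rewrite -EFinM lee_fin indicE; have [cv|ncv] := pselect (cube n M v).
    rewrite mem_set// mulr1 mulrDl mul1r; apply: lerD; first exact: sqb.
    rewrite mulr_natl -[X in _ *+ X](card_ord n) -sumr_const; apply: ler_sum => i _; rewrite mxE.
    exact: sqb.
  rewrite memNset// mulr0 g0// expr0n/= add0r big1// => i _.
  by rewrite mxE (derive_off_cube _ g0 ncv) expr0n.
rewrite ge0_integralZl//.
- by rewrite integral_indic ?setIT//; [rewrite -[mu _]fineK// -EFinM lee_fin mulrAC|exact: measurable_cube].
- by apply/measurable_EFinP; apply: measurable_indic; exact: measurable_cube.
- by rewrite lee_fin mulr_ge0 ?addr_ge0// sqr_ge0.
Qed.

Lemma test_funB g g' : test_fun setT g -> test_fun setT g' -> test_fun setT (g - g').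
Proof.
move=> tg tg'; have [M M0 hM] := test_bounded_supp tg; have [M' M0' hM'] := test_bounded_supp tg'.
apply: (test_fun_rV (M := M + M')).
  rewrite (_ : g - g' = fun v => g v + (-1) * g' v); last by apply/funext => v; rewrite mulN1r.
  by apply: smoothD; [exact: test_fun_smooth tg|apply: smoothM; [exact: smooth_cst|exact: test_fun_smooth tg']].
move=> x; rewrite !fctE; have [gx|gx _] := eqVneq (g x) 0.
  by rewrite gx sub0r oppr_eq0 => /hM' h; rewrite (le_trans h)// lerDr.
by apply: le_trans (hM x gx) _; rewrite lerDl.
Qed.

Lemma H1_slice U phi x : test_fun U phi -> H1 mu (fun v => phi (x, v)).
Proof. by move=> tphi; have [] := test_H1 wt (test_slice x tphi). Qed.

Lemma slice_bounded U phi : test_fun U phi ->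
  exists2 C, 0 <= C & forall x, H1_norm mu (fun v => phi (x, v)) <= C.
Proof.
move=> tphi; have [M M0 hM] := test_supp2 tphi; have [K K0 hK] := H1_norm_test_le M.
have [A A0 hA] := test_bounded tphi.
have /choice[B hB] : forall i : 'I_n, exists B, 0 <= B /\ forall p, `|'D_(0, delta_mx ord0 i) phi p| <= B.
  by move=> i; have [B B0 h] := test_bounded (test_funD (0, delta_mx ord0 i) tphi); exists B.
have S0 : 0 <= \sum_i B i by apply: sumr_ge0 => i _; have [] := hB i.
exists (K * (A + \sum_i B i)) => [|x]; first by rewrite mulr_ge0// addr_ge0.
apply: hK => [|||v i|v nc]; first by rewrite addr_ge0.
- exact: test_slice tphi.
- by move=> v; apply: le_trans (hA _) _; rewrite lerDl.
- rewrite (derive_slice x v _ tphi); apply: le_trans (proj2 (hB i) _) _.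
  rewrite (bigD1 i)//= addrCA lerDl addr_ge0// sumr_ge0// => k _; by have [] := hB k.
apply/eqP/negPn/negP => /hM[_ vM]; apply: nc => i; exact: le_trans (rV_norm_coord v i) vM.
Qed.

(** Makes the slice map Bochner measurable through [lipschitz_strongly], and its image under a fixed
    functional of [Hm1] continuous, hence measurable. *)
Lemma slice_lipschitz U phi : test_fun U phi -> exists2 C, 0 <= C &
  forall x h, H1_norm mu ((fun v => phi (x + h, v)) - (fun v => phi (x, v))) <= C * `|h|.
Proof.
move=> tphi; have [M M0 hM] := test_supp2 tphi; have [K K0 hK] := H1_norm_test_le M.
have [A A0 hA] := test_lipschitzl tphi.
have /choice[B hB] : forall i : 'I_n, exists B, 0 <= B /\
    forall x v h, `|'D_(0, delta_mx ord0 i) phi (x + h, v) - 'D_(0, delta_mx ord0 i) phi (x, v)| <= B * `|h|.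
  by move=> i; have [B B0 h] := test_lipschitzl (test_funD (0, delta_mx ord0 i) tphi); exists B.
have S0 : 0 <= \sum_i B i by apply: sumr_ge0 => i _; have [] := hB i.
exists (K * (A + \sum_i B i)) => [|x h]; first by rewrite mulr_ge0// addr_ge0.
rewrite -mulrA; have t1 := test_slice (x + h) tphi; have t2 := test_slice x tphi.
apply: hK => [|||v i|v nc]; first by rewrite mulr_ge0// addr_ge0.
- exact: test_funB.
- by move=> v; apply: le_trans (hA _ _ _) _; rewrite ler_wpM2r// lerDl.
- have := deriveB (@smooth_derivable R _ _ v (delta_mx ord0 i) (test_fun_smooth t1)) (@smooth_derivable R _ _ v (delta_mx ord0 i) (test_fun_smooth t2)).
  move=> ->; rewrite !(derive_slice _ v _ tphi); apply: le_trans (proj2 (hB i) _ _ _) _.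
  rewrite ler_wpM2r// (bigD1 i)//= addrCA lerDl addr_ge0// sumr_ge0// => k _; by have [] := hB k.
rewrite !fctE; have z y : phi (y, v) = 0.
  by apply/eqP/negPn/negP => /hM[_ vM]; apply: nc => i; exact: le_trans (rV_norm_coord v i) vM.
by rewrite !z subrr.
Qed.

(** The embedding of L^2(mu) into the dual of H^1 through the L^2 pairing. *)
Definition riesz g : (V -> R) -> R := fun h => \int[mu]_v (g v * h v).

Lemma riesz_CS g h : sq_integrable mu g -> H1 mu h ->
  `|riesz g h| <= Num.sqrt (\int[mu]_v (g v ^+ 2)) * H1_norm mu h.
Proof.
move=> sg Hh; have [sh _] := proj1 (H1P mu h) Hh.
have H0 : forall f : V -> R, 0 <= \int[mu]_v (f v * f v) by move=> f; apply: Rintegral_ge0 => v _; exact: sqr_ge0.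
have := @semi_inner_CS R (V -> R) (sq_integrable mu) (fun f g => \int[mu]_v (f v * g v)).
move=> /(_ _ _ _ H0 g h sg sh) H; apply: le_trans (H _ _ _) _ => {H}.
- by move=> a e f se sf; apply: sq_integrableD => //; exact: sq_integrableZ.
- by move=> e f _ _; apply: eq_Rintegral => v _; rewrite mulrC.
- move=> a e f k se sf sk; rewrite -RintegralZl//; last exact: sq_integrableM.
  rewrite -RintegralD//; [|by apply: intZ => //; exact: sq_integrableM|exact: sq_integrableM].
  by apply: eq_Rintegral => v _; rewrite mulrA -mulrDl.
rewrite ler_wpM2l ?sqrtr_ge0// -ler_sqr ?nnegrE ?sqrtr_ge0 ?(H1_norm_ge0 wt)// sqr_sqrtr ?H0//.
exact: (L2_le_H1_norm wt).
Qed.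

Lemma riesz_Hm1 g : sq_integrable mu g -> Hm1 mu (riesz g).
Proof.
move=> sg; split=> [a g1 g2 H1g H2g|]; last first.
  by exists (Num.sqrt (\int[mu]_v (g v ^+ 2))) => h Hh; exact: riesz_CS.
have [[s1 _] [s2 _]] := (proj1 (H1P mu _) H1g, proj1 (H1P mu _) H2g).
rewrite /riesz -RintegralZl//; last exact: sq_integrableM.
rewrite -RintegralD//; [|by apply: intZ => //; exact: sq_integrableM|exact: sq_integrableM].
by apply: eq_Rintegral => v _; rewrite mulrCA -mulrDr.
Qed.

Lemma riesz_norm_le g : H1 mu g -> Hm1_norm mu (riesz g) <= 1 * H1_norm mu g.
Proof.
move=> Hg; have [sg _] := proj1 (H1P mu _) Hg; rewrite mul1r; apply: (Hm1_norm_le wt) => h Hh h1.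
apply: le_trans (riesz_CS sg Hh) _; apply: (@le_trans _ _ (Num.sqrt (\int[mu]_v (g v ^+ 2)))).
  by rewrite ler_piMr// sqrtr_ge0.
rewrite -ler_sqr ?nnegrE ?sqrtr_ge0 ?(H1_norm_ge0 wt)// sqr_sqrtr ?Rintegral_sq_ge0//.
exact: (L2_le_H1_norm wt).
Qed.

Lemma rieszB g g' h : sq_integrable mu g -> sq_integrable mu g' -> sq_integrable mu h ->
  riesz (g - g') h = riesz g h - riesz g' h.
Proof.
move=> sg sg' sh; rewrite /riesz -RintegralB//; [|exact: sq_integrableM|exact: sq_integrableM].
by apply: eq_Rintegral => v _; rewrite !fctE mulrBl.
Qed.

Lemma riesz_normB_le g g' : H1 mu g -> H1 mu g' -> Hm1_norm mu (riesz g - riesz g') <= 1 * H1_norm mu (g - g').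
Proof.
move=> Hg Hg'; have HB := H1B wt Hg Hg'; apply: le_trans (riesz_norm_le HB).
have [[sg _] [sg' _]] := (proj1 (H1P mu _) Hg, proj1 (H1P mu _) Hg').
have mB : Hm1 mu (riesz (g - g')) by apply: riesz_Hm1; have [] := proj1 (H1P mu _) HB.
apply: (Hm1_norm_le wt) => h Hh h1; have [sh _] := proj1 (H1P mu _) Hh.
rewrite (_ : (riesz g - riesz g') h = riesz (g - g') h); last by rewrite rieszB.
by apply: le_trans (Hm1_le wt mB Hh) _; rewrite ler_piMr// (Hm1_norm_ge0 wt).
Qed.

End slices_H1.

(** * The kinetic space *)

Section L2_bochner_theory.
Context d (T : measurableType d) (R : realType) (E : lmodType R) (M : set E) (N : E -> R).
Hypothesis hN : seminorm_on M N.
Variables (leb : {measure set T -> \bar R}) (D : set T).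
Hypothesis mD : measurable D.

Lemma L2_bochner_integrable F : L2_bochner leb D M N F -> leb.-integrable D (EFin \o (fun x => N (F x) ^+ 2)).
Proof.
move=> [MF sF iF]; apply/integrableP; split; first exact: (measurable_sn2 hN mD MF sF).
by under eq_integral do rewrite /= ger0_norm ?sqr_ge0//.
Qed.

Lemma L2_bochner_norm_sq F :
  L2_bochner_norm leb D N F ^+ 2 = \int[leb]_(x in D) N (F x) ^+ 2.
Proof. by rewrite sqr_sqrtr//; apply: Rintegral_ge0 => x _; exact: sqr_ge0. Qed.

Lemma L2_bochner_norm_sqEFin F : L2_bochner leb D M N F ->
  ((L2_bochner_norm leb D N F ^+ 2)%:E = \int[leb]_(x in D) (N (F x) ^+ 2)%:E)%E.
Proof.
by move=> LF; rewrite L2_bochner_norm_sq -(EFin_Rintegral mD (L2_bochner_integrable LF)).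
Qed.

Lemma eq_L2_bochner F F' : (forall x, D x -> F x = F' x) -> L2_bochner leb D M N F -> L2_bochner leb D M N F'.
Proof.
move=> e [MF [s [ss sF]] iF]; split.
- by move=> x Dx; rewrite -e//; exact: MF.
- by exists s; split=> // x Dx; rewrite -e//; exact: sF.
by rewrite -(eq_integral _ (fun x => (N (F x) ^+ 2)%:E))// => x /set_mem Dx; rewrite e.
Qed.

Lemma L2_bochner_norm_ae F F' : L2_bochner leb D M N F -> L2_bochner leb D M N F' ->
  (\int[leb]_(x in D) (N (F x - F' x) ^+ 2)%:E = 0)%E ->
  L2_bochner_norm leb D N F = L2_bochner_norm leb D N F'.
Proof.
move=> LF LF' e; have [MF sF _] := LF; have [MF' sF' _] := LF'; congr Num.sqrt.
have LB := L2_bochner_comb hN mD (-1) LF' LF.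
have MB x : D x -> M (F x - F' x) by move=> Dx; apply: (smB hN); [exact: MF|exact: MF'].
have mB : measurable_fun D (fun x => (N (F x - F' x) ^+ 2)%:E : \bar R).
  have [_ sB _] := LB; apply: (measurable_sn2 hN mD (F := fun x => F x - F' x)) => //.
  by move: sB; under eq_fun do rewrite scaleN1r addrC.
have [h _] := @ae_eq_integral_abs _ _ R leb D mD _ mB.
have ae0 : ae_eq leb D (fun x => (N (F x - F' x) ^+ 2)%:E : \bar R) (cst 0%E).
  apply: h; rewrite -[RHS]e; apply: eq_integral => x _.
  by rewrite gee0_abs// lee_fin sqr_ge0.
rewrite /Rintegral; congr fine; apply: ae_eq_integral => //.
- exact: (measurable_sn2 hN mD).
- exact: (measurable_sn2 hN mD).
apply: filterS ae0 => x h0 Dx; congr (_ ^+ 2)%:E.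
have [/eqP] := h0 Dx; rewrite sqrf_eq0 => /eqP z.
apply/eqP; rewrite -subr_eq0 -normr_le0 -z.
by apply: (sn_dist hN); [exact: MF|exact: MF'].
Qed.

Lemma L2_bochner_norm_comb a F G : L2_bochner leb D M N F -> L2_bochner leb D M N G ->
  L2_bochner_norm leb D N (fun x => a *: F x + G x) ^+ 2 <=
  2 * a ^+ 2 * L2_bochner_norm leb D N F ^+ 2 + 2 * L2_bochner_norm leb D N G ^+ 2.
Proof.
move=> LF LG; have LC := L2_bochner_comb hN mD a LF LG.
have [MF _ _] := LF; have [MG _ _] := LG.
rewrite !L2_bochner_norm_sq -!RintegralZl//; [|exact: L2_bochner_integrable..].
have iF := intZ (2 * a ^+ 2) mD (L2_bochner_integrable LF); have iG := intZ 2 mD (L2_bochner_integrable LG).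
rewrite -RintegralD//; apply: le_Rintegral => //; [exact: L2_bochner_integrable|exact: intD|].
move=> x Dx; have h := snD hN (smZ hN a (MF x Dx)) (MG x Dx).
rewrite (snZ hN) ?MF// in h; last exact: MF.
have := sn_ge0 hN (a *: F x + G x); have := sn_ge0 hN (F x); have := sn_ge0 hN (G x).
move: (N (a *: _ + _)) (N (F x)) (N (G x)) h => u v w h w0 v0 u0.
apply: (@le_trans _ _ ((`|a| * v + w) ^+ 2)); first by rewrite ler_sqr// nnegrE// (le_trans u0).
rewrite -[a ^+ 2]real_normK ?num_real//; have := sqr_ge0 (`|a| * v - w); nra.
Qed.

End L2_bochner_theory.

Lemma lipschitz_continuous (R : realType) (W : normedModType R) (u : W -> R) C :
  (forall x h, `|u (x + h) - u x| <= C * `|h|) -> continuous u.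
Proof.
move=> hu x; apply/cvgrPdist_le => e e0.
have p0 : 0 < `|C| + 1 by rewrite ltr_wpDl.
have nx : nbhs x (ball x (e / (`|C| + 1))) by apply: nbhsx_ballx; rewrite divr_gt0.
apply: filterS nx => y; rewrite -ball_normE/= => xy; rewrite distrC.
have := hu x (y - x); rewrite (addrC x) subrK => h; apply: le_trans h _.
apply: (@le_trans _ _ ((`|C| + 1) * `|y - x|)).
  by rewrite ler_wpM2r// (le_trans (ler_norm _))// lerDl.
by rewrite mulrC -ler_pdivlMr// distrC ltW.
Qed.

Section kinetic_theory.
Context {R : realType} {n : nat} (mu : {sigma_finite_measure set 'rV[R]_n -> \bar R}) (m : 'rV[R]_n -> R) (kap : R).
Hypothesis wt : weight_of mu m kap.
Local Notation V := 'rV[R]_n.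
Local Notation leb := (lebesgue_rV R n).
Variable D : set V.
Hypothesis mD : measurable D.
Hypothesis Dshift : forall x y : V, D x -> (forall i, 0 <= y ord0 i) -> D (x + y).
Implicit Types (phi : V * V -> R) (g b : V -> R) (f : V -> V -> R) (G : V -> (V -> R) -> R).

(** A square integrable majorant is integrable on bounded sets: C w <= C^2 + w^2, and the constant
    is only integrated over a cube. *)
Lemma integrable_dominated M C (u w : V -> R) : measurable_fun D u -> measurable_fun D w -> 0 <= C ->
  (forall x, D x -> `|u x| <= C * w x) -> (forall x, D x -> ~ cube n M x -> u x = 0) ->
  (\int[leb]_(x in D) (w x ^+ 2)%:E < +oo)%E -> leb.-integrable D (EFin \o u).
Proof.
move=> mu' mw C0 uw u0 w2; apply/integrableP; split; first exact/measurable_EFinP.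
have mw2 : measurable_fun D (fun x => (w x ^+ 2)%:E : \bar R) by apply/measurable_EFinP; exact: measurable_funX.
have m1 : measurable_fun D (fun x => (\1_(cube n M) x)%:E : \bar R).
  by apply/measurable_EFinP; apply: measurable_indic; exact: measurable_cube.
apply: (@le_lt_trans _ _ (\int[leb]_(x in D) ((C ^+ 2)%:E * (\1_(cube n M) x)%:E + (w x ^+ 2)%:E))%E).
  apply: ge0_le_integral => //.
  - by apply: measurableT_comp => //; exact/measurable_EFinP.
  - by apply: emeasurable_funD => //; exact: emeasurable_funM.
  move=> x Dx; rewrite /= -EFinM -EFinD lee_fin indicE.
  have [h|h] := pselect (cube n M x); last first.
    by rewrite u0// normr0 memNset// mulr0 add0r sqr_ge0.
  rewrite mem_set// mulr1; apply: le_trans (uw x Dx) _.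
  by have := sqr_ge0 (C - w x); have := sqr_ge0 C; have := sqr_ge0 (w x); nra.
rewrite ge0_integralD//.
- rewrite ge0_integralZl//; last by rewrite lee_fin sqr_ge0.
  rewrite integral_indic//; last exact: measurable_cube.
  apply: lte_add_pinfty => //; rewrite lte_mul_pinfty ?lee_fin ?sqr_ge0//.
  apply: le_lt_trans (lebesgue_cube_lty n M); apply: le_measure; rewrite ?inE; [|exact: measurable_cube|exact: subIsetl].
  by apply: measurableI => //; exact: measurable_cube.
- by move=> x _; rewrite -EFinM lee_fin mulr_ge0 ?sqr_ge0.
- exact: emeasurable_funM.
- by move=> x _; rewrite lee_fin sqr_ge0.
Qed.

Lemma lipschitz_measurable (u : V -> R) C : (forall x h, `|u (x + h) - u x| <= C * `|h|) -> measurable_fun D u.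
Proof.
by move=> hu; apply: measurable_funTS; apply: continuous_measurable_rV; exact: lipschitz_continuous hu.
Qed.

Lemma measurable_pair U G phi : (forall x, D x -> Hm1 mu (G x)) ->
  strongly_measurable D (Hm1 mu) (Hm1_norm mu) G -> test_fun U phi ->
  measurable_fun D (fun x => G x (fun v => phi (x, v))).
Proof.
move=> MG sG tphi.
apply: (measurable_pairing (Hm1_seminorm wt) mD (L := fun x (l : (V -> R) -> R) => l (fun v => phi (x, v)))
   (c := fun x => H1_norm mu (fun v => phi (x, v))) MG sG) => [l ml|x l l' _ ml ml'].
  have [C C0 hC] := slice_lipschitz wt tphi.
  apply: (lipschitz_measurable (C := Hm1_norm mu l * C)) => x h.
  rewrite -(Hm1B ml); [|exact: (H1_slice wt _ tphi)..].
  apply: le_trans (Hm1_le wt ml _) _; first by apply: (H1B wt); exact: (H1_slice wt _ tphi).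
  by rewrite -mulrA ler_wpM2l// (Hm1_norm_ge0 wt).
have ml'' := smB (Hm1_seminorm wt) ml ml'.
by have := Hm1_le wt ml'' (H1_slice wt x tphi); rewrite !fctE mulrC.
Qed.

Lemma integrable_pair U G phi : L2Hm1 mu D G -> test_fun U phi ->
  leb.-integrable D (EFin \o (fun x => G x (fun v => phi (x, v)))).
Proof.
move=> [MG sG iG] tphi; have [C C0 hC] := slice_bounded wt tphi; have [M M0 hM] := test_supp2 tphi.
apply: (integrable_dominated (M := M) (C := C) (w := fun x => Hm1_norm mu (G x))) => //.
- exact: measurable_pair tphi.
- exact: (measurable_sn (Hm1_seminorm wt) mD MG sG).
- move=> x Dx; apply: le_trans (Hm1_le wt (MG x Dx) (H1_slice wt x tphi)) _.
  by rewrite mulrC ler_wpM2r// (Hm1_norm_ge0 wt).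
move=> x Dx nc; rewrite (_ : (fun v => _) = 0) ?(Hm1_0 wt (MG x Dx))//; apply/funext => v.
by apply/eqP/negPn/negP => /hM[xM _]; apply: nc => i; exact: le_trans (rV_norm_coord x i) xM.
Qed.

Lemma L2Hm1_riesz f : L2H1 mu D f -> L2Hm1 mu D (fun x => riesz mu (f x)).
Proof.
apply: (L2_bochner_comp mD (H1_seminorm wt) (Hm1_seminorm wt) ler01).
- by move=> g Hg; apply: (riesz_Hm1 wt); have [] := proj1 (H1P mu g) Hg.
- by move=> g g' Hg Hg'; exact: (riesz_normB_le wt).
- by move=> g Hg; exact: (riesz_norm_le wt).
Qed.

Lemma distr_transport_comb a f f' G G' : L2H1 mu D f -> L2H1 mu D f' -> L2Hm1 mu D G -> L2Hm1 mu D G' ->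
  distr_transport mu D f G -> distr_transport mu D f' G' ->
  distr_transport mu D (fun x => a *: f x + f' x) (fun x => a *: G x + G' x).
Proof.
move=> Lf Lf' LG LG' tG tG' phi tphi; have tQ := test_transport tphi.
transitivity (a * \int[leb]_(x in D) G x (fun v => phi (x, v)) + \int[leb]_(x in D) G' x (fun v => phi (x, v))).
  have i1 := integrable_pair LG tphi; have i2 := integrable_pair LG' tphi.
  by rewrite -RintegralZl// -RintegralD//; exact: intZ.
rewrite tG// tG'// mulrN -opprD; congr (- _).
have i1 := integrable_pair (L2Hm1_riesz Lf) tQ; have i2 := integrable_pair (L2Hm1_riesz Lf') tQ.
rewrite -RintegralZl// -RintegralD//; last exact: intZ.
apply: eq_Rintegral => x /set_mem Dx.
have [Hf _ _] := Lf; have [Hf' _ _] := Lf'.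
have [sf _] := proj1 (H1P mu _) (Hf x Dx); have [sf' _] := proj1 (H1P mu _) (Hf' x Dx).
have [sq _] := proj1 (H1P mu _) (H1_slice wt x tQ).
rewrite /= -RintegralZl//; last exact: (sq_integrableM sf sq).
rewrite -RintegralD//; [|by apply: intZ => //; exact: (sq_integrableM sf sq)|exact: (sq_integrableM sf' sq)].
by apply: eq_Rintegral => v _; rewrite /= mulrA -mulrDl.
Qed.

Lemma slice_L2H1 U phi : test_fun U phi -> L2H1 mu D (fun x v => phi (x, v)).
Proof.
move=> tphi; have H := fun x => H1_slice wt x tphi.
have [C C0 hC] := slice_lipschitz wt tphi; have [B B0 hB] := slice_bounded wt tphi.
have sF : strongly_measurable D (H1 mu) (H1_norm mu) (fun x v => phi (x, v)).
  exact: (lipschitz_strongly (H1_seminorm wt) mD H hC).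
split=> //; have [M M0 hM] := test_supp2 tphi.
have mc := @measurable_cube R n M.
apply: (@le_lt_trans _ _ (\int[leb]_(x in D) ((B ^+ 2)%:E * (\1_(cube n M) x)%:E))%E).
  apply: ge0_le_integral => //.
  - by move=> x _; rewrite lee_fin sqr_ge0.
  - exact: (measurable_sn2 (H1_seminorm wt) mD).
  - by apply: emeasurable_funM => //; apply/measurable_EFinP; exact: measurable_indic.
  move=> x _; rewrite -EFinM lee_fin indicE; have [h|h] := pselect (cube n M x).
    by rewrite mem_set// mulr1 ler_sqr ?nnegrE ?(H1_norm_ge0 wt).
  rewrite memNset// mulr0 (_ : (fun v => _) = 0) ?(sn0 (H1_seminorm wt)) ?expr0n//; apply/funext => v.
  by apply/eqP/negPn/negP => /hM[xM _]; apply: h => i; exact: le_trans (rV_norm_coord x i) xM.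
rewrite ge0_integralZl//.
- rewrite integral_indic// lte_mul_pinfty ?lee_fin ?sqr_ge0//.
  apply: le_lt_trans (lebesgue_cube_lty n M); apply: le_measure; rewrite ?inE//; exact: measurableI.
- by apply/measurable_EFinP; exact: measurable_indic.
- by rewrite lee_fin sqr_ge0.
Qed.

Lemma integrable_test2 U phi : test_fun U phi -> (leb \x mu)%E.-integrable setT (EFin \o phi).
Proof.
move=> tphi; have [A A0 hA] := test_bounded tphi; have [M M0 hM] := test_supp2 tphi.
have mc := @measurable_cube R n M; have mcc : measurable (cube n M `*` cube n M) by exact: measurableX.
have mphi : measurable_fun setT phi by apply: continuous_measurable_rV2; apply: smooth_continuous; exact: test_fun_smooth tphi.
apply/integrableP; split; first exact/measurable_EFinP.
apply: (@le_lt_trans _ _ (\int[leb \x mu]_p (A%:E * (\1_(cube n M `*` cube n M) p)%:E))%E).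
  apply: ge0_le_integral => //.
  - by apply: measurableT_comp => //; exact/measurable_EFinP.
  - by apply: emeasurable_funM => //; apply/measurable_EFinP; exact: measurable_indic.
  move=> [x v] _; rewrite /= -EFinM lee_fin indicE; have [h|h] := pselect ((cube n M `*` cube n M) (x, v)).
    by rewrite mem_set// mulr1.
  rewrite memNset// mulr0 (_ : phi (x, v) = 0) ?normr0//.
  apply/eqP/negPn/negP => /hM[xM vM]; apply: h; split=> i /=.
    exact: le_trans (rV_norm_coord x i) xM.
  exact: le_trans (rV_norm_coord v i) vM.
rewrite ge0_integralZl//.
- rewrite integral_indic// setIT [X in (_ * X)%E](_ : _ = (leb (cube n M) * mu (cube n M))%E); last exact: product_measure1E.
  rewrite lte_mul_pinfty//.
  apply: lte_mul_pinfty => //; last exact: (wt_cube_lty wt).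
  by rewrite ge0_fin_numE// lebesgue_cube_lty.
- by apply/measurable_EFinP; exact: measurable_indic.
Qed.

Lemma test_fun_mul2 U phi psi : test_fun U phi -> test_fun setT psi -> test_fun U (fun p => psi p * phi p).
Proof.
by move=> tphi tpsi; under eq_fun do rewrite mulrC; apply: test_funM => //; exact: test_fun_smooth tpsi.
Qed.

(** For a fixed velocity [v] the integrand is a derivative in x along a constant direction; Fubini
    puts the integral in x inside. The weight in the velocity is never differentiated. *)
Lemma integral_transport_eq0 U phi : test_fun U phi ->
  (\int[leb]_x (\int[mu]_v ('D_(v, 0) phi (x, v))%:E) = 0)%E.
Proof.
move=> tphi; have tQ := test_transport tphi; have iQ := integrable_test2 tQ.
rewrite (Fubini iQ) integral0_eq// => v _.
have [A A0 hA] := test_bounded tphi; have [B B0 hB] := test_bounded tQ; have [M M0 hM] := test_supp2 tphi.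
have [||||i0 e0] := @integral_derive_eq0 R n (fun x => phi (x, v)) (fun x => 'D_(v, 0) phi (x, v)) v B A M _ (fun x => hA _).
- apply: continuous_measurable_rV; apply: smooth_continuous.
  exact: (smooth_comp (is_diff_pairl v) (test_fun_smooth tphi)).
- move=> x; have e := @derive_comp_affine R _ _ phi (fun x : V => (x, v)) (fun e => (e, 0)) x v (is_diff_pairl v x).
  apply: DeriveDef.
    by apply: smooth_derivable; exact: (smooth_comp (is_diff_pairl v) (test_fun_smooth tphi)).
  by apply: e; apply: smooth_differentiable; exact: test_fun_smooth tphi.
- by move=> x; exact: (hB (x, v)).
- move=> x nc; apply/eqP/negPn/negP => /hM[xM _]; apply: nc => i; exact: le_trans (rV_norm_coord x i) xM.
by rewrite [LHS](EFin_Rintegral measurableT i0) e0.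
Qed.

Lemma derive_transportM phi psi x v : smooth phi -> smooth psi ->
  'D_(v, 0) (fun p => psi p * phi p) (x, v) = 'D_(v, 0) psi (x, v) * phi (x, v) + psi (x, v) * 'D_(v, 0) phi (x, v).
Proof.
move=> sphi spsi; have := deriveM (@smooth_derivable R _ _ (x, v) (v, 0) spsi) (@smooth_derivable R _ _ (x, v) (v, 0) sphi).
by move=> ->; rewrite /GRing.scale/=; ring.
Qed.

(** The product rule for [F * phi], whose support lies over [D] because that of [phi] does: the
    boundary is never met and the total derivative integrates to zero. *)
Lemma test_transport_eq F : test_fun setT F ->
  distr_transport mu D (fun x v => F (x, v)) (fun x => riesz mu (fun v => 'D_(v, 0) F (x, v))).
Proof.
move=> tF phi tphi; have tQF := test_transport tF; have tQ := test_transport tphi.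
have i1 := integrable_pair (L2Hm1_riesz (slice_L2H1 tQF)) tphi.
have i2 := integrable_pair (L2Hm1_riesz (slice_L2H1 tF)) tQ.
apply/eqP; rewrite -addr_eq0 -RintegralD//.
have sl (psi psi' : V * V -> R) x U U' : test_fun U psi -> test_fun U' psi' ->
    mu.-integrable setT (EFin \o (fun v => psi (x, v) * psi' (x, v))).
  move=> t t'; have [s _] := proj1 (H1P mu _) (H1_slice wt x t); have [s' _] := proj1 (H1P mu _) (H1_slice wt x t').
  exact: (sq_integrableM s s').
have tp : test_fun (D `*` setT) (fun p => F p * phi p) by exact: test_fun_mul2.
have e x : riesz mu (fun v => 'D_(v, 0) F (x, v)) (fun v => phi (x, v)) + \int[mu]_v (F (x, v) * 'D_(v, 0) phi (x, v)) =
    \int[mu]_v ('D_(v, 0) (fun p => F p * phi p) (x, v)).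
  rewrite /riesz -RintegralD//; [|exact: (sl (fun p => 'D_(p.2, 0) F p) phi x _ _ tQF tphi)
    |exact: (sl F (fun p => 'D_(p.2, 0) phi p) x _ _ tF tQ)].
  by apply: eq_Rintegral => v _; rewrite derive_transportM//; [exact: test_fun_smooth tphi|exact: test_fun_smooth tF].
under eq_Rintegral do rewrite e.
rewrite Rintegral_mkcond.
rewrite (_ : _ \_ D = fun x => \int[mu]_v ('D_(v, 0) (fun p => F p * phi p) (x, v))); last first.
  apply/funext => x; rewrite patchE; case: ifPn => // /negP nD.
  have z : (fun v => 'D_(v, 0) (fun p => F p * phi p) (x, v)) = cst 0; last by rewrite z Rintegral_cst ?mul0r.
  apply/funext => v; apply: derive_eq0_supp => s; apply: nD; apply/mem_set.
  by have [_ _ h] := tp; have [] := h _ s.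
apply/eqP; rewrite /Rintegral -[RHS]/(fine 0) -(integral_transport_eq0 tp); congr fine.
apply: eq_integral => x _; rewrite fineK//; apply: integrable_fin_num => //.
have tQp := test_transport tp; have [s _] := proj1 (H1P mu _) (H1_slice wt x tQp).
have := sl (fun p => 'D_(p.2, 0) F p) phi x _ _ tQF tphi => j1.
have := sl F (fun p => 'D_(p.2, 0) phi p) x _ _ tF tQ => j2.
apply: eq_integrable (intD measurableT j1 j2) => // v _; rewrite /= derive_transportM//.
  exact: test_fun_smooth tphi.
exact: test_fun_smooth tF.
Qed.

Lemma test_kinetic f F : test_fun setT F -> (forall x, D x -> f x = fun v => F (x, v)) ->
  L2H1 mu D f /\ L2Hm1_transport mu D f (fun x => riesz mu (fun v => 'D_(v, 0) F (x, v))).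
Proof.
move=> tF fF; split; first by apply: eq_L2_bochner (slice_L2H1 tF) => x /fF.
split; first exact: L2Hm1_riesz (slice_L2H1 (test_transport tF)).
move=> phi tphi; rewrite (test_transport_eq tF tphi); congr (- _).
by apply: eq_Rintegral => x /set_mem Dx; rewrite fF.
Qed.

End kinetic_theory.

Lemma sqrD_le2 (R : realDomainType) (u w : R) : (u + w) ^+ 2 <= 2 * u ^+ 2 + 2 * w ^+ 2.
Proof. by have := sqr_ge0 (u - w); nra. Qed.

(** * Uniqueness of the transport derivative, cutoffs in the velocity, and kernel estimates *)

Section transport_theory.
Context {R : realType} {n : nat} (mu : {sigma_finite_measure set 'rV[R]_n -> \bar R}) (m : 'rV[R]_n -> R) (kap : R).
Hypothesis wt : weight_of mu m kap.
Local Notation V := 'rV[R]_n.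
Local Notation leb := (lebesgue_rV R n).
Variable D : set V.
Hypothesis mD : measurable D.
Hypothesis Dshift : forall x y : V, D x -> (forall i, 0 <= y ord0 i) -> D (x + y).
Implicit Types (phi : V * V -> R) (g b : V -> R) (f : V -> V -> R) (G : V -> (V -> R) -> R).

Let Dshift_gt0 (x y : V) : D x -> (forall i, 0 < y ord0 i) -> D (x + y).
Proof. by move=> Dx y0; apply: Dshift => // i; exact: ltW. Qed.

(** Density of test functions in H^1; the approximant is divided by 1 + eps to return to the unit
    ball, and the remaining difference is controlled by the norm of [l] itself. *)
Lemma Hm1_norm_le_test (l : (V -> R) -> R) C : Hm1 mu l ->
  (forall b, test_fun setT b -> H1_norm mu b <= 1 -> `|l b| <= C) -> Hm1_norm mu l <= C.
Proof.
move=> ml h; apply: (Hm1_norm_le wt) => g Hg g1; apply/ler_addgt0Pr => e e0.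
have C0 : 0 <= C.
  have t0 : test_fun setT (fun _ : V => 0 : R).
    by apply: (test_fun_rV (M := 0)); [exact: smooth_cst|move=> x; rewrite eqxx].
  have n0 : H1_norm mu (fun _ : V => 0) <= 1 by rewrite (sn0 (H1_seminorm wt)).
  exact: le_trans (h _ t0 n0).
have N0 := Hm1_norm_ge0 wt l.
have p0 : 0 < C + Hm1_norm mu l + 1 by rewrite ltr_wpDl// addr_ge0.
pose eps := e / (C + Hm1_norm mu l + 1); have eps0 : 0 < eps by rewrite divr_gt0.
have [b [tb bg]] := H1_dense wt Hg eps0; have [Hb _] := test_H1 wt tb.
have q0 : 0 < 1 + eps by rewrite addr_gt0.
have b1 : H1_norm mu b <= 1 + eps.
  rewrite -[b](subrK g) addrC; apply: le_trans (snD (H1_seminorm wt) Hg (H1B wt Hb Hg)) _.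
  exact: (lerD g1 bg).
have tc : test_fun setT ((1 + eps)^-1 *: b).
  apply: (test_fun_supp tb) => [|x /supp_eq0 bx]; last by rewrite !fctE bx scaler0.
  by apply: (smoothM (f := fun=> (1 + eps)^-1)); [exact: smooth_cst|exact: test_fun_smooth tb].
have c1 : H1_norm mu ((1 + eps)^-1 *: b) <= 1.
  rewrite (snZ (H1_seminorm wt) _ Hb) gtr0_norm ?invr_gt0// mulrC ler_pdivrMr// mul1r//.
have lb : `|l b| <= (1 + eps) * C.
  have := h _ tc c1; rewrite (Hm1Z wt) // normrM gtr0_norm ?invr_gt0// ler_pdivrMl//.
rewrite -[g](subrK b) (Hm1D ml) //; last exact: (H1B wt).
apply: le_trans (ler_normD _ _) _.
have lgb : `|l (g - b)| <= Hm1_norm mu l * eps.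
  have gb : H1_norm mu (g - b) <= eps by rewrite (snC (H1_seminorm wt) Hg Hb).
  exact: (le_trans (Hm1_le wt ml (H1B wt Hg Hb)) (ler_wpM2l N0 gb)).
apply: le_trans (lerD lgb lb) _.
rewrite mulrDl mul1r addrCA lerD2l -(mulrC C) -mulrDl.
have -> : e = (C + Hm1_norm mu l + 1) * eps by rewrite /eps mulrC divfK// gt_eqF.
by rewrite ler_pM2r// addrC lerDl.
Qed.

(** The one-sided support pays off here: even for a point close to the boundary, the closed support
    of the shifted kernel lies in the point plus the closed orthant, hence in [D], so the
    distributional identity may be tested with it. *)
Lemma test_shifted_mollifier k b x : D x -> test_fun setT b ->
  test_fun (D `*` setT) (fun p : V * V => @mollifier R n k (p.1 - x) * b p.2).
Proof.
move=> Dx tb; have [M M0 hM] := test_bounded_supp tb.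
have sh : smooth (fun y : V => @mollifier R n k (y - x)).
  exact: (smooth_comp (@is_diff_translate R _ (- x)) (@smooth_mollifier R n k)).
apply: (test_fun_rV2 (M := 1 + `|x| + M)).
- apply: smoothM.
    exact: (smooth_comp (f := fun y : V => @mollifier R n k (y - x)) (@is_diff_fst R V V) sh).
  exact: (smooth_comp (f := b) (@is_diff_snd R V V) (test_fun_smooth tb)).
- move=> [y v] /=; rewrite mulf_eq0 negb_or => /andP[yx bv].
  have h1 : `|y| <= 1 + `|x|.
    rewrite -{1}(subrK x y); apply: le_trans (ler_normD _ _) _; rewrite lerD2r.
    apply: rV_norm_le => // i; have /andP[a c] := mollifier_supp yx i.
    by rewrite ger0_norm ?(ltW a)// (le_trans (ltW c))// invf_le1// ler1n.
  rewrite prod_normE/= ge_max; apply/andP; split; first by apply: le_trans h1 _; rewrite lerDl.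
  by apply: le_trans (hM v bv) _; rewrite lerDr addr_ge0.
have cl : closed [set p : V * V | forall i, x ord0 i <= p.1 ord0 i].
  rewrite (_ : [set p | _] = \bigcap_i ((fun p : V * V => p.1 ord0 i) @^-1` [set t | x ord0 i <= t])).
    apply: closed_bigI => i _; apply: preimage_closed; last exact: closed_ge.
    move=> p _; apply: (@continuous_comp _ _ _ (@fst V V) (fun y : V => y ord0 i)); [exact: cvg_fst|exact: coord_continuous].
  by apply/seteqP; split=> [p h i _|p h i]; [exact: h|exact: h i I].
move=> p sp; split=> //=.
have h : [set p : V * V | forall i, x ord0 i <= p.1 ord0 i] p.
  apply: supp_subset_closed sp => // -[y v] /=; rewrite mulf_eq0 negb_or => /andP[yx _] i.
  by have /andP[+ _] := mollifier_supp yx i; rewrite !mxE subr_gt0 => /ltW.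
by rewrite -(subrK x p.1) addrC; apply: Dshift => // i; rewrite !mxE subr_ge0; exact: h.
Qed.

(** Translation of the variable, and linearity of [G] at each point: the mollification of [G] tested
    on [b] is the pairing of [G] with an admissible tensor product, to which [distr_transport]
    applies. *)
Lemma moll_pair k b G x : L2Hm1 mu D G -> D x -> test_fun setT b ->
  \int[leb]_y (@mollifier R n k y * G (x + y) b) =
  \int[leb]_(x' in D) G x' (fun v => @mollifier R n k (x' - x) * b v).
Proof.
move=> [MG sG iG] Dx tb; have tp := test_shifted_mollifier k Dx tb; have [Hb _] := test_H1 wt tb.
have mp : measurable_fun D (fun x' => G x' (fun v => @mollifier R n k (x' - x) * b v)).
  exact: (measurable_pair wt mD MG sG tp).
rewrite [RHS]Rintegral_mkcond -[RHS](Rintegral_translate x); last by apply/(measurable_restrictT _ mD).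
apply: eq_Rintegral => y _; rewrite patchE addrK (addrC y x); case: ifPn => [/set_mem Dxy|/negP nD].
  by rewrite -(Hm1Z wt _ (MG _ Dxy) Hb).
have [->|ry] := eqVneq (@mollifier R n k y) 0; first by rewrite mul0r.
by exfalso; apply: nD; apply/mem_set; apply: (moll_shift Dshift_gt0 Dx ry).
Qed.

Lemma Hm1_functional_le b : test_fun setT b -> H1_norm mu b <= 1 ->
  functional_le (Hm1 mu) (Hm1_norm mu) (fun l : (V -> R) -> R => l b).
Proof.
move=> tb b1; have [Hb _] := test_H1 wt tb; split=> [//|l ml].
by apply: le_trans (Hm1_le wt ml Hb) _; rewrite ler_piMr// (Hm1_norm_ge0 wt).
Qed.

Lemma L2_bochner_zero G : L2Hm1 mu D G ->
  (forall del : R, 0 < del -> exists r : V -> R, [/\ measurable_fun D r, forall x, 0 <= r x,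
     (\int[leb]_(x in D) (r x ^+ 2)%:E <= del%:E)%E & forall x, D x -> Hm1_norm mu (G x) <= r x]) ->
  (\int[leb]_(x in D) (Hm1_norm mu (G x) ^+ 2)%:E = 0)%E.
Proof.
move=> [MG sG iG] h; apply/eqP; rewrite eq_le; apply/andP; split; last first.
  by apply: integral_ge0 => x _; rewrite lee_fin sqr_ge0.
apply/lee_addgt0Pr => e e0; rewrite add0e; have [r [mr r0 re hr]] := h e e0.
apply: le_trans re; apply: ge0_le_integral => //.
- by move=> x _; rewrite lee_fin sqr_ge0.
- exact: (measurable_sn2 (Hm1_seminorm wt) mD).
- by apply/measurable_EFinP; exact: measurable_funX.
by move=> x Dx; rewrite lee_fin ler_sqr ?nnegrE ?(Hm1_norm_ge0 wt)//; exact: hr.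
Qed.

(** Both derivatives have the same pairing with shifted kernels, so the mollified difference
    vanishes against every [b] and its norm is below an arbitrarily small majorant. The
    approximations of [G] and [G'] serve only for the integrability that splits the difference. *)
Lemma transport_unique f G G' : L2Hm1_transport mu D f G -> L2Hm1_transport mu D f G' ->
  (\int[leb]_(x in D) (Hm1_norm mu (G x - G' x) ^+ 2)%:E = 0)%E.
Proof.
move=> [LG tG] [LG' tG'].
have LB : L2Hm1 mu D (fun x => G x - G' x).
  have := L2_bochner_comb (Hm1_seminorm wt) mD (-1) LG' LG.
  by under eq_fun do rewrite scaleN1r addrC.
apply: L2_bochner_zero => // del d0.
have n1 := mollify_approx (Hm1_seminorm wt) mD Dshift_gt0 d0 LB.
have n2 := mollify_approx (Hm1_seminorm wt) mD Dshift_gt0 d0 LG.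
have n3 := mollify_approx (Hm1_seminorm wt) mD Dshift_gt0 d0 LG'.
have [k _ /(_ k (leqnn k)) [[r [mr r0 rd hr]] [[r2 [_ _ _ h2]] [r3 [_ _ _ h3]]]]] := filterI n1 (filterI n2 n3).
exists r; split=> // x Dx; have [MB _ _] := LB; apply: Hm1_norm_le_test; first exact: MB.
move=> b tb b1; have fl := Hm1_functional_le tb b1.
have [_ h] := hr _ fl x Dx; have [i2 _] := h2 _ fl x Dx; have [i3 _] := h3 _ fl x Dx.
move: h; rewrite (_ : \int[_]_y _ = 0) ?sub0r ?normrN//.
transitivity (\int[leb]_y (@mollifier R n k y * G (x + y) b - @mollifier R n k y * G' (x + y) b)).
  by apply: eq_Rintegral => y _; rewrite -mulrBr.
rewrite RintegralB// (moll_pair k LG Dx tb) (moll_pair k LG' Dx tb).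
by rewrite (tG _ (test_shifted_mollifier k Dx tb)) (tG' _ (test_shifted_mollifier k Dx tb)) subrr.
Qed.

(** [transport] is a choice, so the kinetic norm is usable only once it is known to be computed by
    any admissible derivative. *)
Lemma L2Hm1_norm_transport f G : L2Hm1_transport mu D f G ->
  L2Hm1_norm mu D (transport mu D f) = L2Hm1_norm mu D G.
Proof.
move=> tG; have tt : L2Hm1_transport mu D f (transport mu D f).
  exact: (@xgetI _ (fun=> cst 0) (L2Hm1_transport mu D f) G tG).
apply: (L2_bochner_norm_ae (Hm1_seminorm wt) mD); [exact: tt.1|exact: tG.1|exact: transport_unique tt tG].
Qed.

Lemma kinetic_norm_ge0 f : 0 <= kinetic_norm mu D f.
Proof. exact: sqrtr_ge0. Qed.

Lemma kinetic_norm_sq f G : L2Hm1_transport mu D f G ->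
  kinetic_norm mu D f ^+ 2 = L2H1_norm mu D f ^+ 2 + L2Hm1_norm mu D G ^+ 2.
Proof.
move=> tG; rewrite sqr_sqrtr ?addr_ge0 ?sqr_ge0//; congr (_ + _ ^+ 2).
exact: L2Hm1_norm_transport.
Qed.

Lemma transport_comb a f f' G G' : L2H1 mu D f -> L2H1 mu D f' ->
  L2Hm1_transport mu D f G -> L2Hm1_transport mu D f' G' ->
  L2H1 mu D (a *: f + f') /\ L2Hm1_transport mu D (a *: f + f') (fun x => a *: G x + G' x).
Proof.
move=> Lf Lf' [LG tG] [LG' tG']; split; first exact: (L2_bochner_comb (H1_seminorm wt) mD a Lf Lf').
split; first exact: (L2_bochner_comb (Hm1_seminorm wt) mD a LG LG').
exact: (distr_transport_comb wt mD a Lf Lf' LG LG' tG tG').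
Qed.

Lemma kinetic_comb a f f' : kinetic mu D f -> kinetic mu D f' -> kinetic mu D (a *: f + f').
Proof.
move=> [Lf [G tG]] [Lf' [G' tG']]; have [h1 h2] := transport_comb a Lf Lf' tG tG'.
by split=> //; eexists; exact: h2.
Qed.

Lemma kinetic_norm_comb a f f' : kinetic mu D f -> kinetic mu D f' ->
  kinetic_norm mu D (a *: f + f') ^+ 2 <= 2 * a ^+ 2 * kinetic_norm mu D f ^+ 2 + 2 * kinetic_norm mu D f' ^+ 2.
Proof.
move=> [Lf [G tG]] [Lf' [G' tG']]; have [h1 h2] := transport_comb a Lf Lf' tG tG'.
rewrite [leLHS](kinetic_norm_sq h2) [X in _ <= _ * X + _](kinetic_norm_sq tG) [X in _ <= _ + _ * X](kinetic_norm_sq tG').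
rewrite [X in _ <= X + _]mulrDr [X in _ <= _ + X]mulrDr [leRHS]addrACA; apply: lerD.
  exact: (L2_bochner_norm_comb (H1_seminorm wt) mD a Lf Lf').
exact: (L2_bochner_norm_comb (Hm1_seminorm wt) mD a tG.1 tG'.1).
Qed.

(** Dominated convergence for uniformly bounded operators converging strongly. Stated abstractly
    because it is applied twice: to the cutoff on H^1 and to its transpose on the dual. *)
Lemma L2_bochner_op_cvg (E : lmodType R) (M : set E) (N : E -> R) (op : nat -> E -> E) (K : R) F (del : R) :
  seminorm_on M N -> (forall j e, M e -> M (op j e)) ->
  (forall j e e', M e -> M e' -> op j e - op j e' = op j (e - e')) ->
  0 <= K -> (forall j e, M e -> N (op j e) <= K * N e) ->
  (forall e (d : R), M e -> 0 < d -> \forall j \near \oo, N (op j e - e) <= d) ->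
  L2_bochner leb D M N F -> 0 < del ->
  (forall j, L2_bochner leb D M N (fun x => op j (F x))) /\
  \forall j \near \oo, (\int[leb]_(x in D) (N (op j (F x) - F x) ^+ 2)%:E <= del%:E)%E.
Proof.
move=> hN Mop opB K0 Nop cvop LF d0; have [MF sF iF] := LF.
have Lop j : L2_bochner leb D M N (fun x => op j (F x)).
  apply: (L2_bochner_comp mD hN hN K0 (Mop j)) LF => [e e' Me Me'|e Me]; last exact: Nop.
  by rewrite opB//; apply: Nop; exact: (smB hN).
split=> //.
have LB j : L2_bochner leb D M N (fun x => op j (F x) - F x).
  have := L2_bochner_comb hN mD (-1) LF (Lop j).
  by under eq_fun do rewrite scaleN1r addrC.
have [|||||_ _ cv] := @dominated_convergence _ _ R leb D mD (fun j x => (N (op j (F x) - F x) ^+ 2)%:E) (cst 0%E)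
   (fun x => ((K + 1) ^+ 2 * N (F x) ^+ 2)%:E).
- by move=> j; have [MB sB _] := LB j; exact: (measurable_sn2 hN mD MB sB).
- exact: measurable_cst.
- apply: aeW => x Dx; apply: cvg_EFin; first exact: nearW.
  apply/cvgr0Pnorm_le => e e0; have se0 : 0 < Num.sqrt e by rewrite sqrtr_gt0.
  apply: filterS (cvop (F x) (Num.sqrt e) (MF x Dx) se0) => j h.
  rewrite /= ger0_norm ?sqr_ge0// -[leRHS](sqr_sqrtr (ltW e0)) ler_sqr ?nnegrE ?(sn_ge0 hN)// ltW//.
- exact: (intZ _ mD (L2_bochner_integrable hN mD LF)).
- apply: aeW => x j Dx; rewrite gee0_abs ?lee_fin ?sqr_ge0// -exprMn ler_sqr ?nnegrE ?(sn_ge0 hN)//; last first.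
    by rewrite mulr_ge0 ?addr_ge0 ?(sn_ge0 hN).
  have Me := MF x Dx; apply: le_trans (snB hN (Mop j _ Me) Me) _.
  by rewrite mulrDl mul1r lerD2r; exact: Nop.
move: cv; rewrite integral0 => /fine_cvgP[h1 /cvgr0Pnorm_le/(_ _ d0) h2].
apply: filterS2 h1 h2 => j f h.
have f' : (\int[leb]_(x in D) (N (op j (F x) - F x) ^+ 2)%:E)%E \is a fin_num by exact: f.
by rewrite -(fineK f') lee_fin; exact: le_trans (ler_norm _) h.
Qed.

(** A factor depending on the velocity alone commutes with v . grad_x, so the derivative of the
    truncated function is the transpose of the cutoff applied to [G]. *)
Lemma transport_cutoff j f G : L2Hm1_transport mu D f G ->
  distr_transport mu D (fun x v => cutoff j v * f x v) (fun x g => G x (fun v => cutoff j v * g v)).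
Proof.
move=> [LG tG] phi tphi.
have sc : smooth (fun p : V * V => @cutoff R n j p.2).
  by apply: (smooth_comp (f := @cutoff R n j) (@is_diff_snd R V V)); exact: smooth_cutoff.
have tp : test_fun (D `*` setT) (fun p : V * V => cutoff j p.2 * phi p).
  by under eq_fun do rewrite mulrC; exact: test_funM.
rewrite (tG _ tp); apply: (congr1 (fun z : R => - z)); apply: eq_Rintegral => x _; apply: eq_Rintegral => v _.
rewrite (derive_transportM x v (test_fun_smooth tphi) sc) /=.
have -> : 'D_(v, 0) (fun p : V * V => cutoff j p.2) (x, v) = 0.
  have := @derive_comp_affine R _ _ (@cutoff R n j) (@snd V V) (@snd V V) (x, v) (v, 0) (@is_diff_snd R V V _).
  move=> ->; last by apply: smooth_differentiable; exact: smooth_cutoff.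
  by rewrite deriveE ?linear0//; apply: smooth_differentiable; exact: smooth_cutoff.
by rewrite mul0r add0r mulrCA mulrA.
Qed.

(** The sign of the kernel is arbitrary, since derivatives of the mollifier are used as kernels too.
    The support condition ensures that only values over [D] enter. *)
Lemma kernel_pairing (E : lmodType R) (M : set E) (N : E -> R) (kp : V -> R) (K c : R) (lam : E -> R) F x :
  seminorm_on M N -> measurable_fun setT kp -> (forall y, `|kp y| <= K) -> (\int[leb]_y (`|kp y|)%:E <= c%:E)%E ->
  (forall y, kp y != 0 -> D (x + y)) ->
  forall a, 0 <= a -> (forall e e', M e -> M e' -> lam (e - e') = lam e - lam e') ->
  (forall e, M e -> `|lam e| <= a * N e) -> L2_bochner leb D M N F ->
  leb.-integrable setT (EFin \o (fun y => kp y * lam (F (x + y)))) /\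
  `|\int[leb]_y (kp y * lam (F (x + y)))| <= a * \int[leb]_y (`|kp y| * ((N \o F) \_ D) (x + y)).
Proof.
move=> hN mk kK kc kD a a0 lB lle [MF sF iF].
have [||iu _ _ _] := @young R n D (fun y => `|kp y|) (N \o F) c K mD _ _ kc (measurable_sn hN mD MF sF) (fun x => sn_ge0 hN _) iF.
- exact: measurableT_comp.
- by move=> y; rewrite normr_ge0 kK.
have mlF : measurable_fun D (lam \o F).
  apply: (measurable_pairing hN mD (L := fun _ e => lam e) (c := fun=> a) MF sF) => // y e e' _ Me Me'.
  by rewrite -lB//; apply: lle; exact: (smB hN).
have eF y : kp y * lam (F (x + y)) = kp y * ((lam \o F) \_ D) (x + y).
  by have [->|/kD Dxy] := eqVneq (kp y) 0; [rewrite !mul0r|rewrite patchE mem_set].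
have le y : `|kp y * lam (F (x + y))| <= a * (`|kp y| * ((N \o F) \_ D) (x + y)).
  have [->|/kD Dxy] := eqVneq (kp y) 0; first by rewrite !mul0r normr0 mul0r mulr0.
  by rewrite normrM mulrCA ler_wpM2l// patchE mem_set//; exact: lle (MF _ Dxy).
have iA := intZ a measurableT (iu x).
have ii : leb.-integrable setT (EFin \o (fun y => kp y * lam (F (x + y)))).
  apply: le_integrable iA => //.
    apply/measurable_EFinP; under eq_fun do rewrite eF; apply: measurable_funM => //.
    under eq_fun do rewrite addrC.
    have m3 : measurable_fun setT ((lam \o F) \_ D) by apply/(measurable_restrictT _ mD).
    exact: (measurableT_comp m3 (measurable_rVD x)).
  by move=> y _ /=; rewrite lee_fin; apply: le_trans (le y) (ler_norm _).
split=> //; apply: le_trans (le_normr_Rintegral _ ii) _ => //.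
rewrite -RintegralZl//.
apply: le_Rintegral => //; exact: integrable_norm.
Qed.

Lemma simple_kernel (E : lmodType R) (M : set E) (s : V -> E) (r : seq E) (kp : V -> R) (lam : E -> R) x :
  simple_on D M s -> uniq r -> (forall x, D x -> s x \in r) ->
  leb.-integrable setT (EFin \o kp) -> (forall y, kp y != 0 -> D (x + y)) ->
  \int[leb]_y (kp y * lam (s (x + y))) =
  \sum_(e <- r) lam e * \int[leb]_y (kp y * \1_(D `&` s @^-1` [set e]) (x + y)).
Proof.
move=> [_ _ ms] ur sr ik kD.
have ie e : leb.-integrable setT (EFin \o (fun y => kp y * \1_(D `&` s @^-1` [set e]) (x + y))).
  under eq_fun do rewrite mulrC.
  apply: (@integrableM_bounded _ _ R leb setT _ _ 1) => //.
    exact: measurable_indic_shift.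
  by move=> y _; rewrite indicE; case: (_ \in _); rewrite ?normr1 ?normr0.
have [_ <-] := @Rintegral_lincomb _ _ R leb setT _ r lam _ measurableT ie.
apply: eq_Rintegral => y _; have [->|/kD Dxy] := eqVneq (kp y) 0.
  by rewrite mul0r big1// => e _; rewrite mul0r mulr0.
rewrite (sum_indic_seq lam ur Dxy (sr _ Dxy)) mulr_sumr; apply: eq_bigr => e _; ring.
Qed.

(** Each of the finitely many values of a simple approximant is moved slightly into [P]; the total
    error stays controlled because the approximant is zero outside a cube of finite measure. *)
Lemma L2_bochner_approx_dense (E : lmodType R) (M P : set E) (N : E -> R) F (del : R) :
  seminorm_on M N -> P `<=` M -> P 0 -> (forall e (d : R), M e -> 0 < d -> exists2 b, P b & N (b - e) <= d) ->
  0 < del -> L2_bochner leb D M N F ->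
  exists s, [/\ simple_on D M s, (forall x, D x -> P (s x)),
    exists2 B, 0 <= B & forall x, D x -> ~ cube n B x -> s x = 0 &
    (\int[leb]_(x in D) (N (s x - F x) ^+ 2)%:E <= del%:E)%E].
Proof.
move=> hN PM P0 dense d0 LF; have [MF sF iF] := LF.
have d40 : 0 < del / 4 by rewrite divr_gt0.
have [s [ss [B B0 sB] sd]] := L2_bochner_approx hN mD d40 LF.
have vB : (leb (cube n B) < +oo)%E by exact: lebesgue_cube_lty.
have vf : leb (cube n B) \is a fin_num by rewrite ge0_fin_numE.
pose v := fine (leb (cube n B)); have v0 : 0 <= v by rewrite fine_ge0.
(* The moved values contribute at most 2 eta^2 times the measure of the cube, which is at most
   del/2; the other half pays for the simple approximant. *)
pose eta := Num.sqrt (del / (4 * (v + 1))).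
have q0 : 0 < 4 * (v + 1) by rewrite mulr_gt0// ltr_wpDl.
have eta0 : 0 < eta by rewrite sqrtr_gt0 divr_gt0.
have Ms x : D x -> M (s x) by have [_ + _] := ss; move=> h Dx; apply: h; exists x.
(* The value 0 is kept at 0, so the modified function still vanishes outside the cube. *)
have /choice[b hb] : forall e : E, exists b : E, M e -> [/\ P b, N (b - e) <= eta & (e = 0 -> b = 0)].
  move=> e; have [Me|nMe] := pselect (M e); last by exists 0 => /nMe.
  have [->|e0] := eqVneq e 0.
    by exists 0 => _; split=> //; rewrite subrr (sn0 hN) ltW.
  have [b Pb be] := dense e eta Me eta0; exists b => _; split=> // e00.
  by rewrite e00 eqxx in e0.
have sP x : D x -> P (b (s x)) by move=> /Ms /hb[].
have ss' : simple_on D M (fun x => b (s x)).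
  apply: (simple_on_comp2 (op := fun e _ => b e) _ ss ss) => e _ Me _.
  by apply: PM; have [] := hb e Me.
exists (fun x => b (s x)); split=> //.
  exists B => // x Dx nc; have [_ _ h] := hb _ (Ms x Dx); exact: h (sB x Dx nc).
have m1 := measurable_sn_simple hN mD ss MF sF; have m2 := measurable_sn_simple hN mD ss' MF sF.
have mc := @measurable_cube R n B.
have mi : measurable_fun D (fun x => (\1_(cube n B) x)%:E : \bar R).
  by apply/measurable_EFinP; exact: measurable_indic.
have ms2 : measurable_fun D (fun x => (N (s x - F x) ^+ 2)%:E : \bar R).
  by apply/measurable_EFinP; exact: measurable_funX.
have e20 : 0 <= 2 * eta ^+ 2 by rewrite mulr_ge0// sqr_ge0.
apply: (@le_trans _ _ (\int[leb]_(x in D) ((2 * eta ^+ 2)%:E * (\1_(cube n B) x)%:E + 2%:E * (N (s x - F x) ^+ 2)%:E))%E).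
  apply: ge0_le_integral => //.
  - by move=> x _; rewrite lee_fin sqr_ge0.
  - by apply/measurable_EFinP; exact: measurable_funX.
  - by apply: emeasurable_funD; exact: emeasurable_funM.
  move=> x Dx; rewrite -!EFinM -EFinD lee_fin.
  have [Pb be b0] := hb _ (Ms x Dx); have Mb := PM _ Pb; have MFx := MF x Dx; have Msx := Ms x Dx.
  have le1 : N (b (s x) - s x) <= eta * \1_(cube n B) x.
    rewrite indicE; have [h|h] := pselect (cube n B x); first by rewrite mem_set// mulr1.
    by rewrite memNset// mulr0 (b0 (sB x Dx h)) (sB x Dx h) subrr (sn0 hN).
  have le2 : N (b (s x) - F x) <= eta * \1_(cube n B) x + N (s x - F x).
    rewrite -[b (s x) - F x](subrKA (s x)); apply: le_trans (snD hN (smB hN Mb Msx) (smB hN Msx MFx)) _.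
    by rewrite lerD2r.
  have i01 : (\1_(cube n B) x : R) ^+ 2 = \1_(cube n B) x by rewrite indicE; case: (_ \in _); rewrite /= ?expr1n ?expr0n.
  have N0 := sn_ge0 hN (b (s x) - F x); have N1 := sn_ge0 hN (s x - F x).
  have j0 : 0 <= eta * \1_(cube n B) x by rewrite mulr_ge0 ?(ltW eta0).
  apply: (@le_trans _ _ ((eta * \1_(cube n B) x + N (s x - F x)) ^+ 2)).
    by rewrite ler_sqr// nnegrE addr_ge0.
  by apply: le_trans (sqrD_le2 _ _) _; rewrite exprMn i01 mulrA.
rewrite ge0_integralD//; last 4 first.
- by move=> x _; rewrite -EFinM lee_fin mulr_ge0.
- exact: emeasurable_funM.
- by move=> x _; rewrite -EFinM lee_fin mulr_ge0// sqr_ge0.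
- exact: emeasurable_funM.
have e1 : (\int[leb]_(x in D) ((2 * eta ^+ 2)%:E * (\1_(cube n B) x)%:E) = (2 * eta ^+ 2)%:E * leb (cube n B `&` D))%E.
  by rewrite ge0_integralZl// integral_indic.
have e2 : (\int[leb]_(x in D) (2%:E * (N (s x - F x) ^+ 2)%:E) = 2%:E * \int[leb]_(x in D) (N (s x - F x) ^+ 2)%:E)%E.
  by rewrite ge0_integralZl// => x _; rewrite lee_fin sqr_ge0.
rewrite e1 e2.
apply: (@le_trans _ _ ((2 * eta ^+ 2)%:E * v%:E + 2%:E * (del / 4)%:E)%E).
  apply: leeD; last by rewrite lee_wpmul2l.
  rewrite lee_wpmul2l ?lee_fin// /v fineK//; apply: le_measure; rewrite ?inE//; exact: measurableI.
rewrite -!EFinM -EFinD lee_fin /eta sqr_sqrtr; last by apply: divr_ge0; exact: ltW.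
rewrite (_ : 2 * _ * v + _ = del / 2 * (v / (v + 1)) + del / 2); last by field; rewrite gt_eqF// ltr_wpDl.
have vv : v / (v + 1) <= 1 by rewrite ler_pdivrMr ?ltr_wpDl// mul1r lerDl.
rewrite [leRHS](splitr del) lerD2r; apply: ler_piMr => //; apply: divr_ge0 => //; exact: ltW.
Qed.

End transport_theory.

(** * Density of test functions *)

Section tensor.
Context {R : realType} {n : nat}.
Local Notation V := 'rV[R]_n.
Local Notation leb := (lebesgue_rV R n).

Lemma convE (f g : V -> R) x : measurable_fun setT f -> measurable_fun setT g ->
  @mconv R n f g x = \int[leb]_y (f y * g (x + y)).
Proof.
move=> mf mg; rewrite /mconv -(Rintegral_translate x).
  by apply: eq_Rintegral => y _; rewrite addrK addrC.
by apply: measurable_funM => //; exact: (measurableT_comp mf (measurable_rVD (- x))).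
Qed.

Lemma test_tensor (a b : V -> R) : test_fun setT a -> test_fun setT b ->
  test_fun setT (fun p : V * V => a p.1 * b p.2).
Proof.
move=> ta tb; have [M M0 hM] := test_bounded_supp ta; have [M' M0' hM'] := test_bounded_supp tb.
apply: (test_fun_rV2 (M := M + M')) => //.
  apply: smoothM.
    exact: (smooth_comp (f := a) (@is_diff_fst R V V) (test_fun_smooth ta)).
  exact: (smooth_comp (f := b) (@is_diff_snd R V V) (test_fun_smooth tb)).
move=> [y v] /=; rewrite mulf_eq0 negb_or => /andP[ay bv].
rewrite prod_normE/= ge_max; apply/andP; split.
  by apply: le_trans (hM _ ay) _; rewrite lerDl.
by apply: le_trans (hM' _ bv) _; rewrite lerDr.
Qed.

Lemma test_addf2 (f g : V * V -> R) : test_fun setT f -> test_fun setT g -> test_fun setT (fun p => f p + g p).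
Proof.
move=> ta tb; have [M M0 hM] := test_bounded_supp ta; have [M' M0' hM'] := test_bounded_supp tb.
apply: (test_fun_rV2 (M := M + M')) => //.
  by apply: smoothD; [exact: test_fun_smooth ta|exact: test_fun_smooth tb].
move=> p; have [gx|gx _] := eqVneq (f p) 0.
  by rewrite gx add0r => /hM' h; rewrite (le_trans h)// lerDr.
by apply: le_trans (hM p gx) _; rewrite lerDl.
Qed.

Lemma test_tensor_sum (I : eqType) (r : seq I) (a b : I -> V -> R) :
  (forall i, test_fun setT (a i)) -> (forall i, i \in r -> test_fun setT (b i)) ->
  test_fun setT (fun p : V * V => \sum_(i <- r) a i p.1 * b i p.2).
Proof.
move=> ta; elim: r => [|i r IH] tb.
  under eq_fun do rewrite big_nil; apply: (test_fun_rV2 (M := 0)) => //; first exact: smooth_cst.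
  by move=> p; rewrite eqxx.
under eq_fun do rewrite big_cons; apply: test_addf2.
  by apply: test_tensor => //; apply: tb; rewrite mem_head.
by apply: IH => j jr; apply: tb; rewrite inE jr orbT.
Qed.

Lemma derive_lincomb (I : Type) (r : seq I) (a : I -> V -> R) (c : I -> R) x h :
  (forall i, smooth (a i)) ->
  'D_h (fun x => \sum_(i <- r) a i x * c i) x = \sum_(i <- r) 'D_h (a i) x * c i.
Proof.
move=> sa; have sS (s : seq I) : smooth (fun x => \sum_(i <- s) a i x * c i).
  by apply: smooth_sum => i; apply: smoothM => //; exact: smooth_cst.
elim: r => [|i r IH].
  under eq_fun do rewrite big_nil; by rewrite big_nil derive_cst.
under eq_fun do rewrite big_cons; rewrite big_cons -IH.
have d1 : derivable (fun x => a i x * c i) x h.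
  by apply: smooth_derivable; apply: smoothM => //; exact: smooth_cst.
have := deriveD d1 (@smooth_derivable R _ _ x h (sS r)).
move=> ->; congr (_ + _).
have d2 : derivable (fun _ : V => c i) x h by exact: derivable_cst.
by rewrite (deriveM (@smooth_derivable R _ _ x h (sa i)) d2) derive_cst /GRing.scale/= mulr0 add0r mulrC.
Qed.

(** The derivative is supported in the closure of the set where the kernel is nonzero, hence in the
    closed orthant. *)
Lemma derive_mollifier_ge0 k e (y : V) : 'D_e (@mollifier R n k) y != 0 -> forall i, 0 <= y ord0 i.
Proof.
move=> h; have sy : supp (@mollifier R n k) y.
  by apply: contrapT => /(derive_eq0_supp e) h0; rewrite h0 eqxx in h.
have cl : closed [set y : V | forall i, 0 <= y ord0 i].
  rewrite (_ : [set y | _] = \bigcap_i ((fun y : V => y ord0 i) @^-1` [set t | 0 <= t])).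
    by apply: closed_bigI => i _; apply: preimage_closed; [move=> p _; exact: coord_continuous|exact: closed_ge].
  by apply/seteqP; split=> [p hp i _|p hp i]; [exact: hp|exact: hp i I].
move: sy; apply: (supp_subset_closed cl) => z rz i.
by have /andP[/ltW] := mollifier_supp rz i.
Qed.

Lemma linear_on_sum (E : lmodType R) (M : set E) (lam : E -> R) (I : eqType) (r : seq I) (c : I -> R) (b : I -> E) :
  M 0 -> lam 0 = 0 -> (forall a e e', M e -> M e' -> M (a *: e + e')) ->
  (forall a e e', M e -> M e' -> lam (a *: e + e') = a * lam e + lam e') ->
  (forall i, i \in r -> M (b i)) ->
  M (\sum_(i <- r) c i *: b i) /\ lam (\sum_(i <- r) c i *: b i) = \sum_(i <- r) c i * lam (b i).
Proof.
move=> M0 l0 MD lD; elim: r => [|i r IH] Mb; first by rewrite !big_nil.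
have [|h1 h2] := IH; first by move=> j jr; apply: Mb; rewrite inE jr orbT.
have Mi : M (b i) by apply: Mb; rewrite mem_head.
by rewrite !big_cons lD// h2; split=> //; exact: MD.
Qed.

End tensor.

(** The inner product with g divided by the norm of g. It turns an estimate valid for all dominated
    functionals into an estimate of a norm. *)
Lemma norming_functional (R : realType) (E : lmodType R) (M : set E) (B : E -> E -> R) g :
  (forall a e f, M e -> M f -> M (a *: e + f)) -> (forall e f, M e -> M f -> B e f = B f e) ->
  (forall a e f g, M e -> M f -> M g -> B (a *: e + f) g = a * B e g + B f g) ->
  (forall e, 0 <= B e e) -> M g -> Num.sqrt (B g g) != 0 ->
  exists lam : E -> R, [/\ forall a e f, M e -> M f -> lam (a *: e + f) = a * lam e + lam f,
    forall e, M e -> `|lam e| <= Num.sqrt (B e e) & lam g = Num.sqrt (B g g)].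
Proof.
move=> MD BC BD B0 Mg; set N := Num.sqrt (B g g) => N0.
have Np : 0 < N by rewrite lt_neqAle eq_sym N0 sqrtr_ge0.
exists (fun e => N^-1 * B e g); split=> [a e f Me Mf|e Me|].
- by rewrite BD// mulrDr mulrCA.
- rewrite normrM gtr0_norm ?invr_gt0// ler_pdivrMl// mulrC.
  exact: (semi_inner_CS MD BC BD B0 Me Mg).
by rewrite -[B g g]sqr_sqrtr// -/N expr2 mulrA mulVf// mul1r.
Qed.

Section kinetic_density.
Context {R : realType} {n : nat} (mu : {sigma_finite_measure set 'rV[R]_n -> \bar R}) (m : 'rV[R]_n -> R) (kap : R).
Hypothesis wt : weight_of mu m kap.
Local Notation V := 'rV[R]_n.
Local Notation leb := (lebesgue_rV R n).
Variable D : set V.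
Hypothesis mD : measurable D.
Hypothesis Dshift : forall x y : V, D x -> (forall i, 0 <= y ord0 i) -> D (x + y).
Implicit Types (phi : V * V -> R) (g b : V -> R) (f : V -> V -> R) (G : V -> (V -> R) -> R).

Lemma integral_sq_split (u r w : V -> R) (c e del : R) : measurable_fun D u -> measurable_fun D r ->
  measurable_fun D w -> (forall x, 0 <= w x) ->
  (\int[leb]_(x in D) (r x ^+ 2)%:E <= (del / 4)%:E)%E -> (\int[leb]_(x in D) (u x ^+ 2)%:E <= e%:E)%E ->
  c ^+ 2 * e <= del / 4 -> (forall x, D x -> w x <= c * u x + r x) ->
  (\int[leb]_(x in D) (w x ^+ 2)%:E <= del%:E)%E.
Proof.
move=> mu' mr mw w0 r2 u2 ce le.
have msq (k : V -> R) : measurable_fun D k -> measurable_fun D (fun x => (k x ^+ 2)%:E : \bar R).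
  by move=> mk; apply/measurable_EFinP; exact: measurable_funX.
have c20 : 0 <= 2 * c ^+ 2 by rewrite mulr_ge0// sqr_ge0.
apply: (@le_trans _ _ (\int[leb]_(x in D) ((2 * c ^+ 2)%:E * (u x ^+ 2)%:E + 2%:E * (r x ^+ 2)%:E))%E).
  apply: ge0_le_integral => //.
  - by move=> x _; rewrite lee_fin sqr_ge0.
  - exact: msq.
  - by apply: emeasurable_funD; apply: emeasurable_funM => //; exact: msq.
  move=> x Dx; rewrite -!EFinM -EFinD lee_fin; apply: (@le_trans _ _ ((c * u x + r x) ^+ 2)).
    by rewrite ler_sqr ?nnegrE ?le//; apply: le_trans (w0 x) (le x Dx).
  by apply: le_trans (sqrD_le2 _ _) _; rewrite exprMn mulrA.
rewrite ge0_integralD//; last 4 first.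
- by move=> x _; rewrite -EFinM lee_fin mulr_ge0// sqr_ge0.
- by apply: emeasurable_funM => //; exact: msq.
- by move=> x _; rewrite -EFinM lee_fin mulr_ge0// sqr_ge0.
- by apply: emeasurable_funM => //; exact: msq.
rewrite ge0_integralZl//; [|exact: msq|by move=> x _; rewrite lee_fin sqr_ge0].
rewrite ge0_integralZl//; [|exact: msq|by move=> x _; rewrite lee_fin sqr_ge0].
apply: (@le_trans _ _ ((2 * c ^+ 2)%:E * e%:E + 2%:E * (del / 4)%:E)%E).
  by apply: leeD; rewrite lee_wpmul2l// lee_fin.
rewrite -!EFinM -EFinD lee_fin -mulrA; have := ler_wpM2l (ler0n R 2) ce.
move: (2 * (c ^+ 2 * e)) => z; lra.
Qed.

Lemma simple_L2_bochner (E : lmodType R) (M : set E) (N : E -> R) (s F : V -> E) (e : R) :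
  seminorm_on M N -> simple_on D M s -> L2_bochner leb D M N F ->
  (\int[leb]_(x in D) (N (s x - F x) ^+ 2)%:E <= e%:E)%E -> L2_bochner leb D M N s.
Proof.
move=> hN ss LF se; have [MF sF iF] := LF.
have Ms x : D x -> M (s x) by have [_ + _] := ss; move=> h Dx; apply: h; exists x.
have sS : strongly_measurable D M N s.
  by exists (fun=> s); split=> // x _; rewrite subrr (sn0 hN); exact: cvg_cst.
split=> //.
have m1 : measurable_fun D (fun x => (N (s x - F x) ^+ 2)%:E).
  by apply/measurable_EFinP; apply: measurable_funX; exact: (measurable_sn_simple hN mD ss MF sF).
have m2 := measurable_sn2 hN mD MF sF.
have n0 (x : E) : (0 <= (N x ^+ 2)%:E)%E by rewrite lee_fin sqr_ge0.
apply: (@le_lt_trans _ _ (\int[leb]_(x in D) (2%:E * (N (s x - F x) ^+ 2)%:E + 2%:E * (N (F x) ^+ 2)%:E))%E).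
  apply: ge0_le_integral => //.
  - exact: (measurable_sn2 hN mD Ms sS).
  - by apply: emeasurable_funD; apply: emeasurable_funM.
  move=> x Dx; rewrite -!EFinM -EFinD lee_fin; apply: (@le_trans _ _ ((N (s x - F x) + N (F x)) ^+ 2)).
    rewrite ler_sqr ?nnegrE ?addr_ge0 ?(sn_ge0 hN)//.
    by have := snD hN (smB hN (Ms x Dx) (MF x Dx)) (MF x Dx); rewrite subrK.
  exact: sqrD_le2.
rewrite ge0_integralD//; [|by move=> x _; rewrite mule_ge0|exact: emeasurable_funM|by move=> x _; rewrite mule_ge0|exact: emeasurable_funM].
rewrite ge0_integralZl// ?ge0_integralZl//.
by rewrite lte_add_pinfty// lte_mul_pinfty//; apply: le_lt_trans se (ltry _).
Qed.

Lemma sq_sum1_gt0 (a b : R) : 0 <= b -> 0 < a ^+ 2 + b + 1.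
Proof. by move=> b0; have := sqr_ge0 a; lra. Qed.

(** * Error of a mollified simple approximant *)

Section mollified.
Variables (k J : nat) (f : V -> V -> R) (s : V -> V -> R) (r : seq (V -> R)) (B : R).
Hypothesis Lf : L2H1 mu D f.
Hypothesis fJ : forall x v, D x -> cutoff J v * f x v = f x v.
Hypothesis ss : simple_on D [set b : V -> R | test_fun setT b] s.
Hypothesis B0 : 0 <= B.
Hypothesis sB : forall x, D x -> ~ cube n B x -> s x = 0.
Hypothesis ur : uniq r.
Hypothesis rt : forall e, e \in r -> test_fun setT e.
Hypothesis sr : forall x, D x -> s x \in r.
Hypothesis Ls : L2H1 mu D s.

Local Notation rho := (@mollifier R n k).
Let A (e : V -> R) := D `&` s @^-1` [set e].
Let a (e : V -> R) : V -> R := moll k (\1_(A e `&` cube n B)).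
(** The mollification in x of the simple approximant, with each value truncated in the velocity: a
    finite sum of tensor products of test functions. Every estimate below bounds its distance to
    [f], or that of its transport derivative to the one of [f]. *)
Let F (p : V * V) : R := \sum_(e <- r) a e p.1 * (cutoff J p.2 * e p.2).

Let mA e : measurable (A e).
Proof. by have [_ _] := ss; exact. Qed.

Let mAB e : measurable (A e `&` cube n B).
Proof. by apply: measurableI => //; exact: measurable_cube. Qed.

Let i1AB e : leb.-integrable setT (EFin \o (\1_(A e `&` cube n B) : V -> R)).
Proof.
apply: (integrable_bounded_cube (C := 1) (M := B)) => //.
  by move=> x; rewrite indicE; case: (_ \in _); rewrite ?normr1 ?normr0.
by move=> x nc; rewrite indicE memNset// => -[].
Qed.

Let ta e : test_fun setT (a e).
Proof.
by apply: (test_moll k (i1AB e) B0) => x nc; rewrite indicE memNset// => -[].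
Qed.

Let tc e : e \in r -> test_fun setT (fun v => cutoff J v * e v).
Proof. by move=> er; apply: test_funM; [exact: test_cutoff|exact: test_fun_smooth (rt er)]. Qed.

Lemma test_mollified : test_fun setT F.
Proof. exact: test_tensor_sum ta tc. Qed.

(** Intersecting with the cube makes every level set bounded, hence its indicator integrable; only
    the level set of 0 is changed, and it carries no weight. *)
Let A_eq e x : e != 0 -> \1_(A e `&` cube n B) x = \1_(A e) x :> R.
Proof.
move=> e0; rewrite !indicE; have [h|h] := pselect (A e x); last by rewrite !memNset// => -[].
rewrite !mem_set//; split=> //; apply: contrapT => nc; case: h => Dx /= sx.
by move: e0; rewrite -sx (sB Dx nc) eqxx.
Qed.

Let sum_kernel (kp : V -> R) (lam : (V -> R) -> R) x : lam 0 = 0 ->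
  leb.-integrable setT (EFin \o kp) -> (forall y, kp y != 0 -> D (x + y)) ->
  \sum_(e <- r) (\int[leb]_y (kp y * \1_(A e `&` cube n B) (x + y))) * lam e =
  \int[leb]_y (kp y * lam (s (x + y))).
Proof.
move=> l0 ik kD; rewrite (simple_kernel lam ss ur sr ik kD).
apply: eq_bigr => e _; have [->|e0] := eqVneq e 0; first by rewrite l0 mulr0 mul0r.
by rewrite mulrC; congr (_ * _); apply: eq_Rintegral => y _; rewrite A_eq.
Qed.

Let derive_a e i x : 'D_(delta_mx ord0 i) (a e) x =
  - \int[leb]_y ('D_(delta_mx ord0 i) rho y * \1_(A e `&` cube n B) (x + y)).
Proof.
rewrite /a mollE// (derive_conv (i1AB e) x _ (test_mollifier n k)) convE//.
exact: measurable_test (test_funD _ (test_mollifier n k)).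
Qed.

Let rho_D x y : D x -> rho y != 0 -> D (x + y).
Proof. by move=> Dx /mollifier_supp h; apply: Dshift => // i; have /andP[/ltW] := h i. Qed.

Let drho_D x i y : D x -> 'D_(delta_mx ord0 i) rho y != 0 -> D (x + y).
Proof. by move=> Dx /derive_mollifier_ge0 h; exact: Dshift. Qed.

Let h x := H1_norm mu (s x - f x).

Let Lsf : L2H1 mu D (fun x => s x - f x).
Proof.
have := L2_bochner_comb (H1_seminorm wt) mD (-1) Lf Ls.
by under eq_fun do rewrite scaleN1r addrC.
Qed.

Let fJE x : D x -> (fun v => cutoff J v * f x v) = f x.
Proof. by move=> Dx; apply/funext => v; exact: fJ. Qed.

(** The cutoff may be inserted in front of [f], which it leaves unchanged over [D], so the
    difference is a kernel integral of a functional of s - f. The kernel is arbitrary: the mollifier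
    for the H^1 estimate, its derivatives for the dual one. *)
Let kernel_diff (kp : V -> R) (lam : (V -> R) -> R) (c L : R) x :
  D x -> test_fun setT kp -> (forall y, kp y != 0 -> D (x + y)) -> 0 <= L ->
  (forall a e e', H1 mu e -> H1 mu e' -> lam (a *: e + e') = a * lam e + lam e') ->
  (forall e, H1 mu e -> `|lam (fun v => cutoff J v * e v)| <= L * H1_norm mu e) ->
  `|\int[leb]_y (kp y * lam (fun v => cutoff J v * s (x + y) v)) - \int[leb]_y (kp y * lam (f (x + y)))| <=
  L * \int[leb]_y (`|kp y| * (h \_ D) (x + y)).
Proof.
move=> Dx tk kD L0 lD lL; have [K K0 hK] := test_bounded tk.
have [C C0 hC] := H1_cutoff wt.
pose lam' (e : V -> R) := lam (fun v => cutoff J v * e v).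
have Hc e : H1 mu e -> H1 mu (fun v => cutoff J v * e v) by move=> He; have [] := hC J e He.
have lB' e e' : H1 mu e -> H1 mu e' -> lam' (e - e') = lam' e - lam' e'.
  move=> He He'; rewrite /lam' (_ : (fun v => _) = (-1) *: (fun v => cutoff J v * e' v) + (fun v => cutoff J v * e v)).
    by rewrite lD ?mulN1r; [rewrite addrC|exact: Hc|exact: Hc].
  by apply/funext => v; rewrite !fctE /GRing.scale/=; ring.
have kc : (\int[leb]_y (`|kp y|)%:E <= (\int[leb]_y `|kp y|)%:E)%E.
  by rewrite EFin_Rintegral//; exact: (integrable_norm (integrable_test tk)).
have KP F' := @kernel_pairing R n D mD _ _ _ kp K _ lam' F' x (H1_seminorm wt) (measurable_test tk) hK kc kD L L0 lB' lL.
have [i1 _] := KP _ Ls; have [i2 _] := KP _ Lf; have [i3 b3] := KP _ Lsf.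
suff -> : \int[leb]_y (kp y * lam (fun v => cutoff J v * s (x + y) v)) - \int[leb]_y (kp y * lam (f (x + y))) =
  \int[leb]_y (kp y * lam' (s (x + y) - f (x + y))) by exact: b3.
transitivity (\int[leb]_y (kp y * lam' (s (x + y))) - \int[leb]_y (kp y * lam' (f (x + y)))).
  congr (_ - _); apply: eq_Rintegral => y _; have [->|/kD Dxy] := eqVneq (kp y) 0; first by rewrite !mul0r.
  by rewrite /lam' fJE.
rewrite -RintegralB//; apply: eq_Rintegral => y _.
have [->|/kD Dxy] := eqVneq (kp y) 0; first by rewrite !mul0r subrr.
have [Ms _ _] := Ls; have [Mf _ _] := Lf.
by rewrite lB' ?mulrBr//; [exact: Ms|exact: Mf].
Qed.

Let F_slice x : (fun v => F (x, v)) = \sum_(e <- r) a e x *: (fun v => cutoff J v * e v).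
Proof. by apply/funext => v; rewrite fct_sumE. Qed.

Let H1_test e : test_fun setT e -> H1 mu e.
Proof. by move=> te; have [] := test_H1 wt te. Qed.

(** The norm of the error is its value under a norming functional. Through that functional the error
    splits into the mollification of s - f, handled by [kernel_diff], and the mollification error of
    [f], bounded by [r1] for all functionals at once. *)
Lemma mollified_H1 (C r1 : R) x : D x -> 0 <= C ->
  (forall e, H1 mu e -> H1_norm mu (fun v => cutoff J v * e v) <= C * H1_norm mu e) ->
  (forall lam, functional_le (H1 mu) (H1_norm mu) lam ->
    `|\int[leb]_y (rho y * lam (f (x + y))) - lam (f x)| <= r1) -> 0 <= r1 ->
  H1_norm mu ((fun v => F (x, v)) - f x) <= C * \int[leb]_y (`|rho y| * (h \_ D) (x + y)) + r1.
Proof.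
move=> Dx C0 hC h1 r10; have [Mf _ _] := Lf; have Hfx := Mf x Dx.
set g := _ - f x; have HF : H1 mu (fun v => F (x, v)) by exact: (H1_slice wt x test_mollified).
have Hg : H1 mu g by exact: (H1B wt).
have u0 : 0 <= \int[leb]_y (`|rho y| * (h \_ D) (x + y)).
  apply: Rintegral_ge0 => y _; apply: mulr_ge0 => //; rewrite patchE; case: ifP => // _.
  exact: (H1_norm_ge0 wt).
have [g0|g0] := eqVneq (H1_norm mu g) 0; first by rewrite g0 addr_ge0// mulr_ge0.
have [lam [lD ll lg]] := norming_functional (H1_comb wt) (fun e e' _ _ => H1dotC mu e e') (H1dotD wt) (H1dot_ge0 mu) Hg g0.
have fl : functional_le (H1 mu) (H1_norm mu) lam.
  split=> // e e' He He'; have := lD (-1) e' e He' He.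
  by rewrite scaleN1r addrC mulN1r addrC => ->; rewrite addrC.
have l0 : lam 0 = 0.
  by have := lD (-1) 0 0 (H1_0 mu) (H1_0 mu); rewrite scaler0 addr0 mulN1r addNr.
have lF : lam (fun v => F (x, v)) = \int[leb]_y (rho y * lam (fun v => cutoff J v * s (x + y) v)).
  rewrite F_slice.
  have [_ ->] := linear_on_sum (fun e => a e x) (H1_0 mu) l0 (H1_comb wt) lD (fun e er => H1_test (tc er)).
  rewrite -(@sum_kernel rho (fun e => lam (fun v => cutoff J v * e v)) x)//.
  - by rewrite (_ : (fun v => _) = 0)//; apply/funext => v; rewrite mulr0.
  - exact: integrable_test (test_mollifier n k).
  - by move=> y; exact: rho_D.
have kd := @kernel_diff rho lam C C x Dx (test_mollifier n k) (fun y => @rho_D x y Dx) C0 lD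
  (fun e He => le_trans (ll _ (H1_cutoff_mem wt J He)) (hC e He)).
have lgN : H1_norm mu g = lam g by rewrite lg.
have lB : lam g = lam (fun v => F (x, v)) - lam (f x) by exact: fl.1.
rewrite [leLHS]lgN lB lF.
set I1 := \int[leb]_y _; set I2 := \int[leb]_y (rho y * lam (f (x + y))) in kd.
rewrite -(subrKA I2); apply: lerD; first by apply: le_trans (ler_norm _) kd.
by apply: le_trans (ler_norm _) (h1 lam fl).
Qed.

Let kap' i : V -> R := 'D_(delta_mx ord0 i) rho.

Let tkap i : test_fun setT (kap' i).
Proof. exact: test_funD (test_mollifier n k). Qed.

Let derive_F x v : 'D_(v, 0) F (x, v) =
  \sum_i v ord0 i * \sum_(e <- r) 'D_(delta_mx ord0 i) (a e) x * (cutoff J v * e v).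
Proof.
rewrite deriveE_coordl; last exact: smooth_differentiable (test_fun_smooth test_mollified).
apply: eq_bigr => i _; apply: (congr1 (fun z : R => v ord0 i * z)).
rewrite -(derive_lincomb r (fun e => cutoff J v * e v) x (delta_mx ord0 i) (fun e => test_fun_smooth (ta e))).
have := @derive_comp_affine R _ _ F (fun x : V => (x, v)) (fun e => (e, 0)) x (delta_mx ord0 i) (is_diff_pairl v x).
by move=> <- //; exact: smooth_differentiable (test_fun_smooth test_mollified).
Qed.

(** The i-th component of v in v . grad_x, moved to the test function b: once the x-derivative sits
    on the kernel, the transport derivative is a sum of such moments. *)
Let velocity_moment b i (e : V -> R) := riesz mu (fun v => v ord0 i * b v) e.

Let tvb b i : test_fun setT b -> test_fun setT (fun v : V => v ord0 i * b v).
Proof. by move=> tb; under eq_fun do rewrite mulrC; apply: test_funM => //; exact: smooth_coord. Qed.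

Let moment_Hm1 b i : test_fun setT b -> Hm1 mu (velocity_moment b i).
Proof. by move=> tb; apply: (riesz_Hm1 wt); have [] := proj1 (H1P mu _) (H1_test (tvb i tb)). Qed.

(** The velocity factor is unbounded on H^1, but the cutoff confines it to |v| <= 2 (J + 1); this is
    why truncation in the velocity comes before mollification. *)
Let moment_le b i : test_fun setT b -> H1_norm mu b <= 1 -> forall e, H1 mu e ->
  `|velocity_moment b i (fun v => cutoff J v * e v)| <= 2 * J.+1%:R * H1_norm mu e.
Proof.
move=> tb b1 e He; have tq : test_fun setT (fun v => cutoff J v * (v ord0 i * b v)).
  by apply: test_funM; [exact: test_cutoff|exact: test_fun_smooth (tvb i tb)].
have [sq _] := proj1 (H1P mu _) (H1_test tq); have [sb _] := proj1 (H1P mu _) (H1_test tb).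
rewrite /velocity_moment (_ : riesz mu _ _ = riesz mu (fun v => cutoff J v * (v ord0 i * b v)) e); last first.
  by apply: eq_Rintegral => v _; rewrite mulrCA mulrA.
apply: le_trans (riesz_CS wt sq He) _; apply: ler_wpM2r; first exact: (H1_norm_ge0 wt).
have L0 : 0 <= 2 * J.+1%:R :> R by rewrite mulr_ge0.
rewrite -[leRHS](ger0_norm L0) -sqrtr_sqr; apply: ler_wsqrtr.
apply: (@le_trans _ _ ((2 * J.+1%:R) ^+ 2 * \int[mu]_v (b v ^+ 2))).
  rewrite -RintegralZl//; last exact: sq_integrableP.
  apply: le_Rintegral => //; [exact: sq_integrableP|by apply: intZ => //; exact: sq_integrableP|].
  move=> v _; rewrite mulrA exprMn ler_wpM2r ?sqr_ge0// -[leLHS]real_normK ?num_real// ler_sqr ?nnegrE//.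
  rewrite normrM; have [->|cv] := eqVneq (@cutoff R n J v) 0; first by rewrite normr0 mul0r.
  rewrite (ger0_norm (cutoff_ge0 J v)); apply: le_trans (ler_wpM2r (normr_ge0 _) (cutoff_le1 J v)) _.
  by rewrite mul1r; apply: le_trans (rV_norm_coord v i) (cutoff_supp cv).
rewrite ler_piMr ?sqr_ge0//; apply: le_trans (L2_le_H1_norm wt (H1_test tb)) _.
by rewrite -[leRHS](expr1n _ 2) ler_sqr ?nnegrE ?(H1_norm_ge0 wt).
Qed.

Let transport_F_pair b x : D x -> test_fun setT b ->
  riesz mu (fun v => 'D_(v, 0) F (x, v)) b =
  - \sum_i \int[leb]_y (kap' i y * velocity_moment b i (fun v => cutoff J v * s (x + y) v)).
Proof.
move=> Dx tb.
pose Fi i : V -> R := \sum_(e <- r) 'D_(delta_mx ord0 i) (a e) x *: (fun v => cutoff J v * e v).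
have mm i := moment_Hm1 i tb.
have hF i := linear_on_sum (M := H1 mu) (lam := velocity_moment b i)
  (fun e => 'D_(delta_mx ord0 i) (a e) x) (H1_0 mu) (Hm1_0 wt (mm i)) (H1_comb wt) (mm i).1 (fun e er => H1_test (tc er)).
have FiE i v : Fi i v = \sum_(e <- r) 'D_(delta_mx ord0 i) (a e) x * (cutoff J v * e v) by rewrite /Fi fct_sumE.
have ii (i : 'I_n) : mu.-integrable setT (EFin \o (fun v : V => v ord0 i * b v * Fi i v)).
  have [Hi _] := hF i; have [s1 _] := proj1 (H1P mu _) Hi; have [s2 _] := proj1 (H1P mu _) (H1_test (tvb i tb)).
  exact: (sq_integrableM s2 s1).
have [_ el] := @Rintegral_lincomb _ _ R mu setT _ (index_enum 'I_n) (fun=> 1) _ measurableT ii.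
transitivity (\sum_i 1 * \int[mu]_v (v ord0 i * b v * Fi i v)).
  rewrite -el; apply: eq_Rintegral => v _; rewrite derive_F mulr_suml; apply: eq_bigr => i _.
  by rewrite FiE mul1r mulrAC.
rewrite -sumrN; apply: eq_bigr => i _; rewrite mul1r.
have [_ e2] := hF i; rewrite -[LHS]/(velocity_moment b i (Fi i)) e2.
rewrite -(@sum_kernel (kap' i) (fun e => velocity_moment b i (fun v => cutoff J v * e v)) x).
- by rewrite -sumrN; apply: eq_bigr => e _; rewrite derive_a mulNr.
- by rewrite (_ : (fun v => _) = 0) ?(Hm1_0 wt (mm i))//; apply/funext => v; rewrite mulr0.
- exact: integrable_test (tkap i).
- by move=> y; exact: drho_D.
Qed.

Let moment_kernel_int b i x : D x -> test_fun setT b -> 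
  leb.-integrable setT (EFin \o (fun y => kap' i y * velocity_moment b i (f (x + y)))).
Proof.
move=> Dx tb; have mm := moment_Hm1 i tb; have [K K0 hK] := test_bounded (tkap i).
have kc : (\int[leb]_y (`|kap' i y|)%:E <= (\int[leb]_y `|kap' i y|)%:E)%E.
  by rewrite EFin_Rintegral//; exact: (integrable_norm (integrable_test (tkap i))).
have [ii _] := @kernel_pairing R n D mD _ _ _ (kap' i) K _ (velocity_moment b i) f x (H1_seminorm wt)
  (measurable_test (tkap i)) hK kc (fun y => @drho_D x i y Dx) (Hm1_norm mu (velocity_moment b i)) (Hm1_norm_ge0 wt _)
  (fun e e' He He' => Hm1B mm He He') (fun e He => Hm1_le wt mm He) Lf.
exact: ii.
Qed.

(** The transport equation tested with the shifted mollifier times [b]: the mollified [G] becomes a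
    sum of integrals of derivatives of the kernel against moments of [f], of the same form as for
    [F] with s in place of f. *)
Let transport_G_pair b x G : D x -> test_fun setT b -> L2Hm1_transport mu D f G ->
  \int[leb]_y (rho y * G (x + y) b) = - \sum_i \int[leb]_y (kap' i y * velocity_moment b i (f (x + y))).
Proof.
move=> Dx tb [LG tG]; have [Mf _ _] := Lf.
rewrite (moll_pair wt mD Dshift k LG Dx tb).
have tG' := tG _ (test_shifted_mollifier Dshift k Dx tb).
rewrite [LHS]tG'.
apply: (congr1 (fun z : R => - z)).
have ik i := moment_kernel_int i Dx tb.
have [iH eH] := @Rintegral_lincomb _ _ R leb setT _ (index_enum 'I_n) (fun=> 1) _ measurableT ik.
transitivity (\int[leb]_y \sum_i 1 * (kap' i y * velocity_moment b i (f (x + y)))); last first.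
  by rewrite eH; apply: eq_bigr => i _; rewrite mul1r.
have mH : measurable_fun setT (fun y : V => \sum_i 1 * (kap' i y * velocity_moment b i (f (x + y)))).
  by apply/measurable_EFinP; exact: measurable_int iH.
rewrite -(Rintegral_translate (- x) mH) Rintegral_mkcond; apply: eq_Rintegral => x' _.
rewrite patchE (addrC x (x' - x)) subrK; case: ifPn => [/set_mem Dx'|/negP nD]; last first.
  rewrite big1// => i _; rewrite mul1r.
  have [->|/(@drho_D x i _ Dx)] := eqVneq (kap' i (x' - x)) 0; first by rewrite mul0r.
  by rewrite addrC subrK => Dx'; exfalso; apply: nD; apply/mem_set.
have sf := proj1 (proj1 (H1P mu _) (Mf x' Dx')).
have ii (i : 'I_n) : mu.-integrable setT (EFin \o (fun v : V => v ord0 i * b v * f x' v)).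
  have [s2 _] := proj1 (H1P mu _) (H1_test (tvb i tb)); exact: (sq_integrableM s2 sf).
have [_ el] := @Rintegral_lincomb _ _ R mu setT _ (index_enum 'I_n) (fun i => kap' i (x' - x)) _ measurableT ii.
rewrite (eq_bigr (fun i => kap' i (x' - x) * \int[mu]_v (v ord0 i * b v * f x' v))) => [|i _]; last by rewrite mul1r.
rewrite -el; apply: eq_Rintegral => v _.
have tp := test_shifted_mollifier Dshift k Dx tb.
have e1 := @derive_comp_affine R _ _ _ (fun x : V => (x, v)) (fun e => (e, 0)) x' v (is_diff_pairl v x')
  (smooth_differentiable (x', v) (test_fun_smooth tp)).
rewrite -e1 /=.
have sm : smooth (fun y : V => rho (y - x)).
  exact: (smooth_comp (@is_diff_translate R _ (- x)) (@smooth_mollifier R n k)).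
have dc : derivable (fun _ : V => b v) x' v by exact: derivable_cst.
rewrite (deriveM (@smooth_derivable R _ _ x' v sm) dc) derive_cst /GRing.scale/= mulr0 add0r.
have e2 := @derive_comp_affine R _ _ rho (fun y => y - x) id x' v (is_diff_translate (- x) x')
  (smooth_differentiable (x' - x) (@smooth_mollifier R n k)).
rewrite e2 deriveE_coord; last exact: smooth_differentiable (@smooth_mollifier R n k).
rewrite mulr_sumr mulr_sumr; apply: eq_bigr => i _; rewrite -/(kap' i).
rewrite /kap'; move: ('D__ _ _) => z; ring.
Qed.

(** Tested on [b], the transport derivative of [F] and the mollified [G] differ by a kernel integral
    of moments of s - f, where the kernel is a derivative of the mollifier. Its mass may be large,
    but it is multiplied by an error chosen later. *)
Lemma mollified_Hm1 G (r2 : R) x : D x -> L2Hm1_transport mu D f G ->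
  (forall lam, functional_le (Hm1 mu) (Hm1_norm mu) lam ->
    `|\int[leb]_y (rho y * lam (G (x + y))) - lam (G x)| <= r2) ->
  Hm1_norm mu (riesz mu (fun v => 'D_(v, 0) F (x, v)) - G x) <=
  2 * J.+1%:R * (\sum_i \int[leb]_y (`|kap' i y| * (h \_ D) (x + y))) + r2.
Proof.
move=> Dx tG hG; have [LG _] := tG; have [MG _ _] := LG.
have mT : Hm1 mu (riesz mu (fun v => 'D_(v, 0) F (x, v))).
  by apply: (riesz_Hm1 wt); have [] := proj1 (H1P mu _) (H1_slice wt x (test_transport test_mollified)).
apply: (Hm1_norm_le_test wt); first exact: (smB (Hm1_seminorm wt) mT (MG x Dx)).
move=> b tb b1; have L0 : 0 <= 2 * J.+1%:R :> R by rewrite mulr_ge0.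
have := hG _ (Hm1_functional_le wt tb b1); rewrite (transport_G_pair Dx tb tG).
rewrite [X in _ -> `|X| <= _](_ : _ = riesz mu (fun v => 'D_(v, 0) F (x, v)) b - G x b)//.
rewrite (transport_F_pair Dx tb).
set P := \sum_i _; set Q := \sum_i \int[leb]_y (kap' i y * velocity_moment b i (fun v => cutoff J v * s (x + y) v)) => h1.
rewrite -(subrKA (- P)); apply: le_trans (ler_normD _ _) _; apply: lerD => //.
rewrite opprK addrC -sumrB mulr_sumr; apply: le_trans (ler_norm_sum _ _ _) _; apply: ler_sum => i _.
have kd := @kernel_diff (kap' i) (velocity_moment b i) _ _ x Dx (tkap i) (fun y => @drho_D x i y Dx) L0
  (moment_Hm1 i tb).1 (moment_le i tb b1).
by rewrite distrC; exact: kd.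
Qed.

End mollified.

(** The order of choices matters: first the scale [k], which makes the two mollification errors
    small, then the simple approximant, with a precision depending on the kernel at that scale. *)
Lemma kinetic_dense_compact J f G (del : R) : 0 < del -> L2H1 mu D f ->
  (forall x v, D x -> cutoff J v * f x v = f x v) -> L2Hm1_transport mu D f G ->
  exists F, [/\ test_fun setT F,
    (\int[leb]_(x in D) (H1_norm mu ((fun v => F (x, v)) - f x) ^+ 2)%:E <= del%:E)%E &
    (\int[leb]_(x in D) (Hm1_norm mu (riesz mu (fun v => 'D_(v, 0) F (x, v)) - G x) ^+ 2)%:E <= del%:E)%E].
Proof.
move=> d0 Lf fJ tG; have [LG _] := tG; have d4 : 0 < del / 4 by rewrite divr_gt0.
have [C C0 hC] := H1_cutoff wt.
have Dsh (x y : V) (Dx : D x) (h : forall i, 0 < y ord0 i) : D (x + y) := Dshift Dx (fun i => ltW (h i)).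
have [k _ /(_ k (leqnn k)) [[r1 [mr1 r10 r1d h1]] [r2 [mr2 r20 r2d h2]]]] :=
  filterI (mollify_approx (H1_seminorm wt) mD Dsh d4 Lf) (mollify_approx (Hm1_seminorm wt) mD Dsh d4 LG).
pose kp i : V -> R := 'D_(delta_mx ord0 i) (@mollifier R n k).
have tkp i : test_fun setT (kp i) by exact: test_funD (test_mollifier n k).
have ikp i : leb.-integrable setT (EFin \o (fun y => `|kp i y|)) by exact: (integrable_norm (integrable_test (tkp i))).
pose c := \int[leb]_y \sum_i 1 * `|kp i y|.
have [iks _] := @Rintegral_lincomb _ _ R leb setT _ (index_enum 'I_n) (fun=> 1) _ measurableT ikp.
pose L : R := 2 * J.+1%:R; have L0 : 0 <= L by rewrite mulr_ge0.
(* With e = del/(4 W), both C^2 e and L^2 c^2 e are at most del/4; here [L] bounds the truncated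
   velocities and [c] is the total mass of the derivatives of the kernel. *)
pose W := C ^+ 2 + L ^+ 2 * c ^+ 2 + 1.
have W0 : 0 < W by exact: sq_sum1_gt0 (mulr_ge0 (sqr_ge0 L) (sqr_ge0 c)).
pose e := del / 4 / W; have e0 : 0 < e by rewrite divr_gt0.
have eW : e * W = del / 4 by rewrite /e mulfVK// gt_eqF.
have t0 : test_fun setT (0 : V -> R) by rewrite -(subrr (@mollifier R n 0)); exact: test_funB (test_mollifier n 0) (test_mollifier n 0).
have [s [ss sP [B B0 sB] sd]] := L2_bochner_approx_dense (P := [set b | test_fun setT b]) mD (H1_seminorm wt)
  (fun b tb => proj1 (test_H1 wt tb)) t0 (fun g d Hg dp => let: ex_intro b (conj h h') := H1_dense wt Hg dp in ex_intro2 _ _ b h h') e0 Lf.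
have ssP : simple_on D [set b | test_fun setT b] s.
  by have [h _ h'] := ss; split=> // b [x Dx <-]; exact: sP.
have [r [ur rt sr]] := simple_on_seq ssP.
have Ls := simple_L2_bochner (H1_seminorm wt) ss Lf sd.
pose F (p : V * V) : R := \sum_(b <- r) moll k (\1_((D `&` s @^-1` [set b]) `&` cube n B)) p.1 * (cutoff J p.2 * b p.2).
have tF : test_fun setT F by exact: (test_mollified k J ssP B0 rt).
have subL (E : lmodType R) (M : set E) (N : E -> R) F1 F2 : seminorm_on M N -> L2_bochner leb D M N F1 ->
    L2_bochner leb D M N F2 -> measurable_fun D (fun x => N (F1 x - F2 x)).
  move=> hN L1 L2; have := L2_bochner_comb hN mD (-1) L2 L1; under eq_fun do rewrite scaleN1r addrC.
  by move=> [h h' _]; exact: (measurable_sn hN mD h h').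
pose h x := H1_norm mu (s x - f x).
have [Mf sf _] := Lf; have [MG sG _] := LG.
have mh : measurable_fun D h by exact: (measurable_sn_simple (H1_seminorm wt) mD ss Mf sf).
have h0 x : 0 <= h x by exact: (H1_norm_ge0 wt).
have hoo : (\int[leb]_(x in D) (h x ^+ 2)%:E < +oo)%E by apply: le_lt_trans sd (ltry _).
have [K1 K10 hK1] := test_bounded (@test_mollifier R n k).
have ab1 y : 0 <= `|@mollifier R n k y| <= K1 by rewrite normr_ge0 hK1.
have c1 : (\int[leb]_y (`|@mollifier R n k y|)%:E <= 1%:E)%E.
  by under eq_integral do rewrite (ger0_norm (mollifier_ge0 _ _)); rewrite integral_mollifier.
have [_ mu1 u10 Y1] := young mD (measurableT_comp (@normr_measurable R setT) (measurable_test (test_mollifier n k))) ab1 c1 mh h0 hoo.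
have /choice[K hK] : forall i : 'I_n, exists K, forall y, `|kp i y| <= K.
  by move=> i; have [K _ h'] := test_bounded (tkp i); exists K.
have mk2 : measurable_fun setT (fun y : V => \sum_i 1 * `|kp i y|).
  by apply/measurable_EFinP; exact: measurable_int iks.
have ab2 (y : V) : 0 <= \sum_i 1 * `|kp i y| <= \sum_i K i.
  apply/andP; split; first by apply: sumr_ge0 => i _; rewrite mul1r.
  by apply: ler_sum => i _; rewrite mul1r.
have c2 : (\int[leb]_y (\sum_i 1 * `|kp i y|)%:E <= c%:E)%E by rewrite EFin_Rintegral.
have [_ mu2 u20 Y2] := young mD mk2 ab2 c2 mh h0 hoo.
set u1 := fun x => \int[leb]_y (`|@mollifier R n k y| * (h \_ D) (x + y)) in mu1 u10 Y1.
set u2 := fun x => \int[leb]_y ((\sum_i 1 * `|kp i y|) * (h \_ D) (x + y)) in mu2 u20 Y2.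
have onD (u : V -> R) z : measurable_fun setT u -> (\int[leb]_x (u x ^+ 2)%:E <= (z ^+ 2)%:E * \int[leb]_(x in D) (h x ^+ 2)%:E)%E ->
    (\int[leb]_(x in D) (u x ^+ 2)%:E <= (z ^+ 2 * e)%:E)%E.
  move=> mu' Y; apply: (@le_trans _ _ (\int[leb]_x (u x ^+ 2)%:E)%E).
    apply: (@ge0_subset_integral _ _ R leb _ _ mD measurableT) => //; last by move=> x _; rewrite lee_fin sqr_ge0.
    by apply/measurable_EFinP; exact: measurable_funX.
  by apply: le_trans Y _; rewrite EFinM lee_wpmul2l// lee_fin sqr_ge0.
have Ce : C ^+ 2 * (1 ^+ 2 * e) <= del / 4.
  rewrite expr1n mul1r mulrC -eW; apply: ler_wpM2l; first exact: ltW.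
  by rewrite /W -addrA lerDl addr_ge0// mulr_ge0 ?sqr_ge0.
have Le : L ^+ 2 * (c ^+ 2 * e) <= del / 4.
  rewrite mulrA mulrC -eW; apply: ler_wpM2l; first exact: ltW.
  by rewrite /W -addrA addrCA lerDl addr_ge0// sqr_ge0.
exists F; split=> //.
  apply: (integral_sq_split (measurable_funTS mu1) mr1 _ (fun x => H1_norm_ge0 wt _) r1d (onD _ _ mu1 Y1) Ce).
    exact: (subL _ _ _ _ _ (H1_seminorm wt) (slice_L2H1 wt mD tF) Lf).
  move=> x Dx; apply: (mollified_H1 Lf fJ ssP B0 sB ur rt sr Ls Dx C0 (fun e He => proj2 (hC J e He)) _ (r10 x)).
  by move=> lam fl; exact: proj2 (h1 lam fl x Dx).
have tT := test_transport tF.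
apply: (integral_sq_split (measurable_funTS mu2) mr2 _ (fun x => Hm1_norm_ge0 wt _) r2d (onD _ _ mu2 Y2) Le).
  exact: (subL _ _ _ _ _ (Hm1_seminorm wt) (L2Hm1_riesz wt mD (slice_L2H1 wt mD tT)) LG).
move=> x Dx; rewrite (_ : u2 x = \sum_i \int[leb]_y (`|kp i y| * (h \_ D) (x + y))).
  apply: (mollified_Hm1 Lf fJ ssP B0 sB ur rt sr Ls Dx tG).
  by move=> lam fl; exact: proj2 (h2 lam fl x Dx).
have ii (i : 'I_n) : leb.-integrable setT (EFin \o (fun y : V => `|kp i y| * (h \_ D) (x + y))).
  have aa y : 0 <= `|kp i y| <= K i by rewrite normr_ge0 hK.
  have cc : (\int[leb]_y (`|kp i y|)%:E <= (\int[leb]_y `|kp i y|)%:E)%E by rewrite EFin_Rintegral.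
  have mk : measurable_fun setT (fun y => `|kp i y|) by exact: (measurableT_comp (@normr_measurable R setT) (measurable_test (tkp i))).
  by have [ih _ _ _] := young mD mk aa cc mh h0 hoo; exact: ih.
have [_ el] := @Rintegral_lincomb _ _ R leb setT _ (index_enum 'I_n) (fun=> 1) _ measurableT ii.
transitivity (\sum_i 1 * \int[leb]_y (`|kp i y| * (h \_ D) (x + y))); last by apply: eq_bigr => i _; rewrite mul1r.
rewrite -el; apply: eq_Rintegral => y _; rewrite mulr_suml; apply: eq_bigr => i _.
by rewrite !mul1r.
Qed.

(** Truncation in the velocity converges in both parts of the graph norm, and the truncated function
    falls under [kinetic_dense_compact]. Each part passes through one intermediate function at
    squared distance at most e, giving 4 e, and e = del^2/8. *)
Lemma kinetic_dense f (del : R) : 0 < del -> kinetic mu D f ->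
  exists2 F, test_fun setT F & kinetic_norm mu D ((fun x v => F (x, v)) - f) <= del.
Proof.
move=> d0 [Lf [G tG]]; have [LG _] := tG.
have [C C0 hC] := H1_cutoff wt.
pose e := del ^+ 2 / 8; have e0 : 0 < e by rewrite divr_gt0// exprn_gt0.
have opl j l : Hm1 mu l -> Hm1_norm mu (fun g => l (fun v => cutoff j v * g v)) <= C * Hm1_norm mu l.
  move=> ml; apply: (Hm1_norm_le wt) => g Hg g1.
  have [Hc hc] := hC j g Hg; apply: le_trans (Hm1_le wt ml Hc) _; rewrite [leRHS]mulrC.
  apply: ler_wpM2l; first exact: (Hm1_norm_ge0 wt).
  by apply: le_trans hc _; rewrite ler_piMr.
have opB1 j g g' : H1 mu g -> H1 mu g' -> (fun v : V => cutoff j v * g v) - (fun v => cutoff j v * g' v) = (fun v => cutoff j v * (g - g') v).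
  by move=> _ _; apply/funext => v; rewrite !fctE -mulrBr.
have opB2 j (l l' : (V -> R) -> R) : Hm1 mu l -> Hm1 mu l' ->
    (fun g => l (fun v => cutoff j v * g v)) - (fun g => l' (fun v => cutoff j v * g v)) = (fun g => (l - l') (fun v => cutoff j v * g v)).
  by [].
have hop2 j (l : (V -> R) -> R) : Hm1 mu l -> Hm1 mu (fun g => l (fun v => cutoff j v * g v)) by exact: (Hm1_comp_cutoff wt j).
have [L1 n1] := L2_bochner_op_cvg (op := fun j g v => cutoff j v * g v) mD (H1_seminorm wt) (fun j => H1_cutoff_mem wt j)
  opB1 C0 (fun j g Hg => proj2 (hC j g Hg)) (fun g d Hg dp => H1_cutoff_cvg wt Hg dp) Lf e0.
have [L2 n2] := L2_bochner_op_cvg (op := fun j (l : (V -> R) -> R) (g : V -> R) => l (fun v => cutoff j v * g v)) mD (Hm1_seminorm wt) hop2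
  opB2 C0 opl (fun l d Hg dp => Hm1_cutoff_cvg wt Hg dp) LG e0.
have [j _ /(_ j (leqnn j)) [c1 c2]] := filterI n1 n2.
(* Here J + 1 = 2 (j + 1), so the cutoff of index [J] is 1 on the support of the one of index
   [j]. *)
pose J := (2 * j).+1.
have cJ (x v : V) : D x -> cutoff J v * (cutoff j v * f x v) = cutoff j v * f x v.
  move=> _; have [->|cv] := eqVneq (@cutoff R n j v) 0; first by rewrite mul0r mulr0.
  by rewrite (cutoff1 (j := J)) ?mul1r//; apply: le_trans (cutoff_supp cv) _; rewrite -natrM ler_nat mulnS.
have [F [tF F1 F2]] := kinetic_dense_compact e0 (L1 j) cJ (conj (L2 j) (transport_cutoff j tG)).
have [LF tT] := test_kinetic wt mD tF (f := fun x v => F (x, v)) (fun x _ => erefl).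
exists F => //; have [h1 h2] := transport_comb wt mD (-1) Lf LF tG tT.
have tri (E : lmodType R) (M : set E) (N : E -> R) (f1 f2 f3 : V -> E) : seminorm_on M N ->
    L2_bochner leb D M N f1 -> L2_bochner leb D M N f2 -> L2_bochner leb D M N f3 ->
    (\int[leb]_(x in D) (N (f1 x - f2 x) ^+ 2)%:E <= e%:E)%E -> (\int[leb]_(x in D) (N (f2 x - f3 x) ^+ 2)%:E <= e%:E)%E ->
    L2_bochner_norm leb D N (fun x => (-1) *: f3 x + f1 x) ^+ 2 <= 4 * e.
  move=> hN l1 l2 l3 e1 e2.
  have sub (g1 g2 : V -> E) : L2_bochner leb D M N g1 -> L2_bochner leb D M N g2 -> L2_bochner leb D M N (fun x => g1 x - g2 x).
    by move=> k1 k2; have := L2_bochner_comb hN mD (-1) k2 k1; under eq_fun do rewrite scaleN1r addrC.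
  rewrite (_ : (fun x => (-1) *: f3 x + f1 x) = fun x => 1 *: (f1 x - f2 x) + (f2 x - f3 x)); last first.
    by apply/funext => x; rewrite scaleN1r scale1r subrKA addrC.
  apply: le_trans (L2_bochner_norm_comb hN mD 1 (sub _ _ l1 l2) (sub _ _ l2 l3)) _.
  have b1 : L2_bochner_norm leb D N (fun x => f1 x - f2 x) ^+ 2 <= e by rewrite -lee_fin (L2_bochner_norm_sqEFin hN mD (sub _ _ l1 l2)).
  have b2 : L2_bochner_norm leb D N (fun x => f2 x - f3 x) ^+ 2 <= e by rewrite -lee_fin (L2_bochner_norm_sqEFin hN mD (sub _ _ l2 l3)).
  move: b1 b2; move: (L2_bochner_norm _ _ _ _) (L2_bochner_norm _ _ _ _) => z1 z2 b1 b2.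
  rewrite expr1n mulr1 (_ : 4 * e = 2 * e + 2 * e); last by rewrite -mulrDl -natrD.
  by apply: lerD; apply: ler_wpM2l.
have b1 := tri _ _ _ _ _ _ (H1_seminorm wt) LF (L1 j) Lf F1 c1.
have b2 := tri _ _ _ _ _ _ (Hm1_seminorm wt) tT.1 (L2 j) LG F2 c2.
have kn := kinetic_norm_sq wt mD Dshift h2.
rewrite (_ : _ - f = (-1) *: f + (fun x v => F (x, v))); last by rewrite scaleN1r addrC.
rewrite -(ler_sqr (kinetic_norm_ge0 _ _ _)); last exact: ltW.
rewrite [leLHS]kn (_ : del ^+ 2 = 4 * e + 4 * e); last by rewrite /e; field.
exact: (lerD b1 b2).
Qed.

End kinetic_density.

(** * The boundary multiplier *)

Section profile.
Context {R : realType}.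
Implicit Types r w : R.

Definition rad r w := Num.sqrt (w ^+ 2 + r ^+ 2).
(** A smoothing of sign(w) at width r. The simpler w / [rad r w] decreases in r for w > 0, which
    would give the drift the wrong sign; with 3 r^2 added, the derivative in r has the sign of w
    (w^2 - r^2), so the drift is nonnegative for |w| >= r. *)
Definition profile r w := w * (w ^+ 2 + 3 * r ^+ 2) * (rad r w)^-1 ^+ 3.
Definition profile_w r w := 3 * r ^+ 2 * (r ^+ 2 - w ^+ 2) * (rad r w)^-1 ^+ 5.
Definition profile_r r w := 3 * w * r * (w ^+ 2 - r ^+ 2) * (rad r w)^-1 ^+ 5.
(** In the Hardy inequality the potential is [barrier_w] minus the square of [barrier], that is (4
    r^2 - 2 w^2)/(w^2 + 4 r^2)^2: of size r^-2 for |w| < r, where the drift is not positive. For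
    large |w| it is about -2 w^-2, which the drift, of size 1/(r |w|), absorbs. *)
Definition barrier r w := w * (w ^+ 2 + 4 * r ^+ 2)^-1.
Definition barrier_w r w := (4 * r ^+ 2 - w ^+ 2) * (w ^+ 2 + 4 * r ^+ 2)^-1 ^+ 2.

Lemma rad_gt0 r w : 0 < r -> 0 < rad r w.
Proof. by move=> r0; rewrite sqrtr_gt0 ltr_wpDl ?sqr_ge0// exprn_gt0. Qed.

Lemma rad_sq r w : rad r w ^+ 2 = w ^+ 2 + r ^+ 2.
Proof. by rewrite sqr_sqrtr// addr_ge0 ?sqr_ge0. Qed.

Lemma rad_ge r w : 0 < r -> r <= rad r w.
Proof. by move=> r0; rewrite -[leLHS](ger0_norm (ltW r0)) -sqrtr_sqr ler_wsqrtr// lerDr sqr_ge0. Qed.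

Lemma rad_ge_norm r w : `|w| <= rad r w.
Proof. by rewrite -sqrtr_sqr ler_wsqrtr// lerDl sqr_ge0. Qed.

Lemma is_derive_sqrt_sq (a c : R) : 0 < a ^+ 2 + c ->
  is_derive a 1 (fun a => Num.sqrt (a ^+ 2 + c)) (a / Num.sqrt (a ^+ 2 + c)).
Proof.
move=> h; have d1 : is_derive a 1 (fun a : R => a ^+ 2 + c) (2 * a).
  have := @is_deriveD _ _ _ _ _ a 1 _ _ (@is_deriveX _ _ id 2 a 1 1 (is_derive_id a 1)) (is_derive_cst c a 1).
  by move/is_derive_eq; apply; rewrite /GRing.scale/= addr0 mulr1 expr1.
have := @is_derive1_comp _ Num.sqrt (fun a => a ^+ 2 + c) a _ _ (is_derive1_sqrt h) d1; move/is_derive_eq; apply.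
by rewrite invfM mulrACA mulVf// mul1r mulrC.
Qed.

Lemma is_derive_quot (f g : R -> R) (x a b : R) k : g x != 0 -> is_derive x 1 f a -> is_derive x 1 g b ->
  is_derive x 1 (fun t => f t * (g t)^-1 ^+ k) (a * (g x)^-1 ^+ k - k%:R * f x * b * (g x)^-1 ^+ k.+1).
Proof.
move=> g0 df dg; have d1 := @is_deriveX _ _ (fun t => (g t)^-1) k x 1 _ (is_deriveV g0 dg).
rewrite (_ : (fun t => f t * (g t)^-1 ^+ k) = f * (fun t => (g t)^-1) ^+ k); last by apply/funext => t; rewrite !fctE.
have := @is_deriveM _ _ f _ x 1 _ _ df d1.
move/is_derive_eq; apply; rewrite /GRing.scale/= ?fctE.
clear d1; case: k => [|k]; first by rewrite !mul0r !mulr0; ring.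
rewrite -[k.+1.-1]/k expr2 invfM !exprS; ring.
Qed.

Lemma is_derive_profile_w r w : 0 < r -> is_derive w 1 (profile r) (profile_w r w).
Proof.
move=> r0; have S0 := rad_gt0 w r0; have Sn : rad r w != 0 by rewrite gt_eqF.
have dS : is_derive w 1 (rad r) (w / rad r w).
  by apply: is_derive_sqrt_sq; rewrite ltr_wpDl ?sqr_ge0// exprn_gt0.
have d1 : is_derive w 1 (fun w : R => w * (w ^+ 2 + 3 * r ^+ 2)) (3 * w ^+ 2 + 3 * r ^+ 2).
  have d0 := @is_deriveD _ _ _ _ _ w 1 _ _ (@is_deriveX _ _ id 2 w 1 1 (is_derive_id w 1)) (is_derive_cst (3 * r ^+ 2) w 1).
  have := @is_deriveM _ _ id _ w 1 _ _ (is_derive_id w 1) d0.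
  by move/is_derive_eq; apply; rewrite /GRing.scale/= !fctE; ring.
move: (is_derive_quot 3 Sn d1 dS) => /is_derive_eq; apply.
have e := rad_sq r w; rewrite /profile_w; move: (rad r w) S0 Sn e => S S0 Sn e.
have -> : r ^+ 2 = S ^+ 2 - w ^+ 2 by rewrite e addrC addKr.
by field.
Qed.

Lemma is_derive_profile_r r w : 0 < r -> is_derive r 1 (profile ^~ w) (profile_r r w).
Proof.
move=> r0; have S0 := rad_gt0 w r0; have Sn : rad r w != 0 by rewrite gt_eqF.
have dS : is_derive r 1 (rad ^~ w) (r / rad r w).
  rewrite /rad; under [X in is_derive _ _ X _]eq_fun do rewrite addrC.
  by rewrite addrC; apply: is_derive_sqrt_sq; rewrite ltr_pwDl ?sqr_ge0// exprn_gt0.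
have d1 : is_derive r 1 (fun r : R => w * (w ^+ 2 + 3 * r ^+ 2)) (6 * w * r).
  have d0 : is_derive r 1 (fun r : R => r ^+ 2) (2 * r).
    have := @is_deriveX _ _ id 2 r 1 1 (is_derive_id r 1).
    by move/is_derive_eq; apply; rewrite /GRing.scale/= mulr1 expr1.
  have := @is_deriveD _ _ _ _ _ r 1 _ _ (is_derive_cst (w * w ^+ 2) r 1) (@is_deriveZ _ _ _ _ (w * 3) r 1 _ d0).
  move/is_derive_eq => h; rewrite (_ : (fun r : R => _) = (cst (w * w ^+ 2) + (w * 3) \*: (fun r : R => r ^+ 2))).
    by apply: h; rewrite /GRing.scale/=; ring.
  apply/funext => t; rewrite -[RHS]/(w * w ^+ 2 + w * 3 * t ^+ 2); ring.
move: (@is_derive_quot _ (rad ^~ w) r _ _ 3 Sn d1 dS) => /is_derive_eq; apply.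
have e := rad_sq r w; rewrite /profile_r; move: (rad r w) S0 Sn e => S S0 Sn e.
have -> : r ^+ 2 = S ^+ 2 - w ^+ 2 by rewrite e addrC addKr.
by field.
Qed.

Lemma is_derive_barrier r w : 0 < r -> is_derive w 1 (barrier r) (barrier_w r w).
Proof.
move=> r0; have g0 : w ^+ 2 + 4 * r ^+ 2 != 0.
  by rewrite gt_eqF// ltr_wpDl ?sqr_ge0// mulr_gt0// exprn_gt0.
have dg : is_derive w 1 (fun w : R => w ^+ 2 + 4 * r ^+ 2) (2 * w).
  have := @is_deriveD _ _ _ _ _ w 1 _ _ (@is_deriveX _ _ id 2 w 1 1 (is_derive_id w 1)) (is_derive_cst (4 * r ^+ 2) w 1).
  by move/is_derive_eq; apply; rewrite /GRing.scale/= addr0 mulr1 expr1.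
move: (@is_derive_quot id (fun w => w ^+ 2 + 4 * r ^+ 2) w _ _ 1 g0 (is_derive_id w 1) dg) => /is_derive_eq; apply.
by rewrite /barrier_w; field.
Qed.

Lemma profile_bounded r w : 0 < r -> `|profile r w| <= 3.
Proof.
move=> r0; have S0 := rad_gt0 w r0; have e := rad_sq r w; have wS := rad_ge_norm r w.
rewrite /profile exprVn normrM normfV (gtr0_norm (exprn_gt0 3 S0)) ler_pdivrMr ?exprn_gt0//.
have p0 : 0 <= w ^+ 2 + 3 * r ^+ 2 by rewrite addr_ge0 ?sqr_ge0// mulr_ge0 ?sqr_ge0.
rewrite normrM [X in _ * X]ger0_norm//.
rewrite [leRHS](_ : _ = rad r w * (3 * rad r w ^+ 2)); last by ring.
apply: ler_pM => //.
by rewrite e; have := sqr_ge0 w; lra.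
Qed.

Lemma barrier_bounded r w : 0 < r -> `|w * barrier r w| <= 1.
Proof.
move=> r0; have g0 : 0 < w ^+ 2 + 4 * r ^+ 2 by rewrite ltr_wpDl ?sqr_ge0// mulr_gt0// exprn_gt0.
rewrite /barrier mulrA -expr2 ger0_norm; last by rewrite divr_ge0 ?sqr_ge0 ?ltW.
by rewrite ler_pdivrMr// mul1r lerDl mulr_ge0 ?sqr_ge0.
Qed.

(** The stronger lower bound S - r with S = [rad r w] holds: after clearing denominators the
    difference is (S - r)(r S^2 + 2 r^2 S + 2 r^3). It lets the regularisation be removed at a cost
    linear in r. *)
Lemma norm_le_profile r w : 0 < r -> `|w| - r <= w * profile r w.
Proof.
move=> r0; have S0 := rad_gt0 w r0; have e := rad_sq r w; have wS := rad_ge_norm r w; have rS := rad_ge w r0.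
apply: (@le_trans _ _ (rad r w - r)); first by rewrite lerB.
rewrite (_ : w * profile r w = w ^+ 2 * (w ^+ 2 + 3 * r ^+ 2) / rad r w ^+ 3); last by rewrite /profile exprVn; ring.
rewrite ler_pdivlMr ?exprn_gt0//.
move: (rad r w) e S0 rS wS => S e S0 rS _; have -> : w ^+ 2 = S ^+ 2 - r ^+ 2 by rewrite e addrK.
rewrite -subr_ge0 [leRHS](_ : _ = (S - r) * (r * S ^+ 2 + 2 * r ^+ 2 * S + 2 * r ^+ 3)); last by ring.
by rewrite mulr_ge0 ?subr_ge0// !addr_ge0 ?mulr_ge0 ?exprn_ge0// ltW.
Qed.

(* In [x = rad r w - r] the numerator of the difference is a homogeneous polynomial with nonnegative coefficients. *)
Lemma profile_ineq r w : 0 < r ->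
  100^-1 * profile_w r w ^+ 2 <=
  barrier_w r w - barrier r w ^+ 2 + 2^-1 * (w * (profile_r r w * (3 * r ^+ 2)^-1)).
Proof.
move=> r0; have S0 := rad_gt0 w r0; have e := rad_sq r w; have rS := rad_ge w r0.
rewrite /profile_w /barrier_w /barrier /profile_r.
move: (rad r w) e S0 rS => S e S0 rS; have ew : w ^+ 2 = S ^+ 2 - r ^+ 2 by rewrite e addrK.
have Q0 : 0 < S ^+ 2 + 3 * r ^+ 2 by rewrite ltr_wpDl ?sqr_ge0// mulr_gt0// exprn_gt0.
have Qe : w ^+ 2 + 4 * r ^+ 2 = S ^+ 2 + 3 * r ^+ 2 by rewrite ew; ring.
rewrite Qe !exprMn.
rewrite (_ : w * (3 * w * _ * _ * _ / _) = (S ^+ 2 - r ^+ 2) * (S ^+ 2 - 2 * r ^+ 2) * S^-1 ^+ 5 * r^-1); last first.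
  rewrite -ew (_ : S ^+ 2 - 2 * r ^+ 2 = w ^+ 2 - r ^+ 2); last by rewrite ew; ring.
  by field; rewrite ?gt_eqF.
pose x := S - r; have x0 : 0 <= x by rewrite subr_ge0.
have eS : S = r + x by rewrite /x addrC subrK.
rewrite ew -subr_ge0.
pose N := r * S ^+ 10 * (6 * r ^+ 2 - 2 * S ^+ 2)
  + 2^-1 * (S ^+ 2 - r ^+ 2) * (S ^+ 2 - 2 * r ^+ 2) * S ^+ 5 * (S ^+ 2 + 3 * r ^+ 2) ^+ 2
  - 100^-1 * 9 * r ^+ 5 * (2 * r ^+ 2 - S ^+ 2) ^+ 2 * (S ^+ 2 + 3 * r ^+ 2) ^+ 2.
rewrite [leRHS](_ : _ = N / (r * S ^+ 10 * (S ^+ 2 + 3 * r ^+ 2) ^+ 2)); last first.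
  by rewrite /N; field; rewrite !gt_eqF.
apply: divr_ge0; last by rewrite !mulr_ge0 ?exprn_ge0// ltW.
rewrite (_ : N = (2 + 56 / 100) * r ^+ 13 * x ^+ 0 + (24 + 32 / 100) * r ^+ 12 * x ^+ 1 + (67 + 80 / 100) * r ^+ 11 * x ^+ 2 + (199 + 32 / 100) * r ^+ 10 * x ^+ 3 + (455 + 99 / 100) * r ^+ 9 * x ^+ 4 + (668 + 88 / 100) * r ^+ 8 * x ^+ 5 + (613 + 80 / 100) * r ^+ 7 * x ^+ 6 + (354 + 78 / 100) * r ^+ 6 * x ^+ 7 + (139 + 41 / 100) * r ^+ 5 * x ^+ 8 + (56 + 50 / 100) * r ^+ 4 * x ^+ 9 + (33 + 50 / 100) * r ^+ 3 * x ^+ 10 + (16 + 50 / 100) * r ^+ 2 * x ^+ 11 + (4 + 50 / 100) * r ^+ 1 * x ^+ 12 + (0 + 50 / 100) * r ^+ 0 * x ^+ 13); last by rewrite /N eS; field.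
have mon (a b : nat) i j : 0 <= (a%:R + b%:R / 100) * r ^+ i * x ^+ j.
  apply: mulr_ge0; last exact: exprn_ge0.
  by apply: mulr_ge0; [rewrite addr_ge0// divr_ge0|exact: exprn_ge0 (ltW r0)].
apply: addr_ge0; last exact: (mon 0 50 0 13).
repeat (apply: addr_ge0; last exact: mon); exact: mon.
Qed.

End profile.

Section compactly_supported.
Context {R : realType}.

(** The depth is only continuous at y = 0, so products of test functions with the multiplier and its
    derivatives are handled in this class; it suffices for integrability. *)
Definition Cc (V : normedModType R) (f : V -> R) :=
  continuous f /\ exists M, forall v, f v != 0 -> `|v| <= M.

Lemma CcM (V : normedModType R) (f g : V -> R) : continuous f -> Cc g ->
  Cc (fun v => f v * g v).
Proof.
move=> cf [cg [M hM]]; split; first by move=> v; apply: cvgM; [exact: cf|exact: cg].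
by exists M => v; rewrite mulf_eq0 negb_or => /andP[_]; exact: hM.
Qed.

Lemma CcD (V : normedModType R) (f g : V -> R) : Cc f -> Cc g ->
  Cc (fun v => f v + g v).
Proof.
move=> [cf [M hM]] [cg [N hN]]; split; first by move=> v; apply: cvgD; [exact: cf|exact: cg].
exists (Num.max M N) => v; rewrite le_max; have [->|f0] := eqVneq (f v) 0; last by rewrite (hM _ f0).
by rewrite add0r => /hN ->; rewrite orbT.
Qed.

Lemma CcZ (V : normedModType R) (c : R) (f : V -> R) : Cc f ->
  Cc (fun v => c * f v).
Proof. by apply: CcM => v; exact: cvg_cst. Qed.

Lemma Cc_sum (V : normedModType R) n (f : 'I_n.+1 -> V -> R) : (forall i, Cc (f i)) ->
  Cc (fun v => \sum_i f i v).
Proof.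
elim: n f => [|n IH] f cf; first by under eq_fun do rewrite big_ord_recl big_ord0 addr0.
by under eq_fun do rewrite big_ord_recl; apply: CcD => //; exact: IH.
Qed.

Lemma test_Cc (V : normedModType R) U (f : V -> R) : test_fun U f -> Cc f.
Proof.
move=> tf; split; first by apply: smooth_continuous; exact: test_fun_smooth tf.
by have [M _ hM] := test_bounded_supp tf; exists M.
Qed.

Lemma Cc_bounded (V : normedModType R) (f : V -> R) (A : set V) : continuous f ->
  compact A -> (forall v, f v != 0 -> A v) -> exists2 C, 0 <= C & forall v, `|f v| <= C.
Proof.
move=> cf cA fA; have : compact (f @` A).
  by apply: continuous_compact => //; exact: continuous_subspaceT.
move/compact_bounded => [N [Nr h]]; exists (`|N| + 1) => [|v]; first by rewrite addr_ge0.
have [->|/fA Av] := eqVneq (f v) 0; first by rewrite normr0 addr_ge0.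
by apply: h; [rewrite (le_lt_trans (ler_norm N))// ltrDl|exists v].
Qed.

End compactly_supported.

Lemma continuous_mulr (R : realType) (T : topologicalType) (f g : T -> R) :
  continuous f -> continuous g -> continuous (fun t => f t * g t).
Proof. by move=> cf cg t; apply: cvgM; [exact: cf|exact: cg]. Qed.

Section profile_continuity.
Context {R : realType} {T : topologicalType} (u w : T -> R).
Hypotheses (u0 : forall t, 0 < u t) (cu : continuous u) (cw : continuous w).

Let cu2 : continuous (fun t => u t ^+ 2).
Proof. by move=> t; apply: cvgM; exact: cu. Qed.

Let cw2 : continuous (fun t => w t ^+ 2).
Proof. by move=> t; apply: cvgM; exact: cw. Qed.

Let cr k : continuous (fun t => (rad (u t) (w t))^-1 ^+ k).
Proof.
move=> t; apply: (@continuous_comp _ _ _ (fun t => (rad (u t) (w t))^-1) (fun y => y ^+ k)); last exact: exprn_continuous.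
apply: cvgV; first by rewrite gt_eqF// rad_gt0.
apply: (@continuous_comp _ _ _ (fun t => w t ^+ 2 + u t ^+ 2) Num.sqrt); last exact: sqrt_continuous.
by apply: cvgD; [exact: cw2|exact: cu2].
Qed.

Let cq : continuous (fun t => (w t ^+ 2 + 4 * u t ^+ 2)^-1).
Proof.
move=> t; apply: cvgV; first by rewrite gt_eqF// ltr_wpDl ?sqr_ge0// mulr_gt0// exprn_gt0.
by apply: cvgD; [exact: cw2|apply: cvgM; [exact: cvg_cst|exact: cu2]].
Qed.

Lemma continuous_profile : continuous (fun t => profile (u t) (w t)).
Proof.
move=> t; apply: cvgM; last exact: cr.
apply: cvgM; first exact: cw.
by apply: cvgD; [exact: cw2|apply: cvgM; [exact: cvg_cst|exact: cu2]].
Qed.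

Lemma continuous_profile_w : continuous (fun t => profile_w (u t) (w t)).
Proof.
move=> t; apply: cvgM; last exact: cr.
by apply: cvgM; [apply: cvgM; [exact: cvg_cst|exact: cu2]|apply: cvgB; [exact: cu2|exact: cw2]].
Qed.

Lemma continuous_drift : continuous (fun t => w t * (profile_r (u t) (w t) * (3 * u t ^+ 2)^-1)).
Proof.
move=> t; apply: cvgM; first exact: cw.
apply: cvgM; last first.
  apply: cvgV; first by rewrite gt_eqF// mulr_gt0// exprn_gt0.
  by apply: cvgM; [exact: cvg_cst|exact: cu2].
apply: cvgM; last exact: cr.
apply: cvgM; last by apply: cvgB; [exact: cw2|exact: cu2].
by apply: cvgM; [apply: cvgM; [exact: cvg_cst|exact: cw]|exact: cu].
Qed.

Lemma continuous_barrier : continuous (fun t => barrier (u t) (w t)).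
Proof. by move=> t; apply: cvgM; [exact: cw|exact: cq]. Qed.

Lemma continuous_barrier_w : continuous (fun t => barrier_w (u t) (w t)).
Proof.
move=> t; apply: cvgM; last by apply: cvgM; exact: cq.
by apply: cvgB; [apply: cvgM; [exact: cvg_cst|exact: cu2]|exact: cw2].
Qed.

End profile_continuity.

(** * The energy inequality at a fixed depth *)

Section slice_energy.
Context {R : realType} {n : nat} (mu : {measure set 'rV[R]_n -> \bar R}) (m : 'rV[R]_n -> R) (kap : R).
Hypothesis wt : weight_of mu m kap.
Local Notation V := 'rV[R]_n.
Local Notation leb := (lebesgue_rV R n).
Variable i0 : 'I_n.

Lemma Cc_rV (f : V -> R) : Cc f ->
  [/\ measurable_fun setT f, exists2 C, 0 <= C & (forall v, `|f v| <= C) &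
      exists M, forall v, ~ cube n M v -> f v = 0].
Proof.
move=> [cf [M hM]]; split; first exact: continuous_measurable_rV.
  exact: (Cc_bounded cf (@compact_rV_ball R n M)).
exists M => v nc; apply/eqP/negPn/negP => /hM vM; apply: nc => i; exact: le_trans (rV_norm_coord v i) vM.
Qed.

Lemma integrable_Cc (f : V -> R) : Cc f -> mu.-integrable setT (EFin \o f).
Proof.
move=> cf; have [mf [C C0 fC] [M f0]] := Cc_rV cf.
have : mu.-integrable (cube n M) (EFin \o f).
  apply: measurable_bounded_integrable => //.
  - exact: measurable_cube.
  - exact: (wt_cube_lty wt).
  - exact: measurable_funTS.
  - exists C; split; first exact: num_real.
    by move=> x Cx y _ /=; apply: le_trans (fC y) (ltW Cx).
move=> /integrable_mkcond; rewrite restrict_EFin => h.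
have /h : measurable (cube n M) by exact: measurable_cube.
rewrite (_ : f \_ (cube n M) = f)//; apply/funext => x.
by rewrite patchE; case: ifPn => // /negP nx; rewrite f0// => Cx; apply: nx; rewrite inE.
Qed.

Lemma is_derive_coord (f : R -> R) (d : R) (v e : V) : is_derive (v ord0 i0) 1 f d ->
  is_derive v e (fun v : V => f (v ord0 i0)) (e ord0 i0 * d).
Proof.
move=> df; have dff : differentiable f (v ord0 i0) by apply/derivable1_diffP; exact: (@ex_derive _ _ _ _ _ _ _ df).
have A := @is_diff_coord R n i0 v.
apply: DeriveDef.
  by apply: diff_derivable; apply: (@differentiable_comp _ _ _ _ (fun v : V => v ord0 i0) f).
rewrite (derive_comp_affine e A dff).
have {1}-> : e ord0 i0 = e ord0 i0 *: (1 : R) by rewrite /GRing.scale/= mulr1.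
by rewrite deriveE// linearZ/= -deriveE// (@derive_val _ _ _ _ _ _ _ df).
Qed.

(** The pointwise form of the absorption. [profile_ineq] bounds (pw g)^2/100, the square (b g +
    dg)^2 >= 0 produces the cross term, and |w b| <= 1 handles the logarithmic derivative of the
    weight. The factor 1/200 is what remains after (x + y)^2 <= 2 x^2 + 2 y^2 in the gradient of psi
    g. *)
Lemma slice_pointwise (k g dg t b bw w psi pw S1 S2 : R) :
  100^-1 * pw ^+ 2 <= bw - b ^+ 2 + 2^-1 * t -> `|w * b| <= 1 -> `|psi| <= 3 -> dg ^+ 2 <= S1 ->
  S2 <= 2 * psi ^+ 2 * S1 + 2 * (pw * g) ^+ 2 ->
  0 <= (2 + `|k|) * (g ^+ 2 + S1) + (2^-1 * (t * g ^+ 2) + (bw * g ^+ 2 + b * (2 * g * dg - k * w * g ^+ 2)))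
    - 200^-1 * ((psi * g) ^+ 2 + S2).
Proof.
move=> Q wb p3 dS hS; have g0 := sqr_ge0 g; have S10 := le_trans (sqr_ge0 dg) dS; have k0 := normr_ge0 k.
have h1 : 100^-1 * (pw * g) ^+ 2 <= bw * g ^+ 2 - (b * g) ^+ 2 + 2^-1 * (t * g ^+ 2).
  rewrite !exprMn (_ : _ + 2^-1 * _ = (bw - b ^+ 2 + 2^-1 * t) * g ^+ 2); last by ring.
  by rewrite mulrA; exact: ler_wpM2r.
have h2 : k * (w * b) * g ^+ 2 <= `|k| * g ^+ 2.
  apply: ler_wpM2r => //; apply: le_trans (ler_norm _) _.
  by rewrite normrM ler_piMr.
have h3 : psi ^+ 2 <= 9.
  by rewrite -[leLHS]real_normK ?num_real// (_ : 9 = 3 ^+ 2); [rewrite ler_sqr ?nnegrE|ring].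
have h4 := ler_wpM2r g0 h3; have h5 := ler_wpM2r S10 h3; have h6 := sqr_ge0 (b * g + dg).
have h7 : 0 <= `|k| * S1 by rewrite mulr_ge0.
have e1 : (b * g + dg) ^+ 2 = (b * g) ^+ 2 + 2 * (b * g * dg) + dg ^+ 2 by ring.
have e2 : (2 + `|k|) * (g ^+ 2 + S1) = 2 * g ^+ 2 + 2 * S1 + `|k| * g ^+ 2 + `|k| * S1 by ring.
have e3 : b * (2 * g * dg - k * w * g ^+ 2) = 2 * (b * g * dg) - k * (w * b) * g ^+ 2 by ring.
have e4 : 2 * psi ^+ 2 * S1 = 2 * (psi ^+ 2 * S1) by ring.
rewrite e2 e3 exprMn; rewrite e1 in h6; rewrite e4 in hS.
move: h1 h2 h4 h5 h6 h7 hS dS S10 g0; clear.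
move: (g ^+ 2) (dg ^+ 2) ((b * g) ^+ 2) (b * g * dg) (k * (w * b) * _) (`|k| * _) (`|k| * _) (psi ^+ 2 * _) (psi ^+ 2 * _) ((pw * g) ^+ 2)
  (2^-1 * _) (bw * _) => *; lra.
Qed.

Lemma Rintegral_comb_ge0 (f1 f2 f3 f4 : V -> R) (a c : R) :
  mu.-integrable setT (EFin \o f1) -> mu.-integrable setT (EFin \o f2) ->
  mu.-integrable setT (EFin \o f3) -> mu.-integrable setT (EFin \o f4) ->
  (forall v, 0 <= a * f1 v + (f2 v + f3 v) - c * f4 v) ->
  0 <= a * (\int[mu]_v f1 v) + (\int[mu]_v f2 v + \int[mu]_v f3 v) - c * (\int[mu]_v f4 v).
Proof.
move=> i1 i2 i3 i4 h; have i1' := intZ a measurableT i1; have i4' := intZ c measurableT i4; have i23 := intD measurableT i2 i3.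
have i123 := intD measurableT i1' i23.
have : 0 <= \int[mu]_v (a * f1 v + (f2 v + f3 v) - c * f4 v) by apply: Rintegral_ge0 => v _; exact: h.
by rewrite RintegralB// RintegralD// RintegralZl// RintegralZl// RintegralD.
Qed.

(** Young's inequality t n2 <= n2^2/200 + 50 t^2, matched to the factor 1/200 so that the norm of
    the multiplied function cancels exactly. *)
Lemma slice_arith (a x t2 y n2 i t : R) : 0 <= a * x ^+ 2 + t2 - 200^-1 * n2 ^+ 2 -> `|i| <= t * n2 ->
  0 <= t -> 0 <= n2 -> - (t2 + i) <= a * x ^+ 2 + 50 * t ^+ 2.
Proof.
move=> h1 h2 t0 n0; 
have h4 : - i <= t * n2 by apply: le_trans h2; rewrite -normrN ler_norm.
have h5 : 0 <= (n2 - 100 * t) ^+ 2 by exact: sqr_ge0.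
have e : (n2 - 100 * t) ^+ 2 = n2 ^+ 2 - 200 * (t * n2) + 10000 * t ^+ 2 by ring.
rewrite e in h5; move: h1 h4 h5; clear; move: (t * n2) (n2 ^+ 2) (t ^+ 2) (a * x ^+ 2) => *; lra.
Qed.

(** The duality bound involves the H^1 norm of psi g, which is not bounded uniformly in r by that of
    g. Half the drift controls its square up to the norm of g, so that in the sum the norm of psi g
    disappears and the constants do not depend on r. *)
Lemma slice_energy r (g q : V -> R) : 0 < r -> test_fun setT g -> test_fun setT q ->
  - (\int[mu]_v (2^-1 * (v ord0 i0 * (profile_r r (v ord0 i0) * (3 * r ^+ 2)^-1) * g v ^+ 2)
      + profile r (v ord0 i0) * (g v * q v))) <=
  (2 + `|kap|) * H1_norm mu g ^+ 2 + 50 * Hm1_norm mu (riesz mu q) ^+ 2.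
Proof.
move=> r0 tg tq; have [Hg hg] := test_H1 wt tg.
pose w (v : V) := v ord0 i0; pose dg := 'D_(delta_mx ord0 i0) g.
pose th v := w v * (profile_r r (w v) * (3 * r ^+ 2)^-1).
pose psi v := profile r (w v); pose pw v := profile_w r (w v); pose b v := barrier r (w v); pose bw v := barrier_w r (w v).
have cw : continuous w by move=> v; exact: coord_continuous.
have r1 (v : V) : 0 < r by [].
have cr : continuous (fun _ : V => r) by exact: cst_continuous.
have cpsi : continuous psi by exact: continuous_profile.
have cpw : continuous pw by exact: continuous_profile_w.
have cth : continuous th by exact: continuous_drift.
have cb : continuous b by exact: continuous_barrier.
have cbw : continuous bw by exact: continuous_barrier_w.
have cg := test_Cc tg; have cdg : Cc dg by exact: test_Cc (test_funD _ tg).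
have cg2 : Cc (fun v => g v ^+ 2) by exact: CcM cg.1 cg.
have cE : Cc (fun v => bw v * g v ^+ 2 + b v * (2 * g v * dg v - kap * w v * g v ^+ 2)).
  apply: CcD; first exact: CcM.
  apply: CcM => //; under eq_fun do rewrite -mulrA -!mulNr; apply: CcD; first by apply: CcZ; exact: CcM cg.1 cdg.
  have ck : continuous (fun v : V => - kap * w v) by exact: (continuous_mulr (@cst_continuous _ _ (- kap)) cw).
  exact: CcM ck cg2.
(* Against the density, the integrand is the derivative of barrier * g^2 * m in the direction w; the
   term in [kap] comes from the derivative of the density. Adding this zero brings in the Hardy
   inequality. *)
have E0 : \int[mu]_v (bw v * g v ^+ 2 + b v * (2 * g v * dg v - kap * w v * g v ^+ 2)) = 0.
  have mE : measurable_fun setT (fun v => bw v * g v ^+ 2 + b v * (2 * g v * dg v - kap * w v * g v ^+ 2)) by have [] := Cc_rV cE.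
  rewrite (wt_Rintegral wt mE).
  have cm : continuous m by apply: smooth_continuous; exact: wt_smooth wt.
  have cf : Cc (fun v => b v * (g v ^+ 2 * m v)).
    by apply: CcM => //; under eq_fun do rewrite mulrC; exact: CcM.
  have [mf [B B0 hB] [M hM]] := Cc_rV cf.
  have cEm : Cc (fun v => (bw v * g v ^+ 2 + b v * (2 * g v * dg v - kap * w v * g v ^+ 2)) * m v).
    by under eq_fun do rewrite mulrC; exact: CcM.
  have [_ [C C0 hC] _] := Cc_rV cEm.
  have [|_ ->//] := @integral_derive_eq0 R n _ _ (delta_mx ord0 i0) C B M mf hB _ hC hM.
  move=> v.
  have db : is_derive v (delta_mx ord0 i0 : V) b (bw v).
    have := is_derive_coord (delta_mx ord0 i0) (is_derive_barrier (w v) r0).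
    by move/is_derive_eq; apply; rewrite mxE !eqxx mul1r.
  have dgv : is_derive v (delta_mx ord0 i0 : V) g (dg v).
    by apply: DeriveDef => //; exact: smooth_derivable (test_fun_smooth tg).
  have dm : is_derive v (delta_mx ord0 i0 : V) m (- kap * w v * m v).
    by apply: DeriveDef; [exact: smooth_derivable (wt_smooth wt)|exact: wt_derive wt v i0].
  have := @is_deriveM _ _ _ _ v _ _ _ db (@is_deriveM _ _ _ _ v _ _ _ (@is_deriveM _ _ _ _ v _ _ _ dgv dgv) dm).
  move/is_derive_eq; apply; rewrite /GRing.scale/= !fctE; ring.
pose h i v := psi v * 'D_(delta_mx ord0 i) g v + g v * ((delta_mx ord0 i : V) ord0 i0 * pw v).
have ch i : Cc (h i).
  apply: CcD; first exact: (CcM cpsi (test_Cc (test_funD _ tg))).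
  under eq_fun do rewrite mulrC; apply: (CcM (f := fun v => (delta_mx ord0 i : V) ord0 i0 * pw v)) => //.
  exact: (continuous_mulr (@cst_continuous _ _ ((delta_mx ord0 i : V) ord0 i0)) cpw).
have cpg : Cc (fun v => psi v * g v) by exact: CcM.
have /choice[K hK] : forall i : 'I_n, exists K, forall v, `|h i v| <= K.
  by move=> i; have [_ [K K0 hK] _] := Cc_rV (ch i); exists K.
have [mpg [B B0 hB] [M hM]] := Cc_rV cpg.
pose hv v : V := \row_i h i v.
have dh v i : is_derive v (delta_mx ord0 i : V) (fun v => psi v * g v) (hv v ord0 i).
  have dp := is_derive_coord (delta_mx ord0 i) (is_derive_profile_w (w v) r0).
  have dgv : is_derive v (delta_mx ord0 i : V) g ('D_(delta_mx ord0 i) g v).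
    by apply: DeriveDef => //; exact: smooth_derivable (test_fun_smooth tg).
  have := @is_deriveM _ _ _ _ v _ _ _ dp dgv.
  have -> : hv v ord0 i = h i v by rewrite mxE.
  by move/is_derive_eq; apply.
have hC v i : `|hv v ord0 i| <= \sum_j `|K j|.
  rewrite mxE; apply: le_trans (hK i v) _; apply: le_trans (ler_norm _) _.
  by rewrite (bigD1 i)//= lerDl; apply: sumr_ge0 => j _.
have [sp Lp] := H1_C1 wt mpg hB dh hC hM.
have Hp : H1 mu (fun v => psi v * g v) by apply/H1P; split=> //; exists hv.
have NE := H1_norm_sqE wt Hp Lp; have AE := H1_norm_sqE wt Hg hg.
have cS (u : 'I_n -> V -> R) : (forall i, Cc (u i)) -> Cc (fun v => \sum_i u i v ^+ 2).
  move=> cu; have c2 i : Cc (fun v => u i v ^+ 2) by exact: CcM (cu i).1 (cu i).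
  have n0 : (0 < n)%N by apply: leq_ltn_trans (ltn_ord i0).
  by move: c2; clear -n0; move: u; case: n n0 => // k _ u c2; exact: Cc_sum.
have cA : Cc (fun v => g v ^+ 2 + \sum_i (\row_i 'D_(delta_mx ord0 i) g v : V) ord0 i ^+ 2).
  under eq_fun do under eq_bigr do rewrite mxE; apply: CcD => //.
  by apply: cS => i; exact: test_Cc (test_funD _ tg).
have cB : Cc (fun v => (psi v * g v) ^+ 2 + \sum_i hv v ord0 i ^+ 2).
  under eq_fun do under eq_bigr do rewrite mxE; apply: CcD; first exact: CcM cpg.1 cpg.
  exact: cS.
have cT : Cc (fun v => th v * g v ^+ 2) by exact: CcM.
have cQ : Cc (fun v => psi v * (g v * q v)) by apply: CcM => //; apply: CcM cg.1 (test_Cc tq).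
have [iA iB iT iE] := And4 (integrable_Cc cA) (integrable_Cc cB) (integrable_Cc cT) (integrable_Cc cE).
have iT2 := intZ (2^-1) measurableT iT.
have le0 : 0 <= (2 + `|kap|) * H1_norm mu g ^+ 2 + (\int[mu]_v (2^-1 * (th v * g v ^+ 2)) + 0)
    - 200^-1 * H1_norm mu (fun v => psi v * g v) ^+ 2.
  have := Rintegral_comb_ge0 (a := 2 + `|kap|) (c := 200^-1) iA iT2 iE iB.
  rewrite E0 -AE -NE; apply => v.
  apply: (slice_pointwise (pw := pw v) _ (profile_ineq (w v) r0) (barrier_bounded (w v) r0) (profile_bounded (w v) r0)).
    rewrite (bigD1 i0)//= mxE lerDl; apply: sumr_ge0 => i _; exact: sqr_ge0.
  rewrite mulr_sumr.
  apply: (@le_trans _ _ (\sum_i (2 * psi v ^+ 2 * ('D_(delta_mx ord0 i) g v) ^+ 2 + 2 * (g v * ((delta_mx ord0 i : V) ord0 i0 * pw v)) ^+ 2))).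
    apply: ler_sum => i _; rewrite mxE; apply: le_trans (sqrD_le2 _ _) _.
    by rewrite lerD2r (exprMn _ (psi v)) mulrA.
  rewrite big_split/=; apply: lerD.
    by apply: ler_sum => i _; rewrite mxE.
  rewrite (bigD1 i0)//= big1 => [|i /negPf ii]; last by rewrite mxE eqxx eq_sym ii mul0r mulr0 expr0n mulr0.
  by rewrite addr0 mxE !eqxx mul1r (mulrC (g v)).
have [sq _] := proj1 (H1P mu q) (proj1 (test_H1 wt tq)).
have hT := Hm1_le wt (riesz_Hm1 wt sq) Hp.
have eT : riesz mu q (fun v => psi v * g v) = \int[mu]_v (psi v * (g v * q v)).
  by apply: eq_Rintegral => v _; rewrite mulrC -mulrA.
rewrite eT in hT.
rewrite RintegralD//; last exact: integrable_Cc.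
have T0 := Hm1_norm_ge0 wt (riesz mu q); have N0 := H1_norm_ge0 wt (fun v => psi v * g v).
rewrite addr0 in le0; move: le0 hT T0 N0.
exact: slice_arith.
Qed.

End slice_energy.

(** * Integration along the normal direction, and the depth scale *)

Section last_coordinate.
Context {R : realType}.
Local Notation leb1 := (@lebesgue_measure R).

Lemma integral_row_mx n (f : 'rV[R]_(n + 1) -> R) :
  (lebesgue_rV R (n + 1)).-integrable setT (EFin \o f) ->
  (\int[lebesgue_rV R (n + 1)]_x (f x)%:E =
   \int[lebesgue_rV R n]_z \int[leb1]_y (f (row_mx z (y%:M : 'rV_1)))%:E)%E.
Proof.
move=> fi; have mf := measurable_int _ fi; have [_ foo] := integrableP _ _ _ fi.
pose F (g : 'rV[R]_(n + 1) -> \bar R) z := (\int[leb1]_y g (row_mx z (y%:M : 'rV_1)))%E.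
have iF g : measurable_fun setT g -> (forall x, 0 <= g x)%E -> (forall x, g x <= `|(f x)%:E|)%E ->
    (lebesgue_rV R n).-integrable setT (F g).
  move=> mg g0 gf; have F0 z : (0 <= F g z)%E by apply: integral_ge0.
  have mF : measurable_fun setT (F g).
    apply: (@measurable_fun_fubini_tonelli_F _ _ _ _ R leb1 (fun q : 'rV[R]_n * measurableTypeR R => g (row_mx q.1 (q.2%:M : 'rV_1)))) => //=.
    by apply: measurableT_comp => //; exact: measurable_row_mx.
  apply/integrableP; split=> //; under eq_integral do rewrite gee0_abs//.
  rewrite -(ge0_integral_row_mx mg g0); apply: le_lt_trans foo.
  by apply: ge0_le_integral => //; apply: measurableT_comp.
have mp := measurable_funepos mf; have mn := measurable_funeneg mf.
rewrite integralE (ge0_integral_row_mx mp)// (ge0_integral_row_mx mn)//.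
rewrite -integralB//.
- apply: eq_integral => z _; rewrite [RHS]integralE.
  by congr (_ - _)%E; apply: eq_integral => y _; rewrite ?funeposE ?funenegE.
- apply: (iF ((EFin \o f)^\+)%E) => // x; rewrite funeposE ge_max abse_ge0 andbT.
  exact: lee_abs.
- apply: (iF ((EFin \o f)^\-)%E) => // x; rewrite funenegE ge_max abse_ge0 andbT.
  by rewrite -abseN; exact: lee_abs.
Qed.

Lemma integral_half_line (h g : R -> R) (M : R) : 0 < M -> continuous g -> continuous h ->
  (forall y : R, 0 < y -> is_derive y 1 h (g y)) -> (forall y, M <= y -> h y = 0) -> (forall y, M <= y -> g y = 0) ->
  (\int[leb1]_y ((0 < y)%R%:R * g y)%:E = (- h 0)%:E)%E.
Proof.
move=> M0 cg ch dh hM gM.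
have mg : measurable_fun setT g by exact: continuous_measurable_fun.
have FTC : (\int[leb1]_(y in `[0%R, M]) (g y)%:E = (- h 0)%:E)%E.
  rewrite (@continuous_FTC2 R g h 0 M M0); first by rewrite hM// sub0e.
  - exact: continuous_subspaceT.
  - split; first by move=> y; rewrite in_itv/= => /andP[y0 _]; have := dh y y0; case.
      exact: (cvg_at_right_filter (ch 0)).
    exact: (cvg_at_left_filter (ch M)).
  - by move=> y; rewrite in_itv/= => /andP[y0 _]; rewrite derive1E; have dy := dh y y0; rewrite derive_val.
rewrite -FTC.
rewrite -integral_itv_obnd_cbnd; last by apply: measurable_funTS; exact/measurable_EFinP.
rewrite [RHS]integral_mkcond; apply: eq_integral => y _; rewrite patchE.
case: ifPn => [|/negP]; rewrite inE/= in_itv/=; first by move=> /andP[-> _]; rewrite mul1r.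
move=> /negP; rewrite negb_and -leNgt -ltNge => /orP[y0|/ltW My]; first by rewrite ltNge y0 mul0r.
by rewrite gM// mulr0.
Qed.

(** The cube root of |y| + c, written with exponential and logarithm. The absolute value makes it
    continuous and positive on the whole line; derivatives are only taken for y > 0. *)
Definition depth (c y : R) := expR (ln (`|y| + c) / 3).

Lemma depth_gt0 c y : 0 < depth c y. Proof. exact: expR_gt0. Qed.

Lemma depth0 (r : R) : 0 < r -> depth (r ^+ 3) 0 = r.
Proof.
move=> r0; rewrite /depth normr0 add0r lnXn// -[X in X / 3]mulr_natr mulfK//.
by rewrite lnK// posrE.
Qed.

Lemma continuous_depth (c : R) : 0 < c -> continuous (depth c).
Proof.
move=> c0.
have c1 : continuous (fun y : R => `|y| + c).
  by move=> y; apply: cvgD; [exact: norm_continuous|exact: cvg_cst].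
have c2 : continuous (fun y : R => ln (`|y| + c)).
  move=> y; apply: (@continuous_comp R R R (fun y => `|y| + c) (@ln R)); first exact: c1.
  by apply: continuous_ln; rewrite ltr_wpDl.
have c3 := continuous_mulr c2 (@cst_continuous R R (3^-1)).
by move=> y; apply: (@continuous_comp R R R (fun y => ln (`|y| + c) / 3) (@expR R)); [exact: c3|exact: continuous_expR].
Qed.

Lemma is_derive_depth (c y : R) : 0 < c -> 0 < y -> is_derive y 1 (depth c) (3 * depth c y ^+ 2)^-1.
Proof.
move=> c0 y0; have yc : 0 < y + c by rewrite addr_gt0.
have d1 : is_derive y 1 (fun y : R => y + c) 1.
  by have := @is_deriveD _ _ _ _ _ y 1 _ _ (is_derive_id y 1) (is_derive_cst c y 1); rewrite addr0.
have d2 := @is_derive1_comp _ (@ln R) (fun y => y + c) y _ _ (is_derive1_ln yc) d1.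
have d3 := @is_deriveZ _ _ _ _ (3^-1) y 1 _ d2.
have d4 := @is_derive1_comp _ (@expR R) _ y _ _ (is_derive_expR _) d3.
have e3 : depth c y ^+ 3 = y + c.
  by rewrite /depth -expRM_natl mulrC mulfVK// lnK ?posrE// gtr0_norm.
apply: near_eq_is_derive (is_derive_eq d4 _).
  near=> x; rewrite /= /depth gtr0_norm; first by rewrite mulrC.
  by near: x; exact: lt_nbhsr.
rewrite /GRing.scale/= mulr1.
have -> : expR (3^-1 * ln (y + c)) = depth c y by rewrite /depth gtr0_norm// mulrC.
rewrite -e3; have := depth_gt0 c y; move: (depth c y) => r r0; field.
by rewrite gt_eqF.
Unshelve. all: by end_near. Qed.

End last_coordinate.

(** * Integration by parts on the half-space at a fixed velocity *)

Section boundary.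
Context {R : realType} {n : nat}.
Local Notation V := 'rV[R]_(n + 1).
Local Notation leb := (lebesgue_rV R (n + 1)).
Local Notation D := (@half_space R n).

Lemma measurable_half_space : measurable D.
Proof.
rewrite (_ : D = (fun x : V => x ord0 (rshift n ord0)) @^-1` [set` `]0, +oo[]).
  by rewrite -[X in measurable X]setTI; apply: measurable_coord.
by apply/seteqP; split=> x; rewrite /half_space/= in_itv/= andbT.
Qed.

Lemma half_space_shift (x y : V) : D x -> (forall i, 0 <= y ord0 i) -> D (x + y).
Proof. by move=> Dx y0; rewrite /half_space /lastc/= mxE ltr_pwDl. Qed.

Lemma indic_half_space (x : V) : \1_D x = (0 < lastc x)%R%:R :> R.
Proof.
rewrite indicE; have -> // : (x \in D) = (0 < lastc x).
by apply/idP/idP => [/set_mem//|h]; exact/mem_set.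
Qed.

Lemma continuous_lastc : continuous (@lastc R n).
Proof. by move=> x; exact: coord_continuous. Qed.

Lemma integrable_indic_Cc N (A : set 'rV[R]_N) (g : 'rV[R]_N -> R) : measurable A -> Cc g ->
  (lebesgue_rV R N).-integrable setT (EFin \o (fun x => \1_A x * g x)).
Proof.
move=> mA cg; have [mg [C C0 hC] [M hM]] := Cc_rV cg.
apply: (@integrable_bounded_cube R N _ C M).
- by apply: measurable_funM => //; exact: measurable_indic.
- move=> x; rewrite normrM indicE; case: (_ \in _); first by rewrite normr1 mul1r.
  by rewrite normr0 mul0r.
- by move=> x nc; rewrite hM// mulr0.
Qed.

(** The factor [k] need not be continuous, only constant along the line: it will contain the
    indicator of the half-space, differentiated along a tangential direction. *)
Lemma is_derive_invariant_mul (k u : V -> R) (x e : V) (d : R) : (forall s : R, k (s *: e + x) = k x) ->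
  is_derive x e u d -> is_derive x e (fun x => k x * u x) (k x * d).
Proof.
move=> kx du; have := @is_deriveZ _ _ _ u (k x) x e d du.
have E : (fun h : R => h^-1 *: (((fun x => k x * u x) \o shift x) (h *: e) - k x * u x)) =
         (fun h : R => h^-1 *: (((k x \*: u) \o shift x) (h *: e) - (k x \*: u) x)).
  by apply/funext => h /=; rewrite kx.
move=> [h1 h2]; apply: DeriveDef; first by move: h1; rewrite /derivable -E.
by rewrite -[RHS]h2 /derive -E.
Qed.

Definition normal_vec : V := row_mx 0 1%:M.

Lemma lastcD (x y : V) : lastc (x + y) = lastc x + lastc y.
Proof. by rewrite /lastc mxE. Qed.

Lemma lastcZ (a : R) (x : V) : lastc (a *: x) = a * lastc x.
Proof. by rewrite /lastc mxE. Qed.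

Lemma lastc_row_mx (z : 'rV[R]_n) (y : 'rV[R]_1) : lastc (row_mx z y) = y ord0 ord0.
Proof. by rewrite /lastc row_mxEr. Qed.

Lemma lastc_normal : lastc normal_vec = 1.
Proof. by rewrite lastc_row_mx mxE eqxx. Qed.

Lemma lastc_line (z : 'rV[R]_n) (y : R) : lastc (row_mx z 0 + y *: normal_vec) = y.
Proof. by rewrite lastcD lastcZ lastc_normal lastc_row_mx mxE add0r mulr1. Qed.

Lemma row_mx_line (z : 'rV[R]_n) (y : R) : row_mx z (y%:M : 'rV_1) = row_mx z 0 + y *: normal_vec.
Proof. by rewrite scale_row_mx add_row_mx scaler0 addr0 scale_scalar_mx mulr1 add0r. Qed.

(** The velocity splits into a tangential part, along which the depth and the indicator are constant
    so that its contribution integrates to zero, and w times the normal. On each normal line the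
    remaining integrand is the derivative of w profile u^2 / 2, and the fundamental theorem of
    calculus leaves its value at 0. *)
Lemma boundary_slice (c w : R) (v : V) (u : V -> R) : 0 < c -> lastc v = w -> test_fun setT u ->
  (\int[leb]_x (\1_D x * (2^-1 * (w * (profile_r (depth c (lastc x)) w * (3 * depth c (lastc x) ^+ 2)^-1) * u x ^+ 2)
     + profile (depth c (lastc x)) w * (u x * 'D_v u x)))%:E =
   \int[lebesgue_rV R n]_z (- (2^-1 * (w * profile (depth c 0) w * u (row_mx z 0) ^+ 2)))%:E)%E.
Proof.
move=> c0 vw tu; have mD := measurable_half_space.
have cdep : continuous (fun x : V => depth c (lastc x)).
  by move=> x; apply: (@continuous_comp V R R _ (depth c)); [exact: continuous_lastc|exact: continuous_depth].
have dep0 (x : V) : 0 < depth c (lastc x) by exact: depth_gt0.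
have cw : continuous (fun _ : V => w) by exact: cst_continuous.
have cpsi := continuous_profile dep0 cdep cw.
have cth := continuous_drift dep0 cdep cw.
pose vt := v - w *: normal_vec.
have cu := test_Cc tu; have ct := test_Cc (test_funD vt tu); have ce := test_Cc (test_funD normal_vec tu).
pose psi (x : V) := profile (depth c (lastc x)) w.
pose th (x : V) := w * (profile_r (depth c (lastc x)) w * (3 * depth c (lastc x) ^+ 2)^-1).
pose G1 x := psi x * (u x * 'D_vt u x).
pose G2 x := 2^-1 * (th x * u x ^+ 2) + psi x * (w * (u x * 'D_normal_vec u x)).
have cG1 : Cc G1 by apply: (CcM cpsi); exact: (CcM cu.1 ct).
have cG2 : Cc G2.
  apply: CcD; first by apply: CcZ; apply: (CcM cth); exact: (CcM cu.1 cu).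
  by apply: (CcM cpsi); apply: CcZ; exact: (CcM cu.1 ce).
have du x e : is_derive x e u ('D_e u x).
  by apply: DeriveDef => //; exact: smooth_derivable (test_fun_smooth tu).
have split x : 'D_v u x = 'D_vt u x + w * 'D_normal_vec u x.
  have df : differentiable u x by exact: smooth_differentiable (test_fun_smooth tu).
  by rewrite !deriveE// {1}(_ : v = vt + w *: normal_vec) ?linearD ?linearZ// /vt subrK.
transitivity (\int[leb]_x ((\1_D x * G1 x)%:E + (\1_D x * G2 x)%:E))%E.
  apply: eq_integral => x _; rewrite -EFinD; congr EFin.
  by rewrite split /G1 /G2 /th /psi; ring.
rewrite integralD//; [|exact: integrable_indic_Cc|exact: integrable_indic_Cc].
have vt0 : lastc vt = 0 by rewrite /vt -scaleNr lastcD lastcZ lastc_normal vw mulr1 subrr.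
have -> : (\int[leb]_x (\1_D x * G1 x)%:E = 0)%E.
  have cf : Cc (fun x => psi x * (2^-1 * u x ^+ 2)) by apply: (CcM cpsi); apply: CcZ; exact: (CcM cu.1 cu).
  have [mf [B B0 hB] [M hM]] := Cc_rV cf; have [_ [C C0 hC] _] := Cc_rV cG1.
  have ind1 (k : V -> R) K : (forall x, `|k x| <= K) -> forall x, `|\1_D x * k x| <= K.
    move=> kK x; rewrite normrM indicE; case: (_ \in _); rewrite ?normr1 ?mul1r ?normr0 ?mul0r//.
    exact: le_trans (kK x).
  have m1 : measurable_fun setT (fun x => \1_D x * (psi x * (2^-1 * u x ^+ 2))).
    by apply: measurable_funM => //; exact: measurable_indic.
  have [||i0 e0] := @integral_derive_eq0 R (n + 1) _ (fun x => \1_D x * G1 x) vt C B M m1 (ind1 _ _ hB) _ (ind1 _ _ hC).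
  - move=> x; have inv s : lastc (s *: vt + x) = lastc x by rewrite lastcD lastcZ vt0 mulr0 add0r.
    have d2 : is_derive x vt (fun x => 2^-1 * u x ^+ 2) (u x * 'D_vt u x).
      have := @is_deriveZ _ _ _ _ (2^-1) x vt _ (@is_deriveM _ _ _ _ x vt _ _ (du x vt) (du x vt)).
      move/is_derive_eq; apply; rewrite /GRing.scale/=; by field.
    have iv s : \1_D (s *: vt + x) * psi (s *: vt + x) = \1_D x * psi x.
      by rewrite /psi inv !indic_half_space inv.
    have := @is_derive_invariant_mul (fun x => \1_D x * psi x) _ x vt _ iv d2.
    move/is_derive_eq => h1.
    rewrite (_ : (fun x => _) = (fun x => \1_D x * psi x * (2^-1 * u x ^+ 2))); last by apply/funext => t; rewrite mulrA.
    by apply: h1; rewrite -mulrA.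
  - by move=> x nc; rewrite hM// mulr0.
  by rewrite (EFin_Rintegral measurableT i0) e0.
rewrite add0e integral_row_mx; last exact: integrable_indic_Cc.
apply: eq_integral => z _.
(* The primitive along the normal line. Since the depth has derivative 1/(3 r^2), the chain rule
   through [profile_r] yields exactly the drift term. *)
have [M hM] := cu.2; pose h (y : R) := 2^-1 * (w * profile (depth c y) w * u (row_mx z 0 + y *: normal_vec) ^+ 2).
have uM (y : R) : `|M| + 1 <= y -> u (row_mx z 0 + y *: normal_vec) = 0.
  move=> yM; apply/eqP/negPn/negP => /hM /(le_trans (rV_norm_coord _ (rshift n ord0))).
  rewrite -/(lastc _) lastc_line => yM'; have := le_trans (ler_norm y) yM'; have := ler_norm M.
  by move: yM; clear; move: `|M| => m; lra.
have cl : continuous (fun y : R => row_mx z 0 + y *: normal_vec : V).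
  by move=> y; apply: cvgD; [exact: cvg_cst|apply: cvgZr_tmp; exact: cvg_id].
have cul : continuous (fun y : R => u (row_mx z 0 + y *: normal_vec)).
  by move=> y; apply: (@continuous_comp R V R _ u); [exact: cl|exact: cu.1].
pose g (y : R) := G2 (row_mx z 0 + y *: normal_vec).
have cg : continuous g by move=> y; apply: (@continuous_comp R V R _ G2); [exact: cl|exact: cG2.1].
have cd : continuous (fun y : R => depth c y) by exact: continuous_depth.
have cw1 : continuous (fun _ : R => w) by exact: cst_continuous.
have ch : continuous h.
  apply: continuous_mulr; first exact: cst_continuous.
  apply: continuous_mulr; last exact: (continuous_mulr cul cul).
  apply: continuous_mulr; first exact: cst_continuous.
  exact: (continuous_profile (fun y => depth_gt0 c y) cd cw1).
have M1 : 0 < `|M| + 1 by rewrite ltr_wpDl.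
have dh (y : R) : 0 < y -> is_derive y 1 h (g y).
  move=> y0.
  have d1 := @is_derive1_comp _ (profile ^~ w) (depth c) y _ _ (is_derive_profile_r w (depth_gt0 c y)) (is_derive_depth c0 y0).
  have d2 := is_derive_line (s := y) (du (row_mx z 0 + y *: normal_vec) normal_vec).
  have d3 := @is_deriveM _ _ _ _ y 1 _ _ d1 (@is_deriveM _ _ _ _ y 1 _ _ d2 d2).
  have := @is_deriveZ _ _ _ _ (2^-1 * w) y 1 _ d3.
  move/is_derive_eq => h1.
  rewrite (_ : h = (2^-1 * w) \*: (((profile ^~ w) \o depth c) * ((fun s : R => u (row_mx z 0 + s *: normal_vec)) * (fun s : R => u (row_mx z 0 + s *: normal_vec))))).
    apply: h1; rewrite /GRing.scale/= !fctE /= /g /G2 /th /psi lastc_line /GRing.scale/=.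
    by field; rewrite gt_eqF// depth_gt0.
  by apply/funext => s; rewrite /h -[RHS]/(2^-1 * w * (profile (depth c s) w * (u (row_mx z 0 + s *: normal_vec) * u (row_mx z 0 + s *: normal_vec)))); ring.
have := integral_half_line M1 cg ch dh.
rewrite /h scale0r addr0 => <-.
- by apply: eq_integral => y _; rewrite row_mx_line indic_half_space lastc_line.
- by move=> y /uM ->; rewrite expr0n/= !mulr0.
- by move=> y /uM u0; rewrite /g /G2 u0 mul0r !mulr0 expr0n/= !mulr0 addr0.
Qed.

End boundary.

(** * The trace estimate *)

Section trace_estimate.
Context {R : realType}.

Lemma lipschitz_normed_continuous (W W' : normedModType R) (u : W -> W') :
  (forall x y, `|u x - u y| <= `|x - y|) -> continuous u.
Proof.
move=> lip z; apply/cvgrPdist_le => e e0; near=> z'; apply: le_trans (lip _ _) _.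
by near: z'; exact: (@cvgr_dist_le _ _ _ _ _ id z (@cvg_id _ _)).
Unshelve. all: by end_near. Qed.

Lemma continuous_pairr (T U : topologicalType) (x : T) : continuous (fun v : U => (x, v)).
Proof. by move=> v; apply: cvg_pair; [exact: cvg_cst|exact: cvg_id]. Qed.

Lemma continuous_map_fst (T U W : topologicalType) (f : T -> W) : continuous f ->
  continuous (fun p : T * U => (f p.1, p.2)).
Proof.
move=> cf p; apply: cvg_pair; last exact: cvg_snd.
by apply: (@continuous_comp _ _ _ fst f); [exact: cvg_fst|exact: cf].
Qed.

Lemma integrable_pair_Cc a b (mu : {sigma_finite_measure set 'rV[R]_b -> \bar R}) m kap (wt : weight_of mu m kap)
    (g : 'rV[R]_a * 'rV[R]_b -> R) (A : set 'rV[R]_a) : measurable A -> Cc g ->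
  (lebesgue_rV R a \x mu)%E.-integrable setT (EFin \o (fun p => \1_A p.1 * g p)).
Proof.
move=> mA [cg [M hM]]; set Q := cube a M `*` cube b M.
have mQ : measurable Q by apply: measurableX; exact: measurable_cube.
have hM2 p : g p != 0 -> `|p.1| <= M /\ `|p.2| <= M.
  by move=> /hM; rewrite prod_normE ge_max => /andP[].
have [C C0 hC] : exists2 C, 0 <= C & forall p, `|g p| <= C.
  apply: (@Cc_bounded R _ g ([set x | `|x| <= M] `*` [set x | `|x| <= M])) => //.
  by apply: compact_setX; exact: compact_rV_ball.
have mg : measurable_fun setT (fun p => \1_A p.1 * g p).
  apply: measurable_funM; last exact: continuous_measurable_rV2.
  by apply: (measurableT_comp (f := (\1_A : 'rV[R]_a -> R))) => //; exact: measurable_indic.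
have : (lebesgue_rV R a \x mu)%E.-integrable Q (EFin \o (fun p => \1_A p.1 * g p)).
  apply: measurable_bounded_integrable => //.
  - rewrite [ltLHS](_ : _ = (lebesgue_rV R a (cube a M) * mu (cube b M))%E); last first.
      by apply: product_measure1E; exact: measurable_cube.
    apply: lte_mul_pinfty => //; last exact: (wt_cube_lty wt).
    by rewrite ge0_fin_numE// lebesgue_cube_lty.
  - exact: measurable_funTS.
  - exists C; split; first exact: num_real.
    move=> x Cx y _ /=; apply: le_trans (ltW Cx); rewrite normrM indicE.
    by case: (_ \in _); rewrite ?normr1 ?mul1r ?normr0 ?mul0r.
move=> /(integrable_mkcond _ mQ).1; rewrite restrict_EFin.
rewrite (_ : _ \_ Q = (fun p => \1_A p.1 * g p))//; apply/funext => p.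
rewrite patchE; case: ifPn => // /negP nx; have [->|/hM2[h1 h2]] := eqVneq (g p) 0; first by rewrite mulr0.
by exfalso; apply: nx; apply/mem_set; split=> i; [apply: le_trans h1|apply: le_trans h2]; exact: rV_norm_coord.
Qed.

Context {n : nat} (mu : {sigma_finite_measure set 'rV[R]_(n + 1) -> \bar R}) (m : 'rV[R]_(n + 1) -> R) (kap : R).
Hypothesis wt : weight_of mu m kap.
Local Notation V := 'rV[R]_(n + 1).
Local Notation leb := (lebesgue_rV R (n + 1)).
Local Notation D := (@half_space R n).

Lemma test_slicel (F : V * V -> R) v : test_fun setT F ->
  test_fun setT (fun x => F (x, v)) /\ forall x e, 'D_e (fun x => F (x, v)) x = 'D_(e, 0) F (x, v).
Proof.
move=> tF; have [M M0 hM] := test_supp2 tF; split.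
  apply: (test_fun_rV (M := M)); first exact: (smooth_comp (is_diff_pairl v) (test_fun_smooth tF)).
  by move=> x /hM[].
move=> x e; apply: (@derive_comp_affine R _ _ F (fun x : V => (x, v)) (fun e => (e, 0)) x e (is_diff_pairl v x)).
exact: smooth_differentiable (test_fun_smooth tF).
Qed.

Lemma test_boundary (F : V * V -> R) : test_fun setT F ->
  Cc (fun zv : 'rV[R]_n * V => F (row_mx zv.1 0, zv.2)).
Proof.
move=> tF; have [M M0 hM] := test_supp2 tF; have cF := (test_Cc tF).1.
have lip (z z' : 'rV[R]_n) : `|(row_mx z 0 : V) - row_mx z' 0| <= `|z - z'|.
  rewrite opp_row_mx oppr0 add_row_mx addr0; apply: rV_norm_le => // i.
  case: (split_ordP i) => j ->; first by rewrite row_mxEl; exact: rV_norm_coord.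
  by rewrite row_mxEr mxE normr0.
have cr : continuous (fun z : 'rV[R]_n => row_mx z 0 : V) by exact: (lipschitz_normed_continuous lip).
split.
  move=> zv; apply: (@continuous_comp _ _ _ (fun zv : 'rV[R]_n * V => (row_mx zv.1 0 : V, zv.2)) F); last exact: cF.
  exact: (@continuous_map_fst 'rV[R]_n V V (fun z => row_mx z 0) cr zv).
exists M => -[z v] /hM[/= h1 h2].
rewrite prod_normE ge_max h2 andbT/=.
apply: rV_norm_le => // i; apply: le_trans h1.
by have := rV_norm_coord (row_mx z (0 : 'rV[R]_1)) (lshift 1 i); rewrite row_mxEl.
Qed.

Lemma trace_arith (a b c k : R) : 0 <= a ^+ 2 -> 0 <= b ^+ 2 -> - - (2^-1 * c) <= (2 + `|k|) * a ^+ 2 + 50 * b ^+ 2 ->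
  c <= 2 * (52 + `|k|) * (a ^+ 2 + b ^+ 2).
Proof.
move=> a0 b0; have k0 := normr_ge0 k; have ka := mulr_ge0 k0 a0; have kb := mulr_ge0 k0 b0.
rewrite opprK mulrDl (_ : _ * (a ^+ 2 + b ^+ 2) = 2 * (52 * a ^+ 2 + 52 * b ^+ 2 + (`|k| * a ^+ 2 + `|k| * b ^+ 2))); last by ring.
move: ka kb a0 b0; clear; move: (`|k| * a ^+ 2) (`|k| * b ^+ 2) (a ^+ 2) (b ^+ 2) => *; lra.
Qed.

(** The depth is taken with constant r^3, so it equals r on the boundary. The boundary identity is
    integrated over velocities and [slice_energy] over positions; its constants are uniform in the
    depth, hence in r. *)
Lemma trace_regularized (F : V * V -> R) (r : R) : test_fun setT F -> 0 < r ->
  \int[(lebesgue_rV R n \x mu)%E]_zv (lastc zv.2 * profile r (lastc zv.2) * F (row_mx zv.1 0, zv.2) ^+ 2) <=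
  2 * (52 + `|kap|) * kinetic_norm mu D (fun x v => F (x, v)) ^+ 2.
Proof.
move=> tF r0; have mD := @measurable_half_space R n.
have c0 : 0 < r ^+ 3 by rewrite exprn_gt0.
pose dep (p : V * V) := depth (r ^+ 3) (lastc p.1).
have cw : continuous (fun p : V * V => lastc p.2).
  by move=> p; apply: (@continuous_comp _ _ _ snd (@lastc R n)); [exact: cvg_snd|exact: continuous_lastc].
have cdep : continuous dep.
  move=> p; apply: (@continuous_comp _ _ _ (fun p : V * V => lastc p.1) (depth (r ^+ 3))); last exact: continuous_depth.
  by apply: (@continuous_comp _ _ _ fst (@lastc R n)); [exact: cvg_fst|exact: continuous_lastc].
have dep0 p : 0 < dep p by exact: depth_gt0.
have cF := test_Cc tF; have cT := test_Cc (test_transport tF).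
pose G (p : V * V) := 2^-1 * (lastc p.2 * (profile_r (dep p) (lastc p.2) * (3 * dep p ^+ 2)^-1) * F p ^+ 2)
  + profile (dep p) (lastc p.2) * (F p * 'D_(p.2, 0) F p).
have cG : Cc G.
  apply: CcD; last by apply: (CcM (continuous_profile dep0 cdep cw)); exact: (CcM cF.1 cT).
  by apply: CcZ; apply: (CcM (continuous_drift dep0 cdep cw)); exact: (CcM cF.1 cF).
have iG := integrable_pair_Cc wt mD cG.
pose bt (zv : 'rV[R]_n * V) := lastc zv.2 * profile r (lastc zv.2) * F (row_mx zv.1 0, zv.2) ^+ 2.
have cb := test_boundary tF.
have cw' : continuous (fun p : 'rV[R]_n * V => lastc p.2).
  by move=> p; apply: (@continuous_comp _ _ _ snd (@lastc R n)); [exact: cvg_snd|exact: continuous_lastc].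
have cbt : Cc bt.
  apply: (@CcM R _ (fun zv => lastc zv.2 * profile r (lastc zv.2))); last exact: (CcM cb.1 cb).
  by apply: continuous_mulr => //; apply: (continuous_profile (fun=> r0) _ cw'); exact: cst_continuous.
have ib : (lebesgue_rV R n \x mu)%E.-integrable setT (EFin \o (fun zv => - (2^-1 * bt zv))).
  have := integrable_pair_Cc wt measurableT (CcZ (- 2^-1) cbt); under eq_fun do rewrite indicT mul1r mulNr.
  by [].
(* Fubini is used twice: the velocity is moved outside so that [boundary_slice] applies with it
   frozen, and the result is then recognised as an integral for the product measure. *)
have E1 : (\int[leb]_x \int[mu]_v (\1_D x * G (x, v))%:E =
    \int[(lebesgue_rV R n \x mu)%E]_zv (- (2^-1 * bt zv))%:E)%E.
  rewrite (Fubini iG) -(integral21_prod_meas1 ib); apply: eq_integral => v _.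
  have [tu du] := test_slicel v tF.
  have bs := boundary_slice c0 (erefl (lastc v)) tu.
  apply: etrans _ (etrans bs _).
    by apply: eq_integral => x _; apply: (congr1 (fun z : R => (\1_D x * z)%:E)); rewrite /G /dep/= -du.
  by apply: eq_integral => z _; rewrite (depth0 r0).
pose I x := \int[mu]_v G (x, v).
have cGx x : Cc (fun v => G (x, v)).
  have [cG1 [M hM]] := cG; split; last by exists M => v /hM; rewrite prod_normE ge_max => /andP[].
  move=> v; apply: (@continuous_comp _ _ _ (fun v : V => (x, v)) G); last exact: cG1.
  exact: continuous_pairr.
have iGx x := integrable_Cc wt (cGx x).
have Ix x : (\int[mu]_v (\1_D x * G (x, v))%:E = (\1_D x * I x)%:E)%E.
  by rewrite /I -RintegralZl// EFin_Rintegral//; exact: intZ.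
have iI : leb.-integrable D (EFin \o I).
  have := integrable_fubini_F iG; rewrite /fubini_F.
  rewrite (_ : (fun x => _) = (EFin \o (I \_ D))); last first.
    apply/funext => x; rewrite [LHS]Ix/= patchE indicE; case: (_ \in _); rewrite ?mul1r ?mul0r//.
  by rewrite -restrict_EFin => /(integrable_mkcond _ mD).2.
have [LH [LT tT]] := test_kinetic wt mD tF (f := fun x v => F (x, v)) (fun x _ => erefl).
have i1 := L2_bochner_integrable (H1_seminorm wt) mD LH.
have i2 := L2_bochner_integrable (Hm1_seminorm wt) mD LT.
have le1 : - (\int[leb]_(x in D) I x) <= (2 + `|kap|) * L2H1_norm mu D (fun x v => F (x, v)) ^+ 2
    + 50 * L2Hm1_norm mu D (fun x => riesz mu (fun v => 'D_(v, 0) F (x, v))) ^+ 2.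
  rewrite /L2H1_norm /L2Hm1_norm !L2_bochner_norm_sq -mulN1r.
  have i1' := intZ (2 + `|kap|) mD i1; have i2' := intZ 50 mD i2; have iI' := intZ (-1) mD iI.
  apply: (@le_trans _ _ (\int[leb]_(x in D) ((2 + `|kap|) * H1_norm mu (fun v => F (x, v)) ^+ 2
      + 50 * Hm1_norm mu (riesz mu (fun v => 'D_(v, 0) F (x, v))) ^+ 2))).
    rewrite -[X in X <= _]RintegralZl//; apply: le_Rintegral => //; first exact: intD mD i1' i2'.
    move=> x Dx; rewrite mulN1r.
    exact: (slice_energy wt (rshift n ord0) (dep0 (x, 0)) (test_slice x tF) (test_slice x (test_transport tF))).
  by rewrite [leLHS]RintegralD// [X in X + _]RintegralZl// [X in _ + X]RintegralZl.
have kn := kinetic_norm_sq wt mD (@half_space_shift R n) (conj LT tT).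
have ib0 : (lebesgue_rV R n \x mu)%E.-integrable setT (EFin \o bt).
  have := integrable_pair_Cc wt measurableT cbt; under eq_fun do rewrite indicT mul1r.
  by [].
have E2 : - (2^-1 * \int[(lebesgue_rV R n \x mu)%E]_zv bt zv) = \int[leb]_(x in D) I x.
  apply: EFin_inj; rewrite -(EFin_Rintegral mD iI) integral_mkcond.
  transitivity (\int[leb]_x (\1_D x * I x)%:E)%E; last first.
    by apply: eq_integral => x _; rewrite patchE indicE; case: (_ \in _); rewrite /= ?mul1r ?mul0r.
  rewrite -(eq_integral _ _ (fun x _ => Ix x)) E1 -mulNr -RintegralZl// -EFin_Rintegral//.
    by apply: eq_integral => zv _; rewrite mulNr.
  exact: intZ.
rewrite kn; move: le1; rewrite -E2; exact: (trace_arith (sqr_ge0 _) (sqr_ge0 _)).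
Qed.

End trace_estimate.

(** * Extension by density *)

Section riesz_fischer.
Context d (T : measurableType d) (R : realType) (m : {measure set T -> \bar R}).

Lemma geometric4_sum_le (n : nat) : \sum_(0 <= k < n) (4^-1 : R) ^+ k <= 2.
Proof.
suff -> : \sum_(0 <= k < n) (4^-1 : R) ^+ k = 4 / 3 - 4 / 3 * 4^-1 ^+ n.
  by have : 0 <= (4^-1 : R) ^+ n by []; move: (_ ^+ n) => z; lra.
elim: n => [|n IH]; first by rewrite big_geq// expr0 mulr1 subrr.
by rewrite big_nat_recr//= IH exprS; move: (4^-1 ^+ n) => z; field.
Qed.

(** The sequence is squeezed between v_k - 2^(1-k) q, which increases, and v_k + 2^(1-k) q, which
    decreases; both have the same limit. *)
Lemma geometric_increments (v : nat -> R) (q : R) : 0 <= q ->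
  (forall k, `|v k.+1 - v k| <= 2^-1 ^+ k * q) ->
  exists l, v k @[k --> \oo] --> l /\ forall k, `|v k - l| <= 2 * 2^-1 ^+ k * q.
Proof.
move=> q0 hv; pose y k := v k + 2 * 2^-1 ^+ k * q; pose y' k := v k - 2 * 2^-1 ^+ k * q.
have dec : nonincreasing_seq y.
  apply/nonincreasing_seqP => k; rewrite /y exprS; have := ler_normlW (hv k).
  by move: (2^-1 ^+ k) => z; lra.
have inc : nondecreasing_seq y'.
  apply/nondecreasing_seqP => k; rewrite /y' exprS.
  have : - (v k.+1 - v k) <= 2^-1 ^+ k * q by apply: le_trans (hv k); rewrite -normrN ler_norm.
  by move: (2^-1 ^+ k) => z; lra.
have z0 k : 0 <= 2 * (2^-1 : R) ^+ k * q by rewrite !mulr_ge0.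
have yy k j : y' k <= y j.
  have [kj|/ltnW jk] := leqP k j.
    by apply: le_trans (inc _ _ kj) _; rewrite /y /y'; have := z0 j; lra.
  by apply: le_trans _ (dec _ _ jk); rewrite /y /y'; have := z0 k; lra.
have cy : cvgn y.
  by apply: nonincreasing_is_cvgn dec _; exists (y' 0%N) => _ [k _ <-]; exact: yy.
exists (limn y); split.
  have zc : (fun k => 2 * (2^-1 : R) ^+ k * q) @ \oo --> 0.
    rewrite (_ : (fun k => _) = geometric (2 * q) 2^-1); last by apply/funext => k; rewrite /= mulrAC.
    by apply: cvg_geometric; rewrite ger0_norm// invf_lt1// ltr1n.
  rewrite (_ : v = y \- (fun k => 2 * 2^-1 ^+ k * q)); last by apply/funext => k; rewrite /y/= addrK.
  by rewrite -[limn y]subr0; exact: cvgB.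
move=> k; have h1 : limn y <= y k by exact: nonincreasing_cvgn_ge.
have h2 : y' k <= limn y by apply: limr_ge => //; apply: nearW.
by rewrite ler_norml; move: h1 h2; rewrite /y /y'; move: (limn y) (2 * _ * _) => l z h1 h2; apply/andP; split; lra.
Qed.

(** The fast decay 16^-k leaves room to weight the squared increments by 4^k and still sum them in
    L^1. Where that sum is finite the increments are geometric, which gives pointwise convergence
    and, after integration, the rate 4^-k. *)
Lemma riesz_fischer (u : nat -> T -> R) (C : R) : (forall k, measurable_fun setT (u k)) ->
  (forall k, (\int[m]_x ((u k.+1 x - u k x) ^+ 2)%:E <= (C * 16^-1 ^+ k)%:E)%E) ->
  exists (g : T -> R) (B : R), measurable_fun setT g /\ forall k, (\int[m]_x ((u k x - g x) ^+ 2)%:E <= (B * 4^-1 ^+ k)%:E)%E.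
Proof.
move=> mu hu; pose t k x : \bar R := (4 ^+ k * (u k.+1 x - u k x) ^+ 2)%:E.
have t0 k x : (0 <= t k x)%E by rewrite lee_fin mulr_ge0 ?sqr_ge0.
have mt k : measurable_fun setT (t k).
  by apply/measurable_EFinP; apply: measurable_funM => //; apply: measurable_funX; exact: measurable_funB.
pose S x := (\sum_(0 <= k <oo) t k x)%E.
have S0 x : (0 <= S x)%E by apply: nneseries_ge0.
have mS : measurable_fun setT S by apply: ge0_emeasurable_sum.
have iS : (\int[m]_x S x <= (2 * C)%:E)%E.
  rewrite integral_nneseries//; apply: lime_le; first by apply: is_cvg_nneseries => k _ _; apply: integral_ge0.
  apply: nearW => N; apply: (@le_trans _ _ (\sum_(0 <= k < N) (C * 4^-1 ^+ k)%:E)%E).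
    apply: lee_sum => k _; rewrite /t; under eq_integral do rewrite EFinM.
    rewrite ge0_integralZl//; [|by apply/measurable_EFinP; apply: measurable_funX; exact: measurable_funB|by move=> x _; rewrite lee_fin sqr_ge0].
    apply: (@le_trans _ _ ((4 ^+ k)%:E * (C * 16^-1 ^+ k)%:E)%E); first by rewrite lee_wpmul2l// lee_fin.
    rewrite -EFinM lee_fin mulrCA -exprMn (_ : 4 * 16^-1 = 4^-1 :> R)//; by field.
  rewrite sumEFin lee_fin -mulr_sumr mulrC ler_wpM2r ?geometric4_sum_le//.
  have := hu 0%N; rewrite expr0 mulr1 -lee_fin; apply: le_trans; apply: integral_ge0 => x _; by rewrite lee_fin sqr_ge0.
pose A := [set x | (S x < +oo)%E].
have mA : measurable A by rewrite -[A]setTI; exact: emeasurable_fun_infty_o.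
pose q x := Num.sqrt (fine (S x)).
have hq x k : A x -> `|u k.+1 x - u k x| <= 2^-1 ^+ k * q x.
  move=> Ax; have tk : (t k x <= S x)%E.
    apply: le_trans (nneseries_lim_ge (m := 0%N) k.+1 (fun n _ _ => t0 n x)).
    by rewrite big_nat_recr//= leeDr// sume_ge0.
  have : 4 ^+ k * (u k.+1 x - u k x) ^+ 2 <= fine (S x).
    by rewrite -lee_fin fineK// ge0_fin_numE.
  rewrite mulrC -ler_pdivlMr// => h; rewrite -sqrtr_sqr.
  rewrite [leRHS](_ : _ = Num.sqrt (fine (S x) / 4 ^+ k)); first exact: ler_wsqrtr.
  rewrite mulrC sqrtrM ?fine_ge0//; congr (_ * _).
  rewrite -exprVn (_ : 4^-1 = 2^-1 ^+ 2 :> R); last by field.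
  by rewrite -exprM mulnC exprM sqrtr_sqr ger0_norm.
(* Multiplying by the indicator of the convergence set makes the limit exist everywhere, with value
   0 off that set, so it is measurable as a pointwise limit. *)
have : forall x, exists l, u k x * \1_A x @[k --> \oo] --> l /\ (A x -> forall k, `|u k x - l| <= 2 * 2^-1 ^+ k * q x).
  move=> x; rewrite indicE; have [Ax|nA] := pselect (A x).
    have [l [h1 h2]] := geometric_increments (sqrtr_ge0 _) (fun k => hq x k Ax).
    by exists l; rewrite mem_set//; split=> //; under eq_fun do rewrite mulr1.
  by exists 0; rewrite memNset//; split=> //; under eq_fun do rewrite mulr0; exact: cvg_cst.
move=> /choice[g hg]; exists g, (8 * C); split.
  apply: (measurable_fun_cvg (h := fun k x => u k x * \1_A x)) => [k|x _]; last by have [] := hg x.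
  by apply: measurable_funM => //; exact: measurable_indic.
have aA : {ae m, forall x, A x}.
  have : m.-integrable setT S.
    by apply/integrableP; split=> //; under eq_integral do rewrite gee0_abs//; apply: le_lt_trans iS (ltry _).
  move=> /(integrable_ae measurableT); apply: filterS => x /(_ Logic.I) h.
  by rewrite /A/= -ge0_fin_numE.
have mg : measurable_fun setT g.
  apply: (measurable_fun_cvg (h := fun k x => u k x * \1_A x)) => [k|x _]; last by have [] := hg x.
  by apply: measurable_funM => //; exact: measurable_indic.
move=> k; apply: (@le_trans _ _ (\int[m]_x ((4 * 4^-1 ^+ k)%:E * S x))%E).
  apply: ae_ge0_le_integral => //.
  - by move=> x _; rewrite lee_fin sqr_ge0.
  - by apply/measurable_EFinP; apply: measurable_funX; exact: measurable_funB.
  - by move=> x _; rewrite mule_ge0.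
  - exact: emeasurable_funM.
  apply: filterS aA => x Ax _; have [_ /(_ Ax k) h] := hg x.
  rewrite -(fineK (x := S x)) ?ge0_fin_numE// -EFinM lee_fin -[leLHS]real_normK ?num_real//.
  rewrite [leRHS](_ : _ = (2 * 2^-1 ^+ k * q x) ^+ 2); first by rewrite ler_sqr ?nnegrE// mulr_ge0 ?sqrtr_ge0.
  rewrite exprMn sqr_sqrtr ?fine_ge0//; congr (_ * _); rewrite exprMn -exprM mulnC exprM.
  by congr (_ * _ ^+ k); field.
rewrite ge0_integralZl// [leRHS](_ : _ = (4 * 4^-1 ^+ k)%:E * (2 * C)%:E)%E; last by rewrite -EFinM; congr EFin; ring.
by rewrite lee_wpmul2l// lee_fin.
Qed.

End riesz_fischer.

(* Values are representatives of almost-everywhere classes, so the extension is linear only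
   almost everywhere. *)
Section bounded_extension.
Context d (T : measurableType d) (R : realType) (m : {measure set T -> \bar R}).
Variables (E : lmodType R) (K P : set E) (N : E -> R) (b : E -> T -> R) (C : R).
Hypothesis C0 : 0 <= C.
Hypothesis K_comb : forall a f g, K f -> K g -> K (a *: f + g).
Hypothesis N_comb : forall a f g, K f -> K g -> N (a *: f + g) ^+ 2 <= 2 * a ^+ 2 * N f ^+ 2 + 2 * N g ^+ 2.
Hypothesis N_ge0 : forall f, 0 <= N f.
Hypothesis PK : P `<=` K.
Hypothesis P_comb : forall a f g, P f -> P g -> P (a *: f + g).
Hypothesis dense : forall f (e : R), K f -> 0 < e -> exists2 F, P F & N (F - f) <= e.
Hypothesis b_comb : forall a f g x, b (a *: f + g) x = a * b f x + b g x.
Hypothesis b_meas : forall F, P F -> measurable_fun setT (b F).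
Hypothesis b_le : forall F, P F -> (\int[m]_x (b F x ^+ 2)%:E <= (C * N F ^+ 2)%:E)%E.

Lemma sq_comb_le (a A B : R) (u v : T -> R) : measurable_fun setT u -> measurable_fun setT v ->
  (\int[m]_x (u x ^+ 2)%:E <= A%:E)%E -> (\int[m]_x (v x ^+ 2)%:E <= B%:E)%E ->
  (\int[m]_x ((a * u x + v x) ^+ 2)%:E <= (2 * a ^+ 2 * A + 2 * B)%:E)%E.
Proof.
move=> mu mv uA vB; have sq (w : T -> R) : measurable_fun setT w -> measurable_fun setT (fun x => (w x ^+ 2)%:E : \bar R).
  by move=> mw; apply/measurable_EFinP; exact: measurable_funX.
have n0 (w : T -> R) x : (0 <= (w x ^+ 2)%:E)%E by rewrite lee_fin sqr_ge0.
apply: (@le_trans _ _ (\int[m]_x ((2 * a ^+ 2)%:E * (u x ^+ 2)%:E + 2%:E * (v x ^+ 2)%:E))%E).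
  apply: ge0_le_integral => //.
  - by move=> x _; rewrite lee_fin sqr_ge0.
  - by apply: (sq (fun x => a * u x + v x)); apply: measurable_funD => //; exact: measurable_funM.
  - by apply: emeasurable_funD; apply: emeasurable_funM => //; exact: sq.
  move=> x _; rewrite -!EFinM -EFinD lee_fin; apply: le_trans (sqrD_le2 _ _) _.
  by rewrite exprMn mulrA.
have a0 : 0 <= 2 * a ^+ 2 by rewrite mulr_ge0 ?sqr_ge0.
rewrite ge0_integralD//; last 4 first.
- by move=> x _; rewrite -EFinM lee_fin mulr_ge0// sqr_ge0.
- by apply: emeasurable_funM => //; exact: sq.
- by move=> x _; rewrite -EFinM lee_fin mulr_ge0// sqr_ge0.
- by apply: emeasurable_funM => //; exact: sq.
rewrite ge0_integralZl//; [|exact: sq].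
rewrite ge0_integralZl//; [|exact: sq].
apply: (@le_trans _ _ ((2 * a ^+ 2)%:E * A%:E + 2%:E * B%:E)%E); last by rewrite -!EFinM -EFinD.
by apply: leeD; rewrite lee_wpmul2l// lee_fin.
Qed.

Lemma lee_sq_eps (z : \bar R) (A c : R) : (forall e : R, 0 < e -> (z <= (A + c * e ^+ 2)%:E)%E) -> (z <= A%:E)%E.
Proof.
move=> h; apply/lee_addgt0Pr => e e0.
have t0 : 0 < e / (`|c| + 1) by rewrite divr_gt0// ltr_wpDl.
have := h (Num.sqrt (e / (`|c| + 1))); rewrite sqrtr_gt0 (sqr_sqrtr (ltW t0)) => /(_ t0) h1.
apply: le_trans h1 _; rewrite -EFinD lee_fin lerD2l mulrCA ler_piMr ?ltW//.
by rewrite ltr_pdivrMr ?ltr_wpDl// mul1r; apply: le_lt_trans (ler_norm c) _; rewrite ltrDl.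
Qed.

Lemma sq_small_ae0 (u : T -> R) (c : R) : measurable_fun setT u ->
  (forall e : R, 0 < e -> (\int[m]_x (u x ^+ 2)%:E <= (c * e ^+ 2)%:E)%E) -> {ae m, forall x, u x = 0}.
Proof.
move=> mu h; apply: ae_eq0_sq => //; apply/eqP; rewrite eq_le integral_ge0 ?andbT; last by move=> x _; rewrite lee_fin sqr_ge0.
by apply: (@lee_sq_eps _ 0 c) => e e0; rewrite add0r; exact: h.
Qed.

Let N_sub f g h : K f -> K g -> K h -> N (f - g) ^+ 2 <= 2 * N (g - h) ^+ 2 + 2 * N (f - h) ^+ 2.
Proof.
move=> Kf Kg Kh; have K_sub x y : K x -> K y -> K (x - y).
  by move=> Kx Ky; rewrite addrC -scaleN1r; exact: K_comb.
have := N_comb (-1) (K_sub _ _ Kg Kh) (K_sub _ _ Kf Kh).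
by rewrite sqrrN expr1n mulr1 scaleN1r opprB addrC subrKA.
Qed.

Let b_sub F G : P F -> P G -> (\int[m]_x ((b F x - b G x) ^+ 2)%:E <= (C * N (F - G) ^+ 2)%:E)%E.
Proof.
move=> PF PG; have e x : b F x - b G x = b (F - G) x by rewrite addrC -mulN1r -b_comb scaleN1r addrC.
under eq_integral do rewrite e; apply: b_le; rewrite addrC -scaleN1r; exact: P_comb.
Qed.

(** The value is characterised by an inequality against every element of [P], not by an
    approximating sequence. By density this fixes it almost everywhere, so the choice in [extension]
    is harmless. *)
Lemma extension_value f : K f -> exists g : T -> R, measurable_fun setT g /\
  forall F, P F -> (\int[m]_x ((b F x - g x) ^+ 2)%:E <= (4 * C * N (F - f) ^+ 2)%:E)%E.
Proof.
move=> Kf; have /choice[F hF] : forall k, exists F, P F /\ N (F - f) <= 4^-1 ^+ k.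
  have q0 : 0 < (4^-1 : R) by [].
  by move=> k; have [F PF h] := dense Kf (exprn_gt0 k q0); exists F.
have PF k : P (F k) by have [] := hF k.
have NF k : N (F k - f) ^+ 2 <= 16^-1 ^+ k.
  have [_ h] := hF k; rewrite (_ : 16^-1 = 4^-1 ^+ 2 :> R); last by field.
  by rewrite exprAC ler_sqr ?nnegrE.
have inc k : (\int[m]_x ((b (F k.+1) x - b (F k) x) ^+ 2)%:E <= (C * 4 * 16^-1 ^+ k)%:E)%E.
  apply: le_trans (b_sub (PF _) (PF _)) _; rewrite lee_fin -mulrA ler_wpM2l//.
  apply: le_trans (N_sub (PK (PF _)) (PK (PF _)) Kf) _.
  have h1 := NF k; have := NF k.+1; rewrite (exprS (16^-1 : R) k); have : 0 <= (16^-1 : R) ^+ k by [].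
  by move: h1; move: (_ ^+ k) (N _ ^+ 2) (N _ ^+ 2) => *; lra.
have [g [B [mg hg]]] := riesz_fischer (fun k => b_meas (PF k)) inc.
exists g; split=> // G PG.
(* Passing through an approximant F_k, one factor 2 comes from splitting the square in L^2 and
   another from [N_sub], whence 4 C; the terms in 4^-k disappear in the limit. *)
have ub k : (\int[m]_x ((b G x - g x) ^+ 2)%:E <= (4 * C * N (G - f) ^+ 2 + (4 * C + 2 * `|B|) * 4^-1 ^+ k)%:E)%E.
  have := sq_comb_le 1 (measurable_funB (b_meas PG) (b_meas (PF k))) (measurable_funB (b_meas (PF k)) mg) (b_sub PG (PF k)) (hg k).
  under eq_integral do rewrite mul1r subrKA.
  move=> /le_trans; apply; rewrite lee_fin.
  have h1 := ler_wpM2l C0 (N_sub (PK PG) (PK (PF k)) Kf).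
  have h2 := ler_wpM2l C0 (NF k).
  have h3 : (16^-1 : R) ^+ k <= 4^-1 ^+ k by apply: lerXn2r; rewrite ?nnegrE//; lra.
  have h4 := ler_wpM2l C0 h3; have q0 : 0 <= (4^-1 : R) ^+ k by [].
  have h5 := ler_wpM2r q0 (ler_norm B).
  rewrite expr1n mulr1 [X in _ <= _ + X]mulrDl; rewrite mulrDr in h1.
  have e1 x : C * (2 * x) = 2 * (C * x) by rewrite mulrCA.
  have e2 x : 4 * C * x = 4 * (C * x) by rewrite mulrA.
  rewrite !e1 in h1; rewrite !e2 -[2 * `|B| * _]mulrA.
  clear hg e1 e2; move: h1 h2 h4 h5; move: (C * _) (C * _) (C * _) (C * _) (C * _) (B * _) (`|B| * _) => *; lra.
apply/lee_addgt0Pr => e e0.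
pose D := 4 * C + 2 * `|B| + 1; have D0 : 0 < D by rewrite ltr_wpDl// addr_ge0 ?mulr_ge0.
have : (geometric D 4^-1 : R ^nat) @ \oo --> 0 by apply: cvg_geometric; rewrite ger0_norm// invf_lt1// ltr1n.
move=> /cvgr0Pnorm_le/(_ _ e0)[k _ /(_ k (leqnn k))] hk.
apply: le_trans (ub k) _; rewrite -EFinD lee_fin lerD2l; apply: le_trans (ler_norm _) _; apply: le_trans hk.
have X0 : 0 <= 4 * C + 2 * `|B| by rewrite addr_ge0 ?mulr_ge0.
rewrite /geometric/= normrM [leRHS]normrM; apply: ler_wpM2r; first exact: normr_ge0.
by rewrite (ger0_norm X0) (gtr0_norm D0) /D lerDl ler01.
Qed.

Definition extension f : T -> R := xget (fun=> 0) [set g : T -> R | measurable_fun setT g /\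
  forall F, P F -> (\int[m]_x ((b F x - g x) ^+ 2)%:E <= (4 * C * N (F - f) ^+ 2)%:E)%E].

Lemma extensionP f : K f -> measurable_fun setT (extension f) /\
  forall F, P F -> (\int[m]_x ((b F x - extension f x) ^+ 2)%:E <= (4 * C * N (F - f) ^+ 2)%:E)%E.
Proof.
move=> /extension_value [g hg]; rewrite /extension.
exact: (@xgetI _ (fun=> 0) [set g : T -> R | measurable_fun setT g /\
  forall F, P F -> (\int[m]_x ((b F x - g x) ^+ 2)%:E <= (4 * C * N (F - f) ^+ 2)%:E)%E] g hg).
Qed.

Let sq_le (x e : R) : 0 <= x -> x <= e -> x ^+ 2 <= e ^+ 2.
Proof. by move=> x0 xe; rewrite ler_sqr ?nnegrE// (le_trans x0). Qed.

Lemma extension_le f : K f -> (\int[m]_x (extension f x ^+ 2)%:E <= (4 * C * N f ^+ 2)%:E)%E.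
Proof.
move=> Kf; have [mT hT] := extensionP Kf; apply: (@lee_sq_eps _ _ (12 * C)) => e e0.
have [F PF Fe] := dense Kf e0; have Fe2 := sq_le (N_ge0 _) Fe.
have mb := b_meas PF.
have := sq_comb_le (-1) (measurable_funB mb mT) mb (hT _ PF) (b_le PF).
under eq_integral do rewrite mulN1r opprB subrK.
move=> /le_trans; apply; rewrite lee_fin sqrrN expr1n mulr1.
have K_sub : K (F - f) by rewrite addrC -scaleN1r; apply: K_comb => //; exact: PK.
have := N_comb 1 K_sub Kf; rewrite scale1r subrK expr1n mulr1 => h.
have h1 := ler_wpM2l C0 h; have h2 := ler_wpM2l C0 Fe2.
have e1 x y : C * (2 * x + 2 * y) = 2 * (C * x) + 2 * (C * y) by rewrite mulrDr; congr (_ + _); rewrite mulrCA.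
have e2 k x : k * C * x = k * (C * x) by rewrite mulrA.
rewrite e1 in h1; rewrite !e2; move: h1 h2; move: (C * _) (C * _) (C * _) (C * _) => *; lra.
Qed.

Lemma extension_comb a f g : K f -> K g ->
  {ae m, forall x, extension (a *: f + g) x = a * extension f x + extension g x}.
Proof.
move=> Kf Kg; have Kfg := K_comb a Kf Kg.
have [m1 h1] := extensionP Kfg; have [m2 h2] := extensionP Kf; have [m3 h3] := extensionP Kg.
have mr : measurable_fun setT (fun x => a * extension f x + extension g x) by apply: measurable_funD => //; exact: measurable_funM.
have : {ae m, forall x, (a * extension f x + extension g x) - extension (a *: f + g) x = 0}.
  apply: (@sq_small_ae0 _ (2 * (2 * a ^+ 2 * (4 * C) + 2 * (4 * C)) + 2 * (4 * C * (2 * a ^+ 2 + 2)))); first exact: measurable_funB.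
  move=> e e0; have [F PF Fe] := dense Kf e0; have [G PG Ge] := dense Kg e0.
  have Fe2 := sq_le (N_ge0 _) Fe; have Ge2 := sq_le (N_ge0 _) Ge.
  have mF := b_meas PF; have mG := b_meas PG; have PH := P_comb a PF PG; have mH := b_meas PH.
  have K_sub x y : K x -> K y -> K (x - y) by move=> Kx Ky; rewrite addrC -scaleN1r; exact: K_comb.
  have NH : N ((a *: F + G) - (a *: f + g)) ^+ 2 <= (2 * a ^+ 2 + 2) * e ^+ 2.
    rewrite opprD addrACA -scalerBr mulrDl; apply: le_trans (N_comb a (K_sub _ _ (PK PF) Kf) (K_sub _ _ (PK PG) Kg)) _.
    by apply: lerD; apply: ler_wpM2l => //; rewrite mulr_ge0 ?sqr_ge0.
  have hw (c : R) : 0 <= 4 * C by rewrite mulr_ge0.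
  have b1 : (\int[m]_x ((b F x - extension f x) ^+ 2)%:E <= (4 * C * e ^+ 2)%:E)%E.
    by apply: le_trans (h2 _ PF) _; rewrite lee_fin ler_wpM2l ?hw.
  have b2 : (\int[m]_x ((b G x - extension g x) ^+ 2)%:E <= (4 * C * e ^+ 2)%:E)%E.
    by apply: le_trans (h3 _ PG) _; rewrite lee_fin ler_wpM2l ?hw.
  have b3 : (\int[m]_x ((b (a *: F + G) x - extension (a *: f + g) x) ^+ 2)%:E <= (4 * C * ((2 * a ^+ 2 + 2) * e ^+ 2))%:E)%E.
    by apply: le_trans (h1 _ PH) _; rewrite lee_fin ler_wpM2l ?hw.
  have b12 := sq_comb_le a (measurable_funB mF m2) (measurable_funB mG m3) b1 b2.
  have mc : measurable_fun setT (fun x => a * (b F x - extension f x) + (b G x - extension g x)).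
    by apply: measurable_funD; [apply: measurable_funM => //|]; exact: measurable_funB.
  have := sq_comb_le (-1) mc (measurable_funB mH m1) b12 b3.
  rewrite sqrrN expr1n mulr1.
  rewrite [X in _ -> (_ <= X%:E)%E](_ : _ = 2 * (2 * a ^+ 2 * (4 * C * e ^+ 2) + 2 * (4 * C * e ^+ 2)) + 2 * (4 * C * ((2 * a ^+ 2 + 2) * e ^+ 2))); last by ring.
  apply: le_trans; rewrite le_eqVlt; apply/orP; left; apply/eqP; apply: eq_integral => x _.
  by congr (_ ^+ 2)%:E; rewrite /= b_comb; ring.
by apply: filterS => x /eqP; rewrite subr_eq0 => /eqP ->.
Qed.

(** [f] and [F] may be different elements at distance zero. This occurs for test functions on the
    closed half-space, whose values elsewhere are arbitrary. *)
Lemma extension_eq F f : K f -> P F -> N (F - f) = 0 -> {ae m, forall x, extension f x = b F x}.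
Proof.
move=> Kf PF N0; have [mT hT] := extensionP Kf.
have : {ae m, forall x, b F x - extension f x = 0}.
  apply: (@sq_small_ae0 _ 0); first by apply: measurable_funB => //; exact: b_meas.
  by move=> e e0; apply: le_trans (hT _ PF) _; rewrite N0 expr0n mulr0 mul0r.
by apply: filterS => x /eqP; rewrite subr_eq0 => /eqP ->.
Qed.

(** Any competitor, applied to F - f for F in [P] close to f, is small, and it agrees with [b] on
    [P]; so it differs from the extension by an arbitrarily small amount in L^2. Its constant C' is
    its own. *)
Lemma extension_unique (S : E -> T -> R) (C' : R) : (forall f, K f -> measurable_fun setT (S f)) ->
  (forall a f g, K f -> K g -> {ae m, forall x, S (a *: f + g) x = a * S f x + S g x}) ->
  (forall f, K f -> (\int[m]_x (S f x ^+ 2)%:E <= (C' * N f ^+ 2)%:E)%E) ->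
  (forall F, P F -> {ae m, forall x, S F x = b F x}) ->
  forall f, K f -> {ae m, forall x, S f x = extension f x}.
Proof.
move=> mS S_comb S_le SP f Kf; have [mT hT] := extensionP Kf.
have : {ae m, forall x, S f x - extension f x = 0}.
  apply: (@sq_small_ae0 _ (2 * `|C'| + 2 * (4 * C))); first by apply: measurable_funB => //; exact: mS.
  move=> e e0; have [F PF Fe] := dense Kf e0; have Fe2 := sq_le (N_ge0 _) Fe.
  have KF := PK PF; have KD : K ((-1) *: f + F) by exact: K_comb.
  have eD : (-1) *: f + F = F - f by rewrite scaleN1r addrC.
  have b1 : (\int[m]_x (S ((-1) *: f + F) x ^+ 2)%:E <= (`|C'| * e ^+ 2)%:E)%E.
    apply: le_trans (S_le _ KD) _; rewrite lee_fin eD.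
    by apply: (@le_trans _ _ (`|C'| * N (F - f) ^+ 2)); [rewrite ler_wpM2r ?sqr_ge0 ?ler_norm|rewrite ler_wpM2l].
  have b2 : (\int[m]_x ((b F x - extension f x) ^+ 2)%:E <= (4 * C * e ^+ 2)%:E)%E.
    by apply: le_trans (hT _ PF) _; rewrite lee_fin ler_wpM2l// mulr_ge0.
  have mB := measurable_funB (b_meas PF) mT.
  have -> : (2 * `|C'| + 2 * (4 * C)) * e ^+ 2 = 2 * (-1) ^+ 2 * (`|C'| * e ^+ 2) + 2 * (4 * C * e ^+ 2) by ring.
  apply: le_trans _ (sq_comb_le (-1) (mS _ KD) mB b1 b2).
  rewrite le_eqVlt; apply/orP; left; apply/eqP; apply: ae_eq_integral => //.
  - by apply/measurable_EFinP; apply: measurable_funX; apply: measurable_funB => //; exact: mS.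
  - by apply/measurable_EFinP; apply: measurable_funX; apply: measurable_funD => //; apply: measurable_funM => //; exact: mS.
  apply: filterS2 (S_comb (-1) f F Kf KF) (SP F PF) => x h1 h2 _.
  by congr (_ ^+ 2)%:E; rewrite /= h1 h2; ring.
by apply: filterS => x /eqP; rewrite subr_eq0 => /eqP ->.
Qed.

End bounded_extension.

(** * The trace operator *)

Section integral_density.
Context d (T : measurableType d) (R : realType).
Variables (m : {measure set T -> \bar R}) (w : T -> R).
Variables (mw : measurable_fun [set: T] w) (w0 : forall t, 0 <= w t).
Import HBNNSimple.

Let integral_density_nnsfun (h : {nnsfun T >-> R}) :
  (\int[density m mw w0]_x (h x)%:E = \int[m]_x ((h x)%:E * (w x)%:E))%E.
Proof.
pose s : seq R := finmap.enum_fset (fset_set (range h)); pose A (i : nat) := h @^-1` [set s`_i].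
have mA i : measurable (A i) by exact: measurable_funPTI.
have s0 (i : 'I_(size s)) : 0 <= s`_i.
  have : s`_i \in s by exact: mem_nth.
  by rewrite [_ \in _]in_fset_set// inE => -[x _ <-].
have mi i : measurable_fun setT (\1_(A i) : T -> R) by exact: measurable_indic.
have i0 i x : 0 <= \1_(A i) x :> R by rewrite indicE.
transitivity (\int[density m mw w0]_x (\sum_(i < size s) (s`_i * \1_(A i) x)%:E))%E.
  by apply: eq_integral => x _; rewrite fimfunEord -sumEFin.
transitivity (\int[m]_x (\sum_(i < size s) (s`_i * \1_(A i) x * w x)%:E))%E; last first.
  by apply: eq_integral => x _; rewrite fimfunEord -EFinM mulr_suml -sumEFin.
rewrite ge0_integral_sum//; last 2 first.
- by move=> i; apply/measurable_EFinP; apply: measurable_funM => //; exact: mi.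
- by move=> i x _; rewrite lee_fin mulr_ge0// s0.
rewrite ge0_integral_sum//; last 2 first.
- by move=> i; apply/measurable_EFinP; apply: measurable_funM => //; apply: measurable_funM => //; exact: mi.
- by move=> i x _; rewrite lee_fin !mulr_ge0// s0.
apply: eq_bigr => i _; under eq_integral do rewrite EFinM.
under [in RHS]eq_integral do rewrite -mulrA EFinM.
have m1 : measurable_fun setT (fun x => (\1_(A i) x)%:E : \bar R) by apply/measurable_EFinP; exact: mi.
have m2 : measurable_fun setT (fun x => (\1_(A i) x * w x)%:E : \bar R).
  by apply/measurable_EFinP; apply: measurable_funM => //; exact: mi.
have n1 x : setT x -> (0 <= (\1_(A i) x)%:E :> \bar R)%E by move=> _; rewrite lee_fin.
have n2 x : setT x -> (0 <= (\1_(A i) x * w x)%:E :> \bar R)%E by move=> _; rewrite lee_fin mulr_ge0.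
have si : (0 <= (s`_i)%:E :> \bar R)%E by rewrite lee_fin s0.
rewrite (ge0_integralZl _ measurableT m1 n1 si) (ge0_integralZl _ measurableT m2 n2 si).
congr (_ * _)%E; rewrite integral_indic// setIT.
transitivity (\int[m]_(x in A i) (w x)%:E)%E; first by [].
rewrite integral_mkcond; apply: eq_integral => x _.
by rewrite patchE indicE; case: (_ \in _); rewrite /= ?mul1r ?mul0r.
Qed.

(** On indicators this is the definition of [density]; linearity and monotone convergence do the
    rest. *)
Lemma integral_density (f : T -> \bar R) : measurable_fun setT f -> (forall x, 0 <= f x)%E ->
  (\int[density m mw w0]_x f x = \int[m]_x (f x * (w x)%:E))%E.
Proof.
move=> mf f0; pose g := nnsfun_approx measurableT mf.
have cg x : (g k x)%:E @[k --> \oo] --> f x by apply: cvg_nnsfun_approx.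
have ng x : nondecreasing_seq (fun k => g k x).
  by move=> a b ab; exact/lefP/nd_nnsfun_approx.
transitivity (limn (fun k => \int[density m mw w0]_x (g k x)%:E))%E.
  rewrite -monotone_convergence//.
  - by apply: eq_integral => x _; apply/esym/cvg_lim => //; exact: cg.
  - by move=> k; apply/measurable_EFinP.
  - by move=> k x _; rewrite lee_fin.
  - by move=> x _ a b ab; rewrite lee_fin; exact: ng.
transitivity (limn (fun k => \int[m]_x ((g k x)%:E * (w x)%:E)))%E.
  by apply: (congr1 (fun u => limn u)); apply/funext => k; exact: integral_density_nnsfun.
rewrite -monotone_convergence//.
- apply: eq_integral => x _; apply/cvg_lim => //.
  by apply: cvgeZr => //; exact: cg.
- by move=> k; apply: emeasurable_funM; exact/measurable_EFinP.
- by move=> k x _; rewrite -EFinM lee_fin mulr_ge0.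
- by move=> x _ a b ab; rewrite -!EFinM lee_fin ler_wpM2r//; exact: ng.
Qed.

End integral_density.

Section weights.
Context {R : realType} {n : nat}.
Local Notation V := 'rV[R]_n.

Lemma lebesgue_weight : weight_of (lebesgue_rV R n) (fun=> 1) 0.
Proof.
split=> //.
- exact: smooth_cst.
- by exists 1.
- by move=> v i; rewrite (derive_cst (1 : R)) oppr0 !mul0r.
- by move=> f mf f0; under [in RHS]eq_integral do rewrite mule1.
Qed.

(** Each derivative of [g] is a smooth factor times [g] again, so regularity gains one order at a
    time. Spares the composition of the exponential with a quadratic function at every order. *)
Lemma smooth_log_derivative (V' : normedModType R) (g : V' -> R) (l : V' -> V' -> R) :
  (forall x, differentiable g x) -> (forall v x, 'D_v g x = l v x * g x) -> (forall v, smooth (l v)) -> smooth g.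
Proof.
move=> dg Dg sl; elim=> [|k IH]; first by move=> x; exact: differentiable_continuous.
split=> // v; rewrite (_ : 'D_v g = fun x => l v x * g x); last by apply/funext => x; exact: Dg.
by apply: CkM => //; exact: sl.
Qed.

Lemma smooth_sqnorm : smooth (@sqnorm R n).
Proof. by apply: smooth_sum => i; apply: smoothM; exact: smooth_coord. Qed.

Lemma derive_sqnorm (e x : V) : 'D_e (@sqnorm R n) x = \sum_i 2 * x ord0 i * e ord0 i.
Proof.
have D i : is_derive x e (fun x : V => x ord0 i * x ord0 i) (2 * x ord0 i * e ord0 i).
  have d1 : is_derive x e (fun x : V => x ord0 i) (e ord0 i).
    by have := is_derive_coord (i0 := i) e (is_derive_id (x ord0 i) 1); rewrite mulr1.
  have := @is_deriveM _ _ _ _ x e _ _ d1 d1; move/is_derive_eq; apply; rewrite /GRing.scale/=; ring.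
have := @is_derive_sum _ _ _ n (fun i (x : V) => x ord0 i * x ord0 i) x e _ D.
rewrite (_ : \sum_(i < n) _ = @sqnorm R n) => [h|]; first by rewrite derive_val.
by apply/funext => y; rewrite fct_sumE.
Qed.

Let gc : R := (2 * pi) `^ (- (n%:R / 2)).

Lemma derive_gauss_pdf (e x : V) : differentiable (@gauss_pdf R n) x /\
  'D_e (@gauss_pdf R n) x = - (\sum_i x ord0 i * e ord0 i) * gauss_pdf x.
Proof.
have dq : differentiable (@sqnorm R n) x by exact: smooth_differentiable smooth_sqnorm.
pose ph (t : R) := gc * expR (- (t / 2)).
have dph (t : R) : is_derive t 1 ph (- 2^-1 * ph t).
  have d1 : is_derive t 1 (fun t : R => - 2^-1 * t) (- 2^-1).
    by have := @is_deriveZ _ _ _ id (- 2^-1) t 1 _ (is_derive_id t 1); rewrite /GRing.scale/= mulr1.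
  have d2 := @is_derive1_comp _ (@expR R) _ t _ _ (is_derive_expR _) d1.
  have := @is_deriveZ _ _ _ _ gc t 1 _ d2; move/is_derive_eq => h.
  rewrite (_ : ph = gc \*: (@expR R \o (fun t => - 2^-1 * t))).
    by apply: h; rewrite -[(gc \*: _) t]/(gc * expR (- 2^-1 * t)) /GRing.scale/=; ring.
  by apply/funext => s; rewrite /ph /= mulrC mulNr mulrC (mulrC s).
have ddph t : differentiable ph t by apply/derivable1_diffP; exact: (@ex_derive _ _ _ _ _ _ _ (dph t)).
have gE : @gauss_pdf R n = ph \o @sqnorm R n by [].
rewrite gE; split; first exact: differentiable_comp.
rewrite deriveE; last exact: differentiable_comp.
rewrite diff_comp//=; have <- : 'D_e (@sqnorm R n) x = 'd (@sqnorm R n) x e by rewrite deriveE.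
rewrite derive_sqnorm.
have -> (a b : R) : 'd ph a b = b * (- 2^-1 * ph a).
  have {1}-> : b = b *: (1 : R) by rewrite /GRing.scale/= mulr1.
  by rewrite linearZ/= -deriveE// (@derive_val _ _ _ _ _ _ _ (dph a)).
rewrite mulrA; apply: (congr1 (fun z : R => z * ph (sqnorm x))).
rewrite mulrN mulr_suml -sumrN -sumrN; apply: eq_bigr => i _; by field.
Qed.

Lemma gaussian_weight : weight_of (gaussian_rV R n) (@gauss_pdf R n) 1.
Proof.
split.
- by move=> v; rewrite mulr_gt0 ?expR_gt0// powR_gt0// mulr_gt0// pi_gt0.
- apply: (@smooth_log_derivative V _ (fun e x => - \sum_i x ord0 i * e ord0 i)).
  + by move=> x; have [] := derive_gauss_pdf 0 x.
  + by move=> e x; have [] := derive_gauss_pdf e x.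
  move=> e; under eq_fun do rewrite -sumrN.
  apply: smooth_sum => i; under eq_fun do rewrite -mulrN.
  by apply: smoothM; [exact: smooth_coord|exact: smooth_cst].
- exists gc => v; rewrite -[leRHS]mulr1; apply: ler_wpM2l; first exact: powR_ge0.
  by rewrite -expR0 ler_expR oppr_le0 divr_ge0//; apply: sumr_ge0 => i _; exact: sqr_ge0.
- move=> v i; have [_ ->] := derive_gauss_pdf (delta_mx ord0 i) v.
  rewrite (bigD1 i)//= big1 => [|j /negPf ji]; last by rewrite mxE eqxx ji mulr0.
  by rewrite mxE !eqxx mulr1 addr0 mulN1r.
- move=> f mf f0; exact: integral_density.
Qed.

End weights.

Section trace_operator.
Context {R : realType} {n : nat} (mu : {sigma_finite_measure set 'rV[R]_(n + 1) -> \bar R}) (m : 'rV[R]_(n + 1) -> R) (kap : R).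
Hypothesis wt : weight_of mu m kap.
Variable p : R.
Local Notation V := 'rV[R]_(n + 1).
Local Notation D := (@half_space R n).
Local Notation tm := (trace_measure mu p).
Local Notation b := (@boundary_restriction R n).
Let mD := @measurable_half_space R n.
Let Dshift := @half_space_shift R n.
Let C : R := 2 * (52 + `|kap|).

Let C0 : 0 <= C.
Proof. by rewrite mulr_ge0// addr_ge0. Qed.

(** Letting r tend to 0 in [trace_regularized]: by [norm_le_profile], replacing w profile by |w|
    costs r times the integral of F^2 over the boundary, which is finite for a test function. *)
Lemma trace_estimate (F : V * V -> R) : test_fun setT F ->
  (\int[(lebesgue_rV R n \x mu)%E]_zv (`|lastc zv.2| * F (row_mx zv.1 0, zv.2) ^+ 2)%:E <=
   (C * kinetic_norm mu D (fun x v => F (x, v)) ^+ 2)%:E)%E.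
Proof.
move=> tF; have cb := test_boundary tF; pose F2 (zv : 'rV[R]_n * V) := F (row_mx zv.1 0, zv.2) ^+ 2.
have cF2 : Cc F2 by exact: CcM cb.1 cb.
have cw : continuous (fun zv : 'rV[R]_n * V => lastc zv.2).
  by move=> q; apply: (@continuous_comp _ _ _ snd (@lastc R n)); [exact: cvg_snd|exact: continuous_lastc].
have cnw : continuous (fun zv : 'rV[R]_n * V => `|lastc zv.2|).
  by move=> q; apply: (@continuous_comp _ _ _ (fun zv : 'rV[R]_n * V => lastc zv.2) (@Num.norm R R)); [exact: cw|exact: norm_continuous].
have iC (g : 'rV[R]_n * V -> R) : Cc g -> (lebesgue_rV R n \x mu)%E.-integrable setT (EFin \o g).
  by move=> cg; have := integrable_pair_Cc wt measurableT cg; under eq_fun do rewrite indicT mul1r.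
have c1 : Cc (fun zv => `|lastc zv.2| * F2 zv) by exact: CcM.
rewrite (EFin_Rintegral measurableT (iC _ c1)) lee_fin.
apply/ler_addgt0Pr => e e0; set Z := \int[(lebesgue_rV R n \x mu)%E]_zv F2 zv.
have Z0 : 0 <= Z by apply: Rintegral_ge0 => zv _; exact: sqr_ge0.
have Z1 : 0 < Z + 1 by rewrite ltr_wpDl.
pose r := e / (Z + 1); have r0 : 0 < r by rewrite divr_gt0.
have c2 : Cc (fun zv : 'rV[R]_n * V => lastc zv.2 * profile r (lastc zv.2) * F2 zv).
  apply: CcM => //; apply: continuous_mulr => //.
  by apply: (continuous_profile (fun=> r0) _ cw); exact: cst_continuous.
apply: (@le_trans _ _ (\int[(lebesgue_rV R n \x mu)%E]_zv (lastc zv.2 * profile r (lastc zv.2) * F2 zv + r * F2 zv))).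
  apply: le_Rintegral => //; [exact: iC|by apply: intD => //; [exact: iC|apply: intZ => //; exact: iC]|].
  move=> zv _; rewrite -mulrDl; apply: ler_wpM2r; first exact: sqr_ge0.
  by rewrite -lerBlDr; exact: norm_le_profile.
rewrite RintegralD//; [|exact: iC|by apply: intZ => //; exact: iC].
rewrite RintegralZl//; last exact: iC.
apply: lerD; first exact: (trace_regularized wt tF r0).
by rewrite /r mulrAC ler_pdivrMr// ler_wpM2l ?(ltW e0)// lerDl.
Qed.

Lemma measurable_boundary (F : V * V -> R) : test_fun setT F ->
  measurable_fun setT (b (fun x v => F (x, v))).
Proof. by move=> tF; apply: continuous_measurable_rV2; exact: (test_boundary tF).1. Qed.

Lemma trace_measure_le (F : V * V -> R) : test_fun setT F ->
  (\int[tm]_zv (b (fun x v => F (x, v)) zv ^+ 2)%:E <= (C * kinetic_norm mu D (fun x v => F (x, v)) ^+ 2)%:E)%E.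
Proof.
move=> tF; apply: le_trans _ (trace_estimate tF); have mb := measurable_boundary tF.
have m2 : measurable_fun setT (fun zv => (b (fun x v => F (x, v)) zv ^+ 2)%:E : \bar R).
  by apply/measurable_EFinP; exact: measurable_funX.
rewrite integral_density//; last by move=> zv; rewrite lee_fin sqr_ge0.
have mlw : measurable_fun setT (fun zv : 'rV[R]_n * V => `|lastc zv.2|).
  by apply: measurableT_comp => //; apply: (measurableT_comp (measurable_coord _)).
apply: ge0_le_integral => //.
- by move=> zv _; rewrite -EFinM lee_fin mulr_ge0 ?sqr_ge0 ?trace_weight_ge0.
- by apply: emeasurable_funM => //; apply/measurable_EFinP; exact: measurable_trace_weight.
- by apply/measurable_EFinP; apply: measurable_funM => //; exact: measurable_funX.
move=> zv _; rewrite -EFinM lee_fin mulrC ler_wpM2r ?sqr_ge0//.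
by rewrite /trace_weight /omega ge_min lexx.
Qed.

(** Global representatives: these functions are given by one test function on the whole space, so
    [boundary_restriction] is measurable on them. The other representatives of a test function on
    the closed half-space are reached through [extension_eq]. *)
Let P : set (V -> V -> R) := [set f | exists2 F : V * V -> R, test_fun setT F & f = fun x v => F (x, v)].
Let K := kinetic mu D.
Let N := kinetic_norm mu D.

Let PK : P `<=` K.
Proof.
move=> _ [F tF ->]; have [h1 h2] := test_kinetic wt mD tF (f := fun x v => F (x, v)) (fun x _ => erefl).
exact: (conj h1 (ex_intro _ _ h2)).
Qed.

Let P_comb a f g : P f -> P g -> P (a *: f + g).
Proof.
move=> [F tF ->] [G tG ->]; exists (fun q => a * F q + G q) => //.
have [MF MF0 hF] := test_supp2 tF; have [MG MG0 hG] := test_supp2 tG.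
apply: (test_fun_rV2 (M := MF + MG)) => //.
  by apply: smoothD (test_fun_smooth tG); apply: smoothM (test_fun_smooth tF); exact: smooth_cst.
move=> [x v]; rewrite prod_normE/= ge_max; have [F0|/hF[h1 h2] _] := eqVneq (F (x, v)) 0.
  by rewrite F0 mulr0 add0r => /hG[h1 h2]; rewrite (le_trans h1) ?(le_trans h2) ?lerDr.
by rewrite (le_trans h1) ?(le_trans h2) ?lerDl.
Qed.

Let b_comb a f g zv : b (a *: f + g) zv = a * b f zv + b g zv.
Proof. by []. Qed.

Let b_meas f : P f -> measurable_fun setT (b f).
Proof. by move=> [F tF ->]; exact: measurable_boundary. Qed.

Let b_le f : P f -> (\int[tm]_zv (b f zv ^+ 2)%:E <= (C * N f ^+ 2)%:E)%E.
Proof. by move=> [F tF ->]; exact: trace_measure_le. Qed.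

Let dense f (e : R) : K f -> 0 < e -> exists2 F, P F & N (F - f) <= e.
Proof.
move=> Kf e0; have [F tF h] := kinetic_dense wt mD Dshift e0 Kf.
by exists (fun x v => F (x, v)) => //; exists F.
Qed.

Let K_comb a f g : K f -> K g -> K (a *: f + g).
Proof. by move=> Kf Kg; exact: (kinetic_comb wt mD a Kf Kg). Qed.

Let N_comb a f g : K f -> K g -> N (a *: f + g) ^+ 2 <= 2 * a ^+ 2 * N f ^+ 2 + 2 * N g ^+ 2.
Proof. by move=> Kf Kg; exact: (kinetic_norm_comb wt mD Dshift a Kf Kg). Qed.

Let N_ge0 f : 0 <= N f.
Proof. exact: kinetic_norm_ge0. Qed.

(** Approach along the normal. It is what allows a test function on the closed half-space to be
    replaced at the boundary by the smooth function it restricts. *)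
Lemma closure_half_space (z : 'rV[R]_n) : closure D (row_mx z 0).
Proof.
move=> B nB; have cl : continuous (fun y : R => row_mx z 0 + y *: normal_vec : V).
  by move=> y; apply: cvgD; [exact: cvg_cst|apply: cvgZr_tmp; exact: cvg_id].
have nB' : nbhs (row_mx z 0 + (0 : R) *: normal_vec : V) B by rewrite scale0r addr0.
have : \forall y \near (0 : R)^'+, B (row_mx z 0 + y *: normal_vec) /\ 0 < y.
  near=> y; split; last by near: y; exact: nbhs_right_gt.
  by near: y; apply: cvg_at_right_filter (cl 0) _ nB'.
move=> /filter_ex [y [By y0]]; exists (row_mx z 0 + y *: normal_vec); split=> //.
by rewrite /half_space/= lastc_line.
Unshelve. all: by end_near. Qed.

Lemma Lnorm2_le (u : 'rV[R]_n * V -> R) (A : R) : u \in Lfun tm 2%:E -> 0 <= A ->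
  ('N[tm]_2%:E[EFin \o u] <= A%:E)%E <-> (\int[tm]_zv (u zv ^+ 2)%:E <= (A ^+ 2)%:E)%E.
Proof.
move=> /Lfun2P[mu2 fin] A0; rewrite Lnorm2E.
have i0 : (0 <= \int[tm]_zv (u zv ^+ 2)%:E)%E by apply: integral_ge0 => zv _; rewrite lee_fin sqr_ge0.
move: fin i0; case: (\int[tm]_zv (u zv ^+ 2)%:E)%E => [i| |]// _; rewrite lee_fin => i0.
rewrite poweR_EFin powR12_sqrt// !lee_fin -{2}(sqr_sqrtr i0).
by rewrite ler_sqr ?nnegrE ?sqrtr_ge0.
Qed.

Theorem trace_operator : exists Tr : (V -> V -> R) -> ('rV[R]_n * V -> R),
  [/\ bounded_linear_trace mu p Tr, extends_boundary_restriction mu p Tr &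
      forall Tr', bounded_linear_trace mu p Tr' -> extends_boundary_restriction mu p Tr' ->
        forall f, kinetic mu half_space f -> Tr' f = Tr f %[ae trace_measure mu p]].
Proof.
have C40 : 0 <= 4 * C by rewrite mulr_ge0.
pose Tr := extension tm P N b C.
have TrP f : K f -> measurable_fun setT (Tr f) by move=> Kf; have [] := extensionP C0 K_comb N_comb N_ge0 PK P_comb dense b_comb b_meas b_le Kf.
have Tr_le f : K f -> (\int[tm]_zv (Tr f zv ^+ 2)%:E <= (4 * C * N f ^+ 2)%:E)%E.
  exact: (extension_le C0 K_comb N_comb N_ge0 PK P_comb dense b_comb b_meas b_le).
have TrL f : K f -> Tr f \in Lfun tm 2%:E.
  by move=> Kf; apply/Lfun2P; split; [exact: TrP|apply: le_lt_trans (Tr_le f Kf) (ltry _)].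
exists Tr; split.
- split; first exact: TrL.
  + move=> a f g Kf Kg.
    have := extension_comb C0 K_comb N_comb N_ge0 PK P_comb dense b_comb b_meas b_le a Kf Kg.
    by apply: filterS => zv h _; exact: h.
  + exists (Num.sqrt (4 * C)) => f Kf; apply/(Lnorm2_le (TrL f Kf)).
      by rewrite mulr_ge0 ?sqrtr_ge0// N_ge0.
    by rewrite exprMn sqr_sqrtr//; exact: Tr_le.
- move=> f [F tF fF].
  have fD x : D x -> f x = fun v => F (x, v).
    by move=> Dx; apply/funext => v; apply: fF; exact: subset_closure.
  have [Lf tf] := test_kinetic wt mD tF fD.
  have [Lg tg] := test_kinetic wt mD tF (f := fun x v => F (x, v)) (fun x _ => erefl).
  have Kf : K f := conj Lf (ex_intro _ _ tf).
  split; first exact: Kf.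
  have [h1 h2] := transport_comb wt mD (-1) Lf Lg tf tg.
  have kn := kinetic_norm_sq wt mD Dshift h2.
  (* Over the half-space the two functions coincide, and by the first computation both admit the
     same transport derivative, so both parts of the norm of the difference vanish. *)
  have N0 : N ((fun x v => F (x, v)) - f) = 0.
    apply/eqP; rewrite -sqrf_eq0; apply/eqP; rewrite addrC -scaleN1r; apply: etrans kn _.
    rewrite /L2H1_norm /L2Hm1_norm !L2_bochner_norm_sq.
    rewrite [X in X + _](@eq_Rintegral _ _ R _ D (fun=> 0)) => [|x /set_mem Dx]; last first.
      rewrite (_ : (-1 *: f + _) x = 0) ?(sn0 (H1_seminorm wt)) ?expr0n//.
      by apply/funext => v; rewrite -[LHS]/(-1 * f x v + F (x, v)) (fD x Dx) mulN1r addNr.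
    rewrite [X in _ + X](@eq_Rintegral _ _ R _ D (fun=> 0)) => [|x _]; last first.
      by rewrite scaleN1r addNr (sn0 (Hm1_seminorm wt)) expr0n.
    by rewrite /Rintegral !integral0 addr0.
  have PF : P (fun x v => F (x, v)) by exists F.
  have := extension_eq C0 K_comb N_comb N_ge0 PK P_comb dense b_comb b_meas b_le Kf PF N0.
  apply: filterS => zv h _; rewrite [LHS]h /boundary_restriction fF//; exact: closure_half_space.
- move=> Tr' [L1 L2 [C' L3]] ext f Kf.
  have mS g : K g -> measurable_fun setT (Tr' g) by move=> Kg; have /Lfun2P[] := L1 g Kg.
  have := @extension_unique _ _ _ tm _ K P N b C C0 K_comb N_comb N_ge0 PK P_comb dense b_comb b_meas b_le Tr' (`|C'| ^+ 2) mS _ _ _ f Kf.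
  move=> H; have := H _ _ _; clear H.
  move=> H; apply: filterS (H _ _ _) => [zv h _|a g g' Kg Kg'|g Kg|F [F' tF' ->]].
  + exact: h.
  + by apply: filterS (L2 a g g' Kg Kg') => zv h; exact: h.
  + rewrite -exprMn; apply/(Lnorm2_le (L1 g Kg)); first by rewrite mulr_ge0// N_ge0.
    by apply: le_trans (L3 g Kg) _; rewrite lee_fin ler_wpM2r ?ler_norm// N_ge0.
  + have [_ h] := ext (fun x v => F' (x, v)) (ex_intro2 _ _ F' tF' (fun x v _ => erefl)).
    by apply: filterS h => zv h'; exact: h'.
Qed.

End trace_operator.

Theorem proposition7p7 (R : realType) (n : nat)
    (mu : {sigma_finite_measure set 'rV[R]_(n + 1) -> \bar R})
    (hmu : mu = lebesgue_rV R (n + 1) \/ mu = gaussian_rV R (n + 1))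
    (p : R) (hp : 1 <= p) :
  exists Tr : ('rV[R]_(n + 1) -> 'rV[R]_(n + 1) -> R) ->
              ('rV[R]_n * 'rV[R]_(n + 1) -> R),
    [/\ bounded_linear_trace mu p Tr,
        extends_boundary_restriction mu p Tr &
        forall Tr', bounded_linear_trace mu p Tr' ->
          extends_boundary_restriction mu p Tr' ->
          forall f, kinetic mu half_space f ->
            Tr' f = Tr f %[ae trace_measure mu p]].
Proof.
have [m [kap wt]] : exists m kap, weight_of mu m kap.
  case: hmu => ->; first by exists (fun=> 1), 0; exact: lebesgue_weight.
  by exists (@gauss_pdf R (n + 1)), 1; exact: gaussian_weight.
exact: (trace_operator wt p).
Qed.
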